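(* Let $\mathcal{G}\subset L^2_\sigma(\mathbb{T}^2)$ be a residual set with the following properties: (a) for any $u_0\in\mathcal{G}$ there exists a global weak solution $u\in C([0,+\infty);L^2_\sigma(\mathbb{T}^2))$ to the Euler equations with initial condition $u_0$ and $\|u_t\|_{L^2}=\|u_0\|_{L^2}$ for all $t\ge0$; (b) for any $\tau\in(0,+\infty)$ and $u_0\in\mathcal{G}$, uniqueness holds in the class of admissible measure-valued solutions to the Euler equations on $[0,\tau]$ with initial condition $u_0$; (c) for any $u_0\in\mathcal{G}$, any $(u^n_0)_n\subset L^2_\sigma(\mathbb{T}^2)$ with $u^n_0\to u_0$ in $L^2$ and any $\nu_n\to0^+$, the unique solutions $v^n$ to the Navier--Stokes equations with viscosity $\nu_n$ and initial condition $u^n_0$ satisfy $\sup_{t\in[0,\tau]}\|v^n_t-u_t\|_{L^2}\to0$ and $\int_0^\tau\nu_n\|\nabla v^n_t\|^2_{L^2}dt\to0$ for all $\tau\in(0,+\infty)$. For any $u_0\in\mathcal{G}$, let $u$ be the associated unique solution to the Euler equations. Then for any sequence $(u^n_0)_n\subset L^2_\sigma(\mathbb{T}^2)$ such that $u^n_0=\Pi_nu^n_0$ and $u^n_0\to u_0$ in $L^2$, the solutions $u^n$ to the Galerkin system $$\partial_tu^n+\Pi_n[(u^n\cdot\nabla)u^n]=0,\qquad\nabla\cdot u^n=0,\qquad u^n|_{t=0}=u^n_0$$ satisfy $$\lim_{n\to\infty}\sup_{t\in[0,\tau]}\|u^n_t-u_t\|_{L^2}=0\qquad\forall\,\tau\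in(0,+\infty).$$
   Context: Notation. $D=\mathbb{T}^2$ is the flat torus, with Fourier modes indexed by $k\in\mathbb{Z}^2$. $L^2_\sigma(\mathbb{T}^2)$ is the space of $u\in L^2(\mathbb{T}^2;\mathbb{R}^2)$ with $\nabla\cdot u=0$ in the sense of distributions and $\int_{\mathbb{T}^2}u\,dx=0$, with the $L^2$ norm. $\Pi_n$ is the projection onto divergence-free, mean-zero vector fields with Fourier modes $k\in\mathbb{Z}^2\setminus\{0\}$, $|k|\le n$ (i.e. Fourier truncation composed with the Leray projection when applied to fields that are not divergence free). We write $u_t=u(t,\cdot)$. A set is residual if it is a countable intersection of open dense sets. $C_w([0,\tau];L^2_\sigma)$ denotes weakly continuous $L^2_\sigma$-valued functions on $[0,\tau]$. Euler equations: $\partial_t u+(u\cdot\nabla)u+\nabla p=0$, $\nabla\cdot u=0$, $u|_{t=0}=u_0$. A weak solution on $[0,\tau]$ is $u\in C_w([0,\tau];L^2_\sigma(D))$ with $\int_0^\tau\int_D(\partial_t\phi\cdot u+\nabla\phi:u\otimes u)\,dx\,dt=-\int_D\phi_0\cdot u_0\,dx$ for all divergence-free $\phi\in C^\infty_c([0,\tau)\times D;\mathbb{R}^2)$ (global: for every $\tau$). Here $A:B=\sum_{i,j}a_{ij}b_{ij}$. Navier--Stokes with viscosity $\nu>0$: $\partial_tv+(v\cdot\nabla)v+\nabla p=\nu\Delta v$, $\nabla\cdot v=0$; for an initial condition in $L^2_\sigma$ the unique solution is the one in $C([0,+\infty);L^2_\sigma)\cap L^2([0,+\infty);\dot H^1)$.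 Generalized Young measures: ${\rm Y}^2([0,\tau]\times D,\mathbb{R}^2)$ is the set of triples $\boldsymbol\nu=((\nu_{t,x}),\lambda,(\nu^\infty_{t,x}))$, where $(t,x)\mapsto\nu_{t,x}$ is a (Lebesgue-a.e. defined, weakly-$*$ measurable) family of probability measures on $\mathbb{R}^2$ with $\int_{[0,\tau]\times D}\int_{\mathbb{R}^2}|z|^2\,\nu_{t,x}(dz)\,dt\,dx<\infty$; $\lambda$ is a finite nonnegative measure on $[0,\tau]\times D$; and $(t,x)\mapsto\nu^\infty_{t,x}$ is a ($\lambda$-a.e. defined, weakly-$*$ $\lambda$-measurable) family of probability measures on the unit circle $\mathbb{S}^1$. Triples are identified if the $\nu$'s agree Lebesgue-a.e., the $\lambda$'s agree, and the $\nu^\infty$'s agree $\lambda$-a.e. We write $\langle\nu_{t,x},f\rangle=\int f\,d\nu_{t,x}$ and similarly for $\nu^\infty$. The barycenter is $\bar\nu_{t,x}=\langle\nu_{t,x},z\rangle$. Admissible measure-valued solution on $[0,\tau]$ with initial condition $u_0$: a $\boldsymbol\nu\in{\rm Y}^2([0,\tau]\times D,\mathbb{R}^2)$ such that (i) $\bar\nu\in C_w([0,\tau];L^2_\sigma)$ (up to modification on a negligible set of times); (ii) for all $\phi\in C^\infty_c([0,\tau)\times D;\mathbb{R}^2)$ with $\nabla\cdot\phi=0$, $$\int_{[0,\tau]\times D}\big(\partial_t\phi\cdot\bar\nu+\nabla\phi:\langle\nu,z\otimes z\rangle\big)\,dt\,dx+\int_{[0,\tau]\times D}\nabla\phi:\langle\nu^\infty,\tilde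 z\otimes\tilde z\rangle\,\lambda(dt,dx)=-\int_D\phi_0\cdot u_0\,dx;$$ (iii) for all $\varphi\in C^0_c(D)$ and $\chi\in C([0,\tau])$, $$\int_{[0,\tau]\times D}\varphi(x)\chi(t)\langle\nu_{t,x},|z|^2\rangle\,dt\,dx+\int_{[0,\tau]\times D}\varphi(x)\chi(t)\,\lambda(dt,dx)\le\|\varphi\|_{L^\infty(D)}\|\chi\|_{L^1([0,\tau])}\|u_0\|_{L^2}^2.$$ A weak solution $u$ with $\|u_t\|_{L^2}\le\|u_0\|_{L^2}$ for all $t$ is regarded as an admissible measure-valued solution via $\nu_{t,x}=\delta_{u_t(x)}$, $\lambda=0$. *)

(* Defs.v *)
From HB Require Import structures.
From mathcomp Require Import all_boot all_order all_algebra.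
From mathcomp Require Import all_classical all_reals all_analysis.
From mathcomp Require Import measurable_realfun.
From mathcomp Require Import ring lra.

Set Implicit Arguments.
Unset Strict Implicit.
Unset Printing Implicit Defensive.

Import Order.TTheory GRing.Theory Num.Theory numFieldNormedType.Exports.

Local Open Scope classical_set_scope.
Local Open Scope ring_scope.

(** Vectors and matrices of the plane.  The norm that the library puts on
    [R * R] is the maximum norm; it is only used for the topology, and
    Euclidean lengths are always written with [normsq]. *)
Section plane.
Context {R : realType}.
Implicit Types (z w : R * R) (A B : (R * R) * (R * R)).

Definition dot z w : R := z.1 * w.1 + z.2 * w.2.
Definition normsq z : R := dot z z.

(** [A.1] and [A.2] are the rows of the matrix [A]. *)
Definition tens z w : (R * R) * (R * R) :=
  ((z.1 * w.1, z.1 * w.2), (z.2 * w.1, z.2 * w.2)).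
Definition ddot A B : R := dot A.1 B.1 + dot A.2 B.2.
Definition mulmv A z : R * R := (dot A.1 z, dot A.2 z).

Definition e1 : R * R := (1, 0).
Definition e2 : R * R := (0, 1).
Definition circle : set (R * R) := [set z | normsq z = 1].

End plane.

(** On finite-dimensional spaces this is the class [C^n]. *)
Fixpoint Cn {R : realType} {V W : normedModType R} (n : nat) (f : V -> W) :
    Prop :=
  continuous f /\
  if n is m.+1 then
    forall v : V, (forall x, derivable f x v) /\ Cn m (fun x => 'D_v f x)
  else True.

Definition smooth {R : realType} {V W : normedModType R} (f : V -> W) : Prop :=
  forall n, Cn n f.

(** Differential operators on the plane; [nabla f x] is the Jacobian matrix,
    with entries [d_j f_i], so that [mulmv (nabla u x) (u x)] is the convective
    term [(u . nabla) u]. *)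
Section operators.
Context {R : realType}.
Implicit Types f : R * R -> R * R.

Definition nabla f (x : R * R) : (R * R) * (R * R) :=
  ((('D_e1 f x).1, ('D_e2 f x).1), (('D_e1 f x).2, ('D_e2 f x).2)).
Definition div f (x : R * R) : R := ('D_e1 f x).1 + ('D_e2 f x).2.
Definition lap f (x : R * R) : R * R :=
  'D_e1 (fun y => 'D_e1 f y) x + 'D_e2 (fun y => 'D_e2 f y) x.
Definition grad (psi : R * R -> R) (x : R * R) : R * R :=
  ('D_e1 psi x, 'D_e2 psi x).

End operators.

(** The torus is [R^2 / Z^2].  As a measure space it is identified with the
    fundamental cell [[0, 1[^2] carrying the Lebesgue measure; continuous and
    smooth functions on the torus are [Z^2]-periodic functions on the plane. *)
Section torus.
Context {R : realType}.
Local Notation mR := (measurableTypeR R).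

Definition Z2periodic (W : Type) (f : R * R -> W) : Prop :=
  forall (k : int * int) (x : R * R),
    f (x.1 + k.1%:~R, x.2 + k.2%:~R) = f x.

Definition cell : set (mR * mR) := `[0%R, 1%R[ `*` `[0%R, 1%R[.

Lemma measurable_cell : measurable cell.
Proof. by apply: measurableX; exact: measurable_itv. Qed.

Definition leb2 : set (mR * mR) -> \bar R :=
  (@lebesgue_measure R \x @lebesgue_measure R)%E.
HB.instance Definition _ := Measure.on leb2.

Let leb2_sigma_finite : sigma_finite setT leb2.
Proof.
have /sigma_finiteP[F [TF ndF Foo]] := sigma_finiteT (@lebesgue_measure R).
exists (fun n => F n `*` F n).
  rewrite -setXTT TF predeqE => -[x y]; split.
    move=> [/= [n _ Fnx] [k _ Fky]]; exists (maxn n k) => //; split.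
    - by move: x Fnx; exact/subsetPset/ndF/leq_maxl.
    - by move: y Fky; exact/subsetPset/ndF/leq_maxr.
  by move=> [n _ []/= ? ?]; split; exists n.
move=> k; have [? ?] := Foo k.
split; first exact: measurableX.
by rewrite /leb2 product_measure1E// lte_mul_pinfty// ge0_fin_numE.
Qed.

HB.instance Definition _ :=
  Measure_isSigmaFinite.Build _ _ _ leb2 leb2_sigma_finite.

Definition leb3 : set (mR * (mR * mR)) -> \bar R :=
  (@lebesgue_measure R \x leb2)%E.
HB.instance Definition _ := Measure.on leb3.

Definition cylinder (tau : R) : set (mR * (mR * mR)) := `[0%R, tau] `*` cell.

Definition L2norm (u : R * R -> R * R) : R :=
  Num.sqrt (\int[leb2]_(x in cell) normsq (u x)).

Definition L2dist (u v : R * R -> R * R) : R := L2norm (fun x => u x - v x).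

Definition ae_cell (P : R * R -> Prop) : Prop :=
  {ae leb2, forall x, cell x -> P x}.

Definition in_L2sigma (u : R * R -> R * R) : Prop :=
  [/\ measurable_fun cell (u : mR * mR -> R * R),
      (\int[leb2]_(x in cell) (normsq (u x))%:E < +oo)%E,
      forall psi : R * R -> R, Z2periodic psi -> smooth psi ->
        \int[leb2]_(x in cell) dot (u x) (grad psi x) = 0,
      \int[leb2]_(x in cell) (u x).1 = 0
    & \int[leb2]_(x in cell) (u x).2 = 0].

End torus.

(** Elements are functions, not classes: two fields that agree almost everywhere
    are at distance 0, hence topologically indistinguishable (so that every open
    set, and every countable intersection of open sets, is saturated). *)
Record L2sigma (R : realType) := MkL2sigma {
  L2fun :> R * R -> R * R ;
  L2funP : in_L2sigma L2fun }.

HB.instance Definition _ (R : realType) := gen_eqMixin (L2sigma R).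
HB.instance Definition _ (R : realType) := gen_choiceMixin (L2sigma R).

Section L2sigma_topology.
Context {R : realType}.
Local Notation mR := (measurableTypeR R).

Let sq (u v : R * R -> R * R) : \bar R :=
  (\int[leb2]_(x in cell) (normsq (u x - v x))%:E)%E.

Let normsq_ge0 (z : R * R) : 0 <= normsq z.
Proof. by rewrite addr_ge0// -expr2 sqr_ge0. Qed.

Let measurable_normsqB (u v : R * R -> R * R) :
  measurable_fun cell (u : mR * mR -> R * R) ->
  measurable_fun cell (v : mR * mR -> R * R) ->
  measurable_fun cell ((fun x => normsq (u x - v x)) : mR * mR -> R).
Proof.
have m1 (w : R * R -> R * R) : measurable_fun cell (w : mR * mR -> R * R) ->
    measurable_fun cell ((fun x => (w x).1) : mR * mR -> R).
  by move=> mw; exact: (measurableT_comp measurable_fst mw).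
have m2 (w : R * R -> R * R) : measurable_fun cell (w : mR * mR -> R * R) ->
    measurable_fun cell ((fun x => (w x).2) : mR * mR -> R).
  by move=> mw; exact: (measurableT_comp measurable_snd mw).
move=> mu mv; apply: measurable_funD; apply: measurable_funM;
  apply: measurable_funB; do ?[exact: m1 | exact: m2].
Qed.

Let normsq_young (a b : R) (z w : R * R) : 0 < a -> 0 < b ->
  normsq (z + w) <= (1 + b / a) * normsq z + (1 + a / b) * normsq w.
Proof.
move=> a0 b0; set s := b / a.
have s0 : 0 < s by rewrite divr_gt0.
have -> : a / b = s^-1 by rewrite /s invf_div.
have scal (p q : R) :
    (p + q) * (p + q) <= (1 + s) * (p * p) + (1 + s^-1) * (q * q).
  have : 0 <= s^-1 * ((s * p - q) * (s * p - q)).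
    by rewrite mulr_ge0// ?invr_ge0 ?(ltW s0)// -expr2 sqr_ge0.
  rewrite [X in 0 <= X -> _](_ : _ = s * (p * p) - 2 * (p * q) + s^-1 * (q * q)).
    by lra.
  by field; rewrite gt_eqF.
case: z w => [z1 z2] [w1 w2]; rewrite /normsq /dot/=.
by have := scal z1 w1; have := scal z2 w2; lra.
Qed.

Let sq_ge0 u v : (0 <= sq u v)%E.
Proof. by apply: integral_ge0 => x _; rewrite lee_fin. Qed.

Let sq_triangle (u v w : R * R -> R * R) (a b : R) :
  measurable_fun cell (u : mR * mR -> R * R) ->
  measurable_fun cell (v : mR * mR -> R * R) ->
  measurable_fun cell (w : mR * mR -> R * R) -> 0 < a -> 0 < b ->
  (sq u w <= (1 + b / a)%:E * sq u v + (1 + a / b)%:E * sq v w)%E.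
Proof.
move=> mu mv mw a0 b0.
have c1 : 0 <= 1 + b / a by rewrite addr_ge0// divr_ge0// ltW.
have c2 : 0 <= 1 + a / b by rewrite addr_ge0// divr_ge0// ltW.
have mcell := @measurable_cell R.
have muv := measurable_normsqB mu mv.
have mvw := measurable_normsqB mv mw.
have muw := measurable_normsqB mu mw.
rewrite /sq -!ge0_integralZl//; do ?[by move=> *; rewrite lee_fin];
  do ?exact/measurable_EFinP.
rewrite -ge0_integralD//.
- apply: ge0_le_integral => //.
  + by move=> x _; rewrite lee_fin.
  + exact/measurable_EFinP.
  + apply: emeasurable_funD; apply: emeasurable_funM => //; exact/measurable_EFinP.
  + move=> x _ /=; rewrite lee_fin.
    rewrite (_ : u x - w x = (u x - v x) + (v x - w x)); first exact: normsq_young.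
    by rewrite addrA subrK.
- by move=> x _; rewrite mule_ge0// lee_fin.
- by apply: emeasurable_funM => //; exact/measurable_EFinP.
- by move=> x _; rewrite mule_ge0// lee_fin.
- by apply: emeasurable_funM => //; exact/measurable_EFinP.
Qed.

Let sq_fin (u v : L2sigma R) : sq u v \is a fin_num.
Proof.
have [mu uoo _ _ _] := L2funP u; have [mv voo _ _ _] := L2funP v.
rewrite ge0_fin_numE//.
have m0 : measurable_fun cell ((fun=> 0) : mR * mR -> R * R).
  exact: measurable_cst.
apply: le_lt_trans (sq_triangle mu m0 mv ltr01 ltr01) _.
rewrite lte_add_pinfty// lte_mul_pinfty// ?lee_fin ?divr1//.
  by rewrite /sq; under eq_integral do rewrite subr0.
rewrite /sq; under eq_integral => x _.
  rewrite (_ : normsq (0 - v x) = normsq (v x)); last first.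
    by rewrite sub0r /normsq /dot/= !mulrNN.
  over.
by [].
Qed.

Let L2distE (u v : L2sigma R) : L2dist u v = Num.sqrt (fine (sq u v)).
Proof. by []. Qed.

Let L2ball (u : L2sigma R) (e : R) : set (L2sigma R) :=
  [set v | L2dist u v < e].

Let ball_center u (e : R) : 0 < e -> L2ball u e u.
Proof.
move=> e0; rewrite /L2ball/= L2distE /sq.
under eq_integral do rewrite subrr /normsq /dot/= mulr0 addr0.
by rewrite integral0 /= sqrtr0.
Qed.

Let ball_sym u v (e : R) : L2ball u e v -> L2ball v e u.
Proof.
rewrite /L2ball/= !L2distE /sq; under eq_integral => x _.
  rewrite (_ : normsq (u x - v x) = normsq (v x - u x)); last first.
    by rewrite -opprB /normsq /dot/= !mulrNN.
  over.
by [].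
Qed.

Let ballE (u v : L2sigma R) (e : R) : 0 < e ->
  (L2dist u v < e) = (sq u v < (e ^+ 2)%:E)%E.
Proof.
move=> e0; rewrite L2distE -{2}(fineK (sq_fin u v)) lte_fin.
rewrite -[in LHS](@ger0_norm _ e) ?(ltW e0)// -sqrtr_sqr ltr_sqrt//.
by rewrite exprn_gt0.
Qed.

Let ball_gt0 (u v : L2sigma R) (e : R) : L2ball u e v -> 0 < e.
Proof. by move/(le_lt_trans _); apply; exact: sqrtr_ge0. Qed.

Let ball_triangle u v w (a b : R) :
  L2ball u a v -> L2ball v b w -> L2ball u (a + b) w.
Proof.
move=> uv vw; have a0 := ball_gt0 uv; have b0 := ball_gt0 vw.
move: uv vw; rewrite /L2ball/= !ballE ?addr_gt0// => uv vw.
have [mu _ _ _ _] := L2funP u; have [mv _ _ _ _] := L2funP v.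
have [mw _ _ _ _] := L2funP w.
apply: le_lt_trans (sq_triangle mu mv mw a0 b0) _.
move: uv vw; rewrite -(fineK (sq_fin u v)) -(fineK (sq_fin v w)) !lte_fin.
set p := fine _; set q := fine _ => uv vw.
rewrite (_ : (a + b) ^+ 2 = (1 + b / a) * a ^+ 2 + (1 + a / b) * b ^+ 2).
  by rewrite ltrD// ltr_pM2l// addr_gt0// divr_gt0.
by field; rewrite !gt_eqF.
Qed.

HB.instance Definition _ := hasNbhs.Build (L2sigma R)
  (nbhs_ (entourage_ L2ball)).

HB.instance Definition _ := @Nbhs_isPseudoMetric.Build R (L2sigma R)
  (entourage_ L2ball) erefl L2ball ball_center ball_sym ball_triangle erefl.

Lemma L2sigma_ballE (u : L2sigma R) (e : R) :
  ball u e = [set v : L2sigma R | L2dist u v < e].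
Proof. by []. Qed.

End L2sigma_topology.

Section evolution.
Context {R : realType}.
Local Notation mR := (measurableTypeR R).
Implicit Types (tau nu : R) (u v : R -> L2sigma R).

(** A test function in [C^oo_c([0, tau[ x T^2; R^2)], divergence free.  It is
    given by a smooth extension to all times, of which only the values at
    nonnegative times matter. *)
Definition test_field tau (phi : R -> R * R -> R * R) : Prop :=
  [/\ forall t, Z2periodic (phi t),
      smooth ((fun p => phi p.1 p.2) : R * (R * R) -> R * R),
      (exists2 T, T < tau & forall t x, T <= t -> phi t x = 0)
    & forall t x, 0 <= t -> div (phi t) x = 0].

Definition dt (phi : R -> R * R -> R * R) (t : R) (x : R * R) : R * R :=
  derive1 (fun s => phi s x) t.

Definition weakly_continuous tau u : Prop :=
  forall w : L2sigma R,
    {within `[0, tau], continuous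
      (fun t => \int[leb2]_(x in cell) dot (u t x) (w x))}.

(** [sup_(t in [0, tau]) ||u_t - v_t||], possibly infinite. *)
Definition sup_dist tau u v : \bar R :=
  ereal_sup [set (L2dist (u t) (v t))%:E | t in `[0, tau]].

Definition euler_weak_solution tau (u0 : L2sigma R) u : Prop :=
  weakly_continuous tau u /\
  forall phi, test_field tau phi ->
    \int[lebesgue_measure]_(t in `[0, tau]) \int[leb2]_(x in cell)
      (dot (dt phi t x) (u t x) + ddot (nabla (phi t) x) (tens (u t x) (u t x)))
    = - \int[leb2]_(x in cell) dot (phi 0 x) (u0 x).

Definition conservative_euler_solution (u0 : L2sigma R) u : Prop :=
  [/\ {within `[0, +oo[, continuous u},
      forall tau, 0 < tau -> euler_weak_solution tau u0 u
    & forall t, 0 <= t -> L2norm (u t) = L2norm u0].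

(** [A] is the weak gradient of [v], with entries [A_ij = d_j v_i] in [L^2]. *)
Definition weak_gradient (v : R * R -> R * R)
    (A : R * R -> (R * R) * (R * R)) : Prop :=
  [/\ measurable_fun cell (A : mR * mR -> (R * R) * (R * R)),
      (\int[leb2]_(x in cell) (ddot (A x) (A x))%:E < +oo)%E
    & forall (e : R * R) (psi : R * R -> R * R), Z2periodic psi -> smooth psi ->
        \int[leb2]_(x in cell) dot (v x) ('D_e psi x) =
        - \int[leb2]_(x in cell) dot (mulmv (A x) e) (psi x)].

(** The squared [L^2] norm of the gradient of [v].  The weak gradient is unique
    almost everywhere when it exists, so the infimum is over at most one value;
    it is [+oo] if [v] is not in [H^1]. *)
Definition gradnormsq (v : R * R -> R * R) : \bar R :=
  ereal_inf [set (\int[leb2]_(x in cell) (ddot (A x) (A x))%:E)%E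
            | A in weak_gradient v].

Definition navier_stokes_solution nu (u0 : L2sigma R) v : Prop :=
  [/\ {within `[0, +oo[, continuous v},
      (\int[lebesgue_measure]_(t in `[0%R, +oo[) gradnormsq (v t) < +oo)%E
    & forall tau, 0 < tau -> forall phi, test_field tau phi ->
        \int[lebesgue_measure]_(t in `[0, tau]) \int[leb2]_(x in cell)
          (dot (dt phi t x) (v t x)
           + ddot (nabla (phi t) x) (tens (v t x) (v t x))
           + nu * dot (lap (phi t) x) (v t x))
        = - \int[leb2]_(x in cell) dot (phi 0 x) (u0 x)].

(** Real form of the Fourier series: writing [c_k] for the complex coefficients
    of a real field, the sum of [c_k exp(2 i pi k.x)] over a symmetric set of
    modes equals the sum of [Re c_k cos(2 pi k.x) - Im c_k sin(2 pi k.x)]. *)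
Definition frequency (k : int * int) : R * R := (k.1%:~R, k.2%:~R).
Definition phase (k : int * int) (x : R * R) : R :=
  2 * pi * dot (frequency k) x.

Definition fourier_cos (f : R * R -> R * R) (k : int * int) : R * R :=
  (\int[leb2]_(x in cell) ((f x).1 * cos (phase k x)),
   \int[leb2]_(x in cell) ((f x).2 * cos (phase k x))).
Definition fourier_sin (f : R * R -> R * R) (k : int * int) : R * R :=
  (\int[leb2]_(x in cell) ((f x).1 * sin (phase k x)),
   \int[leb2]_(x in cell) ((f x).2 * sin (phase k x))).

(** Orthogonal projection onto the line orthogonal to [k]: the symbol of the
    Leray projection. *)
Definition leray (k : int * int) (z : R * R) : R * R :=
  z - (dot (frequency k) z / normsq (frequency k)) *: frequency k.

Definition modes (n : nat) : seq (int * int) :=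
  let range := [seq i%:Z - n%:Z | i <- iota 0 n.*2.+1] in
  [seq k <- [seq (i, j) | i <- range, j <- range]
  | (k != (0, 0)) && (k.1 ^+ 2 + k.2 ^+ 2 <= n%:Z ^+ 2)].

Definition Pi_ (n : nat) (f : R * R -> R * R) (x : R * R) : R * R :=
  \sum_(k <- modes n) leray k
    (cos (phase k x) *: fourier_cos f k + sin (phase k x) *: fourier_sin f k).

(** The Galerkin system.  Every [u t] is represented by its trigonometric polynomial, so that the
    equation makes sense pointwise. *)
Definition galerkin_solution (n : nat) (u0 : L2sigma R) u : Prop :=
  [/\ forall t : R, 0 <= t -> forall x : R * R, u t x = Pi_ n (u t) x,
      forall x : R * R, {within `[0, +oo[, continuous (fun t => u t x)},
      forall (t : R) (x : R * R), 0 < t ->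
        is_derive t 1 (fun s => u s x)
          (- Pi_ n (fun y => mulmv (nabla (u t) y) (u t y)) x)
    & ae_cell (fun x => u 0 x = u0 x)].

End evolution.

Section young_measures.
Context {R : realType}.
Local Notation mR := (measurableTypeR R).

Definition C0_fun (f : R * R -> R) : Prop :=
  continuous f /\
  forall e, 0 < e -> exists r, forall z, r <= normsq z -> `|f z| <= e.

(** Weakly-* measurable families of probability measures on the cylinder;
    almost everywhere defined families are given by a representative that is
    defined everywhere and Borel. *)
Definition weakstar_measurable (tau : R)
    (m : mR * (mR * mR) -> probability (R * R)%type R) : Prop :=
  forall f : R * R -> R, C0_fun f ->
    measurable_fun (cylinder tau) ((fun p => \int[m p]_z f z) :
      mR * (mR * mR) -> R).

Record young_measure (tau : R) := YoungMeasure {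
  osc : mR * (mR * mR) -> probability (R * R)%type R ;
  conc : {finite_measure set (mR * (mR * mR))%type -> \bar R} ;
  conc_angle : mR * (mR * mR) -> probability (R * R)%type R ;
  osc_measurable : weakstar_measurable tau osc ;
  osc_moment :
    (\int[leb3]_(p in cylinder tau) \int[osc p]_z (normsq z)%:E < +oo)%E ;
  conc_supp : conc (~` cylinder tau) = 0%E ;
  conc_angle_measurable : weakstar_measurable tau conc_angle ;
  conc_angle_circle : forall p, cylinder tau p -> conc_angle p circle = 1%E }.

Definition same_probability (m m' : probability (R * R)%type R) : Prop :=
  forall A, measurable A -> m A = m' A.

Definition young_eq (tau : R) (N N' : young_measure tau) : Prop :=
  [/\ {ae leb3, forall p, cylinder tau p -> same_probability (osc N p) (osc N' p)},
      forall A, measurable A -> conc N A = conc N' A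
    & {ae conc N, forall p, cylinder tau p ->
        same_probability (conc_angle N p) (conc_angle N' p)}].

Definition barycenter (m : probability (R * R)%type R) : R * R :=
  (\int[m]_z z.1, \int[m]_z z.2).

(** The matrix [<m, z (x) z>]. *)
Definition second_moment (m : probability (R * R)%type R) :
    (R * R) * (R * R) :=
  ((\int[m]_z (z.1 * z.1), \int[m]_z (z.1 * z.2)),
   (\int[m]_z (z.2 * z.1), \int[m]_z (z.2 * z.2))).

Definition Linfty_norm (phi : R * R -> R) : R :=
  fine ('N[mrestr leb2 measurable_cell]_(+oo) [EFin \o phi])%E.

Definition admissible (tau : R) (u0 : L2sigma R) (N : young_measure tau) :
    Prop :=
  [/\ exists2 w : R -> L2sigma R, weakly_continuous tau w &
        {ae lebesgue_measure, forall t, t \in `[0, tau] ->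
          ae_cell (fun x => barycenter (osc N (t, x)) = w t x)},
      forall phi, test_field tau phi ->
        \int[leb3]_(p in cylinder tau)
          (dot (dt phi p.1 p.2) (barycenter (osc N p))
           + ddot (nabla (phi p.1) p.2) (second_moment (osc N p)))
        + \int[conc N]_(p in cylinder tau)
            ddot (nabla (phi p.1) p.2) (second_moment (conc_angle N p))
        = - \int[leb2]_(x in cell) dot (phi 0 x) (u0 x)
    & forall (phi : R * R -> R) (chi : R -> R),
        Z2periodic phi -> continuous phi ->
        {within `[0, tau], continuous chi} ->
        \int[leb3]_(p in cylinder tau)
          (phi p.2 * chi p.1 * \int[osc N p]_z normsq z)
        + \int[conc N]_(p in cylinder tau) (phi p.2 * chi p.1)
        <= Linfty_norm phi
           * (\int[lebesgue_measure]_(t in `[0, tau]) `|chi t|)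
           * L2norm u0 ^+ 2].

End young_measures.

(* Main.v *)
Require Import Defs.
From mathcomp Require Import all_boot all_order all_algebra.
From mathcomp Require Import all_classical all_reals all_analysis.
From mathcomp Require Import borel_hierarchy measurable_realfun.
From HB Require Import structures.
From mathcomp Require Import ring lra zify.

(* Fix an ultrafilter U finer than the Frechet filter; it suffices to prove the convergence along
   every such U, and compactness arguments then need no extraction of subsequences.

   The Galerkin energies are conserved and, for a fixed field g, t |-> <u^n_t, g> is equicontinuous
   in n, so that <u^n_t, g> tends to <w_t, g> uniformly on [0, tau]; the space-time weak limit is W.
   The defects v_n = u^n - W are bounded in L^2 and may concentrate. The distributions of
   (t, x, v_n/|v_n|) under |v_n|^2 dx dt converge to the distribution of a map X under Lebesgue
   measure on some [0, M]; X is built as in Skorokhod's representation theorem, by cutting [0, M]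
   into intervals according to the limit masses of the cells of a binary coding of [0, 1[^5. The
   (t, x)-marginal kappa of X is the concentration measure. Twice the angle of v_n has cosine and
   sine with conditional expectations a and b given (t, x) under kappa, and a mixture of two Dirac
   masses on the circle with the same second moments serves as concentration angle: an admissible
   measure-valued solution only sees second moments. The oscillation part is the Dirac mass at W.

   Uniqueness among admissible measure-valued solutions then gives W = u, hence w_t = u_t. As the
   energies of u^n_t and u_t are constant,
     |u^n_t - u_t|^2 = |u^n_0|^2 - 2 <u^n_t, u_t> + |u_0|^2,
   and the right-hand side tends to 0 uniformly in t. *)

Set Implicit Arguments.
Unset Strict Implicit.
Unset Printing Implicit Defensive.

Import Order.TTheory GRing.Theory Num.Theory numFieldNormedType.Exports.

Local Open Scope classical_set_scope.
Local Open Scope ring_scope.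

(** * Square-integrable functions *)

(** Writing u^n = W + v_n splits each quadratic expression into its value at W, a term linear in
    v_n, which tends to 0 by weak convergence, and a term quadratic in v_n. The limit of the last
    one, whether it comes from oscillation or from concentration, can be charged entirely to the
    concentration part; hence no nontrivial oscillation measure has to be constructed. Since v (x) v
    is |v|^2 times an affine function of the cosine and sine of the double angle of v, three scalar
    limits suffice. The other obstacle is the truncation: the Galerkin equation can be tested only
    against fields that [Pi_ n] preserves up to a constant. Test fields are replaced by their Fejer
    means in space: these are solenoidal trigonometric polynomials, the averaging commutes with
    derivatives, and it converges uniformly. On trigonometric polynomials the integral over the
    torus is a finite sum over a grid, so that differentiating integrals in time needs only the
    pointwise Galerkin equation. Finally, the curves w and u come without joint measurability in (t,
    x); fields on the cylinder with the same slices are obtained as weak limits, and the Fourier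
    modes identify the slices. *)

Section real_L2.
Context d (T : measurableType d) (R : realType).
Variables (mu : {measure set T -> \bar R}) (D : set T).
Hypothesis mD : measurable D.
Implicit Types f g h : T -> R.

Definition rint f := mu.-integrable D (EFin \o f).

Lemma rint_measurable f : rint f -> measurable_fun D f.
Proof. by move/measurable_int/measurable_EFinP. Qed.

Lemma rintD f g : rint f -> rint g -> rint (fun x => f x + g x).
Proof. by move=> rf rg; have := integrableD mD rf rg; exact: eq_integrable. Qed.

Lemma rintZ (c : R) f : rint f -> rint (fun x => c * f x).
Proof. by move=> rf; have := integrableZl mD c rf; exact: eq_integrable. Qed.

Lemma rintN f : rint f -> rint (fun x => - f x).
Proof. by move=> rf; have := integrableN rf; exact: eq_integrable. Qed.

Lemma rintB f g : rint f -> rint g -> rint (fun x => f x - g x).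
Proof. by move=> ? ?; apply: rintD => //; exact: rintN. Qed.

Lemma rint_sum (I : Type) (s : seq I) (F : I -> T -> R) :
  (forall i, rint (F i)) -> rint (fun x => \sum_(i <- s) F i x).
Proof.
move=> Fi; elim: s => [|i s IH].
  by have := integrable0 mu D; apply: eq_integrable => // x _ /=; rewrite big_nil.
rewrite [X in rint X](_ : _ = fun x => F i x + \sum_(j <- s) F j x); first exact: rintD.
by apply/funext => x; rewrite big_cons.
Qed.

Lemma rint_le f g : measurable_fun D f -> rint g ->
  (forall x, D x -> `|f x| <= g x) -> rint f.
Proof.
move=> mf ig fg; apply: (@le_integrable _ _ _ mu D mD _ (EFin \o g)) => //.
  exact/measurable_EFinP.
by move=> x Dx /=; rewrite lee_fin (le_trans (fg _ Dx))// ler_norm.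
Qed.

Lemma Rint_sum (I : Type) (s : seq I) (F : I -> T -> R) :
  (forall i, rint (F i)) ->
  \int[mu]_(x in D) (\sum_(i <- s) F i x) = \sum_(i <- s) \int[mu]_(x in D) F i x.
Proof.
move=> Fi; elim: s => [|i s IH].
  rewrite big_nil; under eq_Rintegral do rewrite big_nil.
  by rewrite /Rintegral integral0.
rewrite big_cons -IH -RintegralD//; [|exact: Fi|exact: rint_sum].
by apply: eq_Rintegral => x _; rewrite big_cons.
Qed.

Lemma eq_Rint f g : (forall x, D x -> f x = g x) ->
  \int[mu]_(x in D) f x = \int[mu]_(x in D) g x.
Proof. by move=> fg; apply: eq_Rintegral => x /set_mem; exact: fg. Qed.

Lemma eq_rint f g : (forall x, D x -> f x = g x) -> rint f -> rint g.
Proof. by move=> fg; apply: (eq_integrable mD) => x /set_mem Dx /=; rewrite fg. Qed.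

Definition L2 f := measurable_fun D f /\ rint (fun x => f x * f x).

Lemma eq_L2 f g : (forall x, D x -> f x = g x) -> L2 f -> L2 g.
Proof.
move=> fg [mf rf]; split.
  by apply: eq_measurable_fun mf => x /set_mem Dx; rewrite fg.
by apply: eq_rint rf => x Dx; rewrite fg.
Qed.

Lemma L2_prod f g : L2 f -> L2 g -> rint (fun x => f x * g x).
Proof.
move=> [mf f2] [mg g2]; apply: rint_le (rintD f2 g2) _.
  exact: measurable_funM.
move=> x Dx; rewrite ler_norml; apply/andP; split.
  by have := sqr_ge0 (f x + g x); rewrite expr2; nra.
by have := sqr_ge0 (f x - g x); rewrite expr2; nra.
Qed.

Lemma L2Z (c : R) f : L2 f -> L2 (fun x => c * f x).
Proof.
move=> [mf f2]; split; first exact: measurable_funM.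
by apply: eq_rint (rintZ (c * c) f2) => x _; ring.
Qed.

Lemma L2D f g : L2 f -> L2 g -> L2 (fun x => f x + g x).
Proof.
move=> [mf f2] [mg g2]; split; first exact: measurable_funD.
have i := rintD f2 (rintD g2 (rintZ 2 (L2_prod (conj mf f2) (conj mg g2)))).
by apply: eq_rint i => x _; ring.
Qed.

Lemma L2N f : L2 f -> L2 (fun x => - f x).
Proof. by move=> /(L2Z (-1)); apply: eq_L2 => x _; rewrite mulN1r. Qed.

Lemma L2B f g : L2 f -> L2 g -> L2 (fun x => f x - g x).
Proof. by move=> lf lg; apply: L2D => //; exact: L2N. Qed.

Lemma L2_sum (I : Type) (s : seq I) (F : I -> T -> R) :
  (forall i, L2 (F i)) -> L2 (fun x => \sum_(i <- s) F i x).
Proof.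
move=> Fi; elim: s => [|i s IH].
  split; first by rewrite [X in measurable_fun D X](_ : _ = cst 0)//; apply/funext => x; rewrite big_nil.
  by have := integrable0 mu D; apply: eq_integrable => // x _ /=; rewrite big_nil mulr0.
apply: eq_L2 (L2D (Fi i) IH) => x _.
by rewrite big_cons.
Qed.

Hypothesis fD : (mu D < +oo)%E.

Lemma rint_bounded f (B : R) : measurable_fun D f ->
  (forall x, D x -> `|f x| <= B) -> rint f.
Proof.
move=> mf fB; apply: rint_le fB => //; apply/integrableP; split.
  exact: measurable_cst.
by rewrite integral_cst//= lte_mul_pinfty// lee_fin.
Qed.

Lemma L2_bounded f (B : R) : measurable_fun D f ->
  (forall x, D x -> `|f x| <= B) -> L2 f.
Proof.
move=> mf fB; split=> //; apply: (@rint_bounded _ (B * B)).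
  exact: measurable_funM.
by move=> x Dx; rewrite normrM ler_pM// fB.
Qed.

Lemma L2_bmul f g (B : R) : measurable_fun D f ->
  (forall x, D x -> `|f x| <= B) -> L2 g -> L2 (fun x => f x * g x).
Proof.
move=> mf fB [mg g2]; split; first exact: measurable_funM.
have i := rintZ (B * B) g2.
apply: rint_le i _; first by do 2?apply: measurable_funM.
move=> x Dx; have := fB _ Dx.
have -> : f x * g x * (f x * g x) = f x ^+ 2 * g x ^+ 2 by ring.
rewrite -!expr2 (ger0_norm (mulr_ge0 (sqr_ge0 _) (sqr_ge0 _))) => fxB.
rewrite ler_wpM2r ?sqr_ge0// -[X in X <= _]real_normK ?num_real// lerXn2r ?nnegrE//.
exact: le_trans fxB.
Qed.

Lemma L2_rint f : L2 f -> rint f.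
Proof.
move=> lf; have l1 : L2 (fun=> 1).
  by apply: (@L2_bounded _ 1) => // x _; rewrite normr1.
by apply: eq_rint (L2_prod lf l1) => x _; rewrite mulr1.
Qed.

End real_L2.

Lemma discriminant (R : realType) (a b c : R) : 0 <= a -> 0 <= c ->
  (forall s : R, 0 <= a - 2 * s * b + s ^+ 2 * c) -> b ^+ 2 <= a * c.
Proof.
move=> a0 c0 H; have [c00|cN0] := eqVneq c 0.
  have [->|bN0] := eqVneq b 0; first by rewrite expr0n/= mulr_ge0.
  (* With [c = 0] the polynomial is affine in [s]; at this point it equals -1. *)
  have := H ((a + 1) / (2 * b)).
  have -> : 2 * ((a + 1) / (2 * b)) * b = a + 1 by field.
  by rewrite c00 mulr0 addr0; lra.
have cp : 0 < c by rewrite lt_neqAle eq_sym cN0.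
have := H (b / c).
have -> : a - 2 * (b / c) * b + (b / c) ^+ 2 * c = (a * c - b ^+ 2) / c by field.
by rewrite pmulr_lge0 ?invr_gt0// subr_ge0.
Qed.

Section cauchy_schwarz.
Context d (T : measurableType d) (R : realType).
Variables (mu : {measure set T -> \bar R}) (D : set T).
Hypothesis mD : measurable D.
Implicit Types f g h : T -> R.
Local Notation L2 := (L2 mu D).
Local Notation "<< f , g >>" := (\int[mu]_(x in D) (f x * g x)).

Lemma ip_ge0 f : 0 <= << f , f >>.
Proof. by apply: Rintegral_ge0 => x _; rewrite -expr2 sqr_ge0. Qed.

Lemma cauchy_schwarz f g : L2 f -> L2 g ->
  << f , g >> ^+ 2 <= << f , f >> * << g , g >>.
Proof.
move=> lf lg; apply: discriminant; [exact: ip_ge0..|move=> s].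
have lfg := L2_prod mD lf lg.
have -> : << f, f >> - 2 * s * << f, g >> + s ^+ 2 * << g, g >> =
  \int[mu]_(x in D) ((f x - s * g x) * (f x - s * g x)).
  rewrite -(RintegralZl _ mD lfg) -(RintegralZl _ mD lg.2).
  rewrite -RintegralB//; [|exact: lf.2|exact: rintZ].
  rewrite -RintegralD//; [|by apply: rintB => //; [exact: lf.2|exact: rintZ]|by apply: rintZ => //; exact: lg.2].
  by apply: eq_Rint => x _; ring.
by apply: Rintegral_ge0 => x _; rewrite -expr2 sqr_ge0.
Qed.

End cauchy_schwarz.

(** * Limits along an ultrafilter *)

Section ultralimits.
Context (R : realType) (U : set_system nat) {UU : UltraFilter U}.

(** Compactness of the segment gives a cluster point of the image ultrafilter, and an ultrafilter
    converges to each of its cluster points. *)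
Lemma ultra_cvg (a : nat -> R) (B : R) :
  (\forall n \near U, `|a n| <= B) -> exists2 l, a @ U --> l & `|l| <= B.
Proof.
move=> aB.
have /(_ (a @ U)) := @segment_compact R (- B) B.
case=> [|l [lB cl]].
  by apply: filterS aB => n; rewrite /= in_itv/= ler_norml.
exists l; last by move: lB; rewrite /= in_itv/= ler_norml.
move=> V Vl; have [//|UnV] := in_ultra_setVsetC (a @^-1` V) UU.
have [y []] := cl (~` V) V UnV Vl; by [].
Qed.

Lemma ultra_cvg_le (a b : nat -> R) (l m : R) : a @ U --> l -> b @ U --> m ->
  (\forall n \near U, a n <= b n) -> l <= m.
Proof. by move=> al bm ab; apply: (ler_cvg_to al bm ab). Qed.

End ultralimits.

(** The form in which Cauchy-Schwarz, or a bound on the square of a functional, yields convergence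
    to 0. *)
Lemma sqr_cvg0 (I : Type) (R : realType) (F : set_system I) {FF : Filter F} (a b : I -> R) :
  (\forall n \near F, a n ^+ 2 <= b n) -> b @ F --> (0 : R) -> a @ F --> (0 : R).
Proof.
move=> ab /cvgr0Pnorm_lt b0; apply/cvgr0Pnorm_lt => e e0.
have e2 : 0 < e ^+ 2 by rewrite exprn_gt0.
near=> n; rewrite -(ltr_pXn2r (ltn0Sn 1)) ?nnegrE ?(ltW e0)// real_normK ?num_real//.
apply: le_lt_trans (near ab n _) _ => //.
by apply: le_lt_trans (ler_norm _) _; near: n; exact: b0.
Unshelve. all: by end_near. Qed.

(** * Dominated convergence, truncation and finitely valued functions *)

Section real_convergence.
Context d (T : measurableType d) (R : realType).
Variables (mu : {measure set T -> \bar R}) (D : set T).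
Hypothesis mD : measurable D.

Lemma Rdominated_convergence (f_ : nat -> T -> R) (f g : T -> R) :
  (forall n, measurable_fun D (f_ n)) ->
  (forall x, D x -> f_ n x @[n --> \oo] --> f x) ->
  rint mu D g -> (forall n x, D x -> `|f_ n x| <= g x) ->
  rint mu D f /\ \int[mu]_(x in D) f_ n x @[n --> \oo] --> \int[mu]_(x in D) f x.
Proof.
move=> mf cf ig fg.
have mf' : measurable_fun D f by apply: measurable_fun_cvg cf.
have [||||| rf _ cv] := @dominated_convergence _ _ _ mu D mD
  (fun n => EFin \o f_ n) (EFin \o f) (EFin \o g).
- by move=> n; exact/measurable_EFinP.
- exact/measurable_EFinP.
- by apply: aeW => x Dx; apply: cvg_EFin; [exact: nearW|exact: cf].
- exact: ig.
- by apply: aeW => x n Dx; rewrite /= lee_fin fg.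
split; first exact: rf.
apply: fine_cvg; rewrite fineK//.
exact: integrable_fin_num.
Qed.

Lemma Rint_subset (A : set T) f : measurable A -> A `<=` D -> rint mu D f ->
  (forall x, D x -> 0 <= f x) -> \int[mu]_(x in A) f x <= \int[mu]_(x in D) f x.
Proof.
move=> mA AD rf f0; rewrite /Rintegral fine_le//.
- by apply: integrable_fin_num => //; exact: integrableS rf.
- exact: integrable_fin_num.
- by apply: ge0_subset_integral => //; exact: (measurable_int mu rf).
Qed.

Definition clamp (K x : R) : R := Num.max (- K) (Num.min x K).

Lemma clamp_id (K x : R) : `|x| <= K -> clamp K x = x.
Proof.
by rewrite ler_norml => /andP[Kx xK]; rewrite /clamp (min_idPl xK) (max_idPr Kx).
Qed.

Lemma clamp_norm (K x : R) : 0 <= K -> `|clamp K x| <= K.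
Proof.
move=> K0; rewrite ler_norml /clamp le_max lexx/= ge_max.
by rewrite ge_min lexx orbT andbT; lra.
Qed.

Lemma clamp_le (K x : R) : 0 <= K -> `|clamp K x| <= `|x|.
Proof.
move=> K0; have [xK|Kx] := leP `|x| K; first by rewrite clamp_id.
exact: le_trans (clamp_norm _ K0) (ltW Kx).
Qed.

Lemma clamp_mul (K x : R) : 0 <= K -> clamp K x * clamp K x <= x * clamp K x.
Proof.
move=> K0; rewrite /clamp; case: (leP x K) => xK; case: (leP (- K) _) => h //; nra.
Qed.

Lemma clampB (K x : R) : 0 <= K -> `|x - clamp K x| <= `|x|.
Proof.
move=> K0; rewrite /clamp; case: (leP x K) => xK; case: (leP (- K) _) => h.
- by rewrite subrr normr0.
- by rewrite !ler0_norm; lra.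
- by rewrite !ger0_norm; lra.
- lra.
Qed.

Lemma measurable_clamp (K : R) (f : T -> R) :
  measurable_fun D f -> measurable_fun D (fun x => clamp K (f x)).
Proof.
move=> mf; apply: measurable_maxr; first exact: measurable_cst.
by apply: measurable_minr => //; exact: measurable_cst.
Qed.

Lemma clamp_cvg (x : R) : clamp n%:R x @[n --> \oo] --> x.
Proof.
apply: cvg_near_cst; have [N _ HN] := nbhs_infty_ger `|x|.
by exists N => // n Nn; rewrite clamp_id// HN.
Qed.

Lemma L2_clamp (K : R) f : 0 <= K -> L2 mu D f -> L2 mu D (fun x => clamp K (f x)).
Proof.
move=> K0 [mf f2]; split; first exact: measurable_clamp.
apply: rint_le f2 _ => //.
  by apply: measurable_funM; exact: measurable_clamp.
move=> x Dx; rewrite normrM -[leRHS]ger0_norm -?expr2 ?sqr_ge0// normrX.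
by rewrite lerXn2r ?nnegrE// clamp_le.
Qed.

Lemma L2_clamp_cvg f : L2 mu D f ->
  \int[mu]_(x in D) ((f x - clamp n%:R (f x)) * (f x - clamp n%:R (f x)))
    @[n --> \oo] --> (0 : R).
Proof.
move=> [mf f2].
have [||||_] := @Rdominated_convergence
  (fun n x => (f x - clamp n%:R (f x)) * (f x - clamp n%:R (f x))) (fun=> 0)
  (fun x => f x * f x); last by rewrite Rintegral_cst// mul0r.
- by move=> n; apply: measurable_funM; apply: measurable_funB => //; exact: measurable_clamp.
- move=> x Dx.
  have : (f x - clamp n%:R (f x)) @[n --> \oo] --> f x - f x.
    by apply: cvgB; [exact: cvg_cst|exact: clamp_cvg].
  by rewrite subrr => c; rewrite -[X in _ --> X](mulr0 0); exact: cvgM.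
- exact: f2.
- move=> n x Dx; rewrite normrM -[leRHS]ger0_norm -?expr2 ?sqr_ge0// normrX.
  by rewrite lerXn2r ?nnegrE// clampB.
Qed.

(** Stands in for simple functions, with a weight [f]. In the Riesz theorem [J] rounds the values of
    a function; in the Skorokhod representation it numbers the cells of a partition. *)
Lemma rint_finite_valued (N : nat) (J : T -> nat) (h : nat -> R) (f : T -> R) :
  (forall x, D x -> (J x < N)%N) ->
  (forall i, measurable (D `&` [set x | J x = i])) -> rint mu D f ->
  rint mu D (fun x => h (J x) * f x) /\
  \int[mu]_(x in D) (h (J x) * f x) =
  \sum_(i < N) h i * \int[mu]_(x in D `&` [set x | J x = i]) f x.
Proof.
move=> JN mJ rf.
pose c i x : R := (J x == i)%:R * f x.
have E x : D x -> h (J x) * f x = \sum_(i < N) h i * c i x.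
  move=> Dx; rewrite (bigD1 (Ordinal (JN _ Dx)))//= big1 ?addr0.
    by rewrite /c/= eqxx mul1r.
  move=> i ne; rewrite /c (_ : (J x == i) = false) ?mul0r ?mulr0//.
  by apply/negbTE; apply: contra ne => /eqP e; apply/eqP/val_inj.
have cE i x : D x -> c i x = (f \_ [set y | J y = i]) x.
  move=> Dx; rewrite /c; case: eqP => e; first by rewrite patchT ?inE// mul1r.
  by rewrite patchN ?mul0r//; apply/negP; rewrite inE.
have ri (i : nat) : rint mu D (c i).
  apply: (@rint_le _ _ _ _ _ mD _ (fun x => `|f x|)).
  - apply: measurable_funM; last exact: rint_measurable rf.
    apply: (eq_measurable_fun (\1_(D `&` [set y | J y = i]) : T -> R)); last exact: measurable_indic.
    move=> x xD; rewrite indicE in_setI xD /=; congr (nat_of_bool _)%:R.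
    by apply/idP/eqP => [/set_mem//|]; exact: mem_set.
  - exact: integrable_norm.
  - by move=> x Dx; rewrite normrM ler_piMl//; case: eqP => _; rewrite ?normr1 ?normr0.
have re := rint_sum mD (index_enum 'I_N) (fun i : 'I_N => rintZ mD (h i) (ri i)).
split; first by apply: eq_rint re => // x Dx; rewrite E.
rewrite (eq_Rint _ E) Rint_sum//; last by move=> i; apply: rintZ.
apply: eq_bigr => i _; rewrite RintegralZl//; last exact: ri.
by rewrite Rintegral_mkcondr; congr (_ * _); apply: eq_Rint => x Dx; rewrite cE.
Qed.

End real_convergence.

(** * Riesz representation and weak limits along an ultrafilter *)

Section riesz.
Context d (T : measurableType d) (R : realType).
Variables (mu : {sigma_finite_measure set T -> \bar R}) (D : set T).
Hypothesis mD : measurable D.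
Hypothesis fD : (mu D < +oo)%E.
Variables (L : (T -> R) -> R) (C : R).
Hypothesis C0 : 0 <= C.
Hypothesis LD : forall f g, L2 mu D f -> L2 mu D g ->
  L (fun x => f x + g x) = L f + L g.
Hypothesis LZ : forall c f, L2 mu D f -> L (fun x => c * f x) = c * L f.
Hypothesis Lb : forall f, L2 mu D f ->
  L f ^+ 2 <= C * \int[mu]_(x in D) (f x * f x).

Let L2_indic (A : set T) : measurable A -> L2 mu D (\1_A).
Proof.
move=> mA; apply: (@L2_bounded _ _ _ _ _ mD fD _ 1); first exact: measurable_indic.
by move=> x _; rewrite indicE; case: (_ \in _); rewrite ?normr1 ?normr0.
Qed.

(** The bound [Lb] sees only the values on [D], so [L] cannot distinguish functions that agree
    there. *)
Let Lext f g : L2 mu D f -> L2 mu D g -> (forall x, D x -> f x = g x) -> L f = L g.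
Proof.
move=> lf lg fg; have lgN := L2Z mD (-1) lg.
have l0 := L2D mD lf lgN.
have := Lb l0; rewrite (@eq_Rint _ _ _ mu D _ (fun=> 0)); last first.
  by move=> x Dx; rewrite fg// mulN1r subrr mulr0.
rewrite Rintegral_cst// mul0r mulr0 => h.
have : L (fun x => f x + -1 * g x) ^+ 2 == 0 by rewrite eq_le h sqr_ge0.
by rewrite sqrf_eq0 LD// LZ// mulN1r subr_eq0 => /eqP.
Qed.

Let L0 : L (fun=> 0) = 0.
Proof.
have l : L2 mu D (\1_set0) by exact: L2_indic.
rewrite -[RHS](mul0r (L (\1_set0))) -LZ//; congr L.
by apply/funext => x; rewrite mul0r.
Qed.

Let L_sum I (s : seq I) (F : I -> T -> R) : (forall i, L2 mu D (F i)) ->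
  L (fun x => \sum_(i <- s) F i x) = \sum_(i <- s) L (F i).
Proof.
move=> lF; elim: s => [|i s IH].
  by rewrite big_nil -[RHS]L0; congr L; apply/funext => x; rewrite big_nil.
rewrite big_cons -IH -LD//; last exact: L2_sum.
by congr L; apply/funext => x; rewrite big_cons.
Qed.

(** The representing function will be the Radon-Nikodym density of this charge. Applied to
    indicators, [Lb] gives both its countable additivity and its absolute continuity. *)
Let nu (A : set T) : \bar R := (L (\1_A))%:E.

Let nu0 : nu set0 = 0%E.
Proof. by rewrite /nu indic0 L0. Qed.

Let finnu A : measurable A -> nu A \is a fin_num.
Proof. by []. Qed.

Let snu : semi_sigma_additive nu.
Proof.
move=> F mF tF mUF.
(* The indicator of the part of the union outside the first [n] sets. Its L^2 norm tends to 0, hence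
   so does its image under [L], and this is countable additivity. *)
pose g n x : R := \1_(\bigcup_n F n) x + -1 * \sum_(i <- index_iota 0 n) \1_(F i) x.
have lS n : L2 mu D (fun x => \sum_(i <- index_iota 0 n) \1_(F i) x).
  by apply: L2_sum => // i; exact: L2_indic.
have lg n : L2 mu D (g n).
  by apply: L2D => //; [exact: L2_indic|exact: L2Z].
have gE n x : g n x = ((x \in \bigcup_n F n) && (x \notin \bigcup_(k < n) F k))%:R.
  rewrite /g; have [/set_mem[k _ Fkx]|xF] := boolP (x \in \bigcup_n F n); last first.
    rewrite indicE (negbTE xF) big1 ?mulr0 ?addr0// => i _.
    by rewrite indicE memNset// => xFi; move: xF; rewrite notin_setE => -[]; exists i.
  have uF i : (x \in F i) = (i == k).
    apply/idP/eqP => [/set_mem Fix|->]; last exact/mem_set.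
    by apply: (tF _ _ I I); exists x.
  rewrite indicE mem_set/=; last by exists k.
  have [kn|nk] := ltnP k n.
    rewrite (bigD1_seq k) ?mem_index_iota ?iota_uniq//= indicE uF eqxx big1 ?addr0.
      rewrite mulN1r subrr; case: (boolP (x \notin _)) => //; rewrite notin_setE => -[].
      by exists k.
    by move=> i ik; rewrite indicE uF (negbTE ik).
  rewrite big_seq big1 ?mulr0 ?addr0; last first.
    move=> i; rewrite mem_index_iota/= => ni; rewrite indicE uF.
    by rewrite (ltn_eqF (leq_trans ni nk)).
  case: (boolP (x \notin _)) => //; rewrite negbK => /set_mem[i /= ni /mem_set].
  by rewrite uF => /eqP e; move: ni; rewrite e ltnNge nk.
have cg : \int[mu]_(x in D) (g n x * g n x) @[n --> \oo] --> (0 : R).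
  have [||||_] := @Rdominated_convergence _ _ _ mu D mD
    (fun n x => g n x * g n x) (fun=> 0) (fun=> 1); last by rewrite Rintegral_cst// mul0r.
  - by move=> n; apply: measurable_funM; case: (lg n).
  - move=> x _; apply: cvg_near_cst.
    have [/set_mem[k _ Fkx]|xF] := boolP (x \in \bigcup_n F n).
      exists k.+1 => // n /= kn; rewrite gE; case: (boolP (x \notin _)); rewrite ?andbF ?mulr0//.
      by rewrite notin_setE => -[]; exists k.
    by exists 0%N => // n _; rewrite gE (negbTE xF) mulr0.
  - by apply: (@rint_bounded _ _ _ _ _ mD fD _ 1) => // x _; rewrite normr1.
  - by move=> n x _; rewrite gE; case: (_ && _); rewrite ?mulr1 ?mulr0 ?normr1 ?normr0.
have cL : L (g n) @[n --> \oo] --> (0 : R).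
  apply: (@sqr_cvg0 _ _ _ _ _ (fun n => C * \int[mu]_(x in D) (g n x * g n x))).
    by apply: nearW => n; exact: Lb.
  by rewrite -(mulr0 C); apply: cvgM => //; exact: cvg_cst.
have E n : (\sum_(0 <= i < n) nu (F i))%E = (L (\1_(\bigcup_n F n)) - L (g n))%:E.
  rewrite /nu sumEFin; congr EFin; rewrite /g LD//; [|exact: L2_indic|exact: L2Z].
  rewrite LZ// L_sum; last by move=> i; exact: L2_indic.
  by rewrite mulN1r opprD opprK addrA subrr add0r.
under eq_fun do rewrite E.
apply: cvg_EFin; first exact: nearW.
rewrite -[X in _ --> X]subr0; apply: cvgB => //; exact: cvg_cst.
Qed.

HB.instance Definition _ := isCharge.Build _ _ _ nu nu0 finnu snu.

Let numu : nu `<< mu.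
Proof.
apply/null_content_dominatesP => A mA muA0; rewrite /nu.
have := Lb (L2_indic mA).
rewrite (_ : \int[mu]_(x in D) _ = 0) ?mulr0 => [h|].
  by apply/eqP; rewrite eqe -sqrf_eq0 eq_le h sqr_ge0.
rewrite (@eq_Rint _ _ _ mu D _ (\1_A)).
  rewrite /Rintegral integral_indic//; apply: (congr1 fine (y := 0%E)).
  by apply: (subset_measure0 _ mA) => //; apply: measurableI.
by move=> x _; rewrite indicE; case: (_ \in _); rewrite ?mulr1 ?mulr0.
Qed.

Let w : T -> R := fine \o Radon_Nikodym nu mu.

Let wE : EFin \o w = Radon_Nikodym nu mu.
Proof. by apply/funext => x /=; rewrite fineK// Radon_Nikodym_fin_num. Qed.

Let w_rint : rint mu D w.
Proof.
by rewrite /rint wE; apply: integrableS (Radon_Nikodym_integrable numu).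
Qed.

Let L_indic A : measurable A -> A `<=` D -> L (\1_A) = \int[mu]_(x in A) w x.
Proof.
move=> mA _; apply: EFin_inj.
have -> : (L \1_A)%:E = (\int[mu]_(x in A) Radon_Nikodym nu mu x)%E := Radon_Nikodym_integral numu mA.
rewrite /Rintegral -/(EFin \o w) wE fineK//.
by apply: integrable_fin_num => //; apply: integrableS (Radon_Nikodym_integrable numu).
Qed.

(** Both sides agree on finitely valued functions, and [g] is a uniform limit of such functions. The
    left side is controlled by the uniform distance through [Lb] and the finiteness of [mu D], the
    right side through the integrability of [w]. *)
Let L_bounded (g : T -> R) (K : R) : measurable_fun D g -> 0 <= K -> (forall x, D x -> `|g x| <= K) ->
  L g = \int[mu]_(x in D) (g x * w x).
Proof.
move=> mg K0 gK; have lg := L2_bounded mD fD mg gK.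
have rgw : rint mu D (fun x => g x * w x).
  apply: (@rint_le _ _ _ _ _ mD _ (fun x => K * `|w x|)).
  - by apply: measurable_funM => //; exact: rint_measurable w_rint.
  - by apply: rintZ => //; exact: integrable_norm.
  - by move=> x Dx; rewrite normrM ler_wpM2r// gK.
apply/eqP; rewrite -subr_eq0 -normr_le0; apply/ler_addgt0Pl => e0 e0p; rewrite addr0.
pose M := Num.sqrt (C * fine (mu D)) + \int[mu]_(x in D) `|w x|.
have M0 : 0 <= M by rewrite addr_ge0 ?sqrtr_ge0// Rintegral_ge0.
(* [M] is the sum of the two Lipschitz constants, so the total error is at most [e * M <= e0]; the
   added 1 keeps the denominator positive. *)
pose e := e0 / (M + 1).
have e_gt0 : 0 < e by rewrite divr_gt0// ltr_wpDl.
(* Number of the step of height [e] that contains the value [g x]. Clamping changes nothing on [D]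
   and makes the bounds on the argument hold at every point. *)
pose J x := Num.trunc ((clamp K (g x) + K) / e).
pose h i : R := i%:R * e - K.
pose N := (Num.trunc ((K + K) / e)).+1.
have cK x : 0 <= (clamp K (g x) + K) / e <= (K + K) / e.
  have := clamp_norm (g x) K0; rewrite ler_norml => /andP[h1 h2].
  rewrite ler_pM2r ?invr_gt0// lerD2r h2 andbT; apply: divr_ge0; [lra|exact: ltW].
have JN x : D x -> (J x < N)%N.
  by move=> _; rewrite ltnS; apply: le_truncn; case/andP: (cK x).
have hJ x : D x -> `|h (J x) - g x| <= e.
  move=> Dx; have /andP[c0 _] := cK x.
  have := truncn_itv c0; rewrite -/(J x) ler_pdivlMr// ltr_pdivrMr//.
  rewrite clamp_id ?gK// => /andP[a b]; rewrite /h ler_norml.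
  by move: b; rewrite -natr1 mulrDl mul1r => b; apply/andP; split; lra.
have mJ i : measurable (D `&` [set x | J x = i]).
  have -> : D `&` [set x | J x = i] =
      D `&` (fun x => (clamp K (g x) + K) / e) @^-1` [set` `[i%:R, i.+1%:R[].
    apply/seteqP; split=> x [Dx] /=; rewrite in_itv/=.
      by move=> <-; split=> //; apply: truncn_itv; case/andP: (cK x).
    by move=> xi; split=> //; apply: truncn_def.
  have : measurable_fun D (fun x => (clamp K (g x) + K) / e).
    apply: measurable_funM => //; apply: measurable_funD => //.
    exact: measurable_clamp.
  by apply => //; exact: measurable_itv.
have [rh hE] := rint_finite_valued mD h JN mJ w_rint.
have lh : L2 mu D (fun x => h (J x)).
  apply: (@L2_bounded _ _ _ _ _ mD fD _ (K + e)).
    have lc : L2 mu D (fun=> 1 : R).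
      by apply: (@L2_bounded _ _ _ _ _ mD fD _ 1) => // x _; rewrite normr1.
    have [r1 _] := rint_finite_valued mD h JN mJ (L2_rint mD fD lc).
    by apply: eq_measurable_fun (rint_measurable r1) => x _; rewrite mulr1.
  move=> x Dx; have := hJ x Dx; have := gK x Dx; have := ler_normD (h (J x) - g x) (g x).
  by rewrite subrK; lra.
have Lh : L (fun x => h (J x)) = \int[mu]_(x in D) (h (J x) * w x).
  rewrite hE; transitivity (L (fun x => \sum_(i <- index_enum 'I_N) h i * \1_(D `&` [set x | J x = i]) x)).
    apply: Lext => //.
      by apply: L2_sum => // i; apply: L2Z => //; exact: L2_indic.
    move=> x Dx; rewrite (bigD1 (Ordinal (JN _ Dx)))//= indicE mem_set// mulr1 big1 ?addr0//.
    move=> i ne; rewrite indicE memNset ?mulr0// => -[_ /= ei]; move/eqP: ne; apply.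
    exact: val_inj.
  rewrite L_sum; last by move=> i; apply: L2Z => //; exact: L2_indic.
  by apply: eq_bigr => i _; rewrite LZ ?L_indic//; first [exact: L2_indic|exact: subIsetl].
have lgh := L2D mD lg (L2Z mD (-1) lh).
have -> : L g - \int[mu]_(x in D) (g x * w x) =
    L (fun x => g x + -1 * h (J x)) + \int[mu]_(x in D) ((h (J x) - g x) * w x).
  rewrite LD//; last exact: L2Z.
  rewrite LZ// Lh mulN1r.
  have -> : \int[mu]_(x in D) ((h (J x) - g x) * w x) =
      \int[mu]_(x in D) (h (J x) * w x) - \int[mu]_(x in D) (g x * w x).
    by rewrite -RintegralB//; apply: eq_Rint => x _; rewrite mulrBl.
  by rewrite addrA subrK.
have b1 : `|L (fun x => g x + -1 * h (J x))| <= e * Num.sqrt (C * fine (mu D)).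
  have -> : e * Num.sqrt (C * fine (mu D)) = Num.sqrt (e ^+ 2 * (C * fine (mu D))).
    by rewrite [RHS]sqrtrM ?sqr_ge0// sqrtr_sqr (ger0_norm (ltW e_gt0)).
  rewrite -sqrtr_sqr ler_wsqrtr//; apply: le_trans (Lb lgh) _; rewrite mulrCA ler_wpM2l//.
  rewrite -Rintegral_cst//; apply: le_Rintegral => //; first exact: lgh.2.
    by apply: (@rint_bounded _ _ _ _ _ mD fD _ (e ^+ 2)) => // x _; rewrite ger0_norm// sqr_ge0.
  move=> x Dx; rewrite -expr2 mulN1r -real_normK ?num_real// distrC.
  by rewrite lerXn2r ?nnegrE ?(ltW e_gt0)// hJ.
have b2 : `|\int[mu]_(x in D) ((h (J x) - g x) * w x)| <= e * \int[mu]_(x in D) `|w x|.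
  have rw : rint mu D (fun x => (h (J x) - g x) * w x).
    by have := rintB mD rh rgw; apply: eq_rint => // x _; rewrite [RHS]mulrBl.
  apply: le_trans (le_normr_Rintegral mD rw) _.
  rewrite -RintegralZl//; last exact: integrable_norm.
  apply: le_Rintegral => //; [exact: integrable_norm|by apply: rintZ => //; exact: integrable_norm|].
  by move=> x Dx; rewrite normrM ler_wpM2r// hJ.
apply: le_trans (ler_normD _ _) _; apply: le_trans (lerD b1 b2) _.
rewrite -mulrDr -/M /e mulrAC ler_pdivrMr ?ltr_wpDl// ler_pM2l//; lra.
Qed.

(** The truncations of [w] are bounded, so they may be inserted in the representation: the integral
    of the squared truncation is at most its integral against [w], which is its image under [L], and
    [Lb] then bounds it by [C]. Fatou's lemma passes the bound to [w]. *)
Let w_L2 : L2 mu D w /\ \int[mu]_(x in D) (w x * w x) <= C.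
Proof.
have mw := rint_measurable w_rint.
pose c n x := clamp n%:R (w x).
have mc n : measurable_fun D (c n) by exact: measurable_clamp.
have cn n x : D x -> `|c n x| <= n%:R by move=> _; exact: clamp_norm.
have lc n : L2 mu D (c n) by exact: L2_bounded (cn n).
have ib n : \int[mu]_(x in D) (c n x * c n x) <= C.
  set q := \int[mu]_(x in D) _; have q0 : 0 <= q by exact: ip_ge0.
  have qL : q <= L (c n).
    rewrite (L_bounded (mc n) _ (cn n))//; apply: le_Rintegral => //; first exact: (lc n).2.
      apply: (@rint_le _ _ _ _ _ mD _ (fun x => n%:R * `|w x|)).
      - exact: measurable_funM.
      - by apply: rintZ => //; exact: integrable_norm.
      - by move=> x Dx; rewrite normrM ler_wpM2r// cn.
    by move=> x _; rewrite [leRHS]mulrC; exact: clamp_mul.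
  have := Lb (lc n); rewrite -/q => h; have [->//|qN0] := eqVneq q 0.
  have qp : 0 < q by rewrite lt_neqAle eq_sym qN0.
  rewrite -(ler_pM2r qp); apply: le_trans h; rewrite expr2.
  by rewrite ler_pM// (le_trans q0).
have wi : rint mu D (fun x => w x * w x).
  apply/integrableP; split; first by apply/measurable_EFinP; exact: measurable_funM.
  apply: (@le_lt_trans _ _ C%:E); last exact: ltry.
  have -> : (\int[mu]_(x in D) `|(EFin \o (fun x => (w x * w x)%R)) x|)%E =
      (\int[mu]_(x in D) limn_einf (fun n => (c n x * c n x)%R%:E))%E.
    apply: eq_integral => x _ /=; rewrite ger0_norm -?expr2 ?sqr_ge0// expr2.
    have : (c n x * c n x)%:E @[n --> \oo] --> (w x * w x)%:E.
      by apply: cvg_EFin; [exact: nearW|apply: cvgM; exact: clamp_cvg].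
    by rewrite limn_einf_lim => /cvg_einfs/cvg_lim ->.
  apply: le_trans (fatou mu mD _ _) _.
  - by move=> n; apply/measurable_EFinP; exact: measurable_funM.
  - by move=> n x _; rewrite lee_fin -expr2 sqr_ge0.
  - rewrite limn_einf_lim; apply: lime_le; first exact: is_cvg_einfs.
    apply: nearW => n; apply: (@le_trans _ _ (\int[mu]_(x in D) (c n x * c n x)%:E)%E).
      by apply: ereal_inf_lbound; exists n => /=.
    have := ib n; rewrite -lee_fin /Rintegral fineK//.
    by apply: integrable_fin_num => //; exact: (lc n).2.
split; first by [].
have := @Rdominated_convergence _ _ _ mu D mD (fun n x => c n x * c n x)
  (fun x => w x * w x) (fun x => w x * w x).
case=> [n|x Dx||n x Dx|_ cv].
- exact: measurable_funM.
- by apply: cvgM; exact: clamp_cvg.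
- exact: wi.
- by rewrite normrM -[leRHS]ger0_norm -?expr2 ?sqr_ge0// normrX lerXn2r ?nnegrE// clamp_le.
- by apply: (ler_cvg_to cv (cvg_cst C)); exact: nearW.
Qed.

(** The passage from bounded to square-integrable [g] is by truncation: both sides are continuous
    for the L^2 norm, and the truncation error tends to 0 in this norm. *)
Lemma riesz_L2 : exists2 v : T -> R, L2 mu D v /\ \int[mu]_(x in D) (v x * v x) <= C
  & forall g, L2 mu D g -> L g = \int[mu]_(x in D) (v x * g x).
Proof.
exists w; first exact: w_L2.
move=> g lg; have [lw wC] := w_L2; have [mg g2] := lg.
pose h n x := g x - clamp n%:R (g x).
have lcl n : L2 mu D (fun x => clamp n%:R (g x)) by exact: L2_clamp.
have lh n : L2 mu D (h n) by apply: L2B => //.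
have hE n : L g - \int[mu]_(x in D) (w x * g x) = L (h n) - \int[mu]_(x in D) (w x * h n x).
  have -> : h n = fun x => g x + -1 * clamp n%:R (g x) by apply/funext => x; rewrite mulN1r.
  rewrite LD//; last exact: L2Z.
  rewrite LZ// (L_bounded (lcl n).1 (ler0n _ n)); last by move=> x _; exact: clamp_norm.
  have -> : \int[mu]_(x in D) (w x * (g x + -1 * clamp n%:R (g x))) =
     \int[mu]_(x in D) (w x * g x) - \int[mu]_(x in D) (clamp n%:R (g x) * w x).
    rewrite -RintegralB//; [|exact: L2_prod|by apply: L2_prod => //; exact: L2_clamp].
    by apply: eq_Rint => x _; ring.
  by ring.
have c1 : L (h n) @[n --> \oo] --> (0 : R).
  apply: (@sqr_cvg0 _ _ _ _ _ (fun n => C * \int[mu]_(x in D) (h n x * h n x))).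
    by apply: nearW => n; exact: Lb.
  by rewrite -(mulr0 C); apply: cvgM; [exact: cvg_cst|exact: L2_clamp_cvg].
have c2 : \int[mu]_(x in D) (w x * h n x) @[n --> \oo] --> (0 : R).
  apply: (@sqr_cvg0 _ _ _ _ _ (fun n => C * \int[mu]_(x in D) (h n x * h n x))).
    apply: nearW => n; apply: le_trans (cauchy_schwarz mD lw (lh n)) _.
    by rewrite ler_wpM2r// ip_ge0.
  by rewrite -(mulr0 C); apply: cvgM; [exact: cvg_cst|exact: L2_clamp_cvg].
apply/eqP; rewrite -subr_eq0; apply/eqP.
have : (L g - \int[mu]_(x in D) (w x * g x)) @[n --> \oo] --> (0 : R).
  rewrite (_ : (fun=> _) = fun n => L (h n) - \int[mu]_(x in D) (w x * h n x)); last exact/funext.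
  by rewrite -[X in _ --> X](subr0 0); exact: cvgB.
by move/cvg_lim => <-//; rewrite lim_cst.
Qed.

End riesz.

Section weak_limit.
Context d (T : measurableType d) (R : realType) (U : set_system nat) {UU : UltraFilter U}.
Variables (mu : {sigma_finite_measure set T -> \bar R}) (D : set T).
Hypothesis mD : measurable D.
Hypothesis fD : (mu D < +oo)%E.

(** One ultrafilter serves all test functions at once, so the limits of the pairings form a linear
    functional of [g]; it is bounded by Cauchy-Schwarz and represented by the Riesz theorem. *)
Lemma weak_L2_limit (f : nat -> T -> R) (C : R) :
  (forall n, L2 mu D (f n)) ->
  (\forall n \near U, \int[mu]_(x in D) (f n x * f n x) <= C) ->
  exists2 v : T -> R, L2 mu D v /\ \int[mu]_(x in D) (v x * v x) <= C
    & forall g, L2 mu D g ->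
      \int[mu]_(x in D) (f n x * g x) @[n --> U] --> \int[mu]_(x in D) (v x * g x).
Proof.
move=> lf fC.
have C0 : 0 <= C.
  have [n /= Hn] := filter_ex fC; apply: le_trans Hn; exact: ip_ge0.
pose a g n := \int[mu]_(x in D) (f n x * g x).
have cva g : L2 mu D g -> cvg (a g @ U).
  move=> lg; have [|l al _] := @ultra_cvg R U UU (a g) (Num.sqrt (C * \int[mu]_(x in D) (g x * g x))).
    apply: filterS fC => n fnC; rewrite -sqrtr_sqr ler_wsqrtr//.
    by apply: le_trans (cauchy_schwarz mD (lf n) lg) _; rewrite ler_wpM2r// ip_ge0.
  by apply/cvg_ex; exists l.
pose L g := lim (a g @ U).
have LP g : L2 mu D g -> a g @ U --> L g by move=> lg; exact: cva.
have LD f1 g : L2 mu D f1 -> L2 mu D g -> L (fun x => f1 x + g x) = L f1 + L g.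
  move=> lf1 lg; apply: cvg_lim => //.
  have -> : a (fun x => f1 x + g x) = (fun n => a f1 n + a g n).
    apply/funext => n; rewrite /a -RintegralD//; [|exact: L2_prod..].
    by apply: eq_Rint => x _; rewrite mulrDr.
  by apply: cvgD; exact: LP.
have LZ c g : L2 mu D g -> L (fun x => c * g x) = c * L g.
  move=> lg; apply: cvg_lim => //.
  have -> : a (fun x => c * g x) = (fun n => c * a g n).
    apply/funext => n; rewrite /a -RintegralZl//; [|exact: L2_prod].
    by apply: eq_Rint => x _; rewrite mulrCA.
  by apply: cvgM; [exact: cvg_cst|exact: LP].
have Lb g : L2 mu D g -> L g ^+ 2 <= C * \int[mu]_(x in D) (g x * g x).
  move=> lg; have c2 : (fun n => a g n * a g n) @ U --> L g * L g by apply: cvgM; exact: LP.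
  rewrite expr2; apply: (ultra_cvg_le c2 (cvg_cst _)); apply: filterS fC => n fnC.
  rewrite -expr2.
  by apply: le_trans (cauchy_schwarz mD (lf n) lg) _; rewrite ler_wpM2r// ip_ge0.
have [v vC vE] := riesz_L2 mD fD C0 LD LZ Lb.
by exists v => // g lg; rewrite -vE//; exact: LP.
Qed.

End weak_limit.

(** * A Skorokhod representation along an ultrafilter *)

Section radix.
Context (S : finType) (K : Type) (dig : nat -> K -> S).

(** The first [k] digits read as a number in base [#|S|]. The subcells of cell [i] are numbered
    consecutively [i * #|S| + e], which makes the intervals assigned to them subintervals of the one
    assigned to [i]. *)
Fixpoint code (k : nat) (z : K) : nat :=
  if k is k'.+1 then (code k' z * #|S| + enum_rank (dig k' z))%N else 0%N.

Lemma code_lt k z : (code k z < #|S| ^ k)%N.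
Proof.
elim: k => [|k IH] /=; first by rewrite expn0.
rewrite expnSr; apply: (@leq_trans ((code k z).+1 * #|S|)); last by rewrite leq_mul2r IH orbT.
by rewrite mulSn addnC ltn_add2r.
Qed.

Lemma code_div k z : (code k.+1 z %/ #|S|)%N = code k z.
Proof.
have S0 : (0 < #|S|)%N by apply/card_gt0P; exists (dig 0 z).
by rewrite /= divnMDl// divn_small ?addn0.
Qed.

Lemma code_dig k z z' j : code k z = code k z' -> (j < k)%N -> dig j z = dig j z'.
Proof.
elim: k => // k IH e; have e' : code k z = code k z'.
  by have := congr1 (fun j => j %/ #|S|)%N e; rewrite !code_div.
rewrite ltnS leq_eqVlt => /predU1P[->|]; last exact: IH.
move: e; rewrite /= e' => /eqP; rewrite eqn_add2l => /eqP e.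
by apply: enum_rank_inj; apply: val_inj.
Qed.

Lemma code_down a b z z' : (a <= b)%N -> code b z = code b z' -> code a z = code a z'.
Proof.
elim: b => [|b IHb]; first by rewrite leqn0 => /eqP ->.
rewrite leq_eqVlt => /predU1P[->//|]; rewrite ltnS => ab eb; apply: IHb => //.
by have := congr1 (fun j => j %/ #|S|)%N eb; rewrite !code_div.
Qed.

End radix.

Lemma cvg_bigsum (R : realType) (I : Type) (F : set_system I) {FF : Filter F} (n : nat)
    (a : 'I_n -> I -> R) (l : 'I_n -> R) : (forall i, a i @ F --> l i) ->
  (fun x => \sum_(i < n) a i x) @ F --> \sum_(i < n) l i.
Proof.
move=> al; elim: (index_enum _) => [|i s IH].
  by rewrite big_nil; under eq_fun do rewrite big_nil; exact: cvg_cst.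
by rewrite big_cons; under eq_fun do rewrite big_cons; apply: cvgD.
Qed.

Lemma exp2_small (R : realType) (e : R) : 0 < e -> exists k : nat, 2 ^- k < e.
Proof.
move=> e0; have /cvgr0Pnorm_lt/(_ _ e0) : 2^-1 ^+ k @[k --> \oo] --> (0 : R).
  by apply: cvg_expr; rewrite ger0_norm ?invr_ge0// invf_lt1// ltr1n.
move=> [k _ /(_ k (leqnn _))]; rewrite ger0_norm ?exprn_ge0 ?invr_ge0// exprVn => h.
by exists k.
Qed.

Section skorokhod.
Context d (T : measurableType d) (R : realType) (U : set_system nat) {UU : UltraFilter U}.
Variables (mu : {measure set T -> \bar R}) (D : set T).
Hypothesis mD : measurable D.
Context (I S : finType) (dig : nat -> (I -> R) -> S).
Local Notation K := (I -> R).
Local Notation B := #|S|.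
Local Notation code := (code dig).
Hypothesis fine_code : forall k (z z' : K), code k z = code k z' ->
  (forall i, 0 <= z i < 1) -> (forall i, 0 <= z' i < 1) ->
  forall i, `|z i - z' i| <= 2 ^- k.
Variables (Z : nat -> T -> K) (rho : nat -> T -> R) (C : R).
Hypothesis Z01 : forall n x, D x -> forall i, 0 <= Z n x i < 1.
Hypothesis mZ : forall n k s, measurable (D `&` [set x | dig k (Z n x) = s]).
Hypothesis rho_int : forall n, rint mu D (rho n).
Hypothesis rho_ge0 : forall n x, D x -> 0 <= rho n x.
Hypothesis rhoC : \forall n \near U, \int[mu]_(x in D) rho n x <= C.

Let cell_ n k i := D `&` [set x | code k (Z n x) = i].

Let mcell n k i : measurable (cell_ n k i).
Proof.
rewrite /cell_; elim: k i => [|k IH] i /=.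
  have [->|i0] := eqVneq i 0%N.
    by rewrite (_ : [set x | _] = setT) ?setIT//; apply/seteqP; split.
  rewrite (_ : [set x | _] = set0) ?setI0//; apply/seteqP; split=> // x /= e.
  by move: i0; rewrite -e eqxx.
rewrite (_ : D `&` _ = \bigcup_(s in [set: S])
   ((D `&` [set x | code k (Z n x) = ((i - enum_rank s) %/ B)%N]) `&`
    (D `&` [set x | dig k (Z n x) = s /\ (((i - enum_rank s) %/ B) * B + enum_rank s = i)%N]))).
  apply: fin_bigcup_measurable => // s _; apply: measurableI; first exact: IH.
  have [e|ne] := pselect (((i - enum_rank s) %/ B) * B + enum_rank s = i)%N.
    rewrite (_ : [set x | _] = [set x | dig k (Z n x) = s]); first exact: mZ.
    by apply/seteqP; split=> x /= => [[]|].
  by rewrite (_ : [set x | _] = set0) ?setI0//; apply/seteqP; split=> // x /= [].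
apply/seteqP; split=> x.
  move=> [Dx /= e]; have S0 : (0 < B)%N by apply/card_gt0P; exists (dig k (Z n x)).
  exists (dig k (Z n x)) => //; rewrite -e addnK mulnK//.
by move=> [s _ [[Dx /= e1] [_ /= [e2 e3]]]]; split=> //=; rewrite e1 e2.
Qed.

Let m n k i := \int[mu]_(x in cell_ n k i) rho n x.

Let m_ge0 n k i : 0 <= m n k i.
Proof. by apply: Rintegral_ge0 => x [Dx _]; exact: rho_ge0. Qed.

Let rint_cell n k i : rint mu (cell_ n k i) (rho n).
Proof. by apply: integrableS (rho_int n) => //; apply: subIsetl. Qed.

Let m_split n k i : m n k i = \sum_(e < B) m n k.+1 (i * B + e).
Proof.
have mJ (e : nat) : cell_ n k i `&` [set x | enum_rank (dig k (Z n x)) = e :> nat] =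
    cell_ n k.+1 (i * B + e) \/ (B <= e)%N.
  have [eB|] := ltnP e B; [left|by right].
  rewrite /cell_; apply/seteqP; split=> x /= => [[[Dx <-] <-//]|[Dx E]].
  have S0 : (0 < B)%N by exact: leq_ltn_trans eB.
  have h : code k (Z n x) = i.
    have := congr1 (fun j => j %/ B)%N E.
    by rewrite /= !divnMDl// !divn_small ?addn0.
  by split=> //; move: E; rewrite h => /eqP; rewrite eqn_add2l => /eqP.
have JB x : cell_ n k i x -> (enum_rank (dig k (Z n x)) < B)%N by [].
have mJ' (e : nat) : measurable (cell_ n k i `&` [set x | enum_rank (dig k (Z n x)) = e :> nat]).
  have [->//|eB] := mJ e.
  rewrite (_ : [set x | enum_rank (dig k (Z n x)) = e :> nat] = set0) ?setI0//.
  by apply/seteqP; split=> // x /= E; move: eB; rewrite -E leqNgt ltn_ord.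
have [_ E] := rint_finite_valued (mcell n k i) (fun=> 1) JB mJ' (rint_cell n k i).
rewrite /m -[LHS](@eq_Rint _ _ _ _ _ (fun x => 1 * rho n x)); last by move=> x _; rewrite mul1r.
rewrite E; apply: eq_bigr => e _; rewrite mul1r.
by have [->//|] := mJ e; rewrite leqNgt ltn_ord.
Qed.

Let m0 n : m n 0 0 = \int[mu]_(x in D) rho n x.
Proof.
by rewrite /m /cell_ (_ : [set x | _] = setT) ?setIT//; apply/seteqP; split.
Qed.

Let m_le n k i : m n k i <= m n 0 0.
Proof.
rewrite m0; apply: Rint_subset => //; [exact: subIsetl|exact: rho_ge0].
Qed.

Let mcv k i : exists2 l : R, m n k i @[n --> U] --> l & 0 <= l <= C.
Proof.
have mC : \forall n \near U, m n k i <= C.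
  by apply: filterS rhoC => n; rewrite -m0; exact: le_trans.
have [|l cl _] := @ultra_cvg R U UU (fun n => m n k i) C.
  by apply: filterS mC => n; rewrite ger0_norm.
exists l => //; apply/andP; split.
  by apply: (ultra_cvg_le (cvg_cst _) cl); exact: nearW.
exact: (ultra_cvg_le cl (cvg_cst _)).
Qed.

Let M k i : R := sval (cid2 (mcv k i)).

Let Mcv k i : m n k i @[n --> U] --> M k i.
Proof. by rewrite /M; case: cid2. Qed.

Let M_ge0 k i : 0 <= M k i.
Proof. by rewrite /M; case: cid2 => l _ /= /andP[]. Qed.

Let M_split k i : M k i = \sum_(e < B) M k.+1 (i * B + e).
Proof.
have c1 : (fun n => \sum_(e < B) m n k.+1 (i * B + e)) @ U --> \sum_(e < B) M k.+1 (i * B + e).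
  apply: (@cvg_bigsum R nat U _ B (fun (e : 'I_B) n => m n k.+1 (i * B + e)) (fun e : 'I_B => M k.+1 (i * B + e))) => e.
  exact: Mcv.
have c2 : (fun n => \sum_(e < B) m n k.+1 (i * B + e)) @ U --> M k i.
  have := @Mcv k i; rewrite (_ : (fun n => m n k i) = fun n => \sum_(e < B) m n k.+1 (i * B + e))//.
  by apply/funext => n; exact: m_split.
exact: cvg_unique c2 c1.
Qed.

(** Cell [i] of level [k] receives the interval from [F k i] to [F k i.+1], whose length is its
    limit mass. *)
Let F k i : R := \sum_(0 <= j < i) M k j.

Let F_homo k i j : (i <= j)%N -> F k i <= F k j.
Proof.
move=> ij; rewrite /F (big_cat_nat _ ij)//= lerDl; exact: sumr_ge0.
Qed.

(** Endpoints of level [k] are endpoints of level [k.+1]. This is the additivity of the masses,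
    which passes to the limit because a cell has finitely many subcells. *)
Let F_split k i : F k i = F k.+1 (i * B).
Proof.
elim: i => [|i IH]; first by rewrite /F mul0n !big_geq.
rewrite /F big_nat_recr//= -/(F k i) IH mulSn addnC (@big_cat_nat _ _ _ (i * B))//= ?leq_addr//.
congr (_ + _); rewrite M_split -{2}[(i * B)%N]add0n big_addn addKn big_mkord.
by apply: eq_bigr => e _; rewrite addnC.
Qed.

Let F_top k : F k (B ^ k) = F 0 1.
Proof. by elim: k => [|k IH]; rewrite ?expn0// expnSr -F_split. Qed.

Let Mt : R := F 0 1.

Let Mt_bound : 0 <= Mt <= C.
Proof.
rewrite /Mt /F big_nat1; rewrite /M; by case: cid2.
Qed.

Let J_ex k (s : R) : 0 <= s < Mt -> exists i, (i < B ^ k)%N /\ F k i <= s < F k i.+1.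
Proof.
move=> /andP[s0 sM].
have ex : exists i, s < F k i.+1.
  exists (B ^ k)%N; apply: lt_le_trans sM _; rewrite /Mt -(F_top k).
  exact: F_homo.
case: (ex_minnP ex) => i Hi imin.
have iF : F k i <= s.
  case: i Hi imin => [|i] Hi imin; first by rewrite /F big_geq.
  by rewrite leNgt; apply/negP => /imin; rewrite ltnn.
exists i; split; last by rewrite iF.
rewrite ltnNge; apply/negP => Bi.
by have := F_homo k Bi; rewrite F_top -/Mt => h; move: (lt_le_trans sM (le_trans h iF)); rewrite ltxx.
Qed.

Let J k (s : R) : nat := xget 0%N [set i | (i < B ^ k)%N /\ F k i <= s < F k i.+1].

Let JP k (s : R) : 0 <= s < Mt -> (J k s < B ^ k)%N /\ F k (J k s) <= s < F k (J k s).+1.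
Proof.
move=> s01; rewrite /J; case: xgetP => [i _ //|].
by have [i Pi] := J_ex k s01 => /(_ i).
Qed.

Let JE k (s : R) i : 0 <= s < Mt -> F k i <= s < F k i.+1 -> J k s = i.
Proof.
move=> s01 /andP[h1 h2]; have [_ /andP[h3 h4]] := JP k s01.
apply/eqP; rewrite eqn_leq; apply/andP; split; rewrite leqNgt; apply/negP => h.
  by have := F_homo k h; rewrite leNgt (le_lt_trans h3 h2).
by have := F_homo k h; rewrite leNgt (le_lt_trans h1 h4).
Qed.

Let J_div k (s : R) : 0 <= s < Mt -> (J k.+1 s %/ B)%N = J k s.
Proof.
move=> s01; apply/esym/JE => //; have [Jlt /andP[h1 h2]] := JP k.+1 s01.
have S0 : (0 < B)%N by rewrite lt0n; apply: contraTneq Jlt => ->; rewrite exp0n.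
rewrite (F_split k (J k.+1 s %/ B)) (F_split k (J k.+1 s %/ B).+1); apply/andP; split.
  by apply: le_trans h1; apply: F_homo; exact: leq_trunc_div.
by apply: lt_le_trans h2 _; apply: F_homo; rewrite ltn_ceil.
Qed.

Let is_pt z := exists n x, D x /\ Z n x = z.

(** An interval containing [s] has positive length, so its cell has positive mass for some [n] and
    therefore contains a value actually taken by [Z]. *)
Let M_nz k (s : R) : 0 <= s < Mt -> exists z, is_pt z /\ code k z = J k s.
Proof.
move=> s01; have [_ /andP[h1 h2]] := JP k s01.
have Mp : 0 < M k (J k s).
  by have := le_lt_trans h1 h2; rewrite /F big_nat_recr//= ltrDl.
have [n mp] : exists n, 0 < m n k (J k s).
  apply: contrapT => /forallNP no.
  have : M k (J k s) <= 0.
    have c0 : (fun=> 0 : R) @ U --> (0 : R) by exact: cvg_cst.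
    apply: (ultra_cvg_le (@Mcv k (J k s)) c0).
    apply: nearW => n.
    by rewrite leNgt; exact/negP/no.
  by rewrite leNgt Mp.
have [x [Dx cx]] : exists x, cell_ n k (J k s) x.
  apply: contrapT => /forallNP no; move: mp; rewrite /m.
  rewrite (_ : cell_ n k (J k s) = set0) ?Rintegral_set0 ?ltxx//.
  by apply/seteqP; split=> // x /no.
by exists (Z n x); split=> //; exists n, x.
Qed.

(** A sample of the cell, chosen among the values of [Z] rather than, say, at a corner: closed
    constraints satisfied by [Z] are then inherited by the limit [X]. *)
Let p k i : K := xget (fun=> 0) [set z | is_pt z /\ code k z = i].

Let pZ k n x : D x -> is_pt (p k (code k (Z n x))) /\
  code k (p k (code k (Z n x))) = code k (Z n x).
Proof.
move=> Dx; rewrite /p; case: xgetP => [z _ //|/(_ (Z n x)) []].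
by split=> //; exists n, x.
Qed.

Let pJ k (s : R) : 0 <= s < Mt -> is_pt (p k (J k s)) /\ code k (p k (J k s)) = J k s.
Proof.
move=> s01; rewrite /p; case: xgetP => [z _ //|].
by have [z Pz] := M_nz k s01 => /(_ z).
Qed.

Let pt01 z : is_pt z -> forall i, 0 <= z i < 1.
Proof. by move=> [n [x [Dx <-]]]; exact: Z01. Qed.

Let code_pJ k l (s : R) : 0 <= s < Mt -> (k <= l)%N -> code k (p l (J l s)) = J k s.
Proof.
move=> s01; elim: l => [|l IH]; first by rewrite leqn0 => /eqP ->; case: (pJ 0 s01).
rewrite leq_eqVlt => /predU1P[->|]; first by case: (pJ l.+1 s01).
rewrite ltnS => kl; rewrite -(IH kl).
apply: (code_down kl).
exact: (etrans (esym (code_div dig l (p l.+1 (J l.+1 s))))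
  (etrans (congr1 (fun j => j %/ B)%N (pJ l.+1 s01).2)
  (etrans (J_div l s01) (esym (pJ l s01).2)))).
Qed.

Let p_close k l l' (s : R) i : 0 <= s < Mt -> (k <= l)%N -> (k <= l')%N ->
  `|p l (J l s) i - p l' (J l' s) i| <= 2 ^- k.
Proof.
move=> s01 kl kl'; apply: fine_code; first exact: (etrans (code_pJ s01 kl) (esym (code_pJ s01 kl'))).
  by apply: pt01; case: (pJ l s01).
by apply: pt01; case: (pJ l' s01).
Qed.

(** The cells whose intervals contain [s] are nested, so their samples form a Cauchy sequence with
    rate [2 ^- k]. *)
Let X (s : R) i : R := lim (p k (J k s) i @[k --> \oo]).

Let Xcv (s : R) i : 0 <= s < Mt -> p k (J k s) i @[k --> \oo] --> X s i.
Proof.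
move=> s01; apply/cauchy_cvgP/cauchy_exP => e e0.
have [k ke] := exp2_small e0.
exists (p k (J k s) i); exists k => // l /= kl.
by apply: le_lt_trans ke; apply: p_close.
Qed.

Let X_close k (s : R) i : 0 <= s < Mt -> `|X s i - p k (J k s) i| <= 2 ^- k.
Proof.
move=> s01; have c : (fun l => `|p l (J l s) i - p k (J k s) i|) @ \oo --> `|X s i - p k (J k s) i|.
  by apply: cvg_norm; apply: cvgB; [exact: Xcv|exact: cvg_cst].
apply: (ler_cvg_to c (cvg_cst _)); exists k => // l /= kl.
exact: p_close.
Qed.

Let X01 (s : R) i : 0 <= s < Mt -> 0 <= X s i <= 1.
Proof.
move=> s01; have h k : 0 <= p k (J k s) i < 1 by apply: pt01; case: (pJ k s01).
apply/andP; split.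
  by apply: (ler_cvg_to (cvg_cst _) (Xcv (i := i) s01)); apply: nearW => k; case/andP: (h k).
by apply: (ler_cvg_to (Xcv (i := i) s01) (cvg_cst _)); apply: nearW => k; case/andP: (h k) => _ /ltW.
Qed.

Local Notation leb := (@lebesgue_measure R).
Local Notation itv := ([set` `[0, Mt[] : set (measurableTypeR R)).

Let itvP (s : R) : itv s -> 0 <= s < Mt.
Proof. by rewrite /= in_itv. Qed.

Let fitv : (leb itv < +oo)%E.
Proof. by rewrite /= lebesgue_measure_itv/=; case: ifP => // _; rewrite -EFinB ltry. Qed.

Let mitv : measurable itv.
Proof. exact: measurable_itv. Qed.

Let Jset k i : itv `&` [set s | J k s = i] = if (i < B ^ k)%N then [set` `[F k i, F k i.+1[] else set0.
Proof.
case: ltnP => iB; apply/seteqP; split=> s //=.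
- by move=> [/itvP s01 <-]; rewrite in_itv/=; case: (JP k s01).
- rewrite in_itv/= => h; have s01 : 0 <= s < Mt.
    case/andP: h => h1 h2; apply/andP; split.
      by apply: le_trans h1; apply: sumr_ge0.
    by apply: lt_le_trans h2 _; rewrite /Mt -(F_top k); exact: F_homo.
  by split; [rewrite in_itv|exact: JE].
- by move=> [/itvP s01 e]; have [] := JP k s01; rewrite e ltnNge iB.
Qed.

Let mJset k i : measurable (itv `&` [set s | J k s = i]).
Proof. by rewrite Jset; case: ifP => _; [exact: measurable_itv|exact: measurable0]. Qed.

Let JMlt k s : itv s -> (J k s < B ^ k)%N.
Proof. by move=> /itvP /(JP k) []. Qed.

Let rint_J k (h : nat -> R) : rint leb itv (fun s => h (J k s)) /\
  \int[leb]_(s in itv) h (J k s) = \sum_(i < B ^ k) h i * M k i.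
Proof.
have r1 : rint leb itv (fun=> 1).
  by apply: (@rint_bounded _ _ _ _ _ mitv fitv _ 1) => // x _; rewrite normr1.
have [r E] := rint_finite_valued mitv h (@JMlt k) (mJset k) r1.
split; first by apply: (eq_rint _ _ r) => // s _; rewrite mulr1.
have -> : \int[leb]_(s in itv) h (J k s) = \int[leb]_(s in itv) (h (J k s) * 1).
  by apply: eq_Rint => s _; rewrite mulr1.
rewrite E; apply: eq_bigr => i _; congr (_ * _).
rewrite Rintegral_cst// mul1r Jset ltn_ord /= lebesgue_measure_itv/= lte_fin.
have FE : F k i.+1 = F k i + M k i by rewrite /F big_nat_recr.
case: ltP => h0; first by rewrite FE -EFinB addrC addKr.
apply/eqP; rewrite eq_le M_ge0 /=; move: h0; rewrite FE gerDl; exact.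
Qed.

Let rint_Z n k (h : nat -> R) : rint mu D (fun x => h (code k (Z n x)) * rho n x) /\
  \int[mu]_(x in D) (h (code k (Z n x)) * rho n x) = \sum_(i < B ^ k) h i * m n k i.
Proof.
exact: (rint_finite_valued mD h (fun x _ => code_lt dig k (Z n x)) (mcell n k) (rho_int n)).
Qed.

Let mX i : measurable_fun itv (X ^~ i).
Proof.
apply: (@measurable_fun_cvg _ _ _ _ (fun k s => p k (J k s) i)) => [k|s /itvP s01]; last exact: Xcv.
have [r _] := rint_J k (fun j => p k j i).
exact: rint_measurable r.
Qed.

(** The box is closed because [X] is a limit of points of the half-open box and may reach the far
    faces. *)
Definition ucont_box (f : K -> R) := forall e, 0 < e -> exists2 de, 0 < de &
  forall a b : K, (forall i, 0 <= a i <= 1) -> (forall i, 0 <= b i <= 1) ->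
  (forall i, `|a i - b i| <= de) -> `|f a - f b| <= e.

Let uc_small (f : K -> R) e : ucont_box f -> 0 < e -> exists k0, forall k, (k0 <= k)%N ->
  (forall s, itv s -> `|f (X s) - f (p k (J k s))| <= e) /\
  (forall n x, D x -> `|f (Z n x) - f (p k (code k (Z n x)))| <= e).
Proof.
move=> uf e0; have [de de0 H] := uf _ e0; have [k0 k0de] := exp2_small de0.
have box z : (forall i, 0 <= z i < 1) -> forall i, 0 <= z i <= 1.
  by move=> h i; case/andP: (h i) => -> /ltW.
have kde k : (k0 <= k)%N -> 2 ^- k <= de.
  move=> kk; apply: le_trans (ltW k0de); rewrite lef_pV2 ?posrE ?exprn_gt0//.
  by rewrite ler_weXn2l// ler1n.
exists k0 => k kk; split=> [s /itvP s01|n x Dx]; apply: H.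
- by move=> i; exact: X01.
- by apply: box; apply: pt01; case: (pJ k s01).
- by move=> i; apply: le_trans (kde _ kk); exact: X_close.
- by apply: box; exact: Z01.
- by apply: box; apply: pt01; case: (pZ k n Dx).
- have [pt e1] := pZ k n Dx.
  move=> i; apply: le_trans (kde _ kk); apply: fine_code; [by rewrite e1|exact: Z01|exact: pt01].
Qed.

(** For a function that is constant on the cells of level [k] both integrals are finite sums,
    weighted by the masses [m] and [M], and these converge. Uniform continuity replaces [f] by its
    value at the sample of the cell, with the same error on both sides. The third clause is the
    means of transferring closed constraints from [Z] to [X]. *)
Lemma skorokhod : exists2 Mt : R, 0 <= Mt <= C & exists X : R -> K,
  [/\ forall i, measurable_fun ([set` `[0, Mt[] : set (measurableTypeR R)) (X ^~ i),
      forall s, 0 <= s < Mt -> forall i, 0 <= X s i <= 1,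
      forall s e, 0 <= s < Mt -> 0 < e ->
        exists n x, D x /\ forall i, `|X s i - Z n x i| <= e
    & forall f, ucont_box f ->
      [/\ forall n, rint mu D (fun x => f (Z n x) * rho n x),
          rint leb ([set` `[0, Mt[] : set (measurableTypeR R)) (fun s => f (X s))
        & \int[mu]_(x in D) (f (Z n x) * rho n x) @[n --> U] -->
          \int[leb]_(s in ([set` `[0, Mt[] : set (measurableTypeR R))) f (X s)]].
Proof.
exists Mt; first exact: Mt_bound.
exists X; split.
- exact: mX.
- by move=> s s01 i; exact: X01.
- move=> s e s01 e0; have [k ke] := exp2_small e0.
  have [[n [x [Dx Zx]]] _] := pJ k s01; exists n, x; split=> // i.
  by rewrite Zx; apply: le_trans (ltW ke); exact: X_close.
move=> f uf.
have cX s : itv s -> f (p k (J k s)) @[k --> \oo] --> f (X s).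
  move=> s01; apply/cvgrPdist_le => e e0; have [k0 H] := uc_small uf e0.
  by exists k0 => // k /= /H [h _]; exact: h.
have cZ n x : D x -> f (p k (code k (Z n x))) @[k --> \oo] --> f (Z n x).
  move=> Dx; apply/cvgrPdist_le => e e0; have [k0 H] := uc_small uf e0.
  by exists k0 => // k /= /H [_ h]; exact: h.
have mfX : measurable_fun itv (fun s => f (X s)).
  apply: measurable_fun_cvg cX => k.
  by have [r _] := rint_J k (fun j => f (p k j)); exact: rint_measurable r.
have [k1 /(_ k1 (leqnn _)) [H1 H2]] := uc_small uf ltr01.
have rX : rint leb itv (fun s => f (X s)).
  have [r _] := rint_J k1 (fun j => f (p k1 j)).
  have r1 : rint leb itv (fun=> 1).
    by apply: (@rint_bounded _ _ _ _ _ mitv fitv _ 1) => // x _; rewrite normr1.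
  apply: (@rint_le _ _ _ _ _ mitv _ (fun s => `|f (p k1 (J k1 s))| + 1)) => //.
    by apply: rintD => //; exact: integrable_norm.
  move=> s is_; have := H1 s is_; have := ler_normD (f (X s) - f (p k1 (J k1 s))) (f (p k1 (J k1 s))).
  by rewrite subrK; lra.
have rZ n : rint mu D (fun x => f (Z n x) * rho n x).
  have [r _] := rint_Z n k1 (fun j => f (p k1 j)).
  apply: (@rint_le _ _ _ _ _ mD _ (fun x => `|f (p k1 (code k1 (Z n x))) * rho n x| + rho n x)).
  - apply: (@measurable_fun_cvg _ _ _ _ (fun k x => f (p k (code k (Z n x))) * rho n x)) => [k|x Dx].
      by have [r' _] := rint_Z n k (fun j => f (p k j)); exact: rint_measurable r'.
    by apply: cvgM; [exact: cZ|exact: cvg_cst].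
  - by apply: rintD => //; exact: integrable_norm.
  - move=> x Dx; have := H2 n x Dx; have r0 := rho_ge0 n Dx.
    have := ler_normD (f (Z n x) - f (p k1 (code k1 (Z n x)))) (f (p k1 (code k1 (Z n x)))).
    rewrite subrK !normrM (ger0_norm r0); nra.
split=> //.
have [/andP[M0 MC] C0] : 0 <= Mt <= C /\ 0 <= C.
  by split; [exact: Mt_bound|case/andP: Mt_bound => ? ?; exact: le_trans (_ : 0 <= Mt) _].
apply/cvgrPdist_le => e e0.
(* Three errors are added: two replacements by cell samples, each at most [e' * C], and the error
   [e'] of the finite sums. *)
pose e' := e / (2 * C + 1).
have e'0 : 0 < e' by rewrite divr_gt0// ltr_wpDl// mulr_ge0.
have [k /(_ k (leqnn _)) [HX HZ]] := uc_small uf e'0.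
have [rJ EJ] := rint_J k (fun j => f (p k j)).
have cS : (\sum_(i < B ^ k) f (p k i) * m n k i) @[n --> U] --> \sum_(i < B ^ k) f (p k i) * M k i.
  apply: (@cvg_bigsum R nat U _ (B ^ k) (fun (i : 'I_(B ^ k)) n => f (p k i) * m n k i) (fun i : 'I_(B ^ k) => f (p k i) * M k i)) => i.
  by apply: cvgM; [exact: cvg_cst|exact: Mcv].
have bX : `|\int[leb]_(s in itv) f (X s) - \sum_(i < B ^ k) f (p k i) * M k i| <= e' * C.
  rewrite -EJ -RintegralB//; apply: le_trans (le_normr_Rintegral _ _) _ => //; first exact: rintB.
  apply: (@le_trans _ _ (\int[leb]_(s in itv) e')).
    apply: le_Rintegral => //.
    - by apply: integrable_norm => //; exact: rintB.
    - by apply: (@rint_bounded _ _ _ _ _ mitv fitv _ e') => // x _; rewrite ger0_norm// ltW.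
  rewrite Rintegral_cst// ler_pM2l//= lebesgue_measure_itv/= lte_fin.
  by case: ifP => _; rewrite ?oppr0 ?addr0//=.
have bZ n : `|\int[mu]_(x in D) (f (Z n x) * rho n x) - \sum_(i < B ^ k) f (p k i) * m n k i| <=
   e' * \int[mu]_(x in D) rho n x.
  have [r Er] := rint_Z n k (fun j => f (p k j)).
  rewrite -Er -RintegralB//; last exact: rZ.
  have rB : rint mu D (fun x => f (Z n x) * rho n x - f (p k (code k (Z n x))) * rho n x).
    by apply: rintB => //; exact: rZ.
  apply: le_trans (le_normr_Rintegral mD rB) _; rewrite -RintegralZl//; last exact: rho_int.
  apply: le_Rintegral => //; [exact: integrable_norm|by apply: rintZ => //|].
  by move=> x Dx; rewrite -mulrBl normrM (ger0_norm (rho_ge0 n Dx)) ler_wpM2r ?rho_ge0// HZ.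
move/cvgrPdist_le : cS => /(_ _ e'0) cS.
near=> n.
have h1 : `|\sum_(i < B ^ k) f (p k i) * M k i - \sum_(i < B ^ k) f (p k i) * m n k i| <= e'.
  by near: n.
have h2 := bZ n.
have h3 : \int[mu]_(x in D) rho n x <= C by near: n.
have h4 : e' * \int[mu]_(x in D) rho n x <= e' * C by rewrite ler_pM2l.
have h5 : e' * C + e' + e' * C = e.
  by rewrite /e'; field; rewrite gt_eqF// ltr_wpDl// mulr_ge0.
move: bX h1 h2; rewrite !ler_norml => /andP[? ?] /andP[? ?] /andP[? ?].
by apply/andP; split; lra.
Unshelve. all: by end_near. Qed.

End skorokhod.

(** * Binary digits of the points of the unit cube *)

Section binary_digits.
Context (R : realType) (I : finType).

(** Digit [k] gathers, for all coordinates at once, the bit of weight [2 ^- k.+1]. *)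
Definition digits (k : nat) (z : I -> R) : {ffun I -> bool} :=
  [ffun i => odd (Num.trunc (2 ^+ k.+1 * z i))].

Lemma trunc_double (a : R) : 0 <= a -> ((Num.trunc (2 * a))./2 = Num.trunc a)%N.
Proof.
move=> a0; apply/esym/truncn_def.
have := truncn_itv (mulr_ge0 (ler0n R 2) a0); set m := Num.trunc (2 * a) => /andP[h1 h2].
have e := odd_double_half m; apply/andP; split.
  rewrite -(ler_pM2l (ltr0n R 2)); apply: le_trans h1.
  by rewrite -natrM ler_nat mul2n -[leqRHS]e leq_addl.
rewrite -(ltr_pM2l (ltr0n R 2)); apply: lt_le_trans h2 _.
by rewrite -natrM ler_nat mul2n doubleS -ltnS -[in leqLHS]e; case: (odd m).
Qed.

Lemma digits_trunc k (z z' : I -> R) i : 0 <= z i < 1 -> 0 <= z' i < 1 ->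
  (forall j, (j < k)%N -> digits j z = digits j z') ->
  Num.trunc (2 ^+ k * z i) = Num.trunc (2 ^+ k * z' i).
Proof.
move=> /andP[z0 z1] /andP[z'0 z'1]; elim: k => [_|k IH H].
  (* The coordinates lie in [0, 1[, so both integer parts vanish at level 0. *)
  by rewrite expr0 !mul1r (@truncn_def _ (z i) 0) ?z0// (@truncn_def _ (z' i) 0)// z'0.
have e := H k (ltnSn k); move/ffunP: e => /(_ i); rewrite !ffunE => e.
rewrite -[LHS]odd_double_half -[RHS]odd_double_half e.
rewrite exprS -!mulrA !trunc_double ?mulr_ge0 ?exprn_ge0//.
by rewrite IH// => j jk; apply: H; exact: ltnW.
Qed.

Lemma digits_close k (z z' : I -> R) : code digits k z = code digits k z' ->
  (forall i, 0 <= z i < 1) -> (forall i, 0 <= z' i < 1) ->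
  forall i, `|z i - z' i| <= 2 ^- k.
Proof.
move=> e z01 z'01 i; have := digits_trunc (z01 i) (z'01 i) (fun j jk => code_dig e jk).
have pk : 0 < 2 ^+ k :> R by rewrite exprn_gt0.
have a0 : 0 <= 2 ^+ k * z i by rewrite mulr_ge0 ?(ltW pk)//; case/andP: (z01 i).
have b0 : 0 <= 2 ^+ k * z' i by rewrite mulr_ge0 ?(ltW pk)//; case/andP: (z'01 i).
have := truncn_itv a0; have := truncn_itv b0; set m := Num.trunc _ => + + E.
rewrite -/m E -natr1 => /andP[h1 h2] /andP[h3 h4].
rewrite -(ler_pM2l pk) mulfV ?gt_eqF// -[X in X * `|_|](ger0_norm (ltW pk)) -normrM mulrBr ler_norml.
by apply/andP; split; lra.
Qed.

Lemma measurable_digits d (T : measurableType d) (D : set T) (mD : measurable D)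
    (Z : T -> I -> R) k (s : {ffun I -> bool}) :
  (forall i, measurable_fun D (Z ^~ i)) -> (forall x, D x -> forall i, 0 <= Z x i < 1) ->
  measurable (D `&` [set x | digits k (Z x) = s]).
Proof.
move=> mZ Z01.
have mo i (b : bool) : measurable (D `&` [set x | odd (Num.trunc (2 ^+ k.+1 * Z x i)) = b]).
  rewrite (_ : _ `&` _ = \bigcup_(j in [set j | odd j = b])
     (D `&` (fun x => 2 ^+ k.+1 * Z x i) @^-1` [set` `[j%:R, j.+1%:R[])).
    apply: bigcup_measurable => j _.
    by apply: (measurable_funM (@measurable_cst _ _ _ _ _ _) (mZ i)) => //; exact: measurable_itv.
  apply/seteqP; split=> x.
    move=> [Dx /= e]; exists (Num.trunc (2 ^+ k.+1 * Z x i)) => //=; split=> //=.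
    by rewrite in_itv/=; apply: truncn_itv; rewrite mulr_ge0 ?exprn_ge0//; case/andP: (Z01 x Dx i).
  by move=> [j /= jb [Dx /=]]; rewrite in_itv/= => h; split=> //=; rewrite (truncn_def h).
rewrite (_ : D `&` _ = D `&` \bigcap_(i in [set: I]) (D `&` [set x | odd (Num.trunc (2 ^+ k.+1 * Z x i)) = s i])).
  by apply: measurableI => //; apply: fin_bigcap_measurable.
apply/seteqP; split=> x /=.
  by move=> [Dx e]; split=> // i _; split=> //; rewrite -e ffunE.
by move=> [Dx H]; split=> //; apply/ffunP => i; rewrite ffunE; by case: (H i Logic.I).
Qed.

End binary_digits.

(** * Calculus on the torus *)

Section product_measure.
Context d1 d2 (T1 : measurableType d1) (T2 : measurableType d2) (R : realType).
Variables (m1 : {sigma_finite_measure set T1 -> \bar R}) (m2 : {sigma_finite_measure set T2 -> \bar R}).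
Variables (A : set T1) (B : set T2).
Hypotheses (mA : measurable A) (mB : measurable B).

(** The inner integral is known to be finite only for almost every [x], while the real-valued
    integral takes a default value elsewhere; hence the detour through [fine \o F], which agrees
    with [F] almost everywhere. *)
Lemma rint_Fubini (f : T1 * T2 -> R) : rint (m1 \x m2)%E (A `*` B) f ->
  [/\ {ae m1, forall x, A x -> rint m2 B (fun y => f (x, y))},
      rint m1 A (fun x => \int[m2]_(y in B) f (x, y))
    & \int[(m1 \x m2)%E]_(z in A `*` B) f z = \int[m1]_(x in A) \int[m2]_(y in B) f (x, y)].
Proof.
move=> rf; have mAB : measurable (A `*` B) by exact: measurableX.
have ig : (m1 \x m2)%E.-integrable setT (EFin \o (f \_ (A `*` B))).
  by rewrite -restrict_EFin; apply/(integrable_mkcond _ mAB).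
have gE x y : A x -> (f \_ (A `*` B)) (x, y) = ((fun y => f (x, y)) \_ B) y.
  move=> Ax; rewrite /patch; congr (if _ then _ else _).
  by apply/idP/idP => /set_mem h; apply/mem_set => //; case: h.
have gN x y : ~ A x -> (f \_ (A `*` B)) (x, y) = 0.
  by move=> Ax; rewrite /patch memNset// => -[].
pose F x := (\int[m2]_y ((f \_ (A `*` B)) (x, y))%:E)%E.
have FA x : A x -> F x = (\int[m2]_(y in B) (f (x, y))%:E)%E.
  move=> Ax; rewrite /F [RHS]integral_mkcond; apply: eq_integral => y _.
  by rewrite gE// restrict_EFin.
have FN x : ~ A x -> F x = 0%E.
  by move=> Ax; rewrite /F; under eq_integral do rewrite gN//; rewrite integral0.
have iF : m1.-integrable setT F by exact: integrable_fubini_F ig.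
have aeF := ae_integrable1 ig.
have finF : {ae m1, forall x, A x -> rint m2 B (fun y => f (x, y))}.
  apply: filterS aeF => x ix Ax; rewrite /rint.
  apply/(integrable_mkcond _ mB); apply: (eq_integrable measurableT) ix.
  by move=> y _; rewrite /= gE// restrict_EFin.
have aeE : ae_eq m1 setT F (EFin \o fine \o F).
  apply: filterS aeF => x ix _ /=; rewrite fineK//.
  exact: integrable_fin_num ix.
have iF' : m1.-integrable setT (EFin \o (fine \o F)).
  apply/integrableP; split.
    apply/measurable_EFinP; apply: measurableT_comp; last exact: measurable_int iF.
    exact: fine_measurable.
  have /integrableP[mF] := iF; apply: le_lt_trans.
  apply: ge0_le_integral => //.
  - by apply: measurableT_comp => //; apply/measurable_EFinP; apply: measurableT_comp; [exact: fine_measurable|].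
  - exact: measurableT_comp.
  - by move=> x _ /=; case: (F x) => [r| |] //=; rewrite ?normr0 ?leey.
have E1 : (EFin \o (fine \o F)) = (EFin \o (fun x => \int[m2]_(y in B) f (x, y))) \_ A.
  apply/funext => x; rewrite /patch; case: ifPn => [/set_mem Ax|]; first by rewrite /= FA.
  by rewrite notin_setE => Ax /=; rewrite FN.
split => //.
  by rewrite /rint; apply/(integrable_mkcond _ mA); rewrite -E1.
rewrite /Rintegral; congr fine.
rewrite [LHS]integral_mkcond [RHS]integral_mkcond.
rewrite -[X in _ = (\int[_]_x X x)%E]E1.
transitivity (\int[(m1 \x m2)%E]_z (EFin \o (f \_ (A `*` B))) z)%E.
  by apply: eq_integral => z _; rewrite -restrict_EFin.
rewrite -(integral12_prod_meas1 ig); apply: ae_eq_integral => //.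
- exact: measurable_int iF.
- exact: measurable_int iF'.
Qed.

Lemma rint_Tonelli (f : T1 * T2 -> R) (C : R) : (m1 A < +oo)%E ->
  measurable_fun (A `*` B) f -> (forall x, A x -> rint m2 B (fun y => f (x, y))) ->
  0 <= C -> (forall x, A x -> \int[m2]_(y in B) `|f (x, y)| <= C) ->
  rint (m1 \x m2)%E (A `*` B) f.
Proof.
move=> fA mf rf C0 fC; have mAB : measurable (A `*` B) by exact: measurableX.
rewrite /rint; apply/(integrable_mkcond _ mAB); rewrite restrict_EFin.
have mg : measurable_fun setT (f \_ (A `*` B)).
  by apply/(measurable_restrict _ mAB measurableT); rewrite setTI.
apply/integrable12ltyP; first exact/measurable_EFinP.
apply: (@le_lt_trans _ _ (\int[m1]_(x in A) C%:E)%E); last first.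
  by rewrite integral_cst//= lte_mul_pinfty// lee_fin.
rewrite [leRHS]integral_mkcond; apply: ge0_le_integral => //.
- by move=> x _; apply: integral_ge0.
- apply: (measurable_fun_fubini_tonelli_F (abse \o EFin \o (f \_ (A `*` B)))) => //=.
  by apply: measurableT_comp => //; apply: measurableT_comp => //.
- by apply/(measurable_restrict _ mA measurableT).
have gN x y : ~ (A x /\ B y) -> (f \_ (A `*` B)) (x, y) = 0.
  by move=> Ax; rewrite /patch memNset.
move=> x _; have [Ax|nAx] := pselect (A x); last first.
  by rewrite integral0_eq ?integral_ge0// => [|y _]; rewrite /= ?gN ?normr0// ?erestrict_ge0// => -[].
rewrite {2}/patch mem_set//.
rewrite (_ : (\int[m2]_y _)%E = (\int[m2]_(y in B) `|f (x, y)|%:E)%E); last first.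
  rewrite [RHS]integral_mkcond; apply: eq_integral => y _; rewrite {2}/patch.
  case: ifPn => [/set_mem By|]; first by rewrite /= /patch mem_set.
  by rewrite notin_setE => By; rewrite /= gN ?normr0// => -[].
have := fC _ Ax; rewrite -lee_fin /Rintegral fineK//.
by apply: integrable_fin_num => //; have := integrable_norm (rf _ Ax).
Qed.

End product_measure.

Section pair_derivatives.
Context {R : realType} {V : normedModType R}.
Implicit Types (f g : V -> R) (F : V -> R * R) (x v : V).

Lemma is_derive_pair f g x v (df dg : R) :
  is_derive x v f df -> is_derive x v g dg ->
  is_derive x v (fun y => (f y, g y)) (df, dg).
Proof.
move=> [Df Ef] [Dg Eg].
have c : (fun h => h^-1 *: (((fun y => (f y, g y)) \o shift x) (h *: v) - (f x, g x))) @ 0^' --> (df, dg).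
  by rewrite -Ef -Eg; exact: (cvg_pair Df Dg).
apply: DeriveDef; first by apply/cvg_ex; exists (df, dg).
exact/cvg_lim.
Qed.

Lemma is_derive_fst F x v (d : R * R) :
  is_derive x v F d -> is_derive x v (fun y => (F y).1) d.1.
Proof.
move=> [DF EF].
have c : (fun h => h^-1 *: (((fun y => (F y).1) \o shift x) (h *: v) - (F x).1)) @ 0^' --> d.1.
  rewrite -EF; have := @cvg_comp _ _ _ _ fst _ _ _ DF (@cvg_fst _ _ _ _ _); exact.
apply: DeriveDef; first by apply/cvg_ex; exists d.1.
exact/cvg_lim.
Qed.

Lemma is_derive_snd F x v (d : R * R) :
  is_derive x v F d -> is_derive x v (fun y => (F y).2) d.2.
Proof.
move=> [DF EF].
have c : (fun h => h^-1 *: (((fun y => (F y).2) \o shift x) (h *: v) - (F x).2)) @ 0^' --> d.2.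
  rewrite -EF; have := @cvg_comp _ _ _ _ snd _ _ _ DF (@cvg_snd _ _ _ _ _); exact.
apply: DeriveDef; first by apply/cvg_ex; exists d.2.
exact/cvg_lim.
Qed.

End pair_derivatives.

Section compactness.
Context {R : realType}.

(** Only the first point has to lie in [K]. The second one may be outside, as happens when a point
    of the cell is moved by a lattice vector towards another one. *)
Lemma compact_ucont (V : pseudoMetricType R) (f : V -> R) (K : set V) (e : R) :
  compact K -> (forall x, K x -> {for x, continuous f}) -> 0 < e ->
  exists2 de, 0 < de & forall a b, K a -> ball a de b -> `|f a - f b| <= e.
Proof.
move=> /compact_near_coveringP cK cf e0.
pose P (de : R) (a : V) := forall b, ball a de b -> `|f a - f b| <= e.
have := cK R (0^'+) P _; case.
  move=> x Kx; have := cf x Kx => /cvgrPdist_lt /(_ (e / 2)) /(_ (divr_gt0 e0 (ltr0n R 2))).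
  move=> /nbhs_ballP [r /= r0 H].
  exists (ball x (r / 2), [set de | de < r / 2]).
    split; first by apply: nbhsx_ballx; exact: divr_gt0.
    by apply: nbhs_right_lt; exact: divr_gt0.
  move=> [a de] [/= xa dr] b ab.
  have hb : ball x r b.
    rewrite [r]splitr; apply: ball_triangle xa _; apply: le_ball ab; exact: ltW.
  have := H b hb; have := H a; move=> /(_ _) h1 h2.
  have h3 : `|f x - f a| < e / 2.
    by apply: h1; apply: le_ball xa; move: (r0 : 0 < r) => r0'; lra.
  have := ler_distD (f x) (f a) (f b); rewrite (distrC (f a) (f x)) => h4.
  by apply: le_trans h4 _; rewrite [e]splitr lerD// ltW.
move=> r /= r0 H; have := H (r / 2); rewrite /= sub0r normrN ger0_norm ?divr_ge0 ?(ltW r0)//.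
move=> /(_ _ _) K2; exists (r / 2); first exact: divr_gt0.
move=> a b Ka; apply: K2 => //; first by rewrite ltr_pdivrMr// ltr_pMr// ltr1n.
exact: divr_gt0.
Qed.

Lemma compact_cont_bounded (V : topologicalType) (f : V -> R) (K : set V) :
  compact K -> (forall x, K x -> {for x, continuous f}) ->
  exists2 B, 0 < B & forall x, K x -> `|f x| <= B.
Proof.
move=> cK cf; have : compact [set f x | x in K].
  apply: continuous_compact => //; apply: continuous_in_subspaceT => x /set_mem; exact: cf.
move=> /compact_bounded [M [_ H]].
exists (Num.max (M + 1) 1); first by rewrite lt_max ltr01 orbT.
move=> x Kx; apply: H; last by exists x.
by rewrite lt_max ltrDl ltr01.
Qed.

End compactness.

Section measurable_continuous.
Context {R : realType}.
Local Notation mR := (measurableTypeR R).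

Lemma measurable_countable_valued d d' (T : measurableType d) (T' : measurableType d')
    (C : countType) (J : T -> C) (h : C -> T') :
  (forall c, measurable [set x | J x = c]) -> measurable_fun setT (h \o J).
Proof.
move=> mJ _ Y mY; rewrite setTI.
rewrite (_ : _ @^-1` _ = \bigcup_(c in [set: C]) ([set x | J x = c] `&` [set _ | Y (h c)])).
  apply: countable_bigcupT_measurable => // c; apply: measurableI => //.
  by have [y|y] := pselect (Y (h c));
    [rewrite (_ : [set _ | _] = setT)|rewrite (_ : [set _ | _] = set0)] => //; apply/seteqP; split.
by apply/seteqP; split=> x /=; [move=> Yx; exists (J x)|move=> [c _ [<-]]].
Qed.

Lemma round_cvg (x : R) :
  ((Num.floor (2 ^+ k * x))%:~R / 2 ^+ k) @[k --> \oo] --> x.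
Proof.
apply/cvgrPdist_lt => e e0; have [k ke] := exp2_small e0.
exists k => // l /= kl; have pl : 0 < 2 ^+ l :> R by rewrite exprn_gt0.
have /andP[h1 h2] := floor_itv (2 ^+ l * x); rewrite intrD in h2.
apply: le_lt_trans ke; apply: (@le_trans _ _ (2 ^- l)).
  rewrite -(ler_pM2l pl) mulfV ?gt_eqF// -[X in X * `|_|](ger0_norm (ltW pl)) -normrM mulrBr mulrCA mulfV ?gt_eqF// mulr1.
  by rewrite ger0_norm ?subr_ge0//; lra.
by rewrite lef_pV2 ?posrE ?exprn_gt0// ler_weXn2l// ler1n.
Qed.

Lemma measurable_floor_fiber (k : nat) (c : int) :
  measurable [set x : mR | Num.floor (2 ^+ k * x) = c].
Proof.
rewrite (_ : [set x | _] = (fun x : mR => 2 ^+ k * x) @^-1` [set` `[c%:~R, (c + 1)%:~R[]); last first.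
  apply/seteqP; split=> x /=; rewrite in_itv/=; first by move=> <-; exact: floor_itv.
  by move=> h; exact: floor_def.
rewrite -[X in measurable X]setTI.
by apply: measurable_funM => //; exact: measurable_itv.
Qed.

(** Measurability is meant for the product sigma-algebra. Rounding each coordinate down to a
    multiple of [2 ^- k] gives maps with countably many values, whose fibres are products of
    intervals; continuity makes [f] the pointwise limit of its values at the rounded points. *)
Lemma measurable_continuous3 (f : R * (R * R) -> R) : continuous f ->
  measurable_fun setT (f : mR * (mR * mR) -> R).
Proof.
move=> cf.
pose J k (p : mR * (mR * mR)) : int * (int * int) :=
  (Num.floor (2 ^+ k * p.1), (Num.floor (2 ^+ k * p.2.1), Num.floor (2 ^+ k * p.2.2))).
pose h k (c : int * (int * int)) : R :=
  f (c.1%:~R / 2 ^+ k, (c.2.1%:~R / 2 ^+ k, c.2.2%:~R / 2 ^+ k)).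
apply: (@measurable_fun_cvg _ _ _ _ (fun k => h k \o J k)) => [k|p _].
  apply: measurable_countable_valued => -[a [b c]].
  rewrite (_ : [set x | _] = [set x : mR | Num.floor (2 ^+ k * x) = a] `*`
    ([set x : mR | Num.floor (2 ^+ k * x) = b] `*` [set x : mR | Num.floor (2 ^+ k * x) = c])).
    by do 2?apply: measurableX; exact: measurable_floor_fiber.
  by apply/seteqP; split=> -[x [y z]] /=; rewrite /J/=; [case=> -> -> ->|case=> -> [-> ->]].
case: p => t [x y].
pose r k (s : R) : R := (Num.floor (2 ^+ k * s))%:~R / 2 ^+ k.
have c3 (a b c : R) : (fun k => (r k a, (r k b, r k c))) @ \oo --> (a, (b, c)).
  have h1 (u : R) : r ^~ u @ \oo --> u by exact: round_cvg.
  have h2 : (fun k => (r k b, r k c)) @ \oo --> (b, c) by exact: (cvg_pair (@h1 b) (@h1 c)).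
  exact: (cvg_pair (@h1 a) h2).
exact: (cvg_comp _ _ (@c3 t x y) (cf (t, (x, y)))).
Qed.

Lemma measurable_continuous2 (f : R * R -> R) : continuous f ->
  measurable_fun setT (f : mR * mR -> R).
Proof.
move=> cf.
have := @measurable_continuous3 (fun p => f p.2).
have c2 : continuous (fun p : R * (R * R) => f p.2).
  move=> [t x]; have cs : (snd : R * (R * R) -> R * R) @ nbhs (t, x) --> nbhs x by exact: cvg_snd.
  exact: (@cvg_comp _ _ _ (snd : R * (R * R) -> R * R) f _ _ _ cs (cf x)).
move=> /(_ c2) m3.
have -> : f = (fun p : R * (R * R) => f p.2) \o (fun x => (0, x)) by [].
apply: measurableT_comp m3 _.
exact: measurable_pair1.
Qed.

End measurable_continuous.

(** * One-dimensional calculus and quadrature over a period *)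

Section calculus.
Context {R : realType}.
Local Notation leb := (@lebesgue_measure R).

Lemma within_rint (f : R -> R) (a b : R) : {within `[a, b], continuous f} ->
  rint leb `[a, b] f.
Proof. by move=> cf; apply: continuous_compact_integrable => //; exact: segment_compact. Qed.

Lemma Rint_FTC (f F : R -> R) (a b : R) : a < b ->
  {within `[a, b], continuous f} -> {within `[a, b], continuous F} ->
  (forall x, a < x < b -> is_derive x 1 F (f x)) ->
  \int[leb]_(x in `[a, b]) f x = F b - F a.
Proof.
move=> ab cf /(continuous_within_itvP _ ab)[_ Fa Fb] dF.
rewrite /Rintegral (continuous_FTC2 (F := F) ab cf)//.
  by split=> // x; rewrite in_itv/= => /dF [].
by move=> x; rewrite in_itv/= => /dF h; rewrite derive1E; case: h.
Qed.

Lemma Rint_co (f : R -> R) (a b : R) : {within `[a, b], continuous f} ->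
  \int[leb]_(x in `[a, b[) f x = \int[leb]_(x in `[a, b]) f x.
Proof.
move=> cf; apply: Rintegral_itv_bndo_bndc.
apply: integrableS (within_rint cf) => //.
by apply: subset_itvl; rewrite bnd_simp.
Qed.

Lemma is_derive_line (V : normedModType R) (f : V -> R) (x v : V) (d : R) :
  is_derive (0 : R) 1 (fun h : R => f (h *: v + x)) d -> is_derive x v f d.
Proof.
move=> [Df Ef].
have E : (fun h => h^-1 *: ((f \o shift x) (h *: v) - f x)) =
  (fun h : R => h^-1 *: (((fun h : R => f (h *: v + x)) \o shift 0) (h *: 1) - f (0 *: v + x))).
  by apply/funext => h; rewrite /= addr0 scale0r add0r -[h *: 1]/(h * 1) mulr1.
apply: DeriveDef; first by rewrite /derivable E.
by rewrite /derive E.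
Qed.

Lemma line_is_derive (V : normedModType R) (f : V -> R) (x v : V) (s d : R) :
  is_derive (s *: v + x) v f d -> is_derive s 1 (fun h : R => f (h *: v + x)) d.
Proof.
move=> [Df Ef].
have E : (fun h => h^-1 *: ((f \o shift (s *: v + x)) (h *: v) - f (s *: v + x))) =
  (fun h : R => h^-1 *: (((fun h : R => f (h *: v + x)) \o shift s) (h *: 1) - f (s *: v + x))).
  by apply/funext => h; rewrite /= -[h *: 1]/(h * 1) mulr1 scalerDl addrA.
apply: DeriveDef; first by rewrite /derivable -E.
by rewrite /derive -E.
Qed.

Lemma cos_int (k : int) (x : R) : cos (2 * pi * k%:~R + x) = cos x.
Proof.
have H (n : nat) (y : R) : cos (2 * pi * n%:R + y) = cos y.
  rewrite addrC (_ : 2 * pi * n%:R = pi *+ 2 *+ n); first exact: (periodicn (@cosD2pi R)).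
  by rewrite -[pi *+ 2]mulr_natl mulr_natr.
case: k => n; first exact: H.
by rewrite -[LHS](H n.+1) NegzE mulrNz mulrN addrA subrr add0r.
Qed.

Lemma sin_int (k : int) (x : R) : sin (2 * pi * k%:~R + x) = sin x.
Proof.
have H (n : nat) (y : R) : sin (2 * pi * n%:R + y) = sin y.
  rewrite addrC (_ : 2 * pi * n%:R = pi *+ 2 *+ n); first exact: (periodicn (@sinD2pi R)).
  by rewrite -[pi *+ 2]mulr_natl mulr_natr.
case: k => n; first exact: H.
by rewrite -[LHS](H n.+1) NegzE mulrNz mulrN addrA subrr add0r.
Qed.

Lemma cos_lt1 (x : R) : 0 < `|x| < 2 * pi -> cos x < 1.
Proof.
move=> h; have -> : cos x = cos `|x| by case: (ger0P x) => _; rewrite ?cosN.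
move: `|x| h => y /andP[y0 y2].
rewrite (splitr y) -mulr2n cos_mulr2n cos2sin2.
have : 0 < sin (y / 2) by apply: sin_gt0_pi; apply/andP; split; lra.
by move=> s0; have := exprn_gt0 2 s0; rewrite mulr2n; lra.
Qed.

Definition quad1 (M : nat) (f : R -> R) : R := M%:R^-1 * \sum_(i < M) f (i%:R / M%:R).

(** The sums [C] and [S] of cosines and sines over the nodes are invariant under the rotation of
    angle [th], because a shift of the index permutes the nodes. As 0 < |k| < M this rotation is not
    the identity, so both sums vanish. *)
Lemma quad1_trig (M : nat) (k : int) : (`|k| < M)%N ->
  quad1 M (fun x => cos (2 * pi * k%:~R * x)) = (k == 0)%:R /\
  quad1 M (fun x => sin (2 * pi * k%:~R * x)) = 0.
Proof.
move=> kM; have M0 : (0 < M)%N by exact: leq_ltn_trans kM.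
have Mp : (M%:R : R) != 0 by rewrite pnatr_eq0 -lt0n.
have [->|k0] := eqVneq k 0.
  split; rewrite /quad1.
    rewrite (eq_bigr (fun=> 1)) => [|i _]; last by rewrite mulr0 mul0r cos0.
    by rewrite sumr_const card_ord mulVf.
  rewrite big1; first by rewrite mulr0.
  by move=> i _; rewrite mulr0 mul0r sin0.
pose th : R := 2 * pi * k%:~R / M%:R.
have thE (i : nat) : 2 * pi * k%:~R * (i%:R / M%:R) = i%:R * th by rewrite /th; ring.
have MthE : M%:R * th = 2 * pi * k%:~R by rewrite /th mulrC divfK.
have cosM : cos (M%:R * th) = 1 by rewrite MthE -[X in cos X]addr0 cos_int cos0.
have sinM : sin (M%:R * th) = 0 by rewrite MthE -[X in sin X]addr0 sin_int sin0.
pose C := \sum_(0 <= i < M) cos (i%:R * th); pose S := \sum_(0 <= i < M) sin (i%:R * th).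
have shift (f : R -> R) : f (M%:R * th) = f 0 ->
    \sum_(0 <= i < M) f (i%:R * th) = \sum_(0 <= i < M) f (i.+1%:R * th).
  move=> fM; have h : \sum_(0 <= i < M.+1) f (i%:R * th) = f 0 + \sum_(0 <= i < M) f (i.+1%:R * th).
    by rewrite big_nat_recl// mul0r.
  by move: h; rewrite big_nat_recr//= fM addrC => /addrI.
have CE : C = C * cos th - S * sin th.
  rewrite {1}/C shift ?cosM ?cos0// mulr_suml mulr_suml -sumrB.
  by apply: eq_bigr => i _; rewrite -natr1 mulrDl mul1r cosD.
have SE : S = S * cos th + C * sin th.
  rewrite {1}/S shift ?sinM ?sin0// mulr_suml mulr_suml -big_split/=.
  by apply: eq_bigr => i _; rewrite -natr1 mulrDl mul1r sinD.
have c1 : cos th < 1.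
  apply: cos_lt1; rewrite /th normrM normfV normrM (ger0_norm (mulr_ge0 (ler0n R 2) (pi_ge0 R))).
  rewrite (ger0_norm (ler0n R M)) -intr_norm; apply/andP; split.
    by rewrite divr_gt0 ?ltr0n// mulr_gt0 ?mulr_gt0 ?pi_gt0// ltr0z normr_gt0.
  rewrite ltr_pdivrMr ?ltr0n// ltr_pM2l ?mulr_gt0 ?pi_gt0//.
  by rewrite -abszE -pmulrn ltr_nat.
have cs := cos2Dsin2 th; have cs1 : 1 - cos th != 0 by lra.
have C0 : C = 0.
  have e1 : C * (1 - cos th) = - (S * sin th) by lra.
  have e2 : S * (1 - cos th) = C * sin th by lra.
  have : C * ((1 - cos th) ^+ 2 + sin th ^+ 2) = 0.
    by rewrite mulrDr !expr2 !mulrA e1 -e2; ring.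
  have -> : (1 - cos th) ^+ 2 + sin th ^+ 2 = 2 * (1 - cos th) by lra.
  by move/eqP; rewrite !mulf_eq0 (negbTE cs1) pnatr_eq0/= !orbF => /eqP.
have S0 : S = 0.
  have e : S * (1 - cos th) = 0 by move: SE; rewrite C0 mul0r; lra.
  by move/eqP: e; rewrite mulf_eq0 (negbTE cs1) orbF => /eqP.
rewrite /quad1; split.
  by under eq_bigr do rewrite thE; rewrite -(big_mkord xpredT (fun i => cos (i%:R * th))) -/C C0 mulr0.
by under eq_bigr do rewrite thE; rewrite -(big_mkord xpredT (fun i => sin (i%:R * th))) -/S S0 mulr0.
Qed.

Lemma Rint_trig (k : int) :
  \int[leb]_(x in `[0, 1[) cos (2 * pi * k%:~R * x) = (k == 0)%:R /\
  \int[leb]_(x in `[0, 1[) sin (2 * pi * k%:~R * x) = 0.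
Proof.
pose w : R := 2 * pi * k%:~R.
have dlin (x : R) : is_derive x 1 (fun y : R => w * y) w.
  by have := is_deriveZ (f := id) w (is_derive_id x 1); rewrite -[w *: 1]/(w * 1) mulr1.
have dc (x : R) : is_derive x 1 (fun y => cos (w * y)) (- sin (w * x) * w).
  exact: (is_derive1_comp (is_derive_cos (w * x)) (dlin x)).
have ds (x : R) : is_derive x 1 (fun y => sin (w * y)) (cos (w * x) * w).
  exact: (is_derive1_comp (is_derive_sin (w * x)) (dlin x)).
have cc : continuous (fun y => cos (w * y)).
  by move=> x; apply: differentiable_continuous; apply/derivable1_diffP; case: (dc x).
have csn : continuous (fun y => sin (w * y)).
  by move=> x; apply: differentiable_continuous; apply/derivable1_diffP; case: (ds x).
have wc (f : R -> R) : continuous f -> {within `[0, 1], continuous f} by move=> cf; exact: continuous_subspaceT.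
rewrite !Rint_co; [|exact: wc..].
have [k0|kn0] := eqVneq k 0.
  rewrite k0; under eq_Rintegral do rewrite mulr0 mul0r cos0.
  under [X in _ /\ X = _]eq_Rintegral do rewrite mulr0 mul0r sin0.
  rewrite !Rintegral_cst//= mul0r; split=> //.
  by rewrite mul1r lebesgue_measure_itv/= lte_fin ltr01 oppr0 addr0.
have w0 : w != 0 by rewrite /w !mulf_neq0 ?pnatr_eq0// ?intr_eq0// gt_eqF// pi_gt0.
split.
  have -> : \int[leb]_(x in `[0, 1]) cos (2 * pi * k%:~R * x) = w^-1 * sin (w * 1) - w^-1 * sin (w * 0).
    apply: (@Rint_FTC _ (fun y => w^-1 * sin (w * y))) => //.
    - exact: wc.
    - by apply: wc => x; apply: cvgM; [exact: cvg_cst|exact: csn].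
    - move=> x _; have := is_deriveZ w^-1 (ds x).
      by rewrite -[_ *: (_ * _)]/(_ * (_ * _)) mulrCA mulVf// mulr1.
  by rewrite mulr1 mulr0 sin0 mulr0 subr0 -[X in sin X]addr0 sin_int sin0 mulr0.
have -> : \int[leb]_(x in `[0, 1]) sin (2 * pi * k%:~R * x) = - w^-1 * cos (w * 1) - - w^-1 * cos (w * 0).
  apply: (@Rint_FTC _ (fun y => - w^-1 * cos (w * y))) => //.
  - exact: wc.
  - by apply: wc => x; apply: cvgM; [exact: cvg_cst|exact: cc].
  - move=> x _; have := is_deriveZ (- w^-1) (dc x).
    rewrite (_ : - w^-1 *: (- sin (w * x) * w) = sin (w * x))//.
    by rewrite -[_ *: _]/(_ * _); field.
by rewrite mulr1 mulr0 cos0 -[X in cos X]addr0 cos_int cos0 subrr.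
Qed.

End calculus.

Section torus_integrals.
Context {R : realType}.
Local Notation mR := (measurableTypeR R).
Local Notation leb := (@lebesgue_measure R).
Local Notation cell := (@cell R).
Local Notation leb2 := (@leb2 R).

Lemma leb_co01 : leb [set` `[0 : R, 1[] = 1%E.
Proof. by rewrite /= lebesgue_measure_itv/= lte_fin ltr01 oppr0 adde0. Qed.

Lemma leb2_cell : leb2 cell = 1%E.
Proof.
rewrite /cell /leb2 product_measure1E; [|exact: measurable_itv..].
by rewrite -[X in (X * _)%E]/(leb [set` `[0 : R, 1[]) -[X in (_ * X)%E]/(leb [set` `[0 : R, 1[]) leb_co01 mule1.
Qed.

Lemma fin_cell : (leb2 cell < +oo)%E.
Proof. by rewrite leb2_cell ltry. Qed.

Lemma continuous_bounded_cell (f : R * R -> R) : continuous f ->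
  exists2 B, 0 < B & forall x, `|x.1| <= 2 -> `|x.2| <= 2 -> `|f x| <= B.
Proof.
move=> cf.
have cK : compact (`[-2, 2] `*` `[-2, 2] : set (R * R)).
  by apply: compact_setX; exact: segment_compact.
have [B B0 H] := compact_cont_bounded cK (fun x _ => cf x).
exists B => // x x1 x2; apply: H.
by split; rewrite /= in_itv/= -ler_norml.
Qed.

Lemma cell_norm (x : R * R) : cell x -> `|x.1| <= 2 /\ `|x.2| <= 2.
Proof. by case; rewrite /= !in_itv/= !ler_norml => /andP[? ?] /andP[? ?]; split; lra. Qed.

Lemma continuous_rint (f : R * R -> R) : continuous f -> rint leb2 cell f.
Proof.
move=> cf; have [B _ H] := continuous_bounded_cell cf.
apply: (@rint_bounded _ _ _ _ _ (@measurable_cell R) fin_cell _ B).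
  exact: measurable_funTS (measurable_continuous2 cf).
by move=> x /cell_norm [h1 h2]; exact: H.
Qed.

Lemma continuous_L2 (f : R * R -> R) : continuous f -> L2 leb2 cell f.
Proof.
move=> cf; have [B _ H] := continuous_bounded_cell cf.
apply: (@L2_bounded _ _ _ _ _ (@measurable_cell R) fin_cell _ B).
  exact: measurable_funTS (measurable_continuous2 cf).
by move=> x /cell_norm [h1 h2]; exact: H.
Qed.

Lemma Rint_cell (f : R * R -> R) : rint leb2 cell f ->
  \int[leb2]_(x in cell) f x =
  \int[leb]_(x in `[0, 1[) \int[leb]_(y in `[0, 1[) f (x, y).
Proof.
move=> rf; have mI : measurable ([set` `[0 : R, 1[] : set mR) by exact: measurable_itv.
by have [_ _ E] := rint_Fubini mI mI rf.
Qed.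

Lemma Rint_cell_prod (f g : R -> R) : continuous f -> continuous g ->
  \int[leb2]_(x in cell) (f x.1 * g x.2) =
  \int[leb]_(x in `[0, 1[) f x * \int[leb]_(y in `[0, 1[) g y.
Proof.
move=> cf cg; rewrite Rint_cell; last first.
  apply: continuous_rint => -[x y].
  have c1 : (fst : R * R -> R) @ nbhs (x, y) --> nbhs x by exact: cvg_fst.
  have c2 : (snd : R * R -> R) @ nbhs (x, y) --> nbhs y by exact: cvg_snd.
  by apply: cvgM; [exact: (cvg_comp _ _ c1 (cf x))|exact: (cvg_comp _ _ c2 (cg y))].
have rco (h : R -> R) : continuous h -> rint leb `[0, 1[ h.
  move=> ch; apply: integrableS (within_rint (a := 0) (b := 1) (continuous_subspaceT ch)) => //.
  by apply: subset_itvl; rewrite bnd_simp.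
rewrite -RintegralZr//; last exact: rco.
by apply: eq_Rint => x _ /=; rewrite RintegralZl//; exact: rco.
Qed.

End torus_integrals.

(** * Trigonometric polynomials *)

Section trigonometric_polynomials.
Context {R : realType}.
Local Notation mR := (measurableTypeR R).
Local Notation leb := (@lebesgue_measure R).
Local Notation cell := (@cell R).
Local Notation leb2 := (@leb2 R).
Implicit Types (f g : R * R -> R) (k l : int * int) (m n M : nat) (x v : R * R).

Definition in_box m k := ((`|k.1| <= m) && (`|k.2| <= m))%N.

(** Real trigonometric polynomials with frequencies in a box. They are given as a closure instead of
    by coefficients, since most of the properties needed are linear and have to be checked only on
    the pure modes. *)
Inductive TP : nat -> (R * R -> R) -> Prop :=
| TP_cos m k : in_box m k -> TP m (fun x => cos (phase k x))
| TP_sin m k : in_box m k -> TP m (fun x => sin (phase k x))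
| TP_add m f g : TP m f -> TP m g -> TP m (fun x => f x + g x)
| TP_scale m c f : TP m f -> TP m (fun x => c * f x).

Lemma phaseE k x : phase k x = 2 * pi * k.1%:~R * x.1 + 2 * pi * k.2%:~R * x.2 :> R.
Proof. by rewrite /phase /dot /frequency/=; ring. Qed.

Lemma phase0 x : phase (0, 0) x = 0 :> R.
Proof. by rewrite phaseE/=; ring. Qed.

Lemma phaseD k l x : phase (k.1 + l.1, k.2 + l.2) x = phase k x + phase l x :> R.
Proof. by rewrite !phaseE/= !intrD; ring. Qed.

Lemma phaseB k l x : phase (k.1 - l.1, k.2 - l.2) x = phase k x - phase l x :> R.
Proof. by rewrite !phaseE/= !intrB; ring. Qed.

Lemma phase_shift k (l : int * int) x :
  phase k (x.1 + l.1%:~R, x.2 + l.2%:~R) =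
  2 * pi * (k.1 * l.1 + k.2 * l.2)%:~R + phase k x :> R.
Proof. by rewrite !phaseE/= intrD !intrM; ring. Qed.

Lemma phase_line k x v (h : R) : phase k (h *: v + x) = h * phase k v + phase k x.
Proof.
rewrite !phaseE/= -[h *: v.1]/(h * v.1) -[h *: v.2]/(h * v.2); ring.
Qed.

Lemma TP_ext m f g : f =1 g -> TP m f -> TP m g.
Proof. by move=> /funext ->. Qed.

Lemma TP_cst m (c : R) : TP m (fun=> c).
Proof.
apply: (TP_ext _ (TP_scale c (@TP_cos m (0, 0) _))) => [x|//].
by rewrite phase0 cos0 mulr1.
Qed.

Lemma TP_opp m f : TP m f -> TP m (fun x => - f x).
Proof. by move=> /(TP_scale (-1)); apply: TP_ext => x; rewrite mulN1r. Qed.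

Lemma TP_sub m f g : TP m f -> TP m g -> TP m (fun x => f x - g x).
Proof. by move=> tf tg; apply: TP_add => //; exact: TP_opp. Qed.

Lemma TP_sum m (I : eqType) (s : seq I) (F : I -> R * R -> R) :
  (forall i, i \in s -> TP m (F i)) -> TP m (fun x => \sum_(i <- s) F i x).
Proof.
elim: s => [|i s IH] H.
  by apply: TP_ext (TP_cst m 0) => x; rewrite big_nil.
apply: TP_ext (TP_add (H i (mem_head _ _)) (IH _)) => [x|j js]; first by rewrite big_cons.
by apply: H; rewrite inE js orbT.
Qed.

Lemma in_boxD m n k l : in_box m k -> in_box n l -> in_box (m + n) (k.1 + l.1, k.2 + l.2).
Proof.
move=> /andP[k1 k2] /andP[l1 l2]; rewrite /in_box/=; apply/andP; split; lia.
Qed.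

Lemma in_boxB m n k l : in_box m k -> in_box n l -> in_box (m + n) (k.1 - l.1, k.2 - l.2).
Proof.
move=> /andP[k1 k2] /andP[l1 l2]; rewrite /in_box/=; apply/andP; split; lia.
Qed.

Lemma TP_mul m n f g : TP m f -> TP n g -> TP (m + n) (fun x => f x * g x).
Proof.
move=> tf; elim: tf n g => {m f} [m k b|m k b|m f1 f2 _ IH1 _ IH2|m c f _ IH] n g.
- elim=> {n g} [n l b'|n l b'|n g1 g2 _ IH1 _ IH2|n c g _ IH].
  + apply: TP_ext (TP_scale 2^-1 (TP_add (TP_cos (in_boxB b b')) (TP_cos (in_boxD b b')))) => x.
    by rewrite phaseB phaseD cosB cosD; field.
  + apply: TP_ext (TP_scale 2^-1 (TP_sub (TP_sin (in_boxD b b')) (TP_sin (in_boxB b b')))) => x.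
    by rewrite phaseB phaseD sinB sinD; field.
  + by apply: TP_ext (TP_add IH1 IH2) => x; rewrite mulrDr.
  + by apply: TP_ext (TP_scale c IH) => x; rewrite mulrCA.
- elim=> {n g} [n l b'|n l b'|n g1 g2 _ IH1 _ IH2|n c g _ IH].
  + apply: TP_ext (TP_scale 2^-1 (TP_add (TP_sin (in_boxD b b')) (TP_sin (in_boxB b b')))) => x.
    by rewrite phaseB phaseD sinB sinD; field.
  + apply: TP_ext (TP_scale 2^-1 (TP_sub (TP_cos (in_boxB b b')) (TP_cos (in_boxD b b')))) => x.
    by rewrite phaseB phaseD cosB cosD; field.
  + by apply: TP_ext (TP_add IH1 IH2) => x; rewrite mulrDr.
  + by apply: TP_ext (TP_scale c IH) => x; rewrite mulrCA.
- by move=> tg; apply: TP_ext (TP_add (IH1 _ _ tg) (IH2 _ _ tg)) => x; rewrite mulrDl.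
- by move=> tg; apply: TP_ext (TP_scale c (IH _ _ tg)) => x; rewrite mulrA.
Qed.

Lemma continuous_cos_phase k : continuous (fun x => cos (phase k x) : R).
Proof.
move=> [x y]; have c1 : (fst : R * R -> R) @ nbhs (x, y) --> x by exact: cvg_fst.
have c2 : (snd : R * R -> R) @ nbhs (x, y) --> y by exact: cvg_snd.
have c3 : (fun z : R * R => phase k z) @ nbhs (x, y) --> phase k (x, y).
  rewrite phaseE; under eq_fun do rewrite phaseE.
  by apply: cvgD; apply: cvgM => //; exact: cvg_cst.
exact: (cvg_comp _ _ c3 (@continuous_cos R _)).
Qed.

Lemma continuous_sin_phase k : continuous (fun x => sin (phase k x) : R).
Proof.
move=> [x y]; have c1 : (fst : R * R -> R) @ nbhs (x, y) --> x by exact: cvg_fst.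
have c2 : (snd : R * R -> R) @ nbhs (x, y) --> y by exact: cvg_snd.
have c3 : (fun z : R * R => phase k z) @ nbhs (x, y) --> phase k (x, y).
  rewrite phaseE; under eq_fun do rewrite phaseE.
  by apply: cvgD; apply: cvgM => //; exact: cvg_cst.
exact: (cvg_comp _ _ c3 (@continuous_sin R _)).
Qed.

Lemma TP_continuous m f : TP m f -> continuous f.
Proof.
elim=> {m f} [m k _|m k _|m f g _ cf _ cg|m c f _ cf] x.
- exact: continuous_cos_phase.
- exact: continuous_sin_phase.
- by apply: cvgD; [exact: cf|exact: cg].
- by apply: cvgM; [exact: cvg_cst|exact: cf].
Qed.

Lemma TP_periodic m f : TP m f -> Z2periodic f.
Proof.
elim=> {m f} [m k _|m k _|m f g _ cf _ cg|m c f _ cf] l x.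
- by rewrite phase_shift cos_int.
- by rewrite phase_shift sin_int.
- by rewrite cf cg.
- by rewrite cf.
Qed.

Definition quad M f : R :=
  M%:R^-1 * M%:R^-1 * \sum_(i < M) \sum_(j < M) f (i%:R / M%:R, j%:R / M%:R).

Lemma quadD M f g : quad M (fun x => f x + g x) = quad M f + quad M g.
Proof. by rewrite /quad -mulrDr -big_split; congr (_ * _); apply: eq_bigr => i _; rewrite -big_split. Qed.

Lemma quadZ M c f : quad M (fun x => c * f x) = c * quad M f.
Proof.
rewrite /quad mulrCA; congr (_ * _); rewrite mulr_sumr; apply: eq_bigr => i _.
by rewrite mulr_sumr.
Qed.

Lemma quad_prod M (f g : R -> R) : quad M (fun x => f x.1 * g x.2) = quad1 M f * quad1 M g.
Proof.
rewrite /quad /quad1 mulrACA; congr (_ * _); rewrite mulr_suml; apply: eq_bigr => i _.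
by rewrite mulr_sumr.
Qed.

Let c1 (a : int) (x : R) : R := cos (2 * pi * a%:~R * x).
Let s1 (a : int) (x : R) : R := sin (2 * pi * a%:~R * x).

Let cc1 a : continuous (c1 a).
Proof.
move=> x; have h : (fun y : R => 2 * pi * a%:~R * y) @ x --> 2 * pi * a%:~R * x.
  by apply: cvgM; [exact: cvg_cst|exact: cvg_id].
exact: (cvg_comp _ _ h (@continuous_cos R _)).
Qed.

Let cs1 a : continuous (s1 a).
Proof.
move=> x; have h : (fun y : R => 2 * pi * a%:~R * y) @ x --> 2 * pi * a%:~R * x.
  by apply: cvgM; [exact: cvg_cst|exact: cvg_id].
exact: (cvg_comp _ _ h (@continuous_sin R _)).
Qed.

Let c2 (f g : R -> R) : continuous f -> continuous g -> rint leb2 cell (fun x => f x.1 * g x.2).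
Proof.
move=> cf cg; apply: continuous_rint => -[x y].
have h1 : (fst : R * R -> R) @ nbhs (x, y) --> x by exact: cvg_fst.
have h2 : (snd : R * R -> R) @ nbhs (x, y) --> y by exact: cvg_snd.
by apply: cvgM; [exact: (cvg_comp _ _ h1 (cf x))|exact: (cvg_comp _ _ h2 (cg y))].
Qed.

Lemma int_trig k :
  \int[leb2]_(x in cell) cos (phase k x) = (k == (0, 0))%:R :> R /\
  \int[leb2]_(x in cell) sin (phase k x) = 0 :> R.
Proof.
have mc := @measurable_cell R.
have [C1 S1] := @Rint_trig R k.1; have [C2 S2] := @Rint_trig R k.2.
split.
  transitivity (\int[leb2]_(x in cell) (c1 k.1 x.1 * c1 k.2 x.2 - s1 k.1 x.1 * s1 k.2 x.2)).
    by apply: eq_Rint => x _; rewrite phaseE cosD.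
  rewrite RintegralB//; [|by apply: c2..].
  rewrite !Rint_cell_prod// C1 C2 S1 S2 mul0r subr0.
  by case: k {C1 C2 S1 S2} => a b /=; rewrite xpair_eqE; do 2!case: eqP; rewrite ?mulr1 ?mulr0.
transitivity (\int[leb2]_(x in cell) (s1 k.1 x.1 * c1 k.2 x.2 + c1 k.1 x.1 * s1 k.2 x.2)).
  by apply: eq_Rint => x _; rewrite phaseE sinD.
rewrite RintegralD//; [|by apply: c2..].
by rewrite !Rint_cell_prod// C1 C2 S1 S2 mul0r mulr0 addr0.
Qed.

Lemma quad_trig m M k : in_box m k -> (m < M)%N ->
  quad M (fun x => cos (phase k x)) = (k == (0, 0))%:R /\
  quad M (fun x => sin (phase k x)) = 0.
Proof.
move=> /andP[b1 b2] mM.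
have [C1 S1] := @quad1_trig R M k.1 (leq_ltn_trans b1 mM).
have [C2 S2] := @quad1_trig R M k.2 (leq_ltn_trans b2 mM).
split.
  transitivity (quad M (fun x => c1 k.1 x.1 * c1 k.2 x.2 + -1 * (s1 k.1 x.1 * s1 k.2 x.2))).
    by congr (quad M); apply/funext => x; rewrite phaseE cosD mulN1r.
  rewrite quadD quadZ !quad_prod C1 C2 S1 S2 mul0r mulr0 addr0.
  by case: k {C1 C2 S1 S2 b1 b2} => a b /=; rewrite xpair_eqE; do 2!case: eqP; rewrite ?mulr1 ?mulr0.
transitivity (quad M (fun x => s1 k.1 x.1 * c1 k.2 x.2 + c1 k.1 x.1 * s1 k.2 x.2)).
  by congr (quad M); apply/funext => x; rewrite phaseE sinD.
by rewrite quadD !quad_prod C1 C2 S1 S2 mul0r mulr0 addr0.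
Qed.

Lemma TP_rint m f : TP m f -> rint leb2 cell f.
Proof. by move=> /TP_continuous; exact: continuous_rint. Qed.

(** A space integral becomes a finite sum of point values. The Galerkin equation holds pointwise in
    [x], so continuity and derivatives in time of such integrals follow term by term. *)
Lemma TP_quad m M f : TP m f -> (m < M)%N -> \int[leb2]_(x in cell) f x = quad M f.
Proof.
have mc := @measurable_cell R.
elim=> {m f} [m k b|m k b|m f g tf IHf tg IHg|m c f tf IH] mM.
- by have [-> _] := int_trig k; have [-> _] := quad_trig b mM.
- by have [_ ->] := int_trig k; have [_ ->] := quad_trig b mM.
- by rewrite quadD -IHf// -IHg// RintegralD//; [exact: TP_rint tf|exact: TP_rint tg].
- by rewrite quadZ -IH// RintegralZl//; exact: TP_rint tf.
Qed.

Lemma is_derive_phase k x v (h : R) :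
  is_derive h 1 (fun h : R => phase k (h *: v + x)) (phase k v).
Proof.
under eq_fun do rewrite phase_line mulrC.
have := is_deriveD (is_deriveZ (phase k v) (is_derive_id h 1)) (is_derive_cst (phase k x) h 1).
by rewrite addr0 -[_ *: 1]/(_ * 1) mulr1.
Qed.

Lemma TP_is_derive m f v : TP m f -> exists f', [/\ TP m f', (forall x, is_derive x v f (f' x))
  & \int[leb2]_(x in cell) f' x = 0].
Proof.
have mc := @measurable_cell R.
have dl k x := is_derive_phase k x v.
elim=> {m f} [m k b|m k b|m f g tf [f' [Tf df If]] tg [g' [Tg dg Ig]]|m c f tf [f' [Tf df If]]].
- exists (fun x => - phase k v * sin (phase k x)); split.
  + by apply: TP_scale; exact: TP_sin.
  + move=> x; apply: is_derive_line; have := is_derive1_comp (is_derive_cos _) (dl k x 0).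
    by rewrite scale0r add0r mulNr mulrC -mulNr.
  + by rewrite RintegralZl//; [have [_ ->] := int_trig k; rewrite mulr0|exact: TP_rint (TP_sin b)].
- exists (fun x => phase k v * cos (phase k x)); split.
  + by apply: TP_scale; exact: TP_cos.
  + move=> x; apply: is_derive_line; have := is_derive1_comp (is_derive_sin _) (dl k x 0).
    by rewrite scale0r add0r mulrC.
  + rewrite RintegralZl//; last exact: TP_rint (TP_cos b).
    have [-> _] := int_trig k; case: eqP => [->|_]; last by rewrite mulr0.
    by rewrite phase0 mul0r.
- exists (fun x => f' x + g' x); split.
  + exact: TP_add.
  + by move=> x; apply: is_deriveD.
  + by rewrite RintegralD ?If ?Ig ?addr0//; [exact: TP_rint Tf|exact: TP_rint Tg].
- exists (fun x => c * f' x); split.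
  + exact: TP_scale.
  + by move=> x; apply: is_deriveZ.
  + by rewrite RintegralZl ?If ?mulr0//; exact: TP_rint Tf.
Qed.

Lemma TP_derive m f v : TP m f ->
  [/\ TP m (fun x => 'D_v f x), (forall x, derivable f x v)
    & \int[leb2]_(x in cell) 'D_v f x = 0].
Proof.
move=> /(TP_is_derive v) [f' [Tf df If]].
have -> : (fun x => 'D_v f x) = f' by apply/funext => x; case: (df x).
by split=> // x; case: (df x).
Qed.

Lemma TP_IBP m n f g v : TP m f -> TP n g ->
  \int[leb2]_(x in cell) ('D_v f x * g x) = - \int[leb2]_(x in cell) (f x * 'D_v g x).
Proof.
move=> tf tg; have mc := @measurable_cell R.
have [tf' df _] := TP_derive v tf; have [tg' dg _] := TP_derive v tg.
have [_ _ I0] := TP_derive v (TP_mul tf tg).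
apply/eqP; rewrite -subr_eq0 opprK -RintegralD//; last 2 first.
- exact: TP_rint (TP_mul tf' tg).
- exact: TP_rint (TP_mul tf tg').
rewrite -[X in _ == X]I0; apply/eqP/eq_Rint => x _.
by rewrite (deriveM (df x) (dg x)) addrC -![_ *: _]/(_ * _) [X in _ = _ + X]mulrC.
Qed.

End trigonometric_polynomials.

Lemma Rint_add4 d (T : measurableType d) (R : realType) (mu : {measure set T -> \bar R}) (D : set T)
    (mD : measurable D) (f1 f2 f3 f4 : T -> R) :
  rint mu D f1 -> rint mu D f2 -> rint mu D f3 -> rint mu D f4 ->
  (\int[mu]_(x in D) f1 x) + (\int[mu]_(x in D) f2 x) +
  ((\int[mu]_(x in D) f3 x) + (\int[mu]_(x in D) f4 x)) =
  \int[mu]_(x in D) (f1 x + f2 x + (f3 x + f4 x)).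
Proof.
move=> r1 r2 r3 r4; rewrite RintegralD//; [|exact: rintD..].
by rewrite !RintegralD.
Qed.

(** * Vector fields and Fourier truncation *)

Section plane_algebra.
Context {R : realType}.
Implicit Types (z w : R * R) (k : int * int) (c : R).

Lemma dotC z w : dot z w = dot w z.
Proof. by rewrite /dot; ring. Qed.

Lemma normsq_ge0 z : 0 <= normsq z.
Proof. by rewrite /normsq /dot addr_ge0// -expr2 sqr_ge0. Qed.

Lemma dot_leray k z w : dot (leray k z) w = dot z (leray k w).
Proof.
rewrite /leray /dot/= -![_ *: _]/(_ * _); ring.
Qed.

Lemma lerayD k z w : leray k (z + w) = leray k z + leray k w.
Proof.
by rewrite /leray /dot; congr pair; rewrite /= -![_ *: _]/(_ * _); ring.
Qed.

Lemma lerayZ k c z : leray k (c *: z) = c *: leray k z.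
Proof.
by rewrite /leray /dot; congr pair; rewrite /= -![_ *: _]/(_ * _); ring.
Qed.

Lemma freq_normsq k : k != (0, 0) -> normsq (frequency k) != 0 :> R.
Proof.
case: k => a b; rewrite xpair_eqE negb_and /normsq /dot/= => h.
have : 0 < a%:~R * a%:~R + b%:~R * b%:~R :> R.
  case/orP: h => h; [apply: ltr_wpDr|apply: ltr_wpDl]; rewrite -expr2 ?sqr_ge0//.
    by rewrite exprn_even_gt0//= intr_eq0.
  by rewrite exprn_even_gt0//= intr_eq0.
by move/gt_eqF => ->.
Qed.

Lemma dot_freq_leray k z : k != (0, 0) -> dot (frequency k) (leray k z) = 0.
Proof.
move/freq_normsq => h; rewrite {1}/dot /leray/= -![_ *: _]/(_ * _).
set q := normsq _ in h *; set f := frequency k in h *.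
have -> : f.1 * (z.1 - dot f z / q * f.1) + f.2 * (z.2 - dot f z / q * f.2) =
  dot f z - dot f z / q * normsq f by rewrite /normsq /dot; ring.
by rewrite -/q divfK// subrr.
Qed.

Lemma leray_perp k z : dot (frequency k) z = 0 -> leray k z = z.
Proof. by rewrite /leray => ->; rewrite mul0r scale0r subr0. Qed.

Lemma leray_leray k z : k != (0, 0) -> leray k (leray k z) = leray k z.
Proof. by move=> k0; rewrite leray_perp// dot_freq_leray. Qed.

Lemma leray_neg k z : leray (- k.1, - k.2) z = leray k z.
Proof.
have -> : leray (- k.1, - k.2) z = z - (dot (- frequency k) z / normsq (- frequency k)) *: (- frequency k) :> R * R.
  by rewrite /leray /frequency/= !mulrNz.
rewrite /leray; congr (_ - _); rewrite scalerN -scaleNr; congr (_ *: _).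
by rewrite /normsq /dot/= !mulrNN !mulNr -opprD mulNr opprK.
Qed.

End plane_algebra.

Section modes.
Local Open Scope int_scope.

Lemma mem_modes (n : nat) (k : int * int) :
  (k \in modes n) = (k != (0, 0)) && (k.1 ^+ 2 + k.2 ^+ 2 <= n%:Z ^+ 2)%R.
Proof.
rewrite mem_filter; apply/idP/idP => [/andP[]//|h]; rewrite h andTb.
have [_ h2] := andP h.
have mr (a : int) : (a ^+ 2 <= n%:Z ^+ 2)%R -> a \in [seq (i%:Z - n%:Z)%R | i <- iota 0 n.*2.+1].
  rewrite -(real_normK (num_real a)) -[X in (_ <= X ^+ 2)%R](ger0_norm (le0z_nat n)).
  rewrite ler_pXn2r ?nnegrE// (ger0_norm (le0z_nat n)) => an.
  have [j ja] : exists j : nat, (a + n%:Z)%R = j%:Z.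
    by exists `|(a + n%:Z)%R|%N; lia.
  apply/mapP; exists j; last by rewrite -ja addrK.
  by rewrite mem_iota; lia.
apply/allpairsP; exists (k.1, k.2); split=> /=; last by case: k {h h2}.
- by apply: mr; apply: le_trans h2; rewrite lerDl sqr_ge0.
- by apply: mr; apply: le_trans h2; rewrite lerDr sqr_ge0.
Qed.

Lemma modes_uniq (n : nat) : uniq (modes n).
Proof.
apply/filter_uniq/allpairs_uniq.
- by rewrite map_inj_uniq ?iota_uniq// => i j /addIr [].
- by rewrite map_inj_uniq ?iota_uniq// => i j /addIr [].
- by move=> [a b] [c d] _ _ [-> ->].
Qed.

Lemma modes_box (n : nat) k : k \in modes n -> in_box n k.
Proof.
rewrite mem_modes => /andP[_ h]; rewrite /in_box; apply/andP; split; nia.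
Qed.

(** A square of half-width [m] lies in the disc of radius [2 * m], as 2 m^2 <= (2m)^2; this is the
    source of the conditions [2 * p <= n] on degrees. *)
Lemma box_modes (m n : nat) k : in_box m k -> k != (0, 0) -> (2 * m <= n)%N -> k \in modes n.
Proof.
move=> /andP[h1 h2] k0 mn; rewrite mem_modes k0/=; nia.
Qed.

Lemma modes_neg (n : nat) k : k \in modes n -> ((- k.1)%R, (- k.2)%R) \in modes n.
Proof.
rewrite !mem_modes/= !sqrrN => /andP[h ->]; rewrite andbT.
by case: k h => a b; rewrite !xpair_eqE !oppr_eq0.
Qed.

End modes.

Section vector_fields.
Context {R : realType}.
Local Notation mR := (measurableTypeR R).
Local Notation cell := (@cell R).
Local Notation leb2 := (@leb2 R).
Implicit Types (u v w f g : R * R -> R * R) (k l : int * int).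

Definition VL2 u := L2 leb2 cell (fun x => (u x).1) /\ L2 leb2 cell (fun x => (u x).2).
Definition vip u v : R := \int[leb2]_(x in cell) dot (u x) (v x).

Let mc := @measurable_cell R.

Lemma VL2_rint u v : VL2 u -> VL2 v -> rint leb2 cell (fun x => dot (u x) (v x)).
Proof. by move=> [u1 u2] [v1 v2]; apply: rintD => //; exact: L2_prod. Qed.

Lemma vipE u v : VL2 u -> VL2 v -> vip u v =
  \int[leb2]_(x in cell) ((u x).1 * (v x).1) + \int[leb2]_(x in cell) ((u x).2 * (v x).2).
Proof. by move=> [u1 u2] [v1 v2]; rewrite /vip RintegralD//; exact: L2_prod. Qed.

Lemma vipC u v : vip u v = vip v u.
Proof. by apply: eq_Rint => x _; rewrite dotC. Qed.

Lemma VL2D u v : VL2 u -> VL2 v -> VL2 (fun x => u x + v x).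
Proof. by move=> [u1 u2] [v1 v2]; split; exact: L2D. Qed.

Lemma VL2Z (c : R) u : VL2 u -> VL2 (fun x => c *: u x).
Proof. by move=> [u1 u2]; split; exact: L2Z. Qed.

Lemma VL2B u v : VL2 u -> VL2 v -> VL2 (fun x => u x - v x).
Proof. by move=> [u1 u2] [v1 v2]; split; exact: L2B. Qed.

Lemma VL2_sum (I : Type) (s : seq I) (F : I -> R * R -> R * R) :
  (forall i, VL2 (F i)) -> VL2 (fun x => \sum_(i <- s) F i x).
Proof.
move=> VF; elim: s => [|i s IH].
  have -> : (fun x => \sum_(i <- [::]) F i x) = fun=> 0 by apply/funext => x; rewrite big_nil.
  by split; apply: (@L2_bounded _ _ _ _ _ mc (@fin_cell R) _ 0) => // x _; rewrite normr0.
have -> : (fun x => \sum_(j <- i :: s) F j x) = fun x => F i x + \sum_(j <- s) F j x.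
  by apply/funext => x; rewrite big_cons.
exact: VL2D.
Qed.

Lemma vipDl u v w : VL2 u -> VL2 v -> VL2 w -> vip (fun x => u x + v x) w = vip u w + vip v w.
Proof.
move=> Vu Vv Vw; rewrite /vip -RintegralD//; [|exact: VL2_rint..].
by apply: eq_Rint => x _; rewrite /dot/=; ring.
Qed.

Lemma vipBl u v w : VL2 u -> VL2 v -> VL2 w -> vip (fun x => u x - v x) w = vip u w - vip v w.
Proof.
move=> Vu Vv Vw; rewrite /vip -RintegralB//; [|exact: VL2_rint..].
by apply: eq_Rint => x _; rewrite /dot/=; ring.
Qed.

Lemma vip_sumr (I : Type) (s : seq I) (F : I -> R * R -> R * R) u : VL2 u -> (forall i, VL2 (F i)) ->
  vip u (fun x => \sum_(i <- s) F i x) = \sum_(i <- s) vip u (F i).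
Proof.
move=> Vu VF; elim: s => [|i s IH].
  rewrite big_nil /vip; under eq_Rintegral => x _ do rewrite big_nil /dot !mulr0 addr0.
  by rewrite Rintegral_cst// mul0r.
rewrite big_cons -IH ![vip u _]vipC -vipDl//; last exact: VL2_sum.
by congr (vip _ u); apply/funext => x; rewrite big_cons.
Qed.

Lemma vip_ge0 u : 0 <= vip u u.
Proof. by apply: Rintegral_ge0 => x _; exact: normsq_ge0. Qed.

Lemma vip_cauchy_schwarz u v : VL2 u -> VL2 v -> vip u v ^+ 2 <= vip u u * vip v v.
Proof.
move=> Vu Vv; apply: discriminant; [exact: vip_ge0..|move=> s].
have Vs := VL2Z s Vv; have Vd := VL2B Vu Vs.
have -> : vip u u - 2 * s * vip u v + s ^+ 2 * vip v v =
    vip (fun x => u x - s *: v x) (fun x => u x - s *: v x).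
  rewrite /vip -(RintegralZl (2 * s) mc (VL2_rint Vu Vv)) -(RintegralZl (s ^+ 2) mc (VL2_rint Vv Vv)).
  rewrite -RintegralB//; [|exact: VL2_rint|by apply: rintZ => //; exact: VL2_rint].
  rewrite -RintegralD//; [|by apply: rintB => //; [exact: VL2_rint|apply: rintZ => //; exact: VL2_rint]|by apply: rintZ => //; exact: VL2_rint].
  by apply: eq_Rint => x _; rewrite /dot/= -![_ *: _]/(_ * _); ring.
exact: vip_ge0.
Qed.

Lemma L2norm_vip u : L2norm u = Num.sqrt (vip u u).
Proof. by []. Qed.

Lemma in_L2sigma_VL2 u : in_L2sigma u -> VL2 u.
Proof.
move=> [mu fu _ _ _].
have m1 : measurable_fun cell (fun x : mR * mR => (u x).1) by exact: (measurableT_comp measurable_fst mu).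
have m2 : measurable_fun cell (fun x : mR * mR => (u x).2) by exact: (measurableT_comp measurable_snd mu).
have rn : rint leb2 cell (fun x => normsq (u x)).
  apply/integrableP; split.
    by apply/measurable_EFinP; apply: measurable_funD; exact: measurable_funM.
  by under eq_integral => x _ do rewrite /= ger0_norm ?normsq_ge0//.
split; split=> //; apply: rint_le rn _ => //; do ?exact: measurable_funM.
  by move=> x _; rewrite /normsq /dot ger0_norm -expr2 ?sqr_ge0// lerDl -expr2 sqr_ge0.
by move=> x _; rewrite /normsq /dot ger0_norm -expr2 ?sqr_ge0// lerDr -expr2 sqr_ge0.
Qed.

Definition VTP m u := TP m (fun x => (u x).1) /\ TP m (fun x => (u x).2).

Lemma VTP_VL2 m u : VTP m u -> VL2 u.
Proof. by move=> [t1 t2]; split; apply: continuous_L2; [exact: (TP_continuous t1)|exact: (TP_continuous t2)]. Qed.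

Lemma VTP_quad m n M u v : VTP m u -> VTP n v -> (m + n < M)%N ->
  vip u v = quad M (fun x => dot (u x) (v x)).
Proof.
move=> [u1 u2] [v1 v2] mn; apply: (@TP_quad _ (m + n)) => //.
by apply: TP_add; exact: TP_mul.
Qed.

Definition smode k (a b : R * R) (x : R * R) : R * R :=
  cos (phase k x) *: a + sin (phase k x) *: b.

Lemma VTP_smode m k a b : in_box m k -> VTP m (smode k a b).
Proof.
move=> bk; split.
  apply: (TP_ext _ (TP_add (TP_scale a.1 (TP_cos bk)) (TP_scale b.1 (TP_sin bk)))) => x.
  by rewrite /smode/= -![_ *: _]/(_ * _) !(mulrC (a.1)) !(mulrC (b.1)).
apply: (TP_ext _ (TP_add (TP_scale a.2 (TP_cos bk)) (TP_scale b.2 (TP_sin bk)))) => x.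
by rewrite /smode/= -![_ *: _]/(_ * _) !(mulrC (a.2)) !(mulrC (b.2)).
Qed.

Lemma in_box_self k : in_box (maxn `|k.1| `|k.2|) k.
Proof. by rewrite /in_box leq_maxl leq_maxr. Qed.

Lemma VL2_smode k a b : VL2 (smode k a b).
Proof. exact: VTP_VL2 (VTP_smode a b (in_box_self k)). Qed.

Lemma vip_smode u k a b : VL2 u ->
  vip u (smode k a b) = dot (fourier_cos u k) a + dot (fourier_sin u k) b.
Proof.
move=> [u1 u2].
have lc : L2 leb2 cell (fun x => cos (phase k x)) by apply: continuous_L2; exact: continuous_cos_phase.
have ls : L2 leb2 cell (fun x => sin (phase k x)) by apply: continuous_L2; exact: continuous_sin_phase.
have r1 := L2_prod mc u1 lc; have r2 := L2_prod mc u2 lc.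
have r3 := L2_prod mc u1 ls; have r4 := L2_prod mc u2 ls.
rewrite /vip /fourier_cos /fourier_sin {2 3}/dot/= -!RintegralZr//.
rewrite -RintegralD//; [|by apply: (eq_rint mc _ (rintZ mc a.1 r1)) => x _; rewrite mulrC|by apply: (eq_rint mc _ (rintZ mc a.2 r2)) => x _; rewrite mulrC].
rewrite -RintegralD//; [|by apply: (eq_rint mc _ (rintZ mc b.1 r3)) => x _; rewrite mulrC|by apply: (eq_rint mc _ (rintZ mc b.2 r4)) => x _; rewrite mulrC].
rewrite -RintegralD//; last 2 first.
- have := rintD mc (rintZ mc a.1 r1) (rintZ mc a.2 r2); apply: eq_rint => // x _; ring.
- have := rintD mc (rintZ mc b.1 r3) (rintZ mc b.2 r4); apply: eq_rint => // x _; ring.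
by apply: eq_Rint => x _; rewrite /smode /dot/= -![_ *: _]/(_ * _); ring.
Qed.

Lemma Pi_smode n f x : Pi_ n f x =
  \sum_(k <- modes n) smode k (leray k (fourier_cos f k)) (leray k (fourier_sin f k)) x.
Proof. by apply: eq_bigr => k _; rewrite lerayD !lerayZ. Qed.

Lemma sum_fst (I : Type) (s : seq I) (F : I -> R * R) : (\sum_(i <- s) F i).1 = \sum_(i <- s) (F i).1.
Proof. by elim: s => [|i s IH]; rewrite ?big_nil// !big_cons/= IH. Qed.

Lemma sum_snd (I : Type) (s : seq I) (F : I -> R * R) : (\sum_(i <- s) F i).2 = \sum_(i <- s) (F i).2.
Proof. by elim: s => [|i s IH]; rewrite ?big_nil// !big_cons/= IH. Qed.

Lemma VTP_sum (I : eqType) m (s : seq I) (F : I -> R * R -> R * R) :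
  (forall i, i \in s -> VTP m (F i)) -> VTP m (fun x => \sum_(i <- s) F i x).
Proof.
move=> H; split.
  apply: (TP_ext (f := fun x => \sum_(i <- s) (F i x).1)) => [x|]; first by rewrite sum_fst.
  by apply: TP_sum => i /H [].
apply: (TP_ext (f := fun x => \sum_(i <- s) (F i x).2)) => [x|]; first by rewrite sum_snd.
by apply: TP_sum => i /H [].
Qed.

Lemma VTP_Pi n f : VTP n (Pi_ n f).
Proof.
have -> : Pi_ n f = fun x => \sum_(k <- modes n) smode k (leray k (fourier_cos f k)) (leray k (fourier_sin f k)) x.
  by apply/funext => x; exact: Pi_smode.
by apply: VTP_sum => k kn; apply: VTP_smode; exact: modes_box.
Qed.

Lemma vip_Pi n f g : VL2 g -> vip g (Pi_ n f) = \sum_(k <- modes n)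
  (dot (fourier_cos g k) (leray k (fourier_cos f k)) + dot (fourier_sin g k) (leray k (fourier_sin f k))).
Proof.
move=> Vg.
have -> : Pi_ n f = fun x => \sum_(k <- modes n) smode k (leray k (fourier_cos f k)) (leray k (fourier_sin f k)) x.
  by apply/funext => x; exact: Pi_smode.
rewrite vip_sumr//; last by move=> k; exact: VL2_smode.
by apply: eq_bigr => k _; rewrite vip_smode.
Qed.

(** On Fourier coefficients this is the symmetry of each orthogonal projection [leray k]. *)
Lemma vip_Pi_sym n f g : VL2 f -> VL2 g -> vip (Pi_ n f) g = vip f (Pi_ n g).
Proof.
move=> Vf Vg; rewrite vipC !vip_Pi//; apply: eq_bigr => k _.
by congr (_ + _); rewrite dotC dot_leray.
Qed.

(** The frequencies [k] and [-k] carry the same cosine, hence two resonances; for the sines the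
    second one enters with a minus sign. *)
Lemma int_cos_cos k l : \int[leb2]_(x in cell) (cos (phase k x) * cos (phase l x)) =
  2^-1 * ((k == l)%:R + (k == (- l.1, - l.2))%:R) :> R.
Proof.
have [C1 _] := @int_trig R (k.1 - l.1, k.2 - l.2); have [C2 _] := @int_trig R (k.1 + l.1, k.2 + l.2).
have t1 := TP_rint (@TP_cos R _ _ (in_box_self (k.1 - l.1, k.2 - l.2))).
have t2 := TP_rint (@TP_cos R _ _ (in_box_self (k.1 + l.1, k.2 + l.2))).
transitivity (\int[leb2]_(x in cell) (2^-1 * (cos (phase (k.1 - l.1, k.2 - l.2) x) + cos (phase (k.1 + l.1, k.2 + l.2) x)))).
  by apply: eq_Rint => x _; rewrite phaseB phaseD cosB cosD; field.
rewrite RintegralZl//; last exact: rintD.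
rewrite RintegralD// C1 C2; congr (_ * (_%:R + _%:R)).
  by case: k l {C1 C2 t1 t2} => a b [c d]; rewrite !xpair_eqE !subr_eq0.
by case: k l {C1 C2 t1 t2} => a b [c d]; rewrite !xpair_eqE !addr_eq0.
Qed.

Lemma int_sin_sin k l : \int[leb2]_(x in cell) (sin (phase k x) * sin (phase l x)) =
  2^-1 * ((k == l)%:R - (k == (- l.1, - l.2))%:R) :> R.
Proof.
have [C1 _] := @int_trig R (k.1 - l.1, k.2 - l.2); have [C2 _] := @int_trig R (k.1 + l.1, k.2 + l.2).
have t1 := TP_rint (@TP_cos R _ _ (in_box_self (k.1 - l.1, k.2 - l.2))).
have t2 := TP_rint (@TP_cos R _ _ (in_box_self (k.1 + l.1, k.2 + l.2))).
transitivity (\int[leb2]_(x in cell) (2^-1 * (cos (phase (k.1 - l.1, k.2 - l.2) x) - cos (phase (k.1 + l.1, k.2 + l.2) x)))).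
  by apply: eq_Rint => x _; rewrite phaseB phaseD cosB cosD; field.
rewrite RintegralZl//; last exact: rintB.
rewrite RintegralB// C1 C2; congr (_ * (_%:R - _%:R)).
  by case: k l {C1 C2 t1 t2} => a b [c d]; rewrite !xpair_eqE !subr_eq0.
by case: k l {C1 C2 t1 t2} => a b [c d]; rewrite !xpair_eqE !addr_eq0.
Qed.

Lemma int_cos_sin k l : \int[leb2]_(x in cell) (cos (phase k x) * sin (phase l x)) = 0 :> R.
Proof.
have [_ C1] := @int_trig R (k.1 - l.1, k.2 - l.2); have [_ C2] := @int_trig R (k.1 + l.1, k.2 + l.2).
have t1 := TP_rint (@TP_sin R _ _ (in_box_self (k.1 - l.1, k.2 - l.2))).
have t2 := TP_rint (@TP_sin R _ _ (in_box_self (k.1 + l.1, k.2 + l.2))).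
transitivity (\int[leb2]_(x in cell) (2^-1 * (sin (phase (k.1 + l.1, k.2 + l.2) x) - sin (phase (k.1 - l.1, k.2 - l.2) x)))).
  by apply: eq_Rint => x _; rewrite phaseB phaseD sinB sinD; field.
rewrite RintegralZl//; last exact: rintB.
by rewrite RintegralB// C1 C2 subrr mulr0.
Qed.

Lemma fourier_smode k l a b :
  fourier_cos (smode k a b) l = (2^-1 * ((k == l)%:R + (k == (- l.1, - l.2))%:R)) *: a /\
  fourier_sin (smode k a b) l = (2^-1 * ((k == l)%:R - (k == (- l.1, - l.2))%:R)) *: b.
Proof.
have cc := TP_rint (TP_mul (@TP_cos R _ _ (in_box_self k)) (TP_cos (in_box_self l))).
have sc := TP_rint (TP_mul (@TP_sin R _ _ (in_box_self k)) (TP_cos (in_box_self l))).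
have cs := TP_rint (TP_mul (@TP_cos R _ _ (in_box_self k)) (TP_sin (in_box_self l))).
have ss := TP_rint (TP_mul (@TP_sin R _ _ (in_box_self k)) (TP_sin (in_box_self l))).
have Ec (p q : R) : \int[leb2]_(x in cell) ((cos (phase k x) * p + sin (phase k x) * q) * cos (phase l x)) =
   2^-1 * ((k == l)%:R + (k == (- l.1, - l.2))%:R) * p.
  transitivity (\int[leb2]_(x in cell) (p * (cos (phase k x) * cos (phase l x)) + q * (sin (phase k x) * cos (phase l x)))).
    by apply: eq_Rint => x _; ring.
  rewrite RintegralD//; [|exact: rintZ..]; rewrite !RintegralZl// int_cos_cos.
  have -> : \int[leb2]_(x in cell) (sin (phase k x) * cos (phase l x)) = 0.
    by rewrite -[RHS](int_cos_sin l k); apply: eq_Rint => x _; rewrite mulrC.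
  by rewrite mulr0 addr0 mulrC.
have Es (p q : R) : \int[leb2]_(x in cell) ((cos (phase k x) * p + sin (phase k x) * q) * sin (phase l x)) =
   2^-1 * ((k == l)%:R - (k == (- l.1, - l.2))%:R) * q.
  transitivity (\int[leb2]_(x in cell) (p * (cos (phase k x) * sin (phase l x)) + q * (sin (phase k x) * sin (phase l x)))).
    by apply: eq_Rint => x _; ring.
  rewrite RintegralD//; [|exact: rintZ..]; rewrite !RintegralZl// int_sin_sin int_cos_sin.
  by rewrite mulr0 add0r mulrC.
by split; congr pair; rewrite /smode/= ?Ec ?Es.
Qed.

(** Real modes are counted twice in the sum over [modes n], once at [k] and once at [-k]. Each of
    the two terms contributes half of the mode, because the mean of a squared cosine or sine is 1/2,
    and [leray] does not distinguish [k] from [-k]. *)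
Lemma Pi_smode_mode n k a b : k \in modes n ->
  Pi_ n (smode k a b) = smode k (leray k a) (leray k b).
Proof.
move=> kn; apply/funext => x; rewrite Pi_smode.
have kN : (- k.1, - k.2) != k.
  move: kn; rewrite mem_modes => /andP[+ _]; case: k => c d; rewrite !xpair_eqE/=.
  by apply: contra => /andP[/eqP h1 /eqP h2]; apply/andP; split; lia.
rewrite (bigD1_seq k)//= ?modes_uniq// -big_filter.
rewrite (bigD1_seq (- k.1, - k.2))//=; last 2 first.
- by rewrite mem_filter kN/=; exact: modes_neg.
- by rewrite filter_uniq ?modes_uniq.
rewrite big1_seq; last first.
  move=> l /andP[lNk]; rewrite mem_filter => /andP[lk _].
  have [-> ->] := fourier_smode k l a b.
  rewrite [k == l]eq_sym (negbTE lk) (_ : (k == (- l.1, - l.2)) = false).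
    by rewrite addr0 subr0 mulr0 !scale0r /smode /leray /dot/= !mulr0 addr0 mul0r scale0r subr0 !scaler0 addr0.
  by apply: contraNF lNk => /eqP ->; rewrite /= !opprK; case: (l).
have [-> ->] := fourier_smode k k a b.
have [-> ->] := fourier_smode k (- k.1, - k.2) a b.
rewrite /= !opprK eqxx [k == (- k.1, - k.2)]eq_sym (negbTE kN) (_ : (k == (k.1, k.2)) = true); last by rewrite -surjective_pairing eqxx.
have ph : phase (- k.1, - k.2) x = - phase k x :> R by rewrite !phaseE/= !mulrNz; ring.
rewrite !lerayZ leray_neg !leray_neg /smode ph cosN sinN.
rewrite addr0 /dot; have nk : normsq (frequency k) != 0 :> R by apply: freq_normsq; move: kn; rewrite mem_modes => /andP[].
by congr pair; rewrite /= -![_ *: _]/(_ * _); field.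
Qed.

Lemma is_derive_smode k (a b x v : R * R) :
  is_derive x v (smode k a b) (phase k v *: smode k b (- a) x).
Proof.
have ic : is_derive x v (fun y => cos (phase k y)) (- phase k v * sin (phase k x)).
  apply: is_derive_line; have := is_derive1_comp (is_derive_cos _) (is_derive_phase k x v 0).
  by rewrite scale0r add0r mulNr mulrC -mulNr.
have is_ : is_derive x v (fun y => sin (phase k y)) (phase k v * cos (phase k x)).
  apply: is_derive_line; have := is_derive1_comp (is_derive_sin _) (is_derive_phase k x v 0).
  by rewrite scale0r add0r mulrC.
have H (p q : R) : is_derive x v (fun y => cos (phase k y) * p + sin (phase k y) * q)
    (phase k v * (cos (phase k x) * q + sin (phase k x) * - p)).
  have := is_deriveD (is_deriveZ p ic) (is_deriveZ q is_).
  rewrite -![_ *: _]/(_ * _) => h.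
  have -> : phase k v * (cos (phase k x) * q + sin (phase k x) * - p) =
    p * (- phase k v * sin (phase k x)) + q * (phase k v * cos (phase k x)) by ring.
  rewrite (_ : (fun y => _) = (fun y => p * cos (phase k y) + q * sin (phase k y)))//.
  by apply/funext => y; ring.
exact: (is_derive_pair (H a.1 b.1) (H a.2 b.2)).
Qed.

Lemma phase_e1 k : phase k e1 = 2 * pi * (frequency k).1 :> R.
Proof. by rewrite phaseE /e1/=; ring. Qed.

Lemma phase_e2 k : phase k e2 = 2 * pi * (frequency k).2 :> R.
Proof. by rewrite phaseE /e2/=; ring. Qed.

Lemma div_smode k a b x : dot (frequency k) a = 0 -> dot (frequency k) b = 0 -> div (smode k a b) x = 0.
Proof.
move=> ha hb; rewrite /div; have [_ ->] := is_derive_smode k a b x e1.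
have [_ ->] := is_derive_smode k a b x e2.
rewrite phase_e1 phase_e2 /smode/= -![_ *: _]/(_ * _).
transitivity (2 * pi * (cos (phase k x) * dot (frequency k) b - sin (phase k x) * dot (frequency k) a)).
  by rewrite /dot /frequency/=; ring.
by rewrite ha hb !mulr0 subrr mulr0.
Qed.

Lemma is_derive_sums (I : Type) (s : seq I) (F : I -> R * R -> R) (F' : I -> R) (x v : R * R) :
  (forall i, is_derive x v (F i) (F' i)) ->
  is_derive x v (fun y => \sum_(i <- s) F i y) (\sum_(i <- s) F' i).
Proof.
move=> dF; elim: s => [|i s IH].
  rewrite big_nil (_ : (fun y => _) = cst 0); first exact: is_derive_cst.
  by apply/funext => y; rewrite big_nil.
rewrite big_cons (_ : (fun y => _) = fun y => F i y + \sum_(j <- s) F j y); first exact: is_deriveD.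
by apply/funext => y; rewrite big_cons.
Qed.

Lemma is_derive_vsum (I : Type) (s : seq I) (F : I -> R * R -> R * R) (F' : I -> R * R) (x v : R * R) :
  (forall i, is_derive x v (F i) (F' i)) ->
  is_derive x v (fun y => \sum_(i <- s) F i y) (\sum_(i <- s) F' i).
Proof.
move=> dF.
have h1 := @is_derive_sums I s (fun i y => (F i y).1) (fun i => (F' i).1) x v (fun i => is_derive_fst (dF i)).
have h2 := @is_derive_sums I s (fun i y => (F i y).2) (fun i => (F' i).2) x v (fun i => is_derive_snd (dF i)).
have := is_derive_pair h1 h2; rewrite -sum_fst -sum_snd -surjective_pairing.
rewrite (_ : (fun y => _) = fun y => \sum_(i <- s) F i y)//.
by apply/funext => y; rewrite -sum_fst -sum_snd -surjective_pairing.
Qed.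

Lemma div_Pi n f x : div (Pi_ n f) x = 0.
Proof.
have -> : Pi_ n f = fun x => \sum_(k <- modes n) smode k (leray k (fourier_cos f k)) (leray k (fourier_sin f k)) x.
  by apply/funext => y; exact: Pi_smode.
have D (v : R * R) := @is_derive_vsum _ (modes n) _ _ x v
  (fun k => is_derive_smode k (leray k (fourier_cos f k)) (leray k (fourier_sin f k)) x v).
rewrite /div; have [_ ->] := D e1; have [_ ->] := D e2.
rewrite sum_fst sum_snd -big_split/= big1_seq// => k; rewrite mem_modes => /andP[_ /andP[k0 _]].
have := div_smode x (dot_freq_leray (fourier_cos f k) k0) (dot_freq_leray (fourier_sin f k) k0).
rewrite /div; have [_ ->] := is_derive_smode k (leray k (fourier_cos f k)) (leray k (fourier_sin f k)) x e1.
by have [_ ->] := is_derive_smode k (leray k (fourier_cos f k)) (leray k (fourier_sin f k)) x e2.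
Qed.

Lemma nablaE m u x : VTP m u -> nabla u x =
  (('D_e1 (fun y => (u y).1) x, 'D_e2 (fun y => (u y).1) x),
   ('D_e1 (fun y => (u y).2) x, 'D_e2 (fun y => (u y).2) x)).
Proof.
move=> [t1 t2].
have H (v : R * R) : 'D_v u x = ('D_v (fun y => (u y).1) x, 'D_v (fun y => (u y).2) x).
  have [_ d1 _] := TP_derive v t1; have [_ d2 _] := TP_derive v t2.
  have -> : u = fun y => ((u y).1, (u y).2) by apply/funext => y; case: (u y).
  by have [_ ->] := is_derive_pair (derivableP (d1 x)) (derivableP (d2 x)).
by rewrite /nabla !H.
Qed.

Lemma divE m u x : VTP m u -> div u x = 'D_e1 (fun y => (u y).1) x + 'D_e2 (fun y => (u y).2) x.
Proof.
by move=> /(nablaE x) E; rewrite -[div u x]/((nabla u x).1.1 + (nabla u x).2.2) E.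
Qed.

Definition conv u x := mulmv (nabla u x) (u x).

Lemma VTP_conv m u : VTP m u -> VTP (m + m) (conv u).
Proof.
move=> tu; have [t1 t2] := tu.
have D1 (v : R * R) := TP_derive v t1; have D2 (v : R * R) := TP_derive v t2.
split; rewrite /conv.
  under eq_fun do rewrite (nablaE _ tu) /mulmv /dot /=.
  by apply: TP_add; apply: TP_mul => //; [case: (D1 e1)|case: (D1 e2)].
under eq_fun do rewrite (nablaE _ tu) /mulmv /dot /=.
by apply: TP_add; apply: TP_mul => //; [case: (D2 e1)|case: (D2 e2)].
Qed.

(** Each of the four products is integrated by parts. The derivative then falls either on the
    transporting component, and these terms add up to a multiple of the divergence, or on [g]. *)
Lemma conv_weak m n u g : VTP m u -> (forall x, div u x = 0) -> VTP n g ->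
  vip (conv u) g = - \int[leb2]_(x in cell) ddot (nabla g x) (tens (u x) (u x)).
Proof.
move=> tu du tg; have [u1 u2] := tu; have [g1 g2] := tg.
have U1 (v : R * R) := TP_derive v u1; have U2 (v : R * R) := TP_derive v u2.
have G1 (v : R * R) := TP_derive v g1; have G2 (v : R * R) := TP_derive v g2.
pose p1 x := (u x).1; pose p2 x := (u x).2; pose q1 x := (g x).1; pose q2 x := (g x).2.
have IBP (v : R * R) (a b c : R * R -> R) : TP m a -> TP m b -> TP n c ->
   \int[leb2]_(x in cell) ('D_v a x * (b x * c x)) =
   - (\int[leb2]_(x in cell) (a x * ('D_v b x * c x))) - (\int[leb2]_(x in cell) (a x * (b x * 'D_v c x))).
  move=> ta tb tc; rewrite (TP_IBP v ta (TP_mul tb tc)) -opprD -RintegralD//.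
  - congr (- _); apply: eq_Rint => x _; have [_ db _] := TP_derive v tb; have [_ dc _] := TP_derive v tc.
    by rewrite (deriveM (db x) (dc x)) -![_ *: _]/(_ * _); ring.
  - have [tb' _ _] := TP_derive v tb; exact: TP_rint (TP_mul ta (TP_mul tb' tc)).
  - have [tc' _ _] := TP_derive v tc; exact: TP_rint (TP_mul ta (TP_mul tb tc')).
have r3 (v : R * R) (a b c : R * R -> R) : TP m a -> TP m b -> TP n c -> rint leb2 cell (fun x => 'D_v a x * (b x * c x)).
  by move=> ta tb tc; have [ta' _ _] := TP_derive v ta; exact: TP_rint (TP_mul ta' (TP_mul tb tc)).
have r3' (v : R * R) (a b c : R * R -> R) : TP m a -> TP m b -> TP n c -> rint leb2 cell (fun x => a x * ('D_v b x * c x)).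
  by move=> ta tb tc; have [tb' _ _] := TP_derive v tb; exact: TP_rint (TP_mul ta (TP_mul tb' tc)).
have r3'' (v : R * R) (a b c : R * R -> R) : TP m a -> TP m b -> TP n c -> rint leb2 cell (fun x => a x * (b x * 'D_v c x)).
  by move=> ta tb tc; have [tc' _ _] := TP_derive v tc; exact: TP_rint (TP_mul ta (TP_mul tb tc')).
have -> : vip (conv u) g =
    \int[leb2]_(x in cell) ('D_e1 p1 x * (p1 x * q1 x)) + \int[leb2]_(x in cell) ('D_e2 p1 x * (p2 x * q1 x)) +
    (\int[leb2]_(x in cell) ('D_e1 p2 x * (p1 x * q2 x)) + \int[leb2]_(x in cell) ('D_e2 p2 x * (p2 x * q2 x))).
  rewrite (Rint_add4 mc (r3 e1 _ _ _ u1 u1 g1) (r3 e2 _ _ _ u1 u2 g1) (r3 e1 _ _ _ u2 u1 g2) (r3 e2 _ _ _ u2 u2 g2)).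
  by apply: eq_Rint => x _; rewrite /conv (nablaE _ tu) /mulmv /dot /=; ring.
rewrite !IBP//.
(* The two terms with the derivative on the transporting component combine into [p] times the
   divergence of [u] times [q]. *)
have dz (q : R * R -> R) (p : R * R -> R) : TP n q -> TP m p ->
    \int[leb2]_(x in cell) (p x * ('D_e1 p1 x * q x)) + \int[leb2]_(x in cell) (p x * ('D_e2 p2 x * q x)) = 0.
  move=> tq tp; rewrite -RintegralD//; [|exact: r3'..].
  rewrite (@eq_Rint _ _ _ _ _ _ (fun=> 0)) ?Rintegral_cst ?mul0r// => x _.
  by have := du x; rewrite (divE _ tu) => h; rewrite -mulrDr -mulrDl h mul0r mulr0.
have -> : \int[leb2]_(x in cell) ddot (nabla g x) (tens (u x) (u x)) =
    \int[leb2]_(x in cell) (p1 x * (p1 x * 'D_e1 q1 x)) + \int[leb2]_(x in cell) (p1 x * (p2 x * 'D_e2 q1 x)) +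
    (\int[leb2]_(x in cell) (p2 x * (p1 x * 'D_e1 q2 x)) + \int[leb2]_(x in cell) (p2 x * (p2 x * 'D_e2 q2 x))).
  rewrite (Rint_add4 mc (r3'' e1 _ _ _ u1 u1 g1) (r3'' e2 _ _ _ u1 u2 g1) (r3'' e1 _ _ _ u2 u1 g2) (r3'' e2 _ _ _ u2 u2 g2)).
  by apply: eq_Rint => x _; rewrite (nablaE _ tg) /ddot /tens /dot /=; rewrite -/(p1 x) -/(p2 x); ring.
have alg (a1 a2 a3 a4 b1 b2 b3 b4 : R) : a1 + a2 = 0 -> a3 + a4 = 0 ->
    - a1 - b1 + (- a2 - b2) + (- a3 - b3 + (- a4 - b4)) = - (b1 + b2 + (b3 + b4)) by lra.
exact: (alg _ _ _ _ _ _ _ _ (dz q1 p1 g1 u1) (dz q2 p2 g2 u2)).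
Qed.

End vector_fields.

(** * The Galerkin system *)

Section quadrature_in_time.
Context {R : realType}.

Lemma is_derive_ord_sum (n : nat) (F : 'I_n -> R -> R) (F' : 'I_n -> R) (t : R) :
  (forall i, is_derive t 1 (F i) (F' i)) ->
  is_derive t 1 (fun s => \sum_(i < n) F i s) (\sum_(i < n) F' i).
Proof.
move=> dF; elim: (index_enum _) => [|i s IH].
  rewrite big_nil (_ : (fun y => _) = cst 0); first exact: is_derive_cst.
  by apply/funext => y; rewrite big_nil.
rewrite big_cons (_ : (fun y => _) = fun y => F i y + \sum_(j <- s) F j y); first exact: is_deriveD.
by apply/funext => y; rewrite big_cons.
Qed.

Lemma is_derive_quad M (f : R -> R * R -> R) (f' : R * R -> R) (t : R) :
  (forall x, is_derive t 1 (fun s => f s x) (f' x)) ->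
  is_derive t 1 (fun s => quad M (f s)) (quad M f').
Proof.
move=> df; apply: is_deriveZ; apply: is_derive_ord_sum => i.
by apply: is_derive_ord_sum => j; exact: df.
Qed.

Lemma within_continuous_quad M (A : set R) (f : R -> R * R -> R) :
  (forall x, {within A, continuous (fun s => f s x)}) ->
  {within A, continuous (fun s => quad M (f s))}.
Proof.
move=> cf t; apply: cvgM; first exact: cvg_cst.
have FF := nbhs_filter (t : subspace A).
apply: (@cvg_bigsum R _ _ FF M (fun i s => \sum_(j < M) f s (i%:R / M%:R, j%:R / M%:R))) => i.
apply: (@cvg_bigsum R _ _ FF M (fun j s => f s (i%:R / M%:R, j%:R / M%:R))) => j.
exact: cf.
Qed.

Lemma within_continuous_fst (A : set R) (f : R -> R * R) :
  {within A, continuous f} -> {within A, continuous (fun s => (f s).1)}.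
Proof.
by move=> cf t; have := @cvg_comp _ _ _ _ fst _ _ _ (cf t) (@cvg_fst _ _ _ _ _); exact.
Qed.

Lemma within_continuous_snd (A : set R) (f : R -> R * R) :
  {within A, continuous f} -> {within A, continuous (fun s => (f s).2)}.
Proof.
by move=> cf t; have := @cvg_comp _ _ _ _ snd _ _ _ (cf t) (@cvg_snd _ _ _ _ _); exact.
Qed.

Lemma within_continuous_dot (A : set R) (f g : R -> R * R) :
  {within A, continuous f} -> {within A, continuous g} ->
  {within A, continuous (fun s => dot (f s) (g s))}.
Proof.
move=> cf cg t; apply: cvgD; apply: cvgM.
- exact: (within_continuous_fst cf).
- exact: (within_continuous_fst cg).
- exact: (within_continuous_snd cf).
- exact: (within_continuous_snd cg).
Qed.

Lemma is_derive_dot (f g : R -> R * R) (t : R) (f' g' : R * R) :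
  is_derive t 1 f f' -> is_derive t 1 g g' ->
  is_derive t 1 (fun s => dot (f s) (g s)) (dot f' (g t) + dot (f t) g').
Proof.
move=> df dg.
have h := is_deriveD (is_deriveM (is_derive_fst df) (is_derive_fst dg))
                     (is_deriveM (is_derive_snd df) (is_derive_snd dg)).
rewrite (_ : _ + _ = (f t).1 *: g'.1 + (g t).1 *: f'.1 + ((f t).2 *: g'.2 + (g t).2 *: f'.2)); first exact: h.
by rewrite /dot -![_ *: _]/(_ * _); ring.
Qed.

Lemma dot_mulmv (A : (R * R) * (R * R)) (z : R * R) :
  dot (mulmv A z) z = ddot A (tens z z).
Proof. by case: A z => -[a b] [c d] [x y]; rewrite /mulmv /ddot /tens /dot/=; ring. Qed.

Lemma MVT_bound (f df : R -> R) (a b L : R) : a <= b ->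
  (forall x, a < x < b -> is_derive x 1 f (df x)) -> {within `[a, b], continuous f} ->
  (forall x, a < x < b -> `|df x| <= L) -> `|f b - f a| <= L * (b - a).
Proof.
rewrite le_eqVlt => /predU1P[<-|ab] dF cf dL; first by rewrite !subrr normr0 mulr0.
have dF' (x : R) : x \in `]a, b[ -> is_derive x 1 f (df x) by rewrite in_itv/=; exact: dF.
have [c] := MVT ab dF' cf.
rewrite in_itv/= => cab ->; rewrite normrM [X in _ * X]ger0_norm ?subr_ge0 ?(ltW ab)//.
by rewrite ler_wpM2r ?subr_ge0 ?(ltW ab)// dL.
Qed.

End quadrature_in_time.

Section galerkin.
Context {R : realType}.
Local Notation mR := (measurableTypeR R).
Local Notation leb := (@lebesgue_measure R).
Local Notation cell := (@cell R).
Local Notation leb2 := (@leb2 R).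
Variables (n : nat) (u0 : L2sigma R) (u : R -> L2sigma R).
Hypothesis gal : galerkin_solution n u0 u.

Let u_Pi t : 0 <= t -> u t = Pi_ n (u t) :> (R * R -> R * R).
Proof. by case: gal => h _ _ _ t0; apply/funext => x; exact: h. Qed.

Lemma galerkin_VTP t : 0 <= t -> VTP n (u t).
Proof. by move=> t0; rewrite u_Pi//; exact: VTP_Pi. Qed.

Lemma galerkin_div t x : 0 <= t -> div (u t) x = 0.
Proof. by move=> t0; rewrite u_Pi//; exact: div_Pi. Qed.

Let u_cont x (a b : R) : 0 <= a -> {within `[a, b], continuous (fun t => u t x)}.
Proof.
case: gal => _ h _ _ a0; apply: continuous_subspaceW (h x).
by move=> t /=; rewrite !in_itv/= andbT => /andP[h1 _]; exact: le_trans h1.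
Qed.

Let u_der (t : R) x : 0 < t -> is_derive t 1 (fun s => u s x) (- Pi_ n (conv (u t)) x).
Proof. by case: gal => _ _ h _; exact: h. Qed.

Let VL2u t : VL2 (u t).
Proof. exact: in_L2sigma_VL2 (L2funP _). Qed.

(** The projection is moved to [G], where it acts trivially up to a constant field; a constant pairs
    to 0 with the convective term because its gradient vanishes. The constant is needed since test
    fields may have a mean, which [Pi_ n] removes. *)
Lemma vip_conv_Pi t m G : 0 <= t -> VTP m G ->
  (exists c, forall x, G x = Pi_ n G x + c) ->
  vip (Pi_ n (conv (u t))) G = - \int[leb2]_(x in cell) ddot (nabla G x) (tens (u t x) (u t x)).
Proof.
move=> t0 tG [c Gc]; have tc := VTP_conv (galerkin_VTP t0).
rewrite -(conv_weak (galerkin_VTP t0) (fun x => galerkin_div x t0) tG).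
rewrite (vip_Pi_sym n (VTP_VL2 tc) (VTP_VL2 tG)).
have tcst : VTP 0 (fun=> c : R * R) by split; exact: TP_cst.
have -> : vip (conv (u t)) G = vip (conv (u t)) (fun x => Pi_ n G x + c).
  by congr (vip _ _); apply/funext.
rewrite ![vip (conv (u t)) _]vipC vipDl//; [|exact: VTP_VL2 (VTP_Pi n G)|exact: VTP_VL2 tcst|exact: VTP_VL2 tc].
rewrite [X in _ + X]vipC (conv_weak (galerkin_VTP t0) (fun x => galerkin_div x t0) tcst).
have mc := @measurable_cell R.
suff -> : \int[leb2]_(x in cell) ddot (nabla (fun=> c : R * R) x) (tens (u t x) (u t x)) = 0 by rewrite oppr0 addr0.
rewrite -(mul0r (fine (leb2 cell))) -Rintegral_cst//; apply: eq_Rint.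
by move=> x _; rewrite /nabla !derive_cst /ddot /dot/= !mul0r !addr0.
Qed.

(** The energy is a grid sum, so its derivative is -2 times the pairing of the projected convection
    with the solution. The solution is fixed by [Pi_ n], and the convection of a solenoidal field is
    orthogonal to the field itself. The equation holds for positive times only; continuity up to
    time 0 is what the mean value theorem requires. *)
Lemma galerkin_energy (t : R) : 0 <= t -> vip (u t) (u t) = vip u0 u0.
Proof.
move=> t0; pose M := (n + n).+1; pose F s := quad M (fun x => dot (u s x) (u s x)).
have FE s : 0 <= s -> vip (u s) (u s) = F s.
  by move=> s0; apply: (VTP_quad (galerkin_VTP s0) (galerkin_VTP s0)).
have <- : vip (u 0) (u 0) = vip u0 u0.
  case: gal => _ _ _ ae0; rewrite /vip /Rintegral; congr fine.
  apply: ae_eq_integral.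
  - exact: measurable_cell.
  - by apply/measurable_EFinP; exact: rint_measurable (VL2_rint (VL2u 0) (VL2u 0)).
  - by apply/measurable_EFinP; exact: rint_measurable (VL2_rint (in_L2sigma_VL2 (L2funP u0)) (in_L2sigma_VL2 (L2funP u0))).
  - rewrite /ae_cell in ae0; by apply: filterS ae0 => x h cx; rewrite h.
rewrite !FE//; apply/eqP; rewrite -subr_eq0 -normr_le0 -[leRHS](mul0r (t - 0)).
apply: (@MVT_bound _ F (fun=> 0)) => //.
- move=> s /andP[s0 _]; have := is_derive_quad M (fun x => is_derive_dot (u_der x s0) (u_der x s0)).
  have s0' := ltW s0; have ts := galerkin_VTP s0'.
  rewrite (_ : quad M _ = 0)//.
  have tP := VTP_Pi n (conv (u s)).
  transitivity (quad M (fun x => (-2) * dot (Pi_ n (conv (u s)) x) (u s x))).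
    by congr quad; apply/funext => x; rewrite /dot/=; ring.
  rewrite quadZ -(VTP_quad tP ts)// (vip_conv_Pi s0' ts).
    (* Tested against the solution itself, the weak form equates the convective integral with its
       own opposite. *)
    have E := conv_weak ts (fun x => galerkin_div x s0') ts.
    have : vip (conv (u s)) (u s) = \int[leb2]_(x in cell) ddot (nabla (u s) x) (tens (u s x) (u s x)).
      by apply: eq_Rint => x _; exact: dot_mulmv.
    by move: E; set I := vip (conv _) _; set J := Rintegral _ _ _; lra.
  by exists 0 => x; rewrite addr0 -u_Pi.
- by apply: within_continuous_quad => x; apply: within_continuous_dot; exact: u_cont.
- by move=> s _; rewrite normr0.
Qed.

Section weak_form.
Variables (p : nat) (G G' : R -> R * R -> R * R) (tau : R).
Hypothesis tau0 : 0 < tau.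
Hypothesis tG : forall t, VTP p (G t).
Hypothesis tG' : forall t, VTP p (G' t).
Hypothesis dG : forall (t : R) x, is_derive t 1 (fun s => G s x) (G' t x).
Hypothesis PiG : forall t, 0 <= t -> exists c, forall x, G t x = Pi_ n (G t) x + c.

(** The time derivative of [vip (u t) (G t)], after the projected convection has been turned into
    the gradient term by [vip_conv_Pi]. *)
Definition galerkin_rate (t : R) := vip (u t) (G' t) +
  \int[leb2]_(x in cell) ddot (nabla (G t) x) (tens (u t x) (u t x)).

(** The gradient term has two factors of degree [n] and one of degree [p]; with more nodes than this
    degree the quadrature is exact for all the integrals of this section. *)
Let M := (n + n + p).+1.

Let H s := quad M (fun x => dot (u s x) (G s x)).

Let HE s : 0 <= s -> vip (u s) (G s) = H s.
Proof.
by move=> s0; apply: (VTP_quad (galerkin_VTP s0) (tG s)); rewrite /M ltnS -addnA leq_addl.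
Qed.

Let dH (t : R) : 0 < t -> is_derive t 1 H (galerkin_rate t).
Proof.
move=> t0; have t0' := ltW t0; have := is_derive_quad M (fun x => is_derive_dot (u_der x t0) (dG t x)).
rewrite (_ : quad M _ = galerkin_rate t)//.
have ts := galerkin_VTP t0'; have tP := VTP_Pi n (conv (u t)).
rewrite quadD -(VTP_quad ts (tG' t)); last by rewrite /M ltnS -addnA leq_addl.
rewrite addrC /galerkin_rate; congr (_ + _).
transitivity (quad M (fun x => (-1) * dot (Pi_ n (conv (u t)) x) (G t x))).
  by congr quad; apply/funext => x; rewrite /dot/=; ring.
rewrite quadZ -(VTP_quad tP (tG t)); last by rewrite /M ltnS -addnA leq_addl.
by rewrite (vip_conv_Pi t0' (tG t) (PiG t0')) mulN1r opprK.
Qed.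

Let cG x (a b : R) : {within `[a, b], continuous (fun t => G t x)}.
Proof.
apply: continuous_subspaceT => /= t0; pose t : R := t0.
have h1 := is_derive_fst (dG t x); have h2 := is_derive_snd (dG t x).
have c1 : (fun s => (G s x).1) @ t --> (G t x).1.
  by apply: (differentiable_continuous (x := t)); apply/derivable1_diffP; case: h1.
have c2 : (fun s => (G s x).2) @ t --> (G t x).2.
  by apply: (differentiable_continuous (x := t)); apply/derivable1_diffP; case: h2.
have E : (fun s => ((G s x).1, (G s x).2)) = (fun s => G s x).
  by apply/funext => s; case: (G s x).
have := cvg_pair c1 c2; rewrite E => /(_ _ _ _).
by apply; exact: nbhs_filter.
Qed.

Lemma galerkin_lipschitz (L a b : R) : 0 <= a <= b ->
  (forall t, a < t < b -> `|galerkin_rate t| <= L) ->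
  `|vip (u b) (G b) - vip (u a) (G a)| <= L * (b - a).
Proof.
move=> /andP[a0 ab] HL; rewrite !HE//; last exact: le_trans ab.
apply: (MVT_bound ab _ _ HL).
  by move=> x /andP[ax _]; apply: dH; exact: le_lt_trans ax.
by apply: within_continuous_quad => x; apply: within_continuous_dot; [exact: u_cont|exact: cG].
Qed.

Hypothesis cG' : forall x, continuous (fun t => G' t x).
Hypothesis cDG : forall (x v : R * R), v = e1 \/ v = e2 -> continuous (fun t => ('D_v (G t) x).1) /\ continuous (fun t => ('D_v (G t) x).2).

Lemma galerkin_weak : rint leb `[0, tau] galerkin_rate /\
  vip (u tau) (G tau) - vip u0 (G 0) = \int[leb]_(t in `[0, tau]) galerkin_rate t.
Proof.
have cR : {within `[0, tau], continuous galerkin_rate}.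
  (* On the interval the rate coincides with a grid sum, whose continuity in time is that of the
     point values. *)
  pose h (t : R) := quad M (fun x => dot (u t x) (G' t x)) + quad M (fun x => ddot (nabla (G t) x) (tens (u t x) (u t x))).
  have hE : {in ([set` `[0, tau]] : set R), h =1 galerkin_rate}.
    move=> t /set_mem; rewrite /= in_itv/= => /andP[t0 _]; have ts := galerkin_VTP t0.
    rewrite /h /galerkin_rate (VTP_quad (M := M) ts (tG' t)); last by rewrite /M ltnS -addnA leq_addl.
    congr (_ + _); apply/esym; apply: (@TP_quad _ (n + n + p)) => //.
    have [t1 t2] := ts; have [g1 g2] := tG t.
    have Q (f g q : R * R -> R) : TP n f -> TP n g -> TP p q -> TP (n + n + p) (fun x => q x * (f x * g x)).
      by move=> tf tg tq; apply: (TP_ext _ (TP_mul (TP_mul tf tg) tq)) => x; rewrite mulrC.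
    have D1 v := TP_derive v g1; have D2 v := TP_derive v g2.
    apply: (TP_ext (f := fun x => ('D_e1 (fun y => (G t y).1) x * ((u t x).1 * (u t x).1) + 'D_e2 (fun y => (G t y).1) x * ((u t x).1 * (u t x).2)) +
      ('D_e1 (fun y => (G t y).2) x * ((u t x).2 * (u t x).1) + 'D_e2 (fun y => (G t y).2) x * ((u t x).2 * (u t x).2)))).
      by move=> x; rewrite (nablaE _ (tG t)).
    by do 2!apply: TP_add; apply: Q => //; first [by case: (D1 e1)|by case: (D1 e2)|by case: (D2 e1)|by case: (D2 e2)].
  have ch : {within `[0, tau], continuous h}.
    move=> t; apply: cvgD.
      apply: within_continuous_quad => x; apply: within_continuous_dot; first exact: u_cont.
      exact: continuous_subspaceT.
    apply: within_continuous_quad => x {}t.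
    have cu1 := within_continuous_fst (@u_cont x 0 tau (lexx 0)).
    have cu2 := within_continuous_snd (@u_cont x 0 tau (lexx 0)).
    have cD v1 := @cDG x v1.
    have c1 v1 (hv : v1 = e1 \/ v1 = e2) : {within `[0, tau], continuous (fun t => ('D_v1 (G t) x).1)} by apply: continuous_subspaceT; case: (cD v1 hv).
    have c2 v1 (hv : v1 = e1 \/ v1 = e2) : {within `[0, tau], continuous (fun t => ('D_v1 (G t) x).2)} by apply: continuous_subspaceT; case: (cD v1 hv).
    have c11 := c1 _ (or_introl erefl); have c12 := c1 _ (or_intror erefl).
    have c21 := c2 _ (or_introl erefl); have c22 := c2 _ (or_intror erefl).
    apply: cvgD; apply: cvgD.
    - by apply: cvgM; [exact: c11|apply: cvgM; exact: cu1].
    - by apply: cvgM; [exact: c12|apply: cvgM; [exact: cu1|exact: cu2]].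
    - by apply: cvgM; [exact: c21|apply: cvgM; [exact: cu2|exact: cu1]].
    - by apply: cvgM; [exact: c22|apply: cvgM; exact: cu2].
  by move: ch; apply: subspace_eq_continuous; exact: hE.
split; first exact: within_rint.
have <- : vip (u 0) (G 0) = vip u0 (G 0).
  case: gal => _ _ _ ae0; rewrite /vip /Rintegral; congr fine.
  have V0 := VTP_VL2 (tG 0).
  apply: ae_eq_integral.
  - exact: measurable_cell.
  - by apply/measurable_EFinP; exact: rint_measurable (VL2_rint (VL2u 0) V0).
  - by apply/measurable_EFinP; exact: rint_measurable (VL2_rint (in_L2sigma_VL2 (L2funP u0)) V0).
  - rewrite /ae_cell in ae0; by apply: filterS ae0 => x h cx; rewrite h.
rewrite !HE ?(ltW tau0)//; apply/esym; apply: (@Rint_FTC _ _ H) => //.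
- by apply: within_continuous_quad => x; apply: within_continuous_dot; [exact: u_cont|exact: cG].
- by move=> t /andP[t0 _]; exact: dH.
Qed.

End weak_form.
End galerkin.

(** * Fejer approximation *)

Section fejer_kernel.
Context {R : realType}.
Local Notation mR := (measurableTypeR R).
Local Notation cell := (@cell R).
Local Notation leb2 := (@leb2 R).
Implicit Types (f : R * R -> R) (x y z : R * R) (k : int * int) (N : nat).

Let mc := @measurable_cell R.

Lemma phase_subr k x y : phase k (x - y) = phase k x - phase k y :> R.
Proof. by rewrite !phaseE/=; ring. Qed.

(** Invariance of the integral under reflection and translation; on trigonometric polynomials it
    follows from the addition formulas and needs no change of variables. *)
Lemma TP_reflect m f x : TP m f ->
  TP m (fun y => f (x - y)) /\ \int[leb2]_(y in cell) f (x - y) = \int[leb2]_(y in cell) f y.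
Proof.
elim=> {m f} [m k b|m k b|m f g tf [tf' If] tg [tg' Ig]|m c f tf [tf' If]].
- have t : TP m (fun y => cos (phase k x) * cos (phase k y) + sin (phase k x) * sin (phase k y)).
    by apply: TP_add; apply: TP_scale; [exact: TP_cos|exact: TP_sin].
  have E y : cos (phase k (x - y)) = cos (phase k x) * cos (phase k y) + sin (phase k x) * sin (phase k y).
    by rewrite phase_subr cosB.
  split; first by apply: TP_ext t => y; rewrite E.
  transitivity (\int[leb2]_(y in cell) (cos (phase k x) * cos (phase k y) + sin (phase k x) * sin (phase k y))); first by apply: eq_Rint => y _; rewrite E.
  rewrite RintegralD//; [|exact: TP_rint (TP_scale _ (TP_cos b))|exact: TP_rint (TP_scale _ (TP_sin b))].
  rewrite !RintegralZl//; [|exact: TP_rint (TP_sin b)|exact: TP_rint (TP_cos b)].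
  have [-> ->] := @int_trig R k; rewrite mulr0 addr0.
  by case: eqP => [->|]; rewrite ?mulr0// phase0 cos0 mulr1.
- have t : TP m (fun y => sin (phase k x) * cos (phase k y) + (- cos (phase k x)) * sin (phase k y)).
    by apply: TP_add; apply: TP_scale; [exact: TP_cos|exact: TP_sin].
  have E y : sin (phase k (x - y)) = sin (phase k x) * cos (phase k y) + (- cos (phase k x)) * sin (phase k y).
    by rewrite phase_subr sinB mulNr.
  split; first by apply: TP_ext t => y; rewrite E.
  transitivity (\int[leb2]_(y in cell) (sin (phase k x) * cos (phase k y) + (- cos (phase k x)) * sin (phase k y))); first by apply: eq_Rint => y _; rewrite E.
  rewrite RintegralD//; [|exact: TP_rint (TP_scale _ (TP_cos b))|exact: TP_rint (TP_scale _ (TP_sin b))].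
  rewrite !RintegralZl//; [|exact: TP_rint (TP_sin b)|exact: TP_rint (TP_cos b)].
  have [-> ->] := @int_trig R k; rewrite mulr0 addr0.
  by case: eqP => [->|]; rewrite ?mulr0// phase0 sin0 mul0r.
- split; first exact: TP_add.
  by rewrite !RintegralD ?If ?Ig//; [exact: TP_rint tf|exact: TP_rint tg|exact: TP_rint tf'|exact: TP_rint tg'].
- split; first exact: TP_scale.
  by rewrite !RintegralZl ?If//; [exact: TP_rint tf|exact: TP_rint tf'].
Qed.

Definition freqB N (a b : 'I_N * 'I_N) : int * int :=
  (a.1%:Z - b.1%:Z, a.2%:Z - b.2%:Z).

Lemma freqB_box N (a b : 'I_N * 'I_N) : in_box N (freqB a b).
Proof.
case: a b => a1 a2 [b1 b2]; rewrite /in_box /freqB/=; apply/andP.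
have := ltn_ord a1; have := ltn_ord a2; have := ltn_ord b1; have := ltn_ord b2.
by move: (val a1) (val a2) (val b1) (val b2) => ? ? ? ? ? ? ? ?; split; lia.
Qed.

(** The squared modulus of the sum of exp(2 i pi a.z) over 0 <= a_1, a_2 < N, divided by N^2: the
    product of two one-dimensional Fejer kernels, expanded into real modes. *)
Definition fejer_kernel N z : R :=
  N%:R ^- 2 * \sum_(a : 'I_N * 'I_N) \sum_(b : 'I_N * 'I_N) cos (phase (freqB a b) z).

Lemma TP_double_sum N m (F : 'I_N * 'I_N -> 'I_N * 'I_N -> R * R -> R) :
  (forall a b, TP m (F a b)) -> TP m (fun z => \sum_a \sum_b F a b z).
Proof. by move=> H; apply: TP_sum => a _; apply: TP_sum => b _; exact: H. Qed.

Lemma TP_fejer_kernel N : TP N (fejer_kernel N).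
Proof.
by apply: TP_scale; apply: TP_double_sum => a b; apply: TP_cos; exact: freqB_box.
Qed.

Lemma fejer_kernel_ge0 N z : 0 <= fejer_kernel N z.
Proof.
rewrite mulr_ge0 ?invr_ge0 ?sqr_ge0//.
have -> : \sum_(a : 'I_N * 'I_N) \sum_(b : 'I_N * 'I_N) cos (phase (freqB a b) z) =
    (\sum_(a : 'I_N * 'I_N) cos (phase (a.1%:Z, a.2%:Z) z)) ^+ 2 +
    (\sum_(a : 'I_N * 'I_N) sin (phase (a.1%:Z, a.2%:Z) z)) ^+ 2.
  rewrite !expr2 !big_distrlr/= -big_split; apply: eq_bigr => a _.
  rewrite -big_split; apply: eq_bigr => b _ /=.
  by rewrite -cosB -phaseB.
by rewrite addr_ge0// sqr_ge0.
Qed.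

Lemma int_double_sum N m (F : 'I_N * 'I_N -> 'I_N * 'I_N -> R * R -> R) :
  (forall a b, TP m (F a b)) ->
  \int[leb2]_(z in cell) \sum_a \sum_b F a b z = \sum_a \sum_b \int[leb2]_(z in cell) F a b z.
Proof.
move=> H; rewrite Rint_sum//.
  by apply: eq_bigr => a _; rewrite Rint_sum// => b; exact: TP_rint (H a b).
by move=> a; apply: (@TP_rint _ m); apply: TP_sum => b _.
Qed.

Lemma sum_eq_ord N (F : 'I_N -> int) (c : int) (i : 'I_N) : injective F -> F i = c ->
  \sum_(j < N) ((F j == c)%:R : R) = 1.
Proof.
move=> Fi Fc; rewrite (bigD1 i)//= Fc eqxx big1 ?addr0// => j ji.
by rewrite -Fc (inj_eq Fi) (negbTE ji).
Qed.

Let subint_inj N (l : 'I_N) : injective (fun j : 'I_N => j%:Z - l%:Z).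
Proof. by move=> i j /addIr [] /val_inj. Qed.

Lemma sum_diff0 N : \sum_(l < N) \sum_(j < N) ((j%:Z - l%:Z == 0)%:R : R) = N%:R.
Proof.
transitivity (\sum_(l < N) (1 : R)); last by rewrite sumr_const card_ord.
apply: eq_bigr => l _; rewrite (@sum_eq_ord _ (fun j => j%:Z - l%:Z) 0 l) ?subrr//.
Qed.

Lemma sum_diff1 N : \sum_(l < N.+1) \sum_(j < N.+1) ((j%:Z - l%:Z == 1)%:R : R) = N%:R.
Proof.
rewrite big_ord_recr/= [X in _ + X]big1 ?addr0; last first.
  move=> j _; have -> : (j%:Z - N%:Z == 1) = false by apply/eqP; have := ltn_ord j; lia.
  by [].
transitivity (\sum_(l < N) (1 : R)); last by rewrite sumr_const card_ord.
apply: eq_bigr => l _; have lN : (l.+1 < N.+1)%N by rewrite ltnS ltn_ord.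
rewrite (@sum_eq_ord _ (fun j => j%:Z - l%:Z) 1 (Ordinal lN)) //=; last by lia.
by move=> i j /addIr [] /val_inj.
Qed.

Lemma sum_freqB N (p q : int) :
  \sum_(b : 'I_N * 'I_N) \sum_(a : 'I_N * 'I_N) ((freqB a b == (p, q))%:R : R) =
  (\sum_(l < N) \sum_(j < N) ((j%:Z - l%:Z == p)%:R : R)) *
  (\sum_(l < N) \sum_(j < N) ((j%:Z - l%:Z == q)%:R : R)).
Proof.
rewrite -(pair_bigA _ (fun b1 b2 => \sum_(a : 'I_N * 'I_N) ((freqB a (b1, b2) == (p, q))%:R : R)))/=.
rewrite mulr_suml; apply: eq_bigr => b1 _; rewrite mulr_sumr; apply: eq_bigr => b2 _.
rewrite -(pair_bigA _ (fun a1 a2 => ((freqB (a1, a2) (b1, b2) == (p, q))%:R : R)))/=.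
rewrite mulr_suml; apply: eq_bigr => a1 _; rewrite mulr_sumr; apply: eq_bigr => a2 _.
by rewrite /freqB xpair_eqE/= -natrM mulnb.
Qed.

Lemma fejer_kernel_mean N : (0 < N)%N -> \int[leb2]_(z in cell) fejer_kernel N z = 1.
Proof.
move=> N0; have tc a b := @TP_cos R _ _ (@freqB_box N a b).
rewrite /fejer_kernel RintegralZl//; last exact: TP_rint (TP_double_sum tc).
rewrite (int_double_sum tc) exchange_big/=.
transitivity (N%:R ^- 2 * \sum_(b : 'I_N * 'I_N) \sum_(a : 'I_N * 'I_N) ((freqB a b == (0, 0))%:R : R)).
  by congr (_ * _); apply: eq_bigr => a _; apply: eq_bigr => b _; have [-> _] := @int_trig R (freqB b a).
by rewrite sum_freqB !sum_diff0 -expr2 mulVf// expf_neq0// pnatr_eq0 -lt0n.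
Qed.

(** Among N + 1 consecutive integers N ordered pairs differ by 1 and N + 1 by 0. Since the kernel
    has mass 1, it gives the function 1 - cos in each coordinate the integral 1/(N + 1), which
    expresses its concentration at the lattice points. *)
Lemma fejer_kernel_cos N (e : int * int) : (e = (1, 0)) \/ (e = (0, 1)) ->
  \int[leb2]_(z in cell) (fejer_kernel N.+1 z * cos (phase e z)) = N%:R / N.+1%:R.
Proof.
move=> he; have tc a b := TP_mul (@TP_cos R _ _ (in_box_self e)) (@TP_cos R _ _ (@freqB_box N.+1 a b)).
transitivity (\int[leb2]_(z in cell) (N.+1%:R ^- 2 *
    \sum_(a : 'I_N.+1 * 'I_N.+1) \sum_(b : 'I_N.+1 * 'I_N.+1) (cos (phase e z) * cos (phase (freqB a b) z)))).
  apply: eq_Rint => z _; rewrite /fejer_kernel -mulrA; congr (_ * _).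
  rewrite mulr_suml; apply: eq_bigr => a _; rewrite mulr_suml; apply: eq_bigr => b _.
  by rewrite mulrC.
rewrite RintegralZl//; last exact: TP_rint (TP_double_sum tc).
rewrite (int_double_sum tc).
have S (k : int * int) : (k = (1, 0)) \/ (k = (0, 1)) ->
    \sum_(b : 'I_N.+1 * 'I_N.+1) \sum_(a : 'I_N.+1 * 'I_N.+1) ((freqB a b == k)%:R : R) = N%:R * N.+1%:R.
  by case=> ->; rewrite sum_freqB sum_diff0 sum_diff1// mulrC.
transitivity (N.+1%:R ^- 2 * (2^-1 * (
  (\sum_(a : 'I_N.+1 * 'I_N.+1) \sum_(b : 'I_N.+1 * 'I_N.+1) ((freqB a b == e)%:R : R)) +
  (\sum_(b : 'I_N.+1 * 'I_N.+1) \sum_(a : 'I_N.+1 * 'I_N.+1) ((freqB a b == e)%:R : R))))).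
  congr (_ * _); rewrite -big_split/= mulr_sumr; apply: eq_bigr => a _.
  rewrite -big_split/= mulr_sumr; apply: eq_bigr => b _.
  rewrite int_cos_cos; congr (_ * (_%:R + _%:R)); first by rewrite eq_sym.
  congr nat_of_bool; case: a b e {he S tc} => a1 a2 [b1 b2] [p q]; rewrite /freqB !xpair_eqE/=.
  congr andb; apply/eqP/eqP; lia.
rewrite [X in _ * (_ * (X + _))]exchange_big/= !S//; have : (N.+1%:R : R) != 0 by rewrite pnatr_eq0.
by move: (N.+1%:R : R) (N%:R : R) => s t s0; field.
Qed.

(** Convolution with [fejer_kernel N], expanded over the modes. In this form it is visibly a
    trigonometric polynomial, derivatives act only on cosines and sines, and the Fourier
    coefficients of [f] are merely multiplied by scalars. *)
Definition fejer N f x : R := N%:R ^- 2 * \sum_(a : 'I_N * 'I_N) \sum_(b : 'I_N * 'I_N)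
  (cos (phase (freqB a b) x) * (\int[leb2]_(y in cell) (f y * cos (phase (freqB a b) y))) +
   sin (phase (freqB a b) x) * \int[leb2]_(y in cell) (f y * sin (phase (freqB a b) y))).

Lemma L2_TP m f : TP m f -> L2 leb2 cell f.
Proof. by move=> /TP_continuous; exact: continuous_L2. Qed.

Lemma fejer_conv N f x : L2 leb2 cell f ->
  fejer N f x = \int[leb2]_(y in cell) (f y * fejer_kernel N (x - y)).
Proof.
move=> lf; have lc k := L2_TP (@TP_cos R _ _ (in_box_self k)).
have ls k := L2_TP (@TP_sin R _ _ (in_box_self k)).
have rc k := L2_prod mc lf (lc k); have rs k := L2_prod mc lf (ls k).
have rr a b := rintD mc (rintZ mc (cos (phase (@freqB N a b) x)) (rc (freqB a b)))
  (rintZ mc (sin (phase (freqB a b) x)) (rs (freqB a b))).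
transitivity (\int[leb2]_(y in cell) (N%:R ^- 2 * \sum_(a : 'I_N * 'I_N) \sum_(b : 'I_N * 'I_N)
   (cos (phase (freqB a b) x) * (f y * cos (phase (freqB a b) y)) +
    sin (phase (freqB a b) x) * (f y * sin (phase (freqB a b) y))))).
  rewrite RintegralZl//; last by apply: rint_sum => // a; apply: rint_sum => // b; exact: rr.
  congr (_ * _); rewrite Rint_sum//; last by move=> a; apply: rint_sum => // b; exact: rr.
  apply: eq_bigr => a _; rewrite Rint_sum//.
  by apply: eq_bigr => b _; rewrite (RintegralD mc (rintZ mc _ (rc _)) (rintZ mc _ (rs _))) (RintegralZl _ mc (rc _)) (RintegralZl _ mc (rs _)).
apply: eq_Rint => y _; rewrite /fejer_kernel mulrCA; congr (_ * _).
rewrite mulr_sumr; apply: eq_bigr => a _; rewrite mulr_sumr; apply: eq_bigr => b _.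
by rewrite phase_subr cosB; ring.
Qed.

(** A Chebyshev argument: where [f] is far from [v] the sum of the two functions 1 - cos is at least
    [c], and the kernel gives this sum the integral 2/N. The statement is pointwise, so that it
    applies both to continuous functions and to indicators of boxes. *)
Lemma fejer_close N f x (v B eps c : R) : (0 < N)%N -> L2 leb2 cell f ->
  0 <= eps -> 0 <= B -> 0 < c ->
  (forall y, cell y -> `|f y - v| <= eps \/ (`|f y - v| <= B /\
     c <= (1 - cos (2 * pi * (x.1 - y.1))) + (1 - cos (2 * pi * (x.2 - y.2))))) ->
  `|fejer N f x - v| <= eps + B / c * (2 / N%:R).
Proof.
case: N => // N _ lf e0 B0 c0 H.
have [tK IK] := TP_reflect x (TP_fejer_kernel N.+1); rewrite fejer_kernel_mean// in IK.
have lK := L2_TP tK.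
have tcos e := TP_mul (TP_fejer_kernel N.+1) (@TP_cos R _ _ (in_box_self e)).
have [te1 I1] := TP_reflect x (tcos (1, 0)); rewrite fejer_kernel_cos in I1; last by left.
have [te2 I2] := TP_reflect x (tcos (0, 1)); rewrite fejer_kernel_cos in I2; last by right.
pose K y := fejer_kernel N.+1 (x - y).
have rK : rint leb2 cell K := TP_rint tK.
have rfK : rint leb2 cell (fun y => f y * K y) := L2_prod mc lf lK.
pose c1 y := K y * cos (phase (1, 0) (x - y)); pose c2 y := K y * cos (phase (0, 1) (x - y)).
have r1 : rint leb2 cell c1 := TP_rint te1.
have r2 : rint leb2 cell c2 := TP_rint te2.
have -> : fejer N.+1 f x - v = \int[leb2]_(y in cell) (f y * K y - v * K y).
  by rewrite fejer_conv// (RintegralB mc rfK (rintZ mc v rK)) RintegralZl// IK mulr1.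
(* The majorant: the first term covers the points where [f] is close to [v], the second one is at
   least [B * K y] at the others. *)
pose h y := eps * K y + B / c * ((K y - c1 y) + (K y - c2 y)).
have rh1 : rint leb2 cell (fun y => (K y - c1 y) + (K y - c2 y)).
  by apply: rintD => //; exact: rintB.
have Ih : \int[leb2]_(y in cell) h y = eps + B / c * (2 / N.+1%:R).
  rewrite RintegralD//; [|exact: rintZ|exact: rintZ].
  rewrite (RintegralZl _ mc rK) (RintegralZl _ mc rh1) [\int[leb2]_(z in cell) K z]IK mulr1.
  rewrite (RintegralD mc (rintB mc rK r1) (rintB mc rK r2)).
  rewrite (RintegralB mc rK r1) (RintegralB mc rK r2) [\int[leb2]_(z in cell) K z]IK.
  rewrite [\int[leb2]_(z in cell) c1 z]I1 [\int[leb2]_(z in cell) c2 z]I2; congr (_ + _ * _).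
  rewrite -natr1; have : (N%:R + 1 : R) != 0 by rewrite natr1 pnatr_eq0.
  by move: (N%:R : R) => s s0; field.
have rd : rint leb2 cell (fun y => f y * K y - v * K y) by apply: rintB => //; exact: rintZ.
rewrite -Ih; apply: le_trans (le_normr_Rintegral mc rd) _.
apply: le_Rintegral => //.
- exact: (integrable_norm rd).
- by apply: rintD => //; exact: rintZ.
move=> y cy; rewrite -mulrBl normrM (ger0_norm (fejer_kernel_ge0 _ _)) /h /c1 /c2 -/(K y).
have K0 : 0 <= K y by exact: fejer_kernel_ge0.
have p1 : phase (1, 0) (x - y) = 2 * pi * (x.1 - y.1) :> R by rewrite phaseE/=; ring.
have p2 : phase (0, 1) (x - y) = 2 * pi * (x.2 - y.2) :> R by rewrite phaseE/=; ring.
rewrite p1 p2.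
have q1 := cos_le1 (2 * pi * (x.1 - y.1)); have q2 := cos_le1 (2 * pi * (x.2 - y.2)).
move: (H y cy) q1 q2; set C1 := cos _; set C2 := cos _ => Hy q1 q2.
rewrite (_ : _ + _ = K y * (eps + B / c * ((1 - C1) + (1 - C2)))); last by ring.
rewrite mulrC ler_wpM2l//; case: Hy => [Hy|[Hy Hc]].
  by apply: le_trans Hy _; rewrite lerDl mulr_ge0 ?divr_ge0 ?(ltW c0)// addr_ge0// subr_ge0.
apply: le_trans Hy _; rewrite -[leLHS]add0r lerD//.
rewrite -mulrA ler_peMr// mulrC ler_pdivlMr// mul1r; lra.
Qed.

(** On the compact interval [d, 1 - d] the function 1 - cos(2 pi s) has a positive minimum;
    elsewhere the fractional part of [s] is near 0 or near 1, and the integer is the floor or its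
    successor. *)
Lemma cos_sep (d : R) : 0 < d -> exists2 c, 0 < c & forall s : R, 1 - cos (2 * pi * s) < c ->
  exists k : int, `|s - k%:~R| < d.
Proof.
move=> d0; pose K := [set` `[d, 1 - d]] : set R.
have cc : continuous (fun s : R => 1 - cos (2 * pi * s)).
  move=> s; apply: cvgB; first exact: cvg_cst.
  have h : (fun y : R => 2 * pi * y) @ s --> 2 * pi * s by apply: cvgM; [exact: cvg_cst|exact: cvg_id].
  exact: (cvg_comp _ _ h (@continuous_cos R _)).
have pos s : K s -> 0 < 1 - cos (2 * pi * s).
  rewrite /K/= in_itv/= => /andP[ds sd]; rewrite subr_gt0; apply: cos_lt1.
  have pp := @pi_gt0 R; rewrite gtr0_norm; last by rewrite !mulr_gt0//; lra.
  by rewrite !mulr_gt0//=; [rewrite gtr_pMr ?mulr_gt0//; lra|lra].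
have [c c0 Hc] : exists2 c, 0 < c & forall s, K s -> c <= 1 - cos (2 * pi * s).
  have [B B0 HB] := @compact_cont_bounded R R (fun s => (1 - cos (2 * pi * s))^-1) K (@segment_compact R _ _)
     (fun s Ks => cvgV (lt0r_neq0 (pos s Ks)) (cc s)).
  exists B^-1; first by rewrite invr_gt0.
  move=> s Ks; have := HB s Ks; rewrite gtr0_norm ?invr_gt0 ?pos// => h.
  by rewrite -[leRHS]invrK lef_pV2// ?posrE ?invr_gt0 ?pos.
exists c => // s sc; pose k := Num.floor s; pose r : R := s - k%:~R.
have /andP[h1 h2] := floor_itv s; rewrite intrD -/k in h1 h2.
have rc : 1 - cos (2 * pi * r) < c.
  move: sc; have -> : 2 * pi * s = 2 * pi * k%:~R + 2 * pi * r by rewrite -mulrDr addrC subrK.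
  by rewrite cos_int.
have [rd|dr] := ltP r d; first by exists k; rewrite ger0_norm// subr_ge0.
have [r1|r1] := ltP (1 - d) r.
  exists (k + 1); rewrite intrD ltr0_norm -/r; rewrite /r in r1 *; lra.
suff : c <= 1 - cos (2 * pi * r) by lra.
by apply: Hc; rewrite /K/= in_itv/= dr.
Qed.

End fejer_kernel.

Lemma pairl_continuous (V W : topologicalType) (y : W) : continuous (fun x : V => (x, y)).
Proof. by move=> x; exact: (cvg_pair (@cvg_id _ _) (cvg_cst y)). Qed.

Lemma pairr_continuous (V W : topologicalType) (x : V) : continuous (fun y : W => (x, y)).
Proof. by move=> y; exact: (cvg_pair (cvg_cst x) (@cvg_id _ _)). Qed.

Lemma is_derive_mulr (R : realType) (V : normedModType R) (f : V -> R) (x v : V) (d c : R) :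
  is_derive x v f d -> is_derive x v (fun y => f y * c) (d * c).
Proof.
move=> df; have := is_deriveZ c df; rewrite -[c *: d]/(c * d) mulrC.
by congr (is_derive x v _ _); apply/funext => y; rewrite /= mulrC.
Qed.

(** * Derivatives of periodic functions and of their Fejer means *)

Section periodic_calculus.
Context {R : realType}.
Local Notation mR := (measurableTypeR R).
Local Notation leb := (@lebesgue_measure R).
Local Notation cell := (@cell R).
Local Notation leb2 := (@leb2 R).
Implicit Types (f g : R * R -> R) (x y z : R * R) (k : int * int) (N : nat).

Let mc := @measurable_cell R.

(** The derivative along [e1] has to be integrated in the first variable first, which is the reverse
    of the order in [Rint_cell]. *)
Lemma cell_lines0 f : continuous f ->
  (forall y : R, \int[leb]_(s in `[0, 1[) f (s, y) = 0) -> \int[leb2]_(x in cell) f x = 0.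
Proof.
move=> cf H; have rf := continuous_rint cf.
have ig : leb2.-integrable setT (EFin \o (f \_ cell)).
  by rewrite -restrict_EFin; apply/(integrable_mkcond _ mc).
have mI : measurable ([set` `[0 : R, 1[] : set mR) by exact: measurable_itv.
have cf1 (y : R) : continuous (fun s => f (s, y)).
  move=> s; have c2 := @pairl_continuous R R y s.
  exact: (cvg_comp _ _ c2 (cf (s, y))).
rewrite /Rintegral integral_mkcond.
transitivity (fine (\int[leb2]_z (EFin \o (f \_ cell)) z)).
  by congr fine; apply: eq_integral => z _; rewrite -restrict_EFin.
rewrite -(integral21_prod_meas1 (m1 := leb) (m2 := leb) ig) integral0_eq// => y _.
rewrite /fubini_G.
have [Iy|nIy] := pselect ([set` `[0 : R, 1[] y); last first.
  by apply: integral0_eq => s _ /=; rewrite /patch memNset// => -[].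
transitivity (\int[leb]_(s in [set` `[0%R, 1%R[]) (f (s, y))%:E)%E.
  rewrite [RHS]integral_mkcond; apply: eq_integral => s _; rewrite /= /patch.
  have [Is|nIs] := pselect ([set` `[0 : R, 1[] s); first by rewrite !mem_set.
  by rewrite !memNset// => -[].
rewrite -(@fineK _ (integral _ _ _)); first by have := H y; rewrite /Rintegral => ->.
apply: integrable_fin_num => //.
apply: integrableS (within_rint (a := 0) (b := 1) (continuous_subspaceT (cf1 y))) => //.
by apply: subset_itvl; rewrite bnd_simp.
Qed.

Lemma periodic_derive_mean f f' (e : R * R) : e = e1 \/ e = e2 -> continuous f' -> Z2periodic f ->
  (forall x, is_derive x e f (f' x)) -> \int[leb2]_(x in cell) f' x = 0.
Proof.
move=> he cf' pf df.
have L (x : R * R) (F' F : R -> R) : (forall s, F s = f (s *: e + x)) -> (forall s, F' s = f' (s *: e + x)) ->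
    f (1 *: e + x) = f x -> continuous F' -> \int[leb]_(s in `[0, 1[) F' s = 0.
  move=> FE F'E f1 cF'.
  have dF (s : R) : is_derive s 1 F (F' s).
    by rewrite (_ : F = fun h => f (h *: e + x)) ?F'E; [exact: line_is_derive|apply/funext].
  rewrite Rint_co; last exact: continuous_subspaceT.
  have -> : \int[leb]_(s in `[0, 1]) F' s = F 1 - F 0.
    apply: (@Rint_FTC _ F' F) => //; first exact: continuous_subspaceT.
    apply: continuous_subspaceT => s.
    by apply: (differentiable_continuous (x := (s : R))); apply/derivable1_diffP; case: (dF s).
  by rewrite !FE f1 scale0r add0r subrr.
case: he => eE.
  apply: cell_lines0 => // y; apply: (L (0, y) _ (fun s => f (s, y))).
  - by move=> s; rewrite eE; congr f; congr pair; rewrite /= -![_ *: _]/(_ * _); ring.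
  - by move=> s; rewrite eE; congr f'; congr pair; rewrite /= -![_ *: _]/(_ * _); ring.
  - have := pf (1, 0) (0, y); rewrite eE => <-; congr f; congr pair; rewrite /= -?[_ *: _]/(_ * _); ring.
  - move=> s; have c2 := @pairl_continuous R R y s.
    exact: (cvg_comp _ _ c2 (cf' (s, y))).
rewrite Rint_cell; last exact: continuous_rint.
rewrite (@eq_Rint _ _ _ _ _ _ (fun=> 0)); last first.
  suff h (s : R) : \int[leb]_(y in `[0, 1[) f' (s, y) = 0 by move=> s _; exact: h.
  apply: (L (s, 0) _ (fun y : R => f (s, y))).
  - by move=> y; rewrite eE; congr f; congr pair; rewrite /= -![_ *: _]/(_ * _); ring.
  - by move=> y; rewrite eE; congr f'; congr pair; rewrite /= -![_ *: _]/(_ * _); ring.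
  - have := pf (0, 1) (s, 0); rewrite eE => <-; congr f; congr pair; rewrite /= -?[_ *: _]/(_ * _); ring.
  - move=> y; have c2 := @pairr_continuous R R s y.
    exact: (cvg_comp _ _ c2 (cf' (s, y))).
by rewrite Rintegral_cst ?mul0r//; exact: measurable_itv.
Qed.

Lemma is_derive_cos_phase k x v :
  is_derive x v (fun y => cos (phase k y)) (- phase k v * sin (phase k x) : R).
Proof.
apply: is_derive_line; have := is_derive1_comp (is_derive_cos _) (is_derive_phase k x v 0).
by rewrite scale0r add0r mulNr mulrC -mulNr.
Qed.

Lemma is_derive_sin_phase k x v :
  is_derive x v (fun y => sin (phase k y)) (phase k v * cos (phase k x) : R).
Proof.
apply: is_derive_line; have := is_derive1_comp (is_derive_sin _) (is_derive_phase k x v 0).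
by rewrite scale0r add0r mulrC.
Qed.

Let rmul f g : continuous f -> continuous g -> rint leb2 cell (fun x => f x * g x).
Proof. by move=> cf cg; apply: continuous_rint => x; apply: cvgM; [exact: cf|exact: cg]. Qed.

Lemma fourier_derive f f' (e : R * R) k : e = e1 \/ e = e2 -> continuous f -> continuous f' ->
  Z2periodic f -> (forall x, is_derive x e f (f' x)) ->
  \int[leb2]_(x in cell) (f' x * cos (phase k x)) =
    phase k e * \int[leb2]_(x in cell) (f x * sin (phase k x)) /\
  \int[leb2]_(x in cell) (f' x * sin (phase k x)) =
    - phase k e * \int[leb2]_(x in cell) (f x * cos (phase k x)).
Proof.
move=> he cf cf' pf df.
have cc := @continuous_cos_phase R k; have cs := @continuous_sin_phase R k.
have H (g g' h : R * R -> R) (a : R) : continuous g -> continuous h -> Z2periodic g ->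
    (forall x, is_derive x e g (a * h x)) ->
    \int[leb2]_(x in cell) (f' x * g x) = - a * \int[leb2]_(x in cell) (f x * h x).
  move=> cg ch pg dg.
  have d x : is_derive x e (fun y => f y * g y) (f' x * g x + a * (f x * h x)).
    have := is_deriveM (df x) (dg x); rewrite (_ : _ + _ = f' x * g x + a * (f x * h x))//.
    by rewrite -![_ *: _]/(_ * _); ring.
  have := periodic_derive_mean he _ _ d; rewrite RintegralD//; [|exact: rmul|exact: rintZ (rmul _ _)].
  rewrite RintegralZl//; last exact: rmul.
  move=> /(_ _ _)/eqP; rewrite addr_eq0 => /(_ _ _)/eqP -> //; first by rewrite mulNr.
  - move=> x; apply: cvgD; first by apply: cvgM; [exact: cf'|exact: cg].
    by apply: cvgM; [exact: cvg_cst|apply: cvgM; [exact: cf|exact: ch]].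
  - by move=> l x; rewrite pf pg.
split.
  rewrite (H _ (fun=> 0) _ _ cc cs _ (fun x => is_derive_cos_phase k x e)) ?opprK//.
  by move=> l x; rewrite phase_shift cos_int.
rewrite (H _ (fun=> 0) _ _ cs cc _ (fun x => is_derive_sin_phase k x e))//.
by move=> l x; rewrite phase_shift sin_int.
Qed.

(** The Fejer mean of the derivative is the derivative of the Fejer mean: integration by parts
    multiplies the Fourier coefficients by exactly the factors that differentiating the modes
    produces. Uniform convergence of the means thus extends to the derivatives. *)
Lemma is_derive_fejer N f f' (e x : R * R) : e = e1 \/ e = e2 -> continuous f -> continuous f' ->
  Z2periodic f -> (forall x, is_derive x e f (f' x)) ->
  is_derive x e (fejer N f) (fejer N f' x).
Proof.
move=> he cf cf' pf df.
apply: is_deriveZ; apply: is_derive_sums => a; apply: is_derive_sums => b.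
have [-> ->] := fourier_derive (freqB a b) he cf cf' pf df.
move: (\int[_]_(_ in _) _) (\int[_]_(_ in _) _) => C S.
have h1 := is_derive_mulr S (is_derive_cos_phase (freqB a b) x e).
have h2 := is_derive_mulr C (is_derive_sin_phase (freqB a b) x e).
have := is_deriveD h1 h2.
rewrite (_ : _ * _ * _ + _ = cos (phase (freqB a b) x) * (phase (freqB a b) e * C) +
  sin (phase (freqB a b) x) * (- phase (freqB a b) e * S))//; ring.
Qed.

End periodic_calculus.

(** * Fejer means in space of functions of time and space *)

Section time_dependent.
Context {R : realType}.
Local Notation mR := (measurableTypeR R).
Local Notation leb := (@lebesgue_measure R).
Local Notation cell := (@cell R).
Local Notation leb2 := (@leb2 R).
Implicit Types (g h : R * (R * R) -> R) (N : nat).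

Let mc := @measurable_cell R.

Definition slab (a b : R) : set (R * (R * R)) := `[a, b] `*` (`[0, 1] `*` `[0, 1]).

Lemma compact_slab a b : compact (slab a b).
Proof. by apply: compact_setX; [exact: segment_compact|apply: compact_setX; exact: segment_compact]. Qed.

Lemma cell_slab (a b t : R) (x : R * R) : a <= t <= b -> cell x -> slab a b (t, x).
Proof.
move=> tab [x1 x2]; split; first by rewrite /= in_itv.
move: x1 x2; rewrite /= !in_itv/= => /andP[-> h1] /andP[-> h2].
by split; rewrite /= ltW.
Qed.

Lemma slab_bounded g (a b : R) : continuous g ->
  exists2 B, 0 < B & forall t x, a <= t <= b -> cell x -> `|g (t, x)| <= B.
Proof.
move=> cg; have [B B0 H] := compact_cont_bounded (@compact_slab a b) (fun x _ => cg x).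
by exists B => // t x tab cx; apply: H; exact: cell_slab.
Qed.

Lemma continuous_section g (t : R) : continuous g -> continuous (fun x => g (t, x)).
Proof.
move=> cg x; have c2 := @pairr_continuous R (R * R)%type t x.
exact: (cvg_comp _ _ c2 (cg (t, x))).
Qed.

Lemma continuous_time g (x : R * R) : continuous g -> continuous (fun t => g (t, x)).
Proof.
move=> cg t; have c2 := @pairl_continuous R (R * R)%type x t.
exact: (cvg_comp _ _ c2 (cg (t, x))).
Qed.

Lemma continuous_time_Rint g : continuous g ->
  continuous (fun t => \int[leb2]_(x in cell) g (t, x)).
Proof.
move=> cg t; have [B B0 HB] := slab_bounded (t - 1) (t + 1) cg.
have := @continuity_under_integral R _ _ leb2 (fun t x => g (t, x)) cell mc (t - 1) (t + 1) _ _ (fun=> B) _ _ t.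
apply.
- by move=> s _; exact: continuous_rint (continuous_section cg).
- by apply: aeW => x _ s _; exact: continuous_time.
- by apply: (@rint_bounded _ _ _ _ _ mc (@fin_cell R) _ B) => // x _; rewrite ger0_norm// ltW.
- move=> s; rewrite /= in_itv/= => /andP[s1 s2]; apply: aeW => x cx; apply: HB => //.
  by rewrite !ltW.
- by rewrite inE/= in_itv/=; apply/andP; split; lra.
Qed.

Lemma is_derive_time_Rint g gt (t : R) : continuous g -> continuous gt ->
  (forall (s : R) x, is_derive s 1 (fun r => g (r, x)) (gt (s, x))) ->
  is_derive t 1 (fun s => \int[leb2]_(x in cell) g (s, x)) (\int[leb2]_(x in cell) gt (t, x)).
Proof.
move=> cg cgt dg; have [B B0 HB] := slab_bounded (t - 1) (t + 1) cgt.
have It : [set` `]t - 1, t + 1[] t by rewrite /= in_itv/=; apply/andP; split; lra.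
have h1 : forall s : R, [set` `]t - 1, t + 1[] s -> leb2.-integrable cell (EFin \o (fun x => g (s, x))).
  by move=> s _; exact: continuous_rint (continuous_section cg).
have h2 : forall (s : R) x, [set` `]t - 1, t + 1[] s -> cell x -> derivable (fun r => g (r, x)) s 1.
  by move=> s x _ _; case: (dg s x).
have h3 : leb2.-integrable cell (EFin \o (fun=> B)).
  by apply: (@rint_bounded _ _ _ _ _ mc (@fin_cell R) _ B) => // x _; rewrite ger0_norm// ltW.
have E (s : R) x : partial1of2 (fun t x => g (t, x)) s x = gt (s, x).
  by rewrite partial1of2E; case: (dg s x).
have h4 : forall (s : R) x, [set` `]t - 1, t + 1[] s -> cell x -> `|partial1of2 (fun t x => g (t, x)) s x| <= B.
  move=> s x; rewrite /= in_itv/= => /andP[s1 s2] cx; rewrite E; apply: HB => //.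
  by rewrite !ltW.
apply: DeriveDef.
  exact: (derivable_under_integral mc It h1 h2 (fun=> ltW B0) h3 h4).
rewrite -derive1E (differentiation_under_integral mc It h1 h2 (fun=> ltW B0) h3 h4).
by apply: eq_Rint => x _; rewrite E.
Qed.

Let cmul g (f : R * R -> R) : continuous g -> continuous f -> continuous (fun p => g p * f p.2).
Proof.
move=> cg cf [t x]; apply: cvgM; first exact: cg.
have c2 : (snd : R * (R * R) -> R * R) @ nbhs (t, x) --> nbhs x by exact: cvg_snd.
exact: (cvg_comp _ _ c2 (cf x)).
Qed.

Lemma is_derive_fejer_time N g gt (t : R) x : continuous g -> continuous gt ->
  (forall (s : R) x, is_derive s 1 (fun r => g (r, x)) (gt (s, x))) ->
  is_derive t 1 (fun s => fejer N (fun y => g (s, y)) x) (fejer N (fun y => gt (t, y)) x).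
Proof.
move=> cg cgt dg.
have H (f : R * R -> R) (c : R) : continuous f -> is_derive t 1
    (fun s => c * \int[leb2]_(y in cell) (g (s, y) * f y)) (c * \int[leb2]_(y in cell) (gt (t, y) * f y)).
  move=> cf; apply: is_deriveZ.
  apply: (@is_derive_time_Rint (fun p => g p * f p.2) (fun p => gt p * f p.2)); try exact: cmul.
  by move=> s y /=; exact: is_derive_mulr.
apply: is_deriveZ.
have Ssum (F : 'I_N * 'I_N -> R -> R) (F' : 'I_N * 'I_N -> R) : (forall a, is_derive t 1 (F a) (F' a)) ->
    is_derive t 1 (fun s => \sum_a F a s) (\sum_a F' a).
  move=> dF; elim: (index_enum _) => [|i s IH].
    rewrite big_nil (_ : (fun y => _) = cst 0); first exact: is_derive_cst.
    by apply/funext => y; rewrite big_nil.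
  rewrite big_cons (_ : (fun y => _) = fun y => F i y + \sum_(j <- s) F j y); first exact: is_deriveD.
  by apply/funext => y; rewrite big_cons.
apply: (@Ssum) => a; apply: (@Ssum) => b; apply: is_deriveD; apply: H.
  exact: continuous_cos_phase.
exact: continuous_sin_phase.
Qed.

Lemma continuous_fejer_time N g x : continuous g -> continuous (fun t => fejer N (fun y => g (t, y)) x).
Proof.
move=> cg.
have cS (F : 'I_N * 'I_N -> R -> R) : (forall a, continuous (F a)) -> continuous (fun s => \sum_a F a s).
  move=> cF t; rewrite /continuous_at; elim: (index_enum _) => [|i s IH].
    by rewrite big_nil (_ : (fun y => _) = cst 0); [exact: cvg_cst|apply/funext => y; rewrite big_nil].
  rewrite big_cons (_ : (fun y => _) = fun y => F i y + \sum_(j <- s) F j y).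
    by apply: cvgD => //; exact: cF.
  by apply/funext => y; rewrite big_cons.
have H (f : R * R -> R) (c : R) : continuous f ->
    continuous (fun s => c * \int[leb2]_(y in cell) (g (s, y) * f y)).
  move=> cf t; apply: cvgM; first exact: cvg_cst.
  exact: (@continuous_time_Rint (fun p => g p * f p.2) (cmul cg cf) t).
have h (a b : 'I_N * 'I_N) : continuous (fun t =>
    cos (phase (freqB a b) x) * (\int[leb2]_(y in cell) (g (t, y) * cos (phase (freqB a b) y))) +
    sin (phase (freqB a b) x) * \int[leb2]_(y in cell) (g (t, y) * sin (phase (freqB a b) y))).
  move=> t; apply: cvgD; apply: H; [exact: continuous_cos_phase|exact: continuous_sin_phase].
have cSS := cS _ (fun a => cS _ (h a)).
by move=> t; apply: cvgM; [exact: cvg_cst|exact: cSS].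
Qed.

(** Uniform continuity on a compact slab makes the threshold independent of [t] and [x]. Periodicity
    allows [y] to be replaced by its translate closest to [x], since [cos_sep] locates points only
    modulo the lattice. *)
Lemma fejer_uniform g (a b eps : R) : continuous g -> (forall t, Z2periodic (fun x => g (t, x))) ->
  0 < eps -> exists N0, forall N, (N0 <= N)%N -> forall t x, a <= t <= b -> cell x ->
    `|fejer N (fun y => g (t, y)) x - g (t, x)| <= eps.
Proof.
move=> cg pg e0; have [B B0 HB] := slab_bounded a b cg.
have [d d0 Hd] := compact_ucont (@compact_slab a b) (fun x _ => cg x) (divr_gt0 e0 (ltr0n R 2)).
have [c c0 Hc] := cos_sep d0.
(* The oscillation of [g] is at most [2 * B], so the far part contributes at most [K / N%:R]; the
   threshold below makes this at most [eps / 2]. *)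
pose K := 2 * B / c * 2.
have K0 : 0 < K by rewrite !mulr_gt0// invr_gt0.
exists (Num.trunc (2 * K / eps)).+1 => N NN t x tab cx.
have Np : (0 < N)%N by exact: leq_trans NN.
have NK : K / N%:R <= eps / 2.
  rewrite ler_pdivrMr ?ltr0n// mulrAC ler_pdivlMr// [eps * _]mulrC -ler_pdivrMr// [K * 2]mulrC.
  apply: ltW; apply: lt_le_trans (truncnS_gt _) _.
  by rewrite ler_nat.
have cgt := continuous_section (t := t) cg.
have := @fejer_close R N (fun y => g (t, y)) x (g (t, x)) (2 * B) (eps / 2) c Np (continuous_L2 cgt).
move=> H; apply: le_trans (H _ _ _ _) _.
- by rewrite divr_ge0// ltW.
- by rewrite mulr_ge0// ltW.
- by [].
- move=> y cy.
  have [h|h] := leP c (1 - cos (2 * pi * (x.1 - y.1)) + (1 - cos (2 * pi * (x.2 - y.2)))).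
    right; split=> //; have := HB t y tab cy; have := HB t x tab cx.
    by have := ler_normB (g (t, y)) (g (t, x)); lra.
  left; have q1 := cos_le1 (2 * pi * (x.1 - y.1)); have q2 := cos_le1 (2 * pi * (x.2 - y.2)).
  have [|k1 h1] := Hc (x.1 - y.1); first by lra.
  have [|k2 h2] := Hc (x.2 - y.2); first by lra.
  (* The translate of [y] close to [x] may leave the unit square, where [compact_ucont] still
     applies. *)
  have <- := pg t (k1, k2) y; rewrite /= distrC.
  apply: Hd; first exact: cell_slab.
  split; first by rewrite /=; exact: ballxx.
  split; rewrite /ball/= /ball/=.
    by rewrite (_ : _ - _ = x.1 - y.1 - k1%:~R) //; ring.
  by rewrite (_ : _ - _ = x.2 - y.2 - k2%:~R) //; ring.
rewrite [leRHS]splitr lerD2l (le_trans _ NK)//.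
by rewrite le_eqVlt; apply/orP; left; apply/eqP; rewrite /K; ring.
Qed.

End time_dependent.

Lemma ae_and d (T : measurableType d) (R : realType) (mu : {measure set T -> \bar R}) (P Q : T -> Prop) :
  {ae mu, forall x, P x} -> {ae mu, forall x, Q x} -> {ae mu, forall x, P x /\ Q x}.
Proof. by move=> aP aQ; apply: filterS2 aP aQ. Qed.

(** * Completeness of the Fourier modes *)

Section vanishing_integrals.
Context d (T : measurableType d) (R : realType).
Variables (mu : {measure set T -> \bar R}) (D : set T).
Hypothesis mD : measurable D.

Lemma Rint_setI (A : set T) (f : T -> R) :
  \int[mu]_(x in D `&` A) f x = \int[mu]_(x in D) (f x * \1_A x).
Proof.
rewrite /Rintegral integral_mkcondr; congr fine; apply: eq_integral => x _.
by rewrite /patch indicE; case: (x \in A); rewrite ?mulr1 ?mulr0.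
Qed.

(** The pi-lambda argument for an integrand without sign: closure under complements uses the
    vanishing of the integral over the whole of [D]. *)
Lemma dynkin_Rint0 d' (T' : measurableType d') (h : T -> T') (G : set (set T')) (f : T -> R) :
  measurable_fun setT h -> @measurable _ T' = <<s G >> -> setI_closed G -> rint mu D f ->
  \int[mu]_(x in D) f x = 0 ->
  (forall A, G A -> \int[mu]_(x in D `&` h @^-1` A) f x = 0) ->
  forall A, measurable A -> \int[mu]_(x in D `&` h @^-1` A) f x = 0.
Proof.
move=> mh gG cG rf f0 HG A mA; rewrite gG in mA.
have mhA B : measurable B -> measurable (D `&` h @^-1` B).
  by move=> mB; apply: measurableI => //; rewrite -[X in measurable X]setTI; exact: mh.
apply: (dynkin_induction (P := fun A => \int[mu]_(x in D `&` h @^-1` A) f x = 0) gG cG _ HG _ _ mA).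
- by rewrite preimage_setT setIT.
- move=> S mS S0; have mSC := measurableC mS.
  have E : D = (D `&` h @^-1` S) `|` (D `&` h @^-1` (~` S)).
    by rewrite -setIUr -preimage_setU setUv preimage_setT setIT.
  have := f0; rewrite {1}E Rintegral_setU ?S0 ?add0r//; [exact: mhA|exact: mhA|by rewrite -E|].
  apply/disj_setPS => x [[_ h1] [_ h2]]; exact: h2.
- move=> F mF tF F0; rewrite preimage_bigcup setI_bigcupr /Rintegral integral_bigcup//.
  + rewrite eseries0// => i _ _.
    rewrite -(@fineK _ (integral _ _ _)); first by have := F0 i; rewrite /Rintegral => ->.
    by apply: integrable_fin_num; [exact: mhA|apply: integrableS rf => //; exact: mhA].
  + apply/trivIsetP => i j _ _ ij; have /trivIsetP/(_ i j Logic.I Logic.I ij) := tF.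
    move=> FF; apply/eqP/disj_setPS => x [[_ h1] [_ h2]].
    by have : (F i `&` F j) (h x) by []; rewrite FF.
  + by move=> k; exact: mhA.
  + by apply: integrableS rf => //; [apply: bigcup_measurable => k _; exact: mhA|move=> x [k _ []]].
Qed.

Lemma rint_ae0 (f : T -> R) : rint mu D f ->
  (forall A, measurable A -> \int[mu]_(x in D `&` A) f x = 0) ->
  {ae mu, forall x, D x -> f x = 0}.
Proof.
move=> rf H; have : ae_eq mu D (EFin \o f) (cst 0%E).
  apply: integral_ae_eq => //.
  move=> E ED mE; rewrite integral_cst// mul0e -(@fineK _ (integral _ _ _)).
    by have := H E mE; rewrite (setIidr ED) /Rintegral => ->.
  by apply: integrable_fin_num => //; exact: integrableS rf.
by apply: filterS => x h Dx; have /= [] := h Dx.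
Qed.

End vanishing_integrals.

Section completeness.
Context {R : realType}.
Local Notation mR := (measurableTypeR R).
Local Notation leb := (@lebesgue_measure R).
Local Notation cell := (@cell R).
Local Notation leb2 := (@leb2 R).

Let mc := @measurable_cell R.

Lemma TP_fejer N (f : R * R -> R) : TP N (fejer N f).
Proof.
apply: TP_scale; apply: TP_double_sum => a b.
apply: TP_ext (TP_add (TP_scale _ (TP_cos (freqB_box a b))) (TP_scale _ (TP_sin (freqB_box a b)))) => x.
by congr (_ + _); rewrite mulrC; reflexivity.
Qed.

Lemma ae_fst_neq (a : R) : {ae leb2, forall x : R * R, x.1 != a}.
Proof.
exists ([set a] `*` setT); split.
- by apply: measurableX.
- rewrite /leb2 product_measure1E// (_ : _ [set a] = 0%E) ?mul0e//; exact: lebesgue_measure_set1.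
- by move=> [x y] /= h; split=> //=; apply: contrapT => /eqP.
Qed.

Lemma ae_snd_neq (a : R) : {ae leb2, forall x : R * R, x.2 != a}.
Proof.
exists (setT `*` [set a]); split.
- by apply: measurableX.
- rewrite /leb2 product_measure1E// (_ : _ [set a] = 0%E) ?mule0//; exact: lebesgue_measure_set1.
- by move=> [x y] /= h; split=> //=; apply: contrapT => /eqP.
Qed.

(** The radius is the distance from [s] to 0, 1, [a] and [b]. The distances to 0 and 1 exclude that
    [t] approaches [s] around the torus and force [k = 0]; the others keep [s] and [t] on the same
    side of [a] and [b]. *)
Lemma itv_locally_constant (a b s : R) : 0 < s < 1 -> s != a -> s != b ->
  exists2 de, 0 < de & forall t (k : int), 0 <= t < 1 -> `|s - t - k%:~R| < de ->
    (a < t <= b) = (a < s <= b).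
Proof.
move=> /andP[s0 s1] sa sb.
exists (Num.min (Num.min s (1 - s)) (Num.min `|s - a| `|s - b|)).
  by rewrite !lt_min s0 subr_gt0 s1 !normr_gt0 !subr_eq0 sa sb.
move=> t k /andP[t0 t1]; rewrite !lt_min => /andP[/andP[h1 h2] /andP[h3 h4]].
have k0 : k = 0.
  have [k1|] := leP 1 k.
    have : (1 : R) <= k%:~R by rewrite -[1]/(1%:~R) ler_int.
    move=> k2; suff: False by []. 
    by move: h2; rewrite ltr_norml => /andP[]; lra.
  move=> k1'; have [k1|] := leP k (-1); last by move=> km; clear -k1' km; lia.
  have : (k%:~R : R) <= -1 by rewrite -[-1]/((-1)%:~R) ler_int.
  move=> k2; suff: False by [].
  by move: h1; rewrite ltr_norml => /andP[]; lra.
move: h3 h4; rewrite k0 subr0 => h3 h4.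
have H (c : R) : `|s - t| < `|s - c| -> (t <= c) = (s <= c).
  have [sc|sc] := leP s c.
    by rewrite [`|s - c|]ler0_norm ?subr_le0// ltr_norml => /andP[? ?]; apply/idP; lra.
  by rewrite [`|s - c|]ger0_norm ?subr_ge0 ?(ltW sc)// ltr_norml => /andP[? ?]; apply/negP; lra.
by rewrite !ltNge (H a)// (H b).
Qed.

Lemma fejer_bounded N (f : R * R -> R) x : (0 < N)%N -> L2 leb2 cell f ->
  (forall y, cell y -> `|f y| <= 1) -> `|fejer N f x| <= 1.
Proof.
move=> N0 lf f1; have := @fejer_close R N f x 0 0 1 1 N0 lf ler01 (lexx _) ltr01.
rewrite subr0 mul0r mul0r addr0; apply => y cy; left; rewrite subr0; exact: f1.
Qed.

(** Off the lines through the edges the indicator of a box is constant near [x] on the torus, so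
    [fejer_close] applies with [eps = 0]. *)
Lemma fejer_box_cvg (a b c d : R) (x : R * R) : cell x ->
  x.1 != 0 -> x.1 != a -> x.1 != b -> x.2 != 0 -> x.2 != c -> x.2 != d ->
  fejer N.+1 (fun y => ((a < y.1 <= b) && (c < y.2 <= d))%:R) x @[N --> \oo] -->
    (((a < x.1 <= b) && (c < x.2 <= d))%:R : R).
Proof.
move=> [x1 x2] n1 na nb n2 nc nd.
pose h (y : R * R) : R := ((a < y.1 <= b) && (c < y.2 <= d))%:R.
rewrite -[X in _ --> X]/(h x) -[fun N => fejer _ _ _]/(fun N => fejer N.+1 h x).
have lh : L2 leb2 cell h.
  apply: (@L2_bounded _ _ _ _ _ mc (@fin_cell R) _ 1); last first.
    by move=> y _; rewrite /h; case: (_ && _); rewrite ?normr1 ?normr0.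
  rewrite (_ : h = \1_([set` `]a, b]] `*` [set` `]c, d]])).
    by apply: measurable_indic; apply: measurableX; exact: measurable_itv.
  apply/funext => y; rewrite indicE /h; congr (_%:R); congr nat_of_bool.
  by apply/idP/idP => [/andP[h1 h2]|/set_mem [/=]]; [apply/mem_set; split|]; rewrite /= !in_itv/= => // -> ->.
move: x1 x2; rewrite /= !in_itv/= => /andP[x10 x11] /andP[x20 x21].
have i1 : 0 < x.1 < 1 by rewrite lt_neqAle eq_sym n1 x10.
have i2 : 0 < x.2 < 1 by rewrite lt_neqAle eq_sym n2 x20.
have [e1 e10 H1] := itv_locally_constant i1 na nb.
have [e2 e20 H2] := itv_locally_constant i2 nc nd.
have e0 : 0 < Num.min e1 e2 by rewrite lt_min e10.
have [cc c0 Hc] := cos_sep e0.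
apply/cvgrPdist_le => e ep; near=> N.
have := @fejer_close R N.+1 h x (h x) 1 0 cc (ltn0Sn _) lh (lexx _) ler01 c0.
rewrite -/(h x) distrC => H; apply: le_trans (H _) _.
  move=> y [y1 y2].
  have [hc|hc] := leP cc (1 - cos (2 * pi * (x.1 - y.1)) + (1 - cos (2 * pi * (x.2 - y.2)))).
    by right; split=> //; rewrite /h; do 2!case: (_ && _); rewrite ?subrr ?subr0 ?sub0r ?normrN ?normr1 ?normr0.
  left; have q1 := cos_le1 (2 * pi * (x.1 - y.1)); have q2 := cos_le1 (2 * pi * (x.2 - y.2)).
  have [|k1 h1] := Hc (x.1 - y.1); first by lra.
  have [|k2 h2] := Hc (x.2 - y.2); first by lra.
  rewrite /h (H1 y.1 k1) ?(H2 y.2 k2) ?subrr ?normr0//; move: y1 y2; rewrite /= !in_itv//=.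
  - by rewrite lt_min in h2; case/andP: h2.
  - by rewrite lt_min in h1; case/andP: h1.
rewrite add0r mulrA ler_pdivrMr ?ltr0n// -ler_pdivrMl//.
by near: N; exists (Num.trunc (e^-1 * (1 / cc * 2))) => // M /= NM; rewrite ltW// (lt_le_trans (truncnS_gt _))// ler_nat.
Unshelve. all: by end_near. Qed.

(** The function [f] is orthogonal to all trigonometric polynomials, in particular to the Fejer
    means of the indicator of a box. They are bounded by 1 and converge almost everywhere, so [f]
    has integral 0 over every box, hence over every measurable set. *)
Lemma TP_complete (f : R * R -> R) : L2 leb2 cell f ->
  (forall k, \int[leb2]_(x in cell) (f x * cos (phase k x)) = 0) ->
  (forall k, \int[leb2]_(x in cell) (f x * sin (phase k x)) = 0) ->
  {ae leb2, forall x, cell x -> f x = 0}.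
Proof.
move=> lf fc fs; have rf := L2_rint mc (@fin_cell R) lf.
have fTP m g : TP m g -> \int[leb2]_(x in cell) (f x * g x) = 0.
  elim=> {m g} [m k _|m k _|m g h tg Ig th Ih|m c g tg Ig]; [exact: fc|exact: fs|..].
    rewrite -[RHS](addr0 0) -{1}Ig -Ih -RintegralD//; [|exact: L2_prod (L2_TP tg)|exact: L2_prod (L2_TP th)].
    by apply: eq_Rint => x _; rewrite mulrDr.
  rewrite -[RHS](mulr0 c) -Ig -RintegralZl//; last exact: L2_prod (L2_TP tg).
  by apply: eq_Rint => x _; rewrite mulrCA.
have If : \int[leb2]_(x in cell) f x = 0.
  by rewrite -(fTP 0 _ (TP_cst 0 1)); apply: eq_Rint => x _; rewrite mulr1.
have box (a b c d : R) : \int[leb2]_(x in cell `&` ([set` `]a, b]] `*` [set` `]c, d]])) f x = 0.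
  set B := _ `*` _; pose h (y : R * R) : R := ((a < y.1 <= b) && (c < y.2 <= d))%:R.
  have mB : measurable B by apply: measurableX; exact: measurable_itv.
  have hB : h = \1_B.
    apply/funext => y; rewrite indicE /h; congr (_%:R); congr nat_of_bool.
    by apply/idP/idP => [/andP[h1 h2]|/set_mem [/=]]; [apply/mem_set; split|]; rewrite /= !in_itv/= => // -> ->.
  have mh : measurable_fun cell h by rewrite hB; exact: measurable_indic.
  have h1 y : `|h y| <= 1 by rewrite /h; case: (_ && _); rewrite ?normr1 ?normr0.
  have lh : L2 leb2 cell h by apply: (@L2_bounded _ _ _ _ _ mc (@fin_cell R) _ 1).
  have tN N : TP N.+1 (fejer N.+1 h) by exact: TP_fejer.
  have [||||| _ _ cv] := @dominated_convergence _ _ _ leb2 cell mc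
    (fun n => EFin \o (fun x => f x * fejer n.+1 h x)) (EFin \o (fun x => f x * h x)) (EFin \o (fun x => `|f x|)).
  - by move=> n; apply/measurable_EFinP; exact: rint_measurable (L2_prod mc lf (L2_TP (tN n))).
  - by apply/measurable_EFinP; exact: rint_measurable (L2_prod mc lf lh).
  (* The exceptional set consists of six lines: four through the edges of the box and two along the
     boundary of the cell. *)
  - have A1 := ae_and (ae_and (ae_fst_neq 0) (ae_fst_neq a)) (ae_fst_neq b).
    have A2 := ae_and (ae_and (ae_snd_neq 0) (ae_snd_neq c)) (ae_snd_neq d).
    apply: filterS (ae_and A1 A2) => x [[[n1 na] nb] [[n2 nc] nd]] cx.
    apply: cvg_EFin; first exact: nearW.
    by apply: cvgM; [exact: cvg_cst|exact: fejer_box_cvg].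
  - by have := integrable_norm rf.
  - apply: aeW => x n cx; rewrite /= lee_fin normrM ler_piMr//.
    by apply: fejer_bounded.
  have E : (fun n : nat => (\int[leb2]_(x in cell) (f x * fejer n.+1 h x)%R%:E)%E) = cst 0%E.
    apply/funext => n; rewrite /cst -[RHS]/((0 : R)%:E) -(fTP _ _ (tN n)) /Rintegral fineK//.
    by apply: integrable_fin_num => //; exact: (L2_prod mc lf (L2_TP (tN n))).
  have : (\int[leb2]_(x in cell) (f x * h x)%:E)%E = 0%E.
    by move: cv; rewrite [X in X @ _ --> _](_ : _ = cst 0%E); [move=> /cvg_lim <-//; rewrite lim_cst|exact: E].
  by move=> I0; rewrite Rint_setI -hB /Rintegral I0.
have oI : setI_closed (@ocitv R) by exact: ocitvI.
have mY (c d : R) : measurable ([set` `]c, d]] : set mR) by exact: measurable_itv.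
(* Boxes are extended to measurable sets one side at a time, by a Dynkin argument in each
   coordinate. *)
have half (c d : R) (A : set mR) : measurable A ->
    \int[leb2]_(x in cell `&` (A `*` [set` `]c, d]])) f x = 0.
  move=> mA; pose D' := cell `&` (setT `*` [set` `]c, d]]) : set (mR * mR).
  have mD' : measurable D' by apply: measurableI => //; exact: measurableX.
  have DE (B : set mR) : D' `&` (fst @^-1` B) = cell `&` (B `*` [set` `]c, d]]).
    by apply/seteqP; split=> x; [move=> [[cx [_ h]] hB]|move=> [cx [h hB]]].
  rewrite -DE; apply: (@dynkin_Rint0 _ _ _ leb2 D' mD' _ mR fst (@ocitv R)) => //.
  - by apply: integrableS rf => // x [].
  (* Inside the cell the full strip is the box with first side ]-1, 1], which contains [0, 1[. *)
  - rewrite -(box (-1) 1 c d); congr (\int[leb2]_(x in _) _); apply/seteqP; split=> x.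
      move=> [[x1 x2] [_ h]]; split; [by []|split=> //].
      by move: x1; rewrite /= !in_itv/= => /andP[? ?]; apply/andP; split; lra.
    by move=> [cx [_ h]].
  - by move=> _ [[a b] _ <-]; rewrite DE; exact: box.
apply: rint_ae0 => // A mA.
rewrite -[A](@preimage_id _ A).
apply: (@dynkin_Rint0 _ _ _ leb2 cell mc _ (mR * mR)%type id
  [set A `*` B | A in (measurable : set (set mR)) & B in (measurable : set (set mR))]) => //.
- exact: measurable_prod_measurableType.
- move=> _ _ [A1 mA1 [B1 mB1 <-]] [A2 mA2 [B2 mB2 <-]]; exists (A1 `&` A2); first exact: measurableI.
  by exists (B1 `&` B2); [exact: measurableI|rewrite setXI].
move=> _ [A1 mA1 [B1 mB1 <-]]; rewrite preimage_id.
pose D' := cell `&` (A1 `*` setT) : set (mR * mR).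
have mD' : measurable D' by apply: measurableI => //; exact: measurableX.
have DE (B : set mR) : D' `&` (snd @^-1` B) = cell `&` (A1 `*` B).
  by apply/seteqP; split=> x; [move=> [[cx [h _]] hB]|move=> [cx [h hB]]].
rewrite -DE; apply: (@dynkin_Rint0 _ _ _ leb2 D' mD' _ mR snd (@ocitv R)) => //.
- by apply: integrableS rf => // x [].
- rewrite -(half (-1) 1 A1 mA1); congr (\int[leb2]_(x in _) _); apply/seteqP; split=> x.
    move=> [[x1 x2] [h _]]; split; [by []|split=> //].
    by move: x2; rewrite /= !in_itv/= => /andP[? ?]; apply/andP; split; lra.
  by move=> [cx [h _]].
- by move=> _ [[a b] _ <-]; rewrite DE; exact: half.
Qed.

End completeness.

(** * Fourier truncation of solenoidal fields *)

Section projection.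
Context {R : realType}.
Local Notation mR := (measurableTypeR R).
Local Notation cell := (@cell R).
Local Notation leb2 := (@leb2 R).
Implicit Types (f g : R * R -> R * R) (k l : int * int).

Let mc := @measurable_cell R.

Lemma fourier_cosE f k (a : R * R) : VL2 f -> dot (fourier_cos f k) a = vip f (smode k a 0).
Proof. by move=> Vf; rewrite vip_smode// /dot/= !mulr0 !addr0. Qed.

Lemma fourier_sinE f k (a : R * R) : VL2 f -> dot (fourier_sin f k) a = vip f (smode k 0 a).
Proof. by move=> Vf; rewrite vip_smode// /dot/= !mulr0 !add0r. Qed.

Lemma dot_ext (z w : R * R) : (forall a, dot z a = dot w a) -> z = w.
Proof.
case: z w => [z1 z2] [w1 w2] H; have := H (1, 0); have := H (0, 1).
by rewrite /dot/= !mulr0 !mulr1 !add0r !addr0 => -> ->.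
Qed.

Lemma fourier_cosD f g k : VL2 f -> VL2 g ->
  fourier_cos (fun x => f x + g x) k = fourier_cos f k + fourier_cos g k.
Proof.
move=> Vf Vg; apply: dot_ext => a; rewrite fourier_cosE; last exact: VL2D.
rewrite vipDl//; last exact: VL2_smode.
by rewrite -!fourier_cosE// /dot/=; ring.
Qed.

Lemma fourier_sinD f g k : VL2 f -> VL2 g ->
  fourier_sin (fun x => f x + g x) k = fourier_sin f k + fourier_sin g k.
Proof.
move=> Vf Vg; apply: dot_ext => a; rewrite fourier_sinE; last exact: VL2D.
rewrite vipDl//; last exact: VL2_smode.
by rewrite -!fourier_sinE// /dot/=; ring.
Qed.

Lemma PiD n f g x : VL2 f -> VL2 g -> Pi_ n (fun x => f x + g x) x = Pi_ n f x + Pi_ n g x.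
Proof.
move=> Vf Vg; rewrite /Pi_ -big_split; apply: eq_bigr => k _ /=.
rewrite fourier_cosD// fourier_sinD// -lerayD; congr leray.
by rewrite !scalerDr addrACA.
Qed.

Lemma Pi_zero_mode n (a b : R * R) x : Pi_ n (smode (0, 0) a b) x = 0.
Proof.
rewrite Pi_smode big1_seq// => l /andP[_]; rewrite mem_modes => /andP[l0 _].
have [-> ->] := fourier_smode (0, 0) l a b.
have -> : ((0, 0) == l) = false by rewrite eq_sym (negbTE l0).
have -> : ((0, 0) == (- l.1, - l.2)) = false.
  by apply/negbTE; move: l0; case: l => p q; rewrite !xpair_eqE/= ![0 == _]eq_sym !oppr_eq0.
rewrite addr0 subr0 mulr0 !scale0r /smode /leray /dot/= !mulr0 addr0 mul0r scale0r subr0.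
by rewrite !scaler0 addr0.
Qed.

Lemma smode0 (a b x : R * R) : smode (0, 0) a b x = a.
Proof. by rewrite /smode phase0 cos0 sin0 scale1r scale0r addr0. Qed.

Definition solenoidal_mode n k (a b : R * R) :=
  k = (0, 0) \/ [/\ k \in modes n, dot (frequency k) a = 0 & dot (frequency k) b = 0].

(** Solenoidal modes of admissible frequency are fixed by [Pi_ n], zero modes are sent to 0; the
    constant [c] is the sum of the latter. *)
Lemma Pi_sum_smode n (I : eqType) (s : seq I) (k : I -> int * int) (a b : I -> R * R) :
  (forall i, i \in s -> solenoidal_mode n (k i) (a i) (b i)) ->
  exists c, forall x, \sum_(i <- s) smode (k i) (a i) (b i) x =
    Pi_ n (fun y => \sum_(i <- s) smode (k i) (a i) (b i) y) x + c.
Proof.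
elim: s => [_|i s IHs H].
  exists 0 => x; rewrite addr0 big_nil (_ : (fun y => _) = smode (0, 0) 0 0) ?Pi_zero_mode//.
  by apply/funext => y; rewrite big_nil smode0.
have [j js|c IH] := IHs; first by apply: H; rewrite inE js orbT.
have VS : VL2 (fun y => \sum_(i <- s) smode (k i) (a i) (b i) y) by apply: VL2_sum => j; exact: VL2_smode.
have E : (fun y => \sum_(j <- i :: s) smode (k j) (a j) (b j) y) =
    fun y => smode (k i) (a i) (b i) y + \sum_(j <- s) smode (k j) (a j) (b j) y.
  by apply/funext => y; rewrite big_cons.
have D x : Pi_ n (fun y => \sum_(j <- i :: s) smode (k j) (a j) (b j) y) x =
    Pi_ n (smode (k i) (a i) (b i)) x + Pi_ n (fun y => \sum_(j <- s) smode (k j) (a j) (b j) y) x.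
  by rewrite E PiD//; exact: VL2_smode.
case: (H i (mem_head _ _)) => [k0|[kn ka kb]].
  exists (c + a i) => x; rewrite big_cons D IH k0 Pi_zero_mode smode0 add0r.
  by rewrite addrC addrA.
exists c => x; rewrite big_cons D IH Pi_smode_mode// (leray_perp ka) (leray_perp kb).
by rewrite addrA.
Qed.

Lemma TP_smooth m (f : R * R -> R) : TP m f -> smooth f.
Proof.
move=> tf n; elim: n f tf => [|n IH] f tf; split; try exact: TP_continuous tf; first by [].
move=> v; have [tf' df _] := TP_derive v tf; split=> //.
exact: IH.
Qed.

(** The distributional divergence is tested on the sine and the cosine of the phase, whose gradients
    are multiples of the frequency times the cosine and the sine. *)
Lemma in_L2sigma_perp f k : in_L2sigma f ->
  dot (frequency k) (fourier_cos f k) = 0 /\ dot (frequency k) (fourier_sin f k) = 0.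
Proof.
move=> sf; have Vf := in_L2sigma_VL2 sf; case: sf => _ _ H _ _.
have pc := TP_periodic (@TP_cos R _ _ (in_box_self k)); have sc := TP_smooth (@TP_cos R _ _ (in_box_self k)).
have ps := TP_periodic (@TP_sin R _ _ (in_box_self k)); have ss := TP_smooth (@TP_sin R _ _ (in_box_self k)).
have p0 : 2 * pi != 0 :> R by rewrite mulf_neq0// gt_eqF// pi_gt0.
split; apply/eqP.
  have E : \int[leb2]_(x in cell) dot (f x) (grad (fun x => sin (phase k x)) x) = vip f (smode k ((2 * pi) *: frequency k) 0).
    apply: eq_Rint => x _; congr dot; rewrite /grad; have [_ ->] := is_derive_sin_phase k x e1.
    have [_ ->] := is_derive_sin_phase k x e2.
    by rewrite phase_e1 phase_e2 /smode scaler0 addr0; congr pair; rewrite /= -![_ *: _]/(_ * _); ring.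
  have := H _ ps ss; rewrite E -fourier_cosE// => h; rewrite -(mulrI_eq0 _ (lregP p0)); apply/eqP; rewrite -h.
  by rewrite /dot/= -![_ *: _]/(_ * _); ring.
have E : \int[leb2]_(x in cell) dot (f x) (grad (fun x => cos (phase k x)) x) = vip f (smode k 0 (- (2 * pi) *: frequency k)).
  apply: eq_Rint => x _; congr dot; rewrite /grad; have [_ ->] := is_derive_cos_phase k x e1.
  have [_ ->] := is_derive_cos_phase k x e2.
  by rewrite phase_e1 phase_e2 /smode scaler0 add0r; congr pair; rewrite /= -![_ *: _]/(_ * _); ring.
have := H _ pc sc; rewrite E -fourier_sinE// => h; rewrite -(mulrI_eq0 _ (lregP p0)); apply/eqP; rewrite -[RHS]oppr0 -h.
by rewrite /dot/= -![_ *: _]/(_ * _); ring.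
Qed.

Lemma vip_Pi_mode n f k (a b : R * R) : in_L2sigma f -> k = (0, 0) \/ k \in modes n ->
  vip (Pi_ n f) (smode k a b) = vip f (smode k a b).
Proof.
move=> sf hk; have Vf := in_L2sigma_VL2 sf.
rewrite vip_Pi_sym//; last exact: VL2_smode.
have [fc fs] := in_L2sigma_perp k sf; case: hk => [k0|kn].
  have -> : Pi_ n (smode k a b) = smode (0, 0) 0 0.
    by apply/funext => x; rewrite k0 Pi_zero_mode smode0.
  have -> : smode k a b = fun=> a by apply/funext => x; rewrite k0 smode0.
  have -> : smode (0, 0) 0 0 = fun=> 0 :> R * R by apply/funext => x; rewrite smode0.
  have [_ _ _ f1 f2] := sf.
  have f0 : fourier_cos f (0, 0) = 0.
    congr pair; [rewrite -[RHS]f1|rewrite -[RHS]f2].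
      by apply: eq_Rint => x _; rewrite phase0 cos0 mulr1.
    by apply: eq_Rint => x _; rewrite phase0 cos0 mulr1.
  have V c : vip f (fun=> c) = 0.
    have -> : (fun=> c) = smode (0, 0) c 0 by apply/funext => x; rewrite smode0.
    by rewrite -fourier_cosE// f0 /dot/= !mul0r addr0.
  by rewrite !V.
rewrite Pi_smode_mode// !vip_smode// -!dot_leray.
by rewrite (leray_perp fc) (leray_perp fs).
Qed.

Lemma vip_Pi_Pi n f : in_L2sigma f -> vip (Pi_ n f) (Pi_ n f) = vip f (Pi_ n f).
Proof.
move=> sf; have Vf := in_L2sigma_VL2 sf.
have E : Pi_ n f = fun x => \sum_(k <- modes n) smode k (leray k (fourier_cos f k)) (leray k (fourier_sin f k)) x.
  by apply/funext => x; exact: Pi_smode.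
rewrite [X in vip _ X = _]E [X in _ = vip _ X]E.
rewrite !vip_sumr//; [|by move=> k; exact: VL2_smode|exact: VTP_VL2 (VTP_Pi n f)|by move=> k; exact: VL2_smode].
by rewrite !big_seq; apply: eq_bigr => k kn; apply: vip_Pi_mode => //; right.
Qed.

Lemma vip_Pi_dist n f : in_L2sigma f ->
  vip (fun x => f x - Pi_ n f x) (fun x => f x - Pi_ n f x) = vip f f - vip f (Pi_ n f).
Proof.
move=> sf; have Vf := in_L2sigma_VL2 sf; have VP := VTP_VL2 (VTP_Pi n f).
rewrite vipBl//; last exact: VL2B.
rewrite vipC vipBl// [X in _ - X]vipC vipBl// vip_Pi_Pi// [vip (Pi_ n f) f]vipC.
by rewrite subrr subr0.
Qed.

Lemma modes_eventually k : k != (0, 0) -> exists n0, forall n, (n0 <= n)%N -> k \in modes n.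
Proof.
move=> k0; exists (2 * maxn `|k.1| `|k.2|)%N => n; apply: box_modes => //; exact: in_box_self.
Qed.

(** The squared distance is <f, f> - <f, Pi_n f>, so weak convergence of the truncations suffices.
    They are bounded, and a weak limit has the Fourier coefficients of [f], so it equals [f] by
    completeness. *)
Lemma Pi_dense f (eps : R) : in_L2sigma f -> 0 < eps ->
  exists n, vip (fun x => f x - Pi_ n f x) (fun x => f x - Pi_ n f x) < eps.
Proof.
move=> sf e0; have Vf := in_L2sigma_VL2 sf; have [V1 V2] := Vf.
have [U [UU UF]] := @ultraFilterLemma nat \oo _.
have VP n := VTP_VL2 (VTP_Pi n f).
have PC n : vip (Pi_ n f) (Pi_ n f) <= vip f f.
  by rewrite vip_Pi_Pi// -subr_ge0 -vip_Pi_dist// vip_ge0.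
have B n : \int[leb2]_(x in cell) ((Pi_ n f x).1 * (Pi_ n f x).1) <= vip f f /\
           \int[leb2]_(x in cell) ((Pi_ n f x).2 * (Pi_ n f x).2) <= vip f f.
  have := PC n; rewrite vipE//.
  have := ip_ge0 leb2 cell (fun x => (Pi_ n f x).1).
  have := ip_ge0 leb2 cell (fun x => (Pi_ n f x).2).
  move: (\int[_]_(_ in _) _) (\int[_]_(_ in _) _) => P Q; split; lra.
have B1 : \forall n \near U, \int[leb2]_(x in cell) ((Pi_ n f x).1 * (Pi_ n f x).1) <= vip f f.
  by apply: nearW => n; case: (B n).
have B2 : \forall n \near U, \int[leb2]_(x in cell) ((Pi_ n f x).2 * (Pi_ n f x).2) <= vip f f.
  by apply: nearW => n; case: (B n).
have [h1 [lh1 _] H1] := weak_L2_limit (U := U) mc (@fin_cell R) (f := fun n x => (Pi_ n f x).1)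
  (fun n => (VP n).1) B1.
have [h2 [lh2 _] H2] := weak_L2_limit (U := U) mc (@fin_cell R) (f := fun n x => (Pi_ n f x).2)
  (fun n => (VP n).2) B2.
(* For a fixed mode the pairing is constant as soon as [n] is large enough. *)
have key k (a b : R * R) : vip (Pi_ n f) (smode k a b) @[n --> U] --> vip f (smode k a b).
  apply: cvg_near_cst; apply: UF.
  have [k0|k0] := eqVneq k (0, 0); first by exists 0%N => // n _; apply: vip_Pi_mode => //; left.
  have [n0 Hn] := modes_eventually k0; exists n0 => // n /= nn.
  by apply: vip_Pi_mode => //; right; exact: Hn.
have lc k := L2_TP (@TP_cos R _ _ (in_box_self k)); have ls k := L2_TP (@TP_sin R _ _ (in_box_self k)).
have c1 g k : VL2 g -> vip g (smode k (1, 0) 0) = \int[leb2]_(x in cell) ((g x).1 * cos (phase k x)).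
  by move=> Vg; rewrite -fourier_cosE// /dot/= mulr1 mulr0 addr0.
have c2 g k : VL2 g -> vip g (smode k (0, 1) 0) = \int[leb2]_(x in cell) ((g x).2 * cos (phase k x)).
  by move=> Vg; rewrite -fourier_cosE// /dot/= mulr1 mulr0 add0r.
have s1 g k : VL2 g -> vip g (smode k 0 (1, 0)) = \int[leb2]_(x in cell) ((g x).1 * sin (phase k x)).
  by move=> Vg; rewrite -fourier_sinE// /dot/= mulr1 mulr0 addr0.
have s2 g k : VL2 g -> vip g (smode k 0 (0, 1)) = \int[leb2]_(x in cell) ((g x).2 * sin (phase k x)).
  by move=> Vg; rewrite -fourier_sinE// /dot/= mulr1 mulr0 add0r.
have uniq (g h q : R * R -> R) : L2 leb2 cell g -> L2 leb2 cell h -> L2 leb2 cell q ->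
    \int[leb2]_(x in cell) (g x * q x) = \int[leb2]_(x in cell) (h x * q x) ->
    \int[leb2]_(x in cell) ((g x - h x) * q x) = 0.
  move=> lg lh lq E; rewrite -[RHS](subrr (\int[leb2]_(x in cell) (h x * q x))) -{1}E.
  rewrite -RintegralB//; [|exact: L2_prod..].
  by apply: eq_Rint => x _; rewrite mulrBl.
have lim_eq (u : nat -> R) (a b : R) : u @ U --> a -> u @ U --> b -> a = b.
  by move=> ua ub; apply: (cvg_unique _ ua ub).
have z1 : {ae leb2, forall x, cell x -> (f x).1 - h1 x = 0}.
  apply: TP_complete => [|k|k]; first exact: L2B.
    apply: uniq => //; rewrite -c1//; apply: lim_eq (key k (1, 0) 0) _.
    by under eq_fun do rewrite c1//; exact: H1.
  apply: uniq => //; rewrite -s1//; apply: lim_eq (key k 0 (1, 0)) _.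
  by under eq_fun do rewrite s1//; exact: H1.
have z2 : {ae leb2, forall x, cell x -> (f x).2 - h2 x = 0}.
  apply: TP_complete => [|k|k]; first exact: L2B.
    apply: uniq => //; rewrite -c2//; apply: lim_eq (key k (0, 1) 0) _.
    by under eq_fun do rewrite c2//; exact: H2.
  apply: uniq => //; rewrite -s2//; apply: lim_eq (key k 0 (0, 1)) _.
  by under eq_fun do rewrite s2//; exact: H2.
have aeq (g h q : R * R -> R) : L2 leb2 cell g -> L2 leb2 cell h -> L2 leb2 cell q ->
    {ae leb2, forall x, cell x -> g x - h x = 0} ->
    \int[leb2]_(x in cell) (h x * q x) = \int[leb2]_(x in cell) (g x * q x).
  move=> lg lh lq; rewrite /Rintegral => gh; congr fine; apply: ae_eq_integral => //.
  - by apply/measurable_EFinP; exact: rint_measurable (L2_prod mc lh lq).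
  - by apply/measurable_EFinP; exact: rint_measurable (L2_prod mc lg lq).
  - by apply: filterS gh => x hx cx; move/eqP: (hx cx); rewrite subr_eq0 => /eqP ->.
have cv : vip (Pi_ n f) f @[n --> U] --> vip f f.
  rewrite [X in _ --> X]vipE// -(aeq _ _ _ V1 lh1 V1 z1) -(aeq _ _ _ V2 lh2 V2 z2).
  by under eq_fun do rewrite vipE//; apply: cvgD; [exact: H1|exact: H2].
have : \forall n \near U, `|vip f f - vip (Pi_ n f) f| < eps by move/cvgrPdist_lt : cv; apply.
move=> /filter_ex [n Hn]; exists n; rewrite vip_Pi_dist// [vip f (Pi_ n f)]vipC.
by apply: le_lt_trans Hn; rewrite ler_norm.
Qed.

End projection.

(** * Approximation of test fields by solenoidal trigonometric polynomials *)

Section test_fields.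
Context {R : realType}.
Local Notation mR := (measurableTypeR R).
Local Notation cell := (@cell R).
Local Notation leb2 := (@leb2 R).

Let mc := @measurable_cell R.

Let et : R * (R * R) := (1, (0, 0)).
Let ex (e : R * R) : R * (R * R) := (0, e).

Lemma is_derive_slice_time (F : R * (R * R) -> R) (t d : R) x :
  is_derive (t, x) et F d -> is_derive t 1 (fun s => F (s, x)) d.
Proof.
have E (s : R) : s *: et + (0, x) = (s, x).
  by case: x => x1 x2; congr (_, (_, _)); rewrite /= -![_ *: _]/(_ * _); ring.
rewrite -E => /line_is_derive.
by congr (is_derive t 1 _ d); apply/funext => s; rewrite E.
Qed.

Lemma is_derive_slice_space (F : R * (R * R) -> R) (t d : R) (x e : R * R) :
  is_derive (t, x) (ex e) F d -> is_derive x e (fun y => F (t, y)) d.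
Proof.
have E (s : R) : s *: ex e + (t, x) = (t, s *: e + x).
  by case: x => x1 x2; congr (_, (_, _)); rewrite /= -![_ *: _]/(_ * _); ring.
move=> h; apply: is_derive_line.
have : is_derive (0 *: ex e + (t, x)) (ex e) F d by rewrite scale0r add0r.
move=> /line_is_derive.
by congr (is_derive (0 : R) 1 _ d); apply/funext => s; rewrite E.
Qed.

Lemma smooth_derive (F : R * (R * R) -> R * R) : smooth F ->
  (forall p v, is_derive p v F ('D_v F p)) /\ (forall v, continuous (fun p => 'D_v F p)).
Proof.
move=> sF; have [_ H] := sF 1%N; split=> [p v|v].
  by apply: DeriveDef => //; case: (H v).
by case: (H v) => _ [].
Qed.

Lemma continuous_fst_comp (F : R * (R * R) -> R * R) : continuous F -> continuous (fun p => (F p).1).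
Proof. by move=> cF p; have := @cvg_comp _ _ _ _ fst _ _ _ (cF p) (@cvg_fst _ _ _ _ _); exact. Qed.

Lemma continuous_snd_comp (F : R * (R * R) -> R * R) : continuous F -> continuous (fun p => (F p).2).
Proof. by move=> cF p; have := @cvg_comp _ _ _ _ snd _ _ _ (cF p) (@cvg_snd _ _ _ _ _); exact. Qed.

(** Up to the factor 2 pi, the product of the frequency with a Fourier coefficient is a Fourier
    coefficient of the divergence. *)
Lemma solenoidal_fourier (f : R * R -> R * R) (d1 d2 : R * R -> R) k :
  Z2periodic f -> continuous (fun x => (f x).1) -> continuous (fun x => (f x).2) ->
  continuous d1 -> continuous d2 ->
  (forall x, is_derive x e1 (fun y => (f y).1) (d1 x)) ->
  (forall x, is_derive x e2 (fun y => (f y).2) (d2 x)) -> (forall x, d1 x + d2 x = 0) ->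
  dot (frequency k) (fourier_cos f k) = 0 /\ dot (frequency k) (fourier_sin f k) = 0.
Proof.
move=> pf c1 c2 cd1 cd2 D1 D2 dd.
have p1 : Z2periodic (fun x => (f x).1) by move=> l x; rewrite pf.
have p2 : Z2periodic (fun x => (f x).2) by move=> l x; rewrite pf.
have [A1 B1] := fourier_derive k (or_introl erefl) c1 cd1 p1 D1.
have [A2 B2] := fourier_derive k (or_intror erefl) c2 cd2 p2 D2.
have Z (h : R * R -> R) : continuous h ->
    \int[leb2]_(x in cell) (d1 x * h x) + \int[leb2]_(x in cell) (d2 x * h x) = 0.
  move=> ch; rewrite -RintegralD//; try by apply: continuous_rint => x; apply: cvgM; [exact: cd1|exact: ch].
    rewrite (@eq_Rint _ _ _ _ _ _ (fun=> 0)) ?Rintegral_cst ?mul0r// => x _.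
    by rewrite -mulrDl dd mul0r.
  by apply: continuous_rint => x; apply: cvgM; [exact: cd2|exact: ch].
have p0 : 2 * pi != 0 :> R by rewrite mulf_neq0// gt_eqF// pi_gt0.
have Zc := Z _ (@continuous_cos_phase R k); have Zs := Z _ (@continuous_sin_phase R k).
move: Zc Zs; rewrite A1 A2 B1 B2 phase_e1 phase_e2 => Zc Zs.
rewrite /= in Zc Zs.
split; apply: (mulfI p0); rewrite mulr0 /dot/=.
  by rewrite -[RHS]oppr0 -Zs; ring.
by rewrite -[RHS]Zc; ring.
Qed.

(** Fejer averaging multiplies the vector coefficients by scalars, so coefficients orthogonal to
    their frequency remain so. *)
Lemma fejer_smode N (f : R * R -> R * R) x :
  (fejer N (fun y => (f y).1) x, fejer N (fun y => (f y).2) x) =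
  \sum_(i : ('I_N * 'I_N) * ('I_N * 'I_N)) smode (freqB i.1 i.2)
    (N%:R ^- 2 *: fourier_cos f (freqB i.1 i.2)) (N%:R ^- 2 *: fourier_sin f (freqB i.1 i.2)) x.
Proof.
rewrite -(pair_bigA _ (fun a b => smode (freqB a b)
    (N%:R ^- 2 *: fourier_cos f (freqB a b)) (N%:R ^- 2 *: fourier_sin f (freqB a b)) x))/=.
rewrite [RHS]surjective_pairing !(sum_fst, sum_snd); congr pair.
  rewrite /fejer mulr_sumr; apply: eq_bigr => a _; rewrite sum_fst mulr_sumr; apply: eq_bigr => b _.
  by rewrite /smode/= -![_ *: _]/(_ * _); ring.
rewrite /fejer mulr_sumr; apply: eq_bigr => a _; rewrite sum_snd mulr_sumr; apply: eq_bigr => b _.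
by rewrite /smode/= -![_ *: _]/(_ * _); ring.
Qed.

Definition close (eps : R) (z w : R * R) := `|z.1 - w.1| <= eps /\ `|z.2 - w.2| <= eps.

(** [G] and [G'] are the Fejer means in space of the field and of its time derivative. They inherit
    the divergence constraint mode by mode and the vanishing at [tau] by linearity. The averaging
    commutes with all the derivatives involved, so one uniform convergence theorem yields the four
    estimates. *)
Lemma test_field_approx tau (phi : R -> R * R -> R * R) (eps : R) : 0 < tau -> test_field tau phi -> 0 < eps ->
  exists (p : nat) (G G' : R -> R * R -> R * R),
  [/\ (forall t, VTP p (G t)) /\ (forall t, VTP p (G' t)),
      forall (t : R) x, is_derive t 1 (fun s => G s x) (G' t x),
      (forall x, continuous (fun t => G' t x)) /\
      (forall x e, e = e1 \/ e = e2 -> continuous (fun t => ('D_e (G t) x).1) /\ continuous (fun t => ('D_e (G t) x).2)),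
      (forall n t, (2 * p <= n)%N -> 0 <= t -> exists c, forall x, G t x = Pi_ n (G t) x + c) /\
      (forall x, G tau x = 0)
    & forall t x, 0 <= t <= tau -> cell x ->
      [/\ close eps (G t x) (phi t x), close eps (G' t x) (dt phi t x),
          close eps ('D_e1 (G t) x) ('D_e1 (phi t) x) & close eps ('D_e2 (G t) x) ('D_e2 (phi t) x)]].
Proof.
move=> tau0 [pphi sphi [T Ttau phi0] dphi] e0.
set F := (fun p => phi p.1 p.2) in sphi.
have cF : continuous F by have [] := sphi 0%N.
have [dF cDF] := smooth_derive sphi.
pose g1 p := (F p).1; pose g2 p := (F p).2.
have cg1 : continuous g1 := continuous_fst_comp cF.
have cg2 : continuous g2 := continuous_snd_comp cF.
pose D1 v p := ('D_v F p).1; pose D2 v p := ('D_v F p).2.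
have cD1 v : continuous (D1 v) := continuous_fst_comp (cDF v).
have cD2 v : continuous (D2 v) := continuous_snd_comp (cDF v).
have t1 (s : R) x : is_derive s 1 (fun r => g1 (r, x)) (D1 et (s, x)) := is_derive_slice_time (is_derive_fst (dF (s, x) et)).
have t2 (s : R) x : is_derive s 1 (fun r => g2 (r, x)) (D2 et (s, x)) := is_derive_slice_time (is_derive_snd (dF (s, x) et)).
have x1 (s : R) (x e : R * R) : is_derive x e (fun y => g1 (s, y)) (D1 (ex e) (s, x)) := is_derive_slice_space (is_derive_fst (dF (s, x) (ex e))).
have x2 (s : R) (x e : R * R) : is_derive x e (fun y => g2 (s, y)) (D2 (ex e) (s, x)) := is_derive_slice_space (is_derive_snd (dF (s, x) (ex e))).
have dtE (t : R) x : dt phi t x = (D1 et (t, x), D2 et (t, x)).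
  rewrite /dt derive1E; have [_ ] := is_derive_pair (t1 t x) (t2 t x).
  by rewrite (_ : (fun y => (g1 (y, x), g2 (y, x))) = phi ^~ x)//; apply/funext => s; rewrite /g1 /g2/F/= -surjective_pairing.
have dxE (t : R) (x e : R * R) : 'D_e (phi t) x = (D1 (ex e) (t, x), D2 (ex e) (t, x)).
  have [_ ] := is_derive_pair (x1 t x e) (x2 t x e).
  by rewrite (_ : (fun y => (g1 (t, y), g2 (t, y))) = phi t)//; apply/funext => y; rewrite /g1 /g2/F/= -surjective_pairing.
have pg1 t : Z2periodic (fun x => g1 (t, x)) by move=> l x; rewrite /g1 /F/= pphi.
have pg2 t : Z2periodic (fun x => g2 (t, x)) by move=> l x; rewrite /g2 /F/= pphi.
have per_t (g gt : R * (R * R) -> R) : (forall t, Z2periodic (fun x => g (t, x))) ->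
    (forall (s : R) x, is_derive s 1 (fun r => g (r, x)) (gt (s, x))) -> forall t, Z2periodic (fun x => gt (t, x)).
  move=> pg dg t l x; have [_ <-] := dg t (x.1 + l.1%:~R, x.2 + l.2%:~R); have [_ <-] := dg t x.
  by congr ('D_1 _ t); apply/funext => s; exact: pg.
have per_x (g gx : R * (R * R) -> R) (e : R * R) : (forall t, Z2periodic (fun x => g (t, x))) ->
    (forall (s : R) x, is_derive x e (fun y => g (s, y)) (gx (s, x))) -> forall t, Z2periodic (fun x => gx (t, x)).
  move=> pg dg t l x; have [_ <-] := dg t (x.1 + l.1%:~R, x.2 + l.2%:~R); have [_ <-] := dg t x.
  have E : (fun h : R => h^-1 *: (((fun y => g (t, y)) \o shift (x.1 + l.1%:~R, x.2 + l.2%:~R)) (h *: e) -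
      g (t, (x.1 + l.1%:~R, x.2 + l.2%:~R)))) =
      (fun h : R => h^-1 *: (((fun y => g (t, y)) \o shift x) (h *: e) - g (t, x))).
    apply/funext => h /=; congr (_ *: (_ - _)); last exact: pg.
    by rewrite -[RHS](pg t l); congr g; congr pair; congr pair; rewrite /= addrA.
  by rewrite /derive E.
have U (g : R * (R * R) -> R) : continuous g -> (forall t, Z2periodic (fun x => g (t, x))) ->
    exists N0, forall N, (N0 <= N)%N -> forall t x, 0 <= t <= tau -> cell x ->
    `|fejer N (fun y => g (t, y)) x - g (t, x)| <= eps by move=> cg pg; exact: fejer_uniform.
have [N1 H1] := U _ cg1 pg1; have [N2 H2] := U _ cg2 pg2.
have [N3 H3] := U _ (cD1 et) (per_t _ _ pg1 t1); have [N4 H4] := U _ (cD2 et) (per_t _ _ pg2 t2).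
have [N5 H5] := U _ (cD1 (ex e1)) (per_x _ _ e1 pg1 (fun s x => x1 s x e1)).
have [N6 H6] := U _ (cD2 (ex e1)) (per_x _ _ e1 pg2 (fun s x => x2 s x e1)).
have [N7 H7] := U _ (cD1 (ex e2)) (per_x _ _ e2 pg1 (fun s x => x1 s x e2)).
have [N8 H8] := U _ (cD2 (ex e2)) (per_x _ _ e2 pg2 (fun s x => x2 s x e2)).
(* A sum of the thresholds exceeds each of them. *)
pose N := (N1 + N2 + N3 + N4 + N5 + N6 + N7 + N8)%N.
pose G (t : R) x := (fejer N (fun y => g1 (t, y)) x, fejer N (fun y => g2 (t, y)) x).
pose G' (t : R) x := (fejer N (fun y => D1 et (t, y)) x, fejer N (fun y => D2 et (t, y)) x).
have cs1 t : continuous (fun x => g1 (t, x)) by exact: continuous_section.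
have cs2 t : continuous (fun x => g2 (t, x)) by exact: continuous_section.
have csD1 v t : continuous (fun x => D1 v (t, x)) by exact: continuous_section.
have csD2 v t : continuous (fun x => D2 v (t, x)) by exact: continuous_section.
have dG (t : R) (x e : R * R) : e = e1 \/ e = e2 -> is_derive x e (G t)
    (fejer N (fun y => D1 (ex e) (t, y)) x, fejer N (fun y => D2 (ex e) (t, y)) x).
  move=> he; apply: is_derive_pair.
    exact: (is_derive_fejer N x he (cs1 t) (csD1 (ex e) t) (pg1 t) (fun y => x1 t y e)).
  exact: (is_derive_fejer N x he (cs2 t) (csD2 (ex e) t) (pg2 t) (fun y => x2 t y e)).
exists N, G, G'; split.
- by split=> t; split; exact: TP_fejer.
- move=> t x; apply: is_derive_pair; exact: is_derive_fejer_time.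
- split=> [x t|x e he].
    have c1 := @continuous_fejer_time R N _ x (cD1 et) t; have c2 := @continuous_fejer_time R N _ x (cD2 et) t.
    by have := cvg_pair c1 c2 => /(_ _ _ _); apply; exact: nbhs_filter.
  have E t : 'D_e (G t) x = (fejer N (fun y => D1 (ex e) (t, y)) x, fejer N (fun y => D2 (ex e) (t, y)) x).
    by case: (dG t x e he).
  by split; under eq_fun do rewrite E/=; exact: continuous_fejer_time.
- split=> [n t nN t0|x].
    have GE x : G t x = _ := fejer_smode N (phi t) x.
    have [|c Hc] := @Pi_sum_smode R n _ (index_enum _) (fun i : ('I_N * 'I_N) * ('I_N * 'I_N) => freqB i.1 i.2)
      (fun i => N%:R ^- 2 *: fourier_cos (phi t) (freqB i.1 i.2)) (fun i => N%:R ^- 2 *: fourier_sin (phi t) (freqB i.1 i.2)).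
      move=> i _; have [k0|k0] := eqVneq (freqB i.1 i.2) (0, 0); [by left|right].
      have [fc fs] : dot (frequency (freqB i.1 i.2)) (fourier_cos (phi t) (freqB i.1 i.2)) = 0 /\
          dot (frequency (freqB i.1 i.2)) (fourier_sin (phi t) (freqB i.1 i.2)) = 0.
        apply: (solenoidal_fourier _ (pphi t) (cs1 t) (cs2 t) (csD1 (ex e1) t) (csD2 (ex e2) t)).
        by move=> x; have := dphi t x t0; rewrite /div !dxE.
      split; first exact: (box_modes (freqB_box _ _)).
      - by move: fc; rewrite /dot/= -![_ *: _]/(_ * _) => fc; rewrite !(mulrCA _ (N%:R ^- 2)) -mulrDr fc mulr0.
      - by move: fs; rewrite /dot/= -![_ *: _]/(_ * _) => fs; rewrite !(mulrCA _ (N%:R ^- 2)) -mulrDr fs mulr0.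
    exists c => x; rewrite GE Hc; congr (Pi_ n _ x + c).
    by apply/funext => y; rewrite GE.
  (* The field vanishes from a time [T < tau] on, in particular at [tau]. *)
  rewrite /G (_ : (fun y => g1 (tau, y)) = fun=> 0); last by apply/funext => y; rewrite /g1 /F phi0// ltW.
  rewrite (_ : (fun y => g2 (tau, y)) = fun=> 0); last by apply/funext => y; rewrite /g2 /F phi0// ltW.
  suff -> : fejer N (fun=> 0) x = 0 by [].
  have I0 (h : R * R -> R) : \int[leb2]_(y in cell) (0 * h y) = 0.
    rewrite (@eq_Rint _ _ _ _ _ _ (fun=> 0)) ?Rintegral_cst ?mul0r// => y _.
    by rewrite mul0r.
  by rewrite /fejer big1 ?mulr0// => a _; rewrite big1// => b _; rewrite !I0 !mulr0 addr0.
move=> t x tt cx; rewrite !dxE dtE.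
have [_ ->] := dG t x e1 (or_introl erefl); have [_ ->] := dG t x e2 (or_intror erefl).
split; split=> /=.
- by apply: H1 => //; rewrite /N; lia.
- by apply: H2 => //; rewrite /N; lia.
- by apply: H3 => //; rewrite /N; lia.
- by apply: H4 => //; rewrite /N; lia.
- by apply: H5 => //; rewrite /N; lia.
- by apply: H6 => //; rewrite /N; lia.
- by apply: H7 => //; rewrite /N; lia.
- by apply: H8 => //; rewrite /N; lia.
Qed.

End test_fields.

(** * Uniform weak limits *)

Section equicontinuity.
Context {R : realType}.

Lemma grid_cover (tau de : R) : 0 < tau -> 0 < de -> exists M (p : 'I_M -> R),
  (forall i, 0 <= p i <= tau) /\ forall t, 0 <= t <= tau -> exists i, `|t - p i| < de.
Proof.
move=> t0 d0; pose M := (Num.trunc (tau / de)).+1.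
have M0 : 0 < M%:R :> R by rewrite ltr0n.
have Md : tau / M%:R < de by rewrite ltr_pdivrMr// mulrC -ltr_pdivrMr// truncnS_gt.
exists M.+1, (fun i => i%:R * (tau / M%:R)); split=> [i|t /andP[tt0 tt1]].
  rewrite mulr_ge0 ?(divr_ge0 (ltW t0) (ltW M0))//= mulrCA ger_pMr// ler_pdivrMr// mul1r ler_nat.
  by rewrite -ltnS.
pose j := Num.trunc (t * M%:R / tau).
have q0 : 0 <= t * M%:R / tau by rewrite divr_ge0 ?mulr_ge0// ltW.
have /andP[j1 j2] := truncn_itv q0.
have jM : (j < M.+1)%N.
  rewrite ltnS -(ler_nat R); apply: le_trans j1 _.
  by rewrite ler_pdivrMr// [t * _]mulrC ler_wpM2l// ltW.
exists (Ordinal jM) => /=; apply: le_lt_trans Md.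
have h1 : j%:R * (tau / M%:R) <= t by rewrite mulrA ler_pdivrMr// -ler_pdivlMr.
have h2 : t < j.+1%:R * (tau / M%:R) by rewrite mulrA ltr_pdivlMr// -ltr_pdivrMr.
rewrite -natr1 mulrDl mul1r in h2.
by rewrite ger0_norm ?subr_ge0//; lra.
Qed.

Lemma ucont_within (b : R -> R) (tau : R) :
  (forall e, 0 < e -> exists2 de, 0 < de & forall s t, 0 <= s <= tau -> 0 <= t <= tau ->
    `|s - t| < de -> `|b s - b t| <= e) -> {within `[0, tau], continuous b}.
Proof.
move=> H; apply/subspace_continuousP => t /=; rewrite in_itv/= => tt.
apply/cvgrPdist_le => e /H [de d0 h].
exists de => // s /= st; rewrite in_itv/= => ss; exact: h.
Qed.

Lemma within_ucont (V : pseudoMetricType R) (f : R -> V) (tau : R) :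
  {within `[0, tau], continuous f} ->
  forall e, 0 < e -> exists2 de, 0 < de & forall s t, 0 <= s <= tau -> 0 <= t <= tau ->
    `|s - t| < de -> ball (f s) e (f t).
Proof.
move=> /subspace_continuousP cf e e0.
have /compact_near_coveringP cK := @segment_compact R 0 tau.
pose P (de a : R) := forall b : R, 0 <= a <= tau -> 0 <= b <= tau -> `|a - b| < de -> ball (f a) e (f b).
have := cK R (0^'+) P _; case.
  move=> x Kx; have /cvg_ballP := cf x Kx => /(_ (e / 2) (divr_gt0 e0 (ltr0n R 2))).
  move=> [r /= r0 H].
  exists (ball x (r / 2), [set de | de < r / 2]).
    split; first by apply: nbhsx_ballx; exact: divr_gt0.
    by apply: nbhs_right_lt; exact: divr_gt0.
  move=> [a de] [/= xa dr] b aK bK ab.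
  have xa' : `|x - a| < r / 2 by [].
  have h1 : ball (f x) (e / 2) (f a).
    by apply: H; rewrite /= ?in_itv//=; apply: lt_le_trans xa' _; rewrite ler_pdivrMr// ler_peMr ?ler1n// ltW.
  have h2 : ball (f x) (e / 2) (f b).
    apply: H; rewrite /= ?in_itv//=; rewrite [r]splitr.
    have := ler_distD a x b; lra.
  by rewrite [e]splitr; apply: ball_triangle h2; exact: ball_sym.
move=> r /= r0 H; have := H (r / 2); rewrite /= sub0r normrN ger0_norm ?divr_ge0 ?(ltW r0)//.
move=> /(_ _ _) K2; exists (r / 2); first exact: divr_gt0.
move=> s t ss tt; apply: K2 => //; first by rewrite ltr_pdivrMr// ltr_pMr// ltr1n.
  exact: divr_gt0.
Qed.

(** The modulus is asked only of the members of a set in [U]: the energies are bounded, and a given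
    polynomial is preserved by [Pi_ n], only on such sets of indices. *)
Definition equicontinuous_along (U : set_system nat) (tau : R) (a : nat -> R -> R) :=
  forall e, 0 < e -> exists2 de, 0 < de & \forall n \near U, forall s t,
    0 <= s <= tau -> 0 <= t <= tau -> `|s - t| < de -> `|a n s - a n t| <= e.

Definition uniform_along (U : set_system nat) (tau : R) (a : nat -> R -> R) (b : R -> R) :=
  forall e, 0 < e -> \forall n \near U, forall t, 0 <= t <= tau -> `|a n t - b t| <= e.

Context (U : set_system nat) {UU : UltraFilter U}.
Variables (tau : R) (a : nat -> R -> R) (b : R -> R).
Hypothesis tau0 : 0 < tau.
Hypothesis eca : equicontinuous_along U tau a.
Hypothesis ab : forall t, 0 <= t <= tau -> a n t @[n --> U] --> b t.

Lemma equicontinuous_limit e : 0 < e -> exists2 de, 0 < de & forall s t,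
  0 <= s <= tau -> 0 <= t <= tau -> `|s - t| < de -> `|b s - b t| <= e.
Proof.
move=> e0; have [de d0 H] := eca e0; exists de => // s t hs ht st.
have c : `|a n s - a n t| @[n --> U] --> `|b s - b t|.
  by apply: cvg_norm; apply: cvgB; exact: ab.
by apply: (ultra_cvg_le c (cvg_cst e)); apply: filterS H => n; exact.
Qed.

(** The Ascoli argument: pointwise convergence on a finite grid holds simultaneously, as a finite
    intersection of members of [U], and the common modulus extends it to the interval. *)
Lemma equicontinuous_uniform : uniform_along U tau a b.
Proof.
move=> e e0; have e3 : 0 < e / 3 by rewrite divr_gt0.
have [d1 d10 H1] := eca e3; have [d2 d20 H2] := equicontinuous_limit e3.
have d12 : 0 < Num.min d1 d2 by rewrite lt_min d10.
have [M [p [pt pc]]] := grid_cover tau0 d12.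
have HP : \forall n \near U, forall i, `|a n (p i) - b (p i)| <= e / 3.
  by apply: filter_forall => i; move/cvgr_distC_le : (ab (pt i)); apply.
apply: filterS2 H1 HP => n h1 hp t tt.
have [i] := pc t tt.
rewrite lt_min => /andP[i1 i2].
have g1 := h1 _ _ tt (pt i) i1; have g2 := H2 _ _ tt (pt i) i2; have g3 := hp i.
have -> : a n t - b t = (a n t - a n (p i)) + (a n (p i) - b (p i)) - (b t - b (p i)) by ring.
apply: le_trans (ler_normB _ _) _; apply: le_trans (lerD (ler_normD _ _) (lexx _)) _.
lra.
Qed.

Lemma equicontinuous_limit_continuous : {within `[0, tau], continuous b}.
Proof. exact: (ucont_within equicontinuous_limit). Qed.

End equicontinuity.

HB.instance Definition _ (R : realType) := Measure.on (@leb3 R).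

(** * The space-time cylinder and weak limits on it *)

Section cylinders.
Context {R : realType}.
Local Notation mR := (measurableTypeR R).
Local Notation leb := (@lebesgue_measure R).
Local Notation cell := (@cell R).
Local Notation leb2 := (@leb2 R).
Local Notation leb3 := (@leb3 R).

Let mc := @measurable_cell R.

Let leb3_sigma_finite : sigma_finite setT leb3.
Proof.
have /sigma_finiteP[F [TF ndF Foo]] := sigma_finiteT leb.
have /sigma_finiteP[G [TG ndG Goo]] := sigma_finiteT leb2.
exists (fun n => F n `*` G n).
  rewrite -setXTT TF TG predeqE => -[x y]; split.
    move=> [/= [n _ Fnx] [k _ Gky]]; exists (maxn n k) => //; split.
    - by move: x Fnx; exact/subsetPset/ndF/leq_maxl.
    - by move: y Gky; exact/subsetPset/ndG/leq_maxr.
  by move=> [n _ []/= ? ?]; split; exists n.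
move=> k; have [mF Fk] := Foo k; have [mG Gk] := Goo k.
split; first exact: measurableX.
by rewrite /leb3 product_measure1E// lte_mul_pinfty// ge0_fin_numE.
Qed.

HB.instance Definition _ :=
  Measure_isSigmaFinite.Build _ _ _ leb3 leb3_sigma_finite.

Variable tau : R.
Hypothesis tau0 : 0 < tau.
Local Notation cyl := (cylinder tau).

Let mI : measurable ([set` `[0 : R, tau]] : set mR).
Proof. exact: measurable_itv. Qed.

Lemma measurable_cylinder : measurable cyl.
Proof. exact: measurableX. Qed.

Lemma leb_itv : leb ([set` `[0 : R, tau]] : set mR) = tau%:E.
Proof. by rewrite /= lebesgue_measure_itv/= lte_fin tau0 oppr0 adde0. Qed.

Lemma leb3_cylinder : leb3 cyl = tau%:E.
Proof.
rewrite /cylinder /leb3 product_measure1E//.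
by rewrite -[X in (X * _)%E]/(leb [set` `[0 : R, tau]]) leb_itv -[X in (_ * X)%E]/(leb2 cell) leb2_cell mule1.
Qed.

Lemma fin_cylinder : (leb3 cyl < +oo)%E.
Proof. by rewrite leb3_cylinder ltry. Qed.

Lemma fin_itv : (leb ([set` `[0%R, tau]] : set mR) < +oo)%E.
Proof. by rewrite leb_itv ltry. Qed.

Lemma Rint_cst_itv (c : R) : \int[leb]_(t in [set` `[0, tau]]) c = c * tau.
Proof. by rewrite Rintegral_cst// [fine _](_ : _ = tau)//; exact: (congr1 fine leb_itv). Qed.

Lemma measurable_section (F : mR * (mR * mR) -> R) (t : R) : 0 <= t <= tau ->
  measurable_fun cyl F -> measurable_fun cell (fun x => F (t, x)).
Proof.
move=> tt mF; apply: (measurable_comp (F := cyl) measurable_cylinder _ mF).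
  by move=> _ [x cx <-]; split; rewrite //= in_itv.
exact: measurable_funTS (pair1_measurable t).
Qed.

Definition dyadic_floor (m : nat) (t : R) : R := (Num.floor (2 ^+ m * t))%:~R / 2 ^+ m.

Lemma dyadic_floor_itv m t : 0 <= t -> 0 <= dyadic_floor m t <= t.
Proof.
move=> t0; have pm : 0 < 2 ^+ m :> R by rewrite exprn_gt0.
have /andP[h1 _] := floor_itv (2 ^+ m * t).
rewrite /dyadic_floor divr_ge0 ?exprn_ge0//=; last by rewrite ler0z floor_ge0 mulr_ge0// ltW.
by rewrite ler_pdivrMr// [t * _]mulrC.
Qed.

(** Only countably many times occur as values of [dyadic_floor], so measurability in [x] at each
    fixed time is enough. *)
Lemma measurable_step m (v : R -> mR * mR -> R) :
  (forall t, 0 <= t <= tau -> measurable_fun cell (v t)) ->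
  measurable_fun cyl (fun p => v (dyadic_floor m p.1) p.2).
Proof.
move=> mv _ Y mY.
rewrite (_ : _ `&` _ = \bigcup_(c in [set: int])
  (cyl `&` ([set t : mR | Num.floor (2 ^+ m * t) = c] `*` (cell `&` v (c%:~R / 2 ^+ m) @^-1` Y)))).
  apply: countable_bigcupT_measurable => // c.
  have [c0|] := pselect (0 <= (c%:~R / 2 ^+ m : R) <= tau).
    apply: measurableI; first exact: measurable_cylinder.
    apply: measurableX; first exact: measurable_floor_fiber.
    exact: (mv _ c0 mc _ mY).
  move=> nc; rewrite (_ : _ `&` _ = set0)//; apply/seteqP; split=> // -[t x] /=.
  move=> [[tt cx] [fc _]]; case: nc; move: tt; rewrite /= in_itv/= => /andP[t0 t1].
  rewrite -fc -/(dyadic_floor m t); have /andP[-> h] := dyadic_floor_itv m t0.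
  exact: le_trans h t1.
apply/seteqP; split=> [[t x] [[tt cx] /= Yx]|[t x] [c _ [h [/= <- [cx Yx]]]]].
  by exists (Num.floor (2 ^+ m * t)).
by split.
Qed.

(** Caratheodory functions are jointly measurable: they are the limits of their step functions in
    time. *)
Lemma measurable_time_continuous (v : R -> mR * mR -> R) :
  (forall t, 0 <= t <= tau -> measurable_fun cell (v t)) ->
  (forall x, {within `[0, tau], continuous (fun t => v t x)}) ->
  measurable_fun cyl (fun p => v p.1 p.2).
Proof.
move=> mv cv; have ms m := measurable_step m mv.
apply: (measurable_fun_cvg ms) => -[t x] [/= tt cx].
move: (tt); rewrite in_itv/= => /andP[t0 t1].
apply/cvgrPdist_lt => e e0.
have /subspace_continuousP/(_ _ tt)/cvgrPdist_lt/(_ _ e0)[r /= r0 H] := cv x.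
have /cvgrPdist_lt/(_ _ r0)[m0 _ Hm] := @round_cvg R t.
exists m0 => // m /= mm; apply: H; first exact: Hm.
rewrite /= in_itv/=; have /andP[-> h] := dyadic_floor_itv m t0.
exact: le_trans h t1.
Qed.

Lemma cylinder_L2 (f : mR * (mR * mR) -> R) (C : R) : measurable_fun cyl f ->
  (forall t, 0 <= t <= tau -> L2 leb2 cell (fun x => f (t, x)) /\
    \int[leb2]_(x in cell) (f (t, x) * f (t, x)) <= C) ->
  L2 leb3 cyl f /\ \int[leb3]_(p in cyl) (f p * f p) <= tau * C.
Proof.
move=> mf lf.
have rs t (tt : 0 <= t <= tau) : rint leb2 cell (fun x => f (t, x) * f (t, x)) := (lf t tt).1.2.
have tt0 : (0 : R) <= 0 <= tau by rewrite lexx ltW.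
have C0 : 0 <= C by apply: le_trans (lf 0 tt0).2; exact: ip_ge0.
have r3 : rint leb3 cyl (fun p => f p * f p).
  apply: (rint_Tonelli mI mc fin_itv (C := C)) => //; first exact: measurable_funM.
  move=> t; rewrite /= in_itv/= => tt; apply: le_trans (lf t tt).2.
  rewrite le_eqVlt; apply/orP; left; apply/eqP; apply: eq_Rint => x _.
  by rewrite ger0_norm// -expr2 sqr_ge0.
split=> //; have [_ rr ->] := rint_Fubini mI mc r3.
rewrite -[leRHS]mulrC -Rint_cst_itv; apply: le_Rintegral => //.
  by apply: (@rint_bounded _ _ _ _ _ mI fin_itv _ C) => // x _; rewrite ger0_norm.
by move=> t; rewrite /= in_itv/= => tt; exact: (lf t tt).2.
Qed.

Context (U : set_system nat) {UU : UltraFilter U}.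

(** Produces a jointly measurable field whose slices are the given [w t], about which nothing is
    assumed jointly in (t, x). Testing with the indicator of a set of times multiplied by one mode
    shows that [W] and [w] have the same coefficient of this mode at almost every time; there are
    countably many modes, and completeness concludes. *)
Lemma cylinder_weak_limit (f : nat -> mR * (mR * mR) -> R) (w : R -> mR * mR -> R) (C : R)
    (Cn : nat -> R) :
  (forall n, measurable_fun cyl (f n)) ->
  (forall n t, 0 <= t <= tau -> L2 leb2 cell (fun x => f n (t, x)) /\
    \int[leb2]_(x in cell) (f n (t, x) * f n (t, x)) <= Cn n) ->
  (\forall n \near U, Cn n <= C) ->
  (forall t, 0 <= t <= tau -> L2 leb2 cell (w t)) ->
  (forall k, {within `[0, tau], continuous (fun t => \int[leb2]_(x in cell) (w t x * cos (phase k x)))}) ->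
  (forall k, {within `[0, tau], continuous (fun t => \int[leb2]_(x in cell) (w t x * sin (phase k x)))}) ->
  (forall k, uniform_along U tau (fun n t => \int[leb2]_(x in cell) (f n (t, x) * cos (phase k x)))
                               (fun t => \int[leb2]_(x in cell) (w t x * cos (phase k x)))) ->
  (forall k, uniform_along U tau (fun n t => \int[leb2]_(x in cell) (f n (t, x) * sin (phase k x)))
                               (fun t => \int[leb2]_(x in cell) (w t x * sin (phase k x)))) ->
  exists W : mR * (mR * mR) -> R, [/\ L2 leb3 cyl W,
    forall g, L2 leb3 cyl g ->
      \int[leb3]_(p in cyl) (f n p * g p) @[n --> U] --> \int[leb3]_(p in cyl) (W p * g p)
    & {ae leb, forall t, 0 <= t <= tau -> {ae leb2, forall x, cell x -> W (t, x) = w t x}}].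
Proof.
move=> mf lf fC lw cc cs uc us.
have mC := measurable_cylinder.
have Tonelli n := cylinder_L2 (mf n) (lf n).
have l3 n : L2 leb3 cyl (f n) := (Tonelli n).1.
have bC : \forall n \near U, \int[leb3]_(p in cyl) (f n p * f n p) <= tau * C.
  apply: filterS fC => n h; apply: le_trans (Tonelli n).2 _.
  by rewrite ler_wpM2l// ltW.
have [W [lW _] HW] := weak_L2_limit (U := U) mC fin_cylinder l3 bC.
exists W; split=> //.
have key (h : mR * mR -> R) : continuous (h : R * R -> R) -> (forall x, `|h x| <= 1) ->
    {within `[0, tau], continuous (fun t => \int[leb2]_(x in cell) (w t x * h x))} ->
    uniform_along U tau (fun n t => \int[leb2]_(x in cell) (f n (t, x) * h x))
                        (fun t => \int[leb2]_(x in cell) (w t x * h x)) ->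
    {ae leb, forall t, [set` `[0, tau]] t ->
       \int[leb2]_(x in cell) (W (t, x) * h x) - \int[leb2]_(x in cell) (w t x * h x) = 0}.
  move=> ch h1 ca ua.
  have mh : measurable_fun setT h by exact: measurable_continuous2.
  have mh3 : measurable_fun cyl (fun p => h p.2).
    by apply: measurable_funTS; exact: (measurableT_comp mh measurable_snd).
  have lA (A : set mR) : measurable A -> L2 leb3 cyl (fun p => \1_A p.1 * h p.2).
    move=> mA; apply: (@L2_bounded _ _ _ _ _ mC fin_cylinder _ 1).
      apply: measurable_funM => //; apply: measurable_funTS.
      by apply: (measurableT_comp _ measurable_fst); exact: measurable_indic.
    by move=> p _; rewrite normrM indicE mulr_ile1// ?h1//; case: (_ \in A); rewrite ?normr1 ?normr0.
  have ra : rint leb [set` `[0, tau]] (fun t => \int[leb2]_(x in cell) (w t x * h x)) := within_rint ca.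
  have lh : L2 leb3 cyl (fun p => h p.2).
    by apply: (@L2_bounded _ _ _ _ _ mC fin_cylinder _ 1).
  have rWh := L2_prod mC lW lh.
  have [_ rb _] := rint_Fubini mI mc rWh.
  apply: rint_ae0 => // [|A mA]; first exact: rintB.
  have F1 (g : mR * (mR * mR) -> R) : L2 leb3 cyl g -> \int[leb3]_(p in cyl) (g p * (\1_A p.1 * h p.2)) =
      \int[leb]_(t in [set` `[0, tau]]) (\1_A t * \int[leb2]_(x in cell) (g (t, x) * h x)) /\
      rint leb [set` `[0, tau]] (fun t => \1_A t * \int[leb2]_(x in cell) (g (t, x) * h x)).
    move=> lg; have r := L2_prod mC lg (lA A mA); have [aer r1 ->] := rint_Fubini mI mc r.
    have E t : [set` `[0, tau]] t -> \int[leb2]_(y in cell) (g (t, y) * (\1_A t * h y)) =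
        \1_A t * \int[leb2]_(x in cell) (g (t, x) * h x).
      move=> tt; rewrite indicE; case: (t \in A); last first.
        by rewrite mul0r; under eq_Rintegral do rewrite mul0r mulr0; rewrite Rintegral_cst// mul0r.
      by rewrite mul1r; apply: eq_Rint => x _; rewrite mul1r.
    split; first exact: eq_Rint.
    exact: (eq_rint mI E r1).
  rewrite Rint_setI.
  have [E1 r1] := F1 W lW.
  have rA (g : mR -> R) : rint leb [set` `[0, tau]] g -> rint leb [set` `[0, tau]] (fun t => \1_A t * g t).
    move=> rg; apply: rint_le (integrable_norm rg) _ => //.
      by apply: measurable_funM; [exact: measurable_indic|exact: rint_measurable rg].
    by move=> t _ /=; rewrite normrM indicE; case: (_ \in A); rewrite ?normr1 ?mul1r ?normr0 ?mul0r ?lexx.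
  have c1 := HW _ (lA A mA); rewrite E1 in c1.
  have c2 : \int[leb3]_(p in cyl) (f n p * (\1_A p.1 * h p.2)) @[n --> U] -->
      \int[leb]_(t in [set` `[0, tau]]) (\1_A t * \int[leb2]_(x in cell) (w t x * h x)).
    apply/cvgrPdist_le => e e0; have := ua (e / tau) (divr_gt0 e0 tau0).
    apply: filterS => n Hn; have [-> r2] := F1 (f n) (l3 n).
    have rd := rintB mI (rA _ ra) r2.
    rewrite -RintegralB//; last exact: rA.
    apply: le_trans (le_normr_Rintegral mI rd) _.
    have -> : e = \int[leb]_(t in [set` `[0, tau]]) (e / tau).
      by rewrite Rint_cst_itv divfK// gt_eqF.
    apply: le_Rintegral => //.
    - exact: (integrable_norm rd).
    - by apply: (@rint_bounded _ _ _ _ _ mI fin_itv _ (e / tau)) => // x _; rewrite ger0_norm// divr_ge0 ?ltW.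
    - move=> t; rewrite /= in_itv/= => tt; rewrite -mulrBr normrM distrC.
      apply: le_trans (Hn t tt); rewrite ler_piMl// indicE.
      by case: (_ \in A); rewrite ?normr1 ?normr0.
  have E2 := cvg_unique (@Rhausdorff R) c1 c2.
  rewrite -[RHS](subrr (\int[leb]_(t in [set` `[0, tau]]) (\1_A t * \int[leb2]_(x in cell) (w t x * h x)))).
  rewrite -{1}E2 -RintegralB//; last exact: rA.
  by apply: eq_Rint => t _; rewrite mulrBl !(mulrC (\1_A t)).
(* Enumerates all the modes, with the value (0, 0) at integers that code none, so that the
   exceptional sets of times have a null union. *)
pose kk n : int * int := odflt (0, 0) (unpickle n).
have cos1 k (x : mR * mR) : `|cos (phase k x) : R| <= 1 by rewrite ler_norml cos_geN1 cos_le1.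
have sin1 k (x : mR * mR) : `|sin (phase k x) : R| <= 1 by rewrite ler_norml sin_geN1 sin_le1.
have aec := ae_foralln (fun n => key _ (@continuous_cos_phase R (kk n)) (cos1 (kk n)) (cc (kk n)) (uc (kk n))).
have aes := ae_foralln (fun n => key _ (@continuous_sin_phase R (kk n)) (sin1 (kk n)) (cs (kk n)) (us (kk n))).
have [aeW _ _] := rint_Fubini mI mc lW.2.
have := ae_and (ae_and aec aes) aeW; apply: filterS => t [[hc hs] hW] tt.
have tt' : [set` `[0, tau]] t by rewrite /= in_itv.
have lWt : L2 leb2 cell (fun x => W (t, x)).
  by split; [exact: measurable_section lW.1|exact: hW].
have Z (h : R * R -> R) : continuous h ->
    \int[leb2]_(x in cell) (W (t, x) * h x) - \int[leb2]_(x in cell) (w t x * h x) = 0 ->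
    \int[leb2]_(x in cell) ((W (t, x) - w t x) * h x) = 0.
  move=> ch; rewrite -RintegralB//; [|exact: L2_prod (continuous_L2 ch)|exact: L2_prod (lw t tt) (continuous_L2 ch)].
  by move=> <-; apply: eq_Rint => x _; rewrite mulrBl.
have K k : exists n, k = kk n by exists (pickle k); rewrite /kk pickleK.
have Q : {ae leb2, forall x, cell x -> W (t, x) - w t x = 0}.
  apply: TP_complete => [|k|k].
  - by apply: L2B => //; exact: lw.
  - by have [n ->] := K k; apply: Z (hc n tt'); exact: continuous_cos_phase.
  - by have [n ->] := K k; apply: Z (hs n tt'); exact: continuous_sin_phase.
by apply: filterS Q => x h cx; apply/eqP; rewrite -subr_eq0 h.
Qed.

End cylinders.

Lemma measurable_fun_pair_in d (T : measurableType d) (R : realType) (D : set T) (f g : T -> measurableTypeR R) :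
  measurable D -> measurable_fun D f -> measurable_fun D g ->
  measurable_fun D (fun x => (f x, g x)).
Proof.
move=> mD mf mg.
have res (h : T -> measurableTypeR R) : measurable_fun D h -> measurable_fun setT (h \_ D).
  by move=> mh; apply/(measurable_restrict _ mD measurableT); rewrite setTI.
have := measurable_funTS (measurable_fun_pair (res f mf) (res g mg)) (D := D).
by apply: eq_measurable_fun => x xD; rewrite /patch xD.
Qed.

(** * Solenoidal fields: pointwise estimates and weak limits *)

Section solenoidal_fields.
Context {R : realType}.
Local Notation mR := (measurableTypeR R).
Local Notation cell := (@cell R).
Local Notation leb2 := (@leb2 R).

Let mc := @measurable_cell R.

Lemma normsq_abs (w : R * R) (e : R) : 0 <= e -> e * (`|w.1| + `|w.2|) <= e * (1 + normsq w).
Proof.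
move=> e0; rewrite ler_wpM2l// /normsq /dot -!expr2.
have h (s : R) : `|s| <= 2^-1 + s ^+ 2.
  have := sqr_ge0 (`|s| - 2^-1); rewrite sqrrB real_normK ?num_real//.
  have := sqr_ge0 s; have := normr_ge0 s; rewrite -mulr_natl; lra.
have := h w.1; have := h w.2; lra.
Qed.

Lemma dot_close (z w : R * R) (e : R) : 0 <= e -> `|z.1| <= e -> `|z.2| <= e ->
  `|dot z w| <= e * (1 + normsq w).
Proof.
move=> e0 h1 h2; apply: le_trans (normsq_abs w e0); rewrite mulrDr.
by apply: le_trans (ler_normD _ _) _; rewrite !normrM lerD// ler_wpM2r.
Qed.

(** The left side is at most e (|x| + |y|)^2, and this is at most 2 e (x^2 + y^2). *)
Lemma ddot_tens_bound (A : (R * R) * (R * R)) (w : R * R) (e : R) : 0 <= e ->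
  `|A.1.1| <= e -> `|A.1.2| <= e -> `|A.2.1| <= e -> `|A.2.2| <= e ->
  `|ddot A (tens w w)| <= 2 * e * normsq w.
Proof.
case: A w => -[a b] [c d] [x y]/= e0 ha hb hc hd; rewrite /ddot /normsq /dot/=.
have ax := sqr_ge0 (`|x| - `|y|).
have xx : `|x| * `|x| = x * x by rewrite -expr2 real_normK ?num_real// expr2.
have yy : `|y| * `|y| = y * y by rewrite -expr2 real_normK ?num_real// expr2.
have h (p q r : R) : `|p| <= e -> `|p * (q * r)| <= e * (`|q| * `|r|).
  by move=> pe; rewrite !normrM ler_wpM2r// mulr_ge0.
have h1 := h a x x ha; have h2 := h b x y hb; have h3 := h c y x hc; have h4 := h d y y hd.
apply: (@le_trans _ _ (e * (`|x| * `|x|) + e * (`|x| * `|y|) + (e * (`|y| * `|x|) + e * (`|y| * `|y|)))).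
  apply: le_trans (ler_normD _ _) _; apply: lerD; apply: le_trans (ler_normD _ _) _; exact: lerD.
rewrite -xx -yy; have := mulr_ge0 e0 ax; rewrite expr2; lra.
Qed.

Lemma Rint_ddot_bound (A : R * R -> (R * R) * (R * R)) (u : R * R -> R * R) (e : R) : 0 <= e ->
  (forall x, cell x -> [/\ `|(A x).1.1| <= e, `|(A x).1.2| <= e, `|(A x).2.1| <= e & `|(A x).2.2| <= e]) ->
  VL2 u -> measurable_fun cell (fun x => ddot (A x) (tens (u x) (u x))) ->
  rint leb2 cell (fun x => ddot (A x) (tens (u x) (u x))) /\
  `| \int[leb2]_(x in cell) ddot (A x) (tens (u x) (u x))| <= 2 * e * vip u u.
Proof.
move=> e0 HA Vu mA; have ru := VL2_rint Vu Vu.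
have b x : cell x -> `|ddot (A x) (tens (u x) (u x))| <= 2 * e * dot (u x) (u x).
  by move=> /HA [? ? ? ?]; exact: ddot_tens_bound.
have rA := rint_le mc mA (rintZ mc (2 * e) ru) b.
split=> //; rewrite /vip -RintegralZl//; apply: le_trans (le_normr_Rintegral mc rA) _.
apply: le_Rintegral => //; [exact: (integrable_norm rA)|exact: rintZ].
Qed.

Lemma vip_normB (u v : R * R -> R * R) : VL2 u -> VL2 v ->
  vip (fun x => u x - v x) (fun x => u x - v x) = vip u u - 2 * vip u v + vip v v.
Proof.
move=> Vu Vv; have Vd := VL2B Vu Vv; rewrite vipBl//.
have e1 : vip u (fun x => u x - v x) = vip u u - vip u v by rewrite vipC vipBl// [vip v u]vipC.
have e2 : vip v (fun x => u x - v x) = vip u v - vip v v by rewrite vipC vipBl.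
by rewrite e1 e2; ring.
Qed.

Lemma vip_zero_mode f (a b : R * R) : in_L2sigma f -> vip f (smode (0, 0) a b) = 0.
Proof.
move=> sf; have Vf := in_L2sigma_VL2 sf; have [_ _ _ f1 f2] := sf.
have f0 : fourier_cos f (0, 0) = 0.
  congr pair; [rewrite -[RHS]f1|rewrite -[RHS]f2].
    by apply: eq_Rint => x _; rewrite phase0 cos0 mulr1.
  by apply: eq_Rint => x _; rewrite phase0 cos0 mulr1.
have -> : smode (0, 0) a b = smode (0, 0) a 0 by apply/funext => x; rewrite !smode0.
by rewrite -fourier_cosE// f0 /dot/= !mul0r addr0.
Qed.

Lemma vip_leray_mode f k (a b : R * R) : in_L2sigma f ->
  vip f (smode k a b) = vip f (smode k (leray k a) (leray k b)).
Proof.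
move=> sf; have Vf := in_L2sigma_VL2 sf; have [fc fs] := in_L2sigma_perp k sf.
by rewrite !vip_smode// -!dot_leray (leray_perp fc) (leray_perp fs).
Qed.

Lemma continuous_grad (psi : R * R -> R) : smooth psi ->
  continuous (fun x => (grad psi x).1) /\ continuous (fun x => (grad psi x).2).
Proof.
by move=> /(_ 1%N) [_ H]; split; [have [_ []] := H e1|have [_ []] := H e2].
Qed.

(** The divergence and mean constraints are pairings with fixed square-integrable fields, so they
    survive weak limits. *)
Lemma weak_limit_L2sigma (U : set_system nat) {UU : UltraFilter U} (v : nat -> R * R -> R * R) (E : nat -> R) (C : R) :
  (forall n, in_L2sigma (v n)) -> (forall n, vip (v n) (v n) <= E n) -> E n @[n --> U] --> C ->
  exists w : L2sigma R, (forall g, VL2 g -> vip (v n) g @[n --> U] --> vip w g) /\ vip w w <= C.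
Proof.
move=> sv vE EC; have Vv n := in_L2sigma_VL2 (sv n).
have eC : \forall n \near U, E n <= C + 1.
  have /cvgrPdist_le/(_ 1 ltr01) := EC; apply: filterS => n; rewrite ler_norml => /andP[h _]; lra.
have B n : \int[leb2]_(x in cell) ((v n x).1 * (v n x).1) <= E n /\
           \int[leb2]_(x in cell) ((v n x).2 * (v n x).2) <= E n.
  have := vE n; rewrite vipE//.
  have := ip_ge0 leb2 cell (fun x => (v n x).1).
  have := ip_ge0 leb2 cell (fun x => (v n x).2).
  move: (\int[_]_(_ in _) _) (\int[_]_(_ in _) _) => P Q; split; lra.
have B1 : \forall n \near U, \int[leb2]_(x in cell) ((v n x).1 * (v n x).1) <= C + 1.
  by apply: filterS eC => n; apply: le_trans; case: (B n).
have B2 : \forall n \near U, \int[leb2]_(x in cell) ((v n x).2 * (v n x).2) <= C + 1.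
  by apply: filterS eC => n; apply: le_trans; case: (B n).
have [h1 [lh1 _] H1] := weak_L2_limit (U := U) mc (@fin_cell R) (f := fun n x => (v n x).1)
  (fun n => (Vv n).1) B1.
have [h2 [lh2 _] H2] := weak_L2_limit (U := U) mc (@fin_cell R) (f := fun n x => (v n x).2)
  (fun n => (Vv n).2) B2.
pose w (x : R * R) := (h1 x, h2 x); have Vw : VL2 w by split.
have wl g : VL2 g -> vip (v n) g @[n --> U] --> vip w g.
  move=> Vg; rewrite vipE//; under eq_fun do rewrite vipE//.
  by apply: cvgD; [apply: H1; case: Vg|apply: H2; case: Vg].
have lim0 g : VL2 g -> (forall n, vip (v n) g = 0) -> vip w g = 0.
  move=> Vg g0; have c := wl g Vg.
  rewrite (_ : (fun n => vip (v n) g) = cst 0) in c; last exact/funext.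
  exact: (cvg_unique (@Rhausdorff R) c (cvg_cst 0)).
have Vc c : VL2 (fun=> c : R * R).
  by split; apply: continuous_L2; exact: cst_continuous.
have sw : in_L2sigma w.
  split.
  - by apply: measurable_fun_pair_in => //; [exact: lh1.1|exact: lh2.1].
  - have /integrableP[_] := VL2_rint Vw Vw.
    rewrite [X in (X < _)%E -> _](_ : _ = (\int[leb2]_(x in cell) (normsq (w x))%:E)%E)//.
    by apply: eq_integral => x _ /=; rewrite ger0_norm ?normsq_ge0.
  - move=> psi ppsi spsi; have [c1 c2] := continuous_grad spsi.
    have Vg : VL2 (grad psi) := conj (continuous_L2 c1) (continuous_L2 c2).
    suff h : vip w (grad psi) = 0 by exact: h.
    by apply: (lim0 _ Vg) => n; have [_ _ h _ _] := sv n; exact: h.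
  - have := lim0 (fun=> (1, 0)) (Vc _); rewrite /vip.
    have E1 g : \int[leb2]_(x in cell) dot (g x) (1, 0) = \int[leb2]_(x in cell) (g x).1.
      by apply: eq_Rint => x _; rewrite /dot/= mulr1 mulr0 addr0.
    by rewrite E1; apply => n; rewrite E1; case: (sv n).
  - have := lim0 (fun=> (0, 1)) (Vc _); rewrite /vip.
    have E1 g : \int[leb2]_(x in cell) dot (g x) (0, 1) = \int[leb2]_(x in cell) (g x).2.
      by apply: eq_Rint => x _; rewrite /dot/= mulr1 mulr0 add0r.
    by rewrite E1; apply => n; rewrite E1; case: (sv n).
exists (MkL2sigma sw); split=> //=.
have [w0|wN] := eqVneq (vip w w) 0.
  rewrite w0; apply: (ultra_cvg_le (cvg_cst 0) EC); apply: nearW => n.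
  by apply: le_trans (vE n); exact: vip_ge0.
have wp : 0 < vip w w by rewrite lt_neqAle eq_sym wN vip_ge0.
(* After multiplication by [vip w w], the weak convergence is tested on [w] itself and combined with
   Cauchy-Schwarz. *)
rewrite -(ler_pM2r wp).
have c1 : vip (v n) w * vip (v n) w @[n --> U] --> vip w w * vip w w by apply: cvgM; exact: wl.
have c2 : E n * vip w w @[n --> U] --> C * vip w w by apply: cvgM => //; exact: cvg_cst.
apply: (ultra_cvg_le c1 c2); apply: nearW => n; rewrite -expr2.
apply: le_trans (vip_cauchy_schwarz (Vv n) Vw) _.
by rewrite ler_wpM2r// vip_ge0.
Qed.

End solenoidal_fields.

(** * Weak limits of Galerkin solutions *)

Section galerkin_limit.
Context {R : realType}.
Local Notation mR := (measurableTypeR R).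
Local Notation leb := (@lebesgue_measure R).
Local Notation cell := (@cell R).
Local Notation leb2 := (@leb2 R).
Local Notation leb3 := (@leb3 R).
Context (U : set_system nat) {UU : UltraFilter U}.
Hypothesis UF : \oo `<=` U.
Variables (u0 : L2sigma R) (un0 : nat -> L2sigma R) (un : nat -> R -> L2sigma R).
Hypothesis gal : forall n, galerkin_solution n (un0 n) (un n).
Hypothesis un0_cvg : vip (fun x => un0 n x - u0 x) (fun x => un0 n x - u0 x) @[n --> U] --> (0 : R).
Variable tau : R.
Hypothesis tau0 : 0 < tau.
Local Notation cyl := (cylinder tau).

Let mc := @measurable_cell R.
Let Vun n t : VL2 (un n t) := in_L2sigma_VL2 (L2funP (un n t)).
Let Vun0 n : VL2 (un0 n) := in_L2sigma_VL2 (L2funP (un0 n)).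
Let Vu0 : VL2 u0 := in_L2sigma_VL2 (L2funP u0).

Let E n := vip (un0 n) (un0 n).

Lemma un0_weak g : VL2 g -> vip (un0 n) g @[n --> U] --> vip u0 g.
Proof.
move=> Vg; have Vd n := VL2B (Vun0 n) Vu0.
have d0 : vip (fun x => un0 n x - u0 x) g @[n --> U] --> (0 : R).
  apply: (@sqr_cvg0 _ _ _ _ _ (fun n => vip (fun x => un0 n x - u0 x) (fun x => un0 n x - u0 x) * vip g g)).
    by apply: nearW => n; exact: vip_cauchy_schwarz.
  by rewrite -(mul0r (vip g g)); apply: cvgM => //; exact: cvg_cst.
rewrite -[X in _ --> X]add0r.
have -> : (fun n => vip (un0 n) g) = (fun n => vip (fun x => un0 n x - u0 x) g + vip u0 g).
  by apply/funext => n; rewrite vipBl// subrK.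
by apply: cvgD => //; exact: cvg_cst.
Qed.

Lemma energy_cvg : E n @[n --> U] --> vip u0 u0.
Proof.
have Vd n := VL2B (Vun0 n) Vu0.
have -> : E = fun n => vip (fun x => un0 n x - u0 x) (fun x => un0 n x - u0 x) + 2 * vip (un0 n) u0 - vip u0 u0.
  by apply/funext => n; rewrite vip_normB// /E; ring.
rewrite [X in _ --> X](_ : _ = 0 + 2 * vip u0 u0 - vip u0 u0); last by ring.
apply: cvgB; last exact: cvg_cst.
apply: cvgD => //; apply: cvgM; [exact: cvg_cst|exact: un0_weak].
Qed.

Let C := vip u0 u0 + 1.
Let C0 : 0 < C. Proof. by rewrite ltr_wpDl// vip_ge0. Qed.

Lemma energy_bound : \forall n \near U, E n <= C.
Proof.
have /cvgrPdist_le/(_ 1 ltr01) := energy_cvg; apply: filterS => n.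
by rewrite ler_norml /C => /andP[h _]; lra.
Qed.

Lemma galerkin_energyE n t : 0 <= t -> vip (un n t) (un n t) = E n.
Proof. exact: galerkin_energy. Qed.

(** For a stationary polynomial preserved by [Pi_ n] up to a constant, the derivative of the pairing
    is the integral of the gradient of [g] against the tensor of the solution. It is bounded by the
    energy, uniformly in [n], so the pairings share a Lipschitz constant. *)
Lemma poly_equicontinuous p g : VTP p g ->
  (\forall n \near U, exists c, forall x, g x = Pi_ n g x + c) ->
  equicontinuous_along U tau (fun n t => vip (un n t) g).
Proof.
move=> tg Pg e e0; have [g1 g2] := tg.
have bd (f : R * R -> R) v : TP p f -> exists2 b, 0 < b & forall x, cell x -> `|'D_v f x| <= b.
  move=> tf; have [tf' _ _] := TP_derive v tf.
  have [B B0 HB] := continuous_bounded_cell (TP_continuous tf').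
  by exists B => // x /cell_norm [h1 h2]; exact: HB.
have [b1 b10 H1] := bd _ e1 g1; have [b2 b20 H2] := bd _ e2 g1.
have [b3 b30 H3] := bd _ e1 g2; have [b4 b40 H4] := bd _ e2 g2.
pose b := b1 + b2 + b3 + b4; pose L := 2 * b * C.
have b0 : 0 < b by rewrite !addr_gt0.
have L0 : 0 < L by rewrite !mulr_gt0.
exists (e / L); first exact: divr_gt0.
have t0 : forall t : R, VTP p (fun=> 0 : R * R) by move=> t; split; exact: TP_cst.
apply: filterS2 Pg energy_bound => n Pg EC.
have K (s t : R) : 0 <= s <= t -> `|vip (un n t) g - vip (un n s) g| <= L * (t - s).
  move=> st; apply: (galerkin_lipschitz (gal n) (G := fun=> g) (G' := fun=> fun=> 0) (p := p)) => //.
    by move=> r x; exact: is_derive_cst.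
  move=> r /andP[sr _].
  have r0 : 0 <= r by case/andP: st => s0 _; exact: le_trans (ltW sr).
  rewrite /galerkin_rate (_ : vip (un n r) (fun=> 0) = 0) ?add0r; last first.
    rewrite /vip -[RHS](mul0r (fine (leb2 cell))) -Rintegral_cst//; apply: eq_Rint => x _.
    by rewrite /dot/= !mulr0 addr0.
  have tu := galerkin_VTP (gal n) r0; have [u1 u2] := tu.
  have [||_] := @Rint_ddot_bound R (fun x => nabla g x) (un n r) b (ltW b0) _ (Vun n r).
  - move=> x cx; rewrite (nablaE x tg)/= /b; split.
    + by apply: le_trans (H1 x cx) _; lra.
    + by apply: le_trans (H2 x cx) _; lra.
    + by apply: le_trans (H3 x cx) _; lra.
    + by apply: le_trans (H4 x cx) _; lra.
  - have tD (f : R * R -> R) (v : R * R) : TP p f -> TP p (fun x => 'D_v f x) by move=> tf; case: (TP_derive v tf).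
    have t3 (f h q : R * R -> R) : TP n f -> TP n h -> TP p q -> measurable_fun cell (fun x => q x * (f x * h x)).
      by move=> tf th tq; apply: rint_measurable (TP_rint (TP_mul tq (TP_mul tf th))).
    under eq_fun do rewrite (nablaE _ tg).
    by do 2!apply: measurable_funD; apply: t3 => //; exact: tD.
  rewrite galerkin_energyE// => h; apply: le_trans h _.
  by rewrite /L ler_wpM2l// mulr_ge0// ltW.
move=> s t /andP[s0 _] /andP[tt0 _]; rewrite ltr_pdivlMr// => h.
apply: le_trans (ltW h).
have [st|ts] := leP s t.
  rewrite distrC; apply: le_trans (K _ _ _) _; rewrite ?s0//.
  by rewrite distrC (ger0_norm (_ : 0 <= t - s)) ?subr_ge0// mulrC.
have h0 : 0 <= s - t by rewrite subr_ge0 ltW.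
apply: le_trans (K _ _ _) _; first by rewrite tt0 ltW.
by rewrite (ger0_norm h0) mulrC.
Qed.

Lemma mode_equicontinuous k (a b : R * R) :
  equicontinuous_along U tau (fun n t => vip (un n t) (smode k a b)).
Proof.
have [k0|k0] := eqVneq k (0, 0).
  move=> e e0; exists 1 => //; apply: nearW => n s t _ _ _.
  by rewrite k0 !vip_zero_mode ?subrr ?normr0 ?ltW//; exact: L2funP.
have -> : (fun n t => vip (un n t) (smode k a b)) =
          (fun n t => vip (un n t) (smode k (leray k a) (leray k b))).
  by apply/funext => n; apply/funext => t; rewrite vip_leray_mode//; exact: L2funP.
apply: (poly_equicontinuous (VTP_smode _ _ (in_box_self k))).
have [n0 H] := modes_eventually k0; apply: UF; exists n0 => // n /= /H kn.
by exists 0 => x; rewrite addr0 Pi_smode_mode// !leray_leray.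
Qed.

(** A general solenoidal field has no controlled gradient; it is replaced by a truncation [Pi_ m g],
    the error being controlled uniformly in time by the conserved energy. *)
Lemma field_equicontinuous g : in_L2sigma g -> equicontinuous_along U tau (fun n t => vip (un n t) g).
Proof.
move=> sg e e0; have Vg := in_L2sigma_VL2 sg.
have e3 : 0 < e / 3 by rewrite divr_gt0.
(* With energies at most [C], this squared distance makes each pairing with the remainder at most
   [e / 3]. *)
have [m Hm] := Pi_dense sg (divr_gt0 (exprn_gt0 2 e3) C0).
have VP := VTP_VL2 (VTP_Pi m g); have Vd := VL2B Vg VP.
have [|de d0 Hd] := poly_equicontinuous (VTP_Pi m g) _ e3.
  apply: UF; exists m => // n /= mn.
  have Pm : Pi_ m g = fun x => \sum_(k <- modes m) smode k (leray k (fourier_cos g k)) (leray k (fourier_sin g k)) x.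
    by apply/funext => x; exact: Pi_smode.
  have [|c Hc] := @Pi_sum_smode R n _ (modes m) id
    (fun k => leray k (fourier_cos g k)) (fun k => leray k (fourier_sin g k)).
    move=> k km; right; have kn : k != (0, 0) by move: km; rewrite mem_modes => /andP[].
    split; [|exact: dot_freq_leray..].
    by move: km; rewrite !mem_modes => /andP[-> h]; apply: (le_trans h); nia.
  by exists c => x; rewrite Pm.
exists de => //; apply: filterS2 Hd energy_bound => n hd EC s t ss tt st.
have D (r : R) : 0 <= r <= tau -> `|vip (un n r) (fun x => g x - Pi_ m g x)| <= e / 3.
  move=> /andP[r0 _]; rewrite -(ler_pXn2r (ltn0Sn 1)) ?nnegrE ?(ltW e3)// real_normK ?num_real//.
  apply: le_trans (vip_cauchy_schwarz (Vun n r) Vd) _; rewrite galerkin_energyE//.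
  apply: (@le_trans _ _ (C * ((e / 3) ^+ 2 / C))); last by rewrite mulrC divfK// gt_eqF.
  by apply: ler_pM => //; [exact: vip_ge0|exact: vip_ge0|exact: ltW].
have X r : vip (un n r) g = vip (un n r) (fun x => g x - Pi_ m g x) + vip (un n r) (Pi_ m g).
  by rewrite ![vip (un n r) _]vipC vipBl// subrK.
rewrite !X; have := D s ss; have := D t tt; have := hd s t ss tt st.
move: (vip _ _) (vip _ _) (vip _ _) (vip _ _) => p q r z h1 h2 h3.
have -> : p + z - (q + r) = p - q + (z - r) by ring.
apply: le_trans (ler_normD _ _) _; apply: le_trans (lerD (ler_normB _ _) (lexx _)) _.
move: h1 h2 h3; lra.
Qed.

Lemma galerkin_weak_limit : exists w : R -> L2sigma R,
  (forall t, 0 <= t <= tau -> forall g, VL2 g -> vip (un n t) g @[n --> U] --> vip (w t) g) /\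
  (forall t, 0 <= t <= tau -> vip (w t) (w t) <= vip u0 u0).
Proof.
(* Outside the interval [u0] is a placeholder, so that the choice can be made for every real
   time. *)
have H (t : R) : exists w : L2sigma R, 0 <= t <= tau ->
    (forall g, VL2 g -> vip (un n t) g @[n --> U] --> vip w g) /\ vip w w <= vip u0 u0.
  have [tt|tt] := boolP (0 <= t <= tau); last by exists u0.
  have t0 : 0 <= t by case/andP: tt.
  have [||w Hw] := @weak_limit_L2sigma R U UU (fun n => un n t) E (vip u0 u0) _ _ energy_cvg.
  - by move=> n; exact: L2funP.
  - by move=> n; rewrite galerkin_energyE.
  - by exists w.
have [w Hw] := choice H.
by exists w; split=> t tt; [exact: (Hw t tt).1|exact: (Hw t tt).2].
Qed.

Variable w : R -> L2sigma R.
Hypothesis w_lim : forall t, 0 <= t <= tau -> forall g, VL2 g -> vip (un n t) g @[n --> U] --> vip (w t) g.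
Let Vw t : VL2 (w t) := in_L2sigma_VL2 (L2funP (w t)).

Lemma limit_weakly_continuous : weakly_continuous tau w.
Proof.
move=> g; apply: (@equicontinuous_limit_continuous R U UU tau _ _ (field_equicontinuous (L2funP g))).
by move=> t tt; apply: w_lim => //; exact: in_L2sigma_VL2 (L2funP g).
Qed.

Lemma field_uniform g : in_L2sigma g ->
  uniform_along U tau (fun n t => vip (un n t) g) (fun t => vip (w t) g).
Proof.
move=> sg; apply: (equicontinuous_uniform tau0 (field_equicontinuous sg)) => t tt.
by apply: w_lim => //; exact: in_L2sigma_VL2.
Qed.

Lemma vip_modes_coord g k : VL2 g ->
  [/\ vip g (smode k (1, 0) 0) = \int[leb2]_(x in cell) ((g x).1 * cos (phase k x)),
      vip g (smode k (0, 1) 0) = \int[leb2]_(x in cell) ((g x).2 * cos (phase k x)),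
      vip g (smode k 0 (1, 0)) = \int[leb2]_(x in cell) ((g x).1 * sin (phase k x))
    & vip g (smode k 0 (0, 1)) = \int[leb2]_(x in cell) ((g x).2 * sin (phase k x))].
Proof.
move=> Vg; split.
- by rewrite -fourier_cosE// /dot/= mulr1 mulr0 addr0.
- by rewrite -fourier_cosE// /dot/= mulr1 mulr0 add0r.
- by rewrite -fourier_sinE// /dot/= mulr1 mulr0 addr0.
- by rewrite -fourier_sinE// /dot/= mulr1 mulr0 add0r.
Qed.

Lemma galerkin_measurable n :
  measurable_fun cyl (fun p => (un n p.1 p.2).1) /\ measurable_fun cyl (fun p => (un n p.1 p.2).2).
Proof.
have cu x : {within `[0, tau], continuous (fun t => un n t x)}.
  case: (gal n) => _ h _ _; apply: continuous_subspaceW (h x).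
  by move=> t /=; rewrite !in_itv/= andbT => /andP[].
split.
  apply: (measurable_time_continuous (v := fun t x => (un n t x).1)) => [t _|x]; first by case: (Vun n t) => -[].
  exact: within_continuous_fst.
apply: (measurable_time_continuous (v := fun t x => (un n t x).2)) => [t _|x]; first by case: (Vun n t) => _ [].
exact: within_continuous_snd.
Qed.

Lemma galerkin_cylinder_limit : exists W : R * (R * R) -> R * R,
  [/\ L2 leb3 cyl (fun p => (W p).1) /\ L2 leb3 cyl (fun p => (W p).2),
    forall g, L2 leb3 cyl g ->
      (\int[leb3]_(p in cyl) ((un n p.1 p.2).1 * g p) @[n --> U] --> \int[leb3]_(p in cyl) ((W p).1 * g p)) /\
      (\int[leb3]_(p in cyl) ((un n p.1 p.2).2 * g p) @[n --> U] --> \int[leb3]_(p in cyl) ((W p).2 * g p))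
    & {ae leb, forall t, 0 <= t <= tau -> ae_cell (fun x => W (t, x) = w t x)}].
Proof.
have B n t (tt : 0 <= t <= tau) : \int[leb2]_(x in cell) ((un n t x).1 * (un n t x).1) <= E n /\
           \int[leb2]_(x in cell) ((un n t x).2 * (un n t x).2) <= E n.
  have t0 : 0 <= t by case/andP: tt.
  have := galerkin_energyE n t0; rewrite vipE//.
  have := ip_ge0 leb2 cell (fun x => (un n t x).1).
  have := ip_ge0 leb2 cell (fun x => (un n t x).2).
  move: (\int[_]_(_ in _) _) (\int[_]_(_ in _) _) => P Q; split; lra.
have UC k a b : uniform_along U tau (fun n t => vip (un n t) (smode k a b)) (fun t => vip (w t) (smode k a b)) /\
    {within `[0, tau], continuous (fun t => vip (w t) (smode k a b))}.
  have lim t : 0 <= t <= tau -> vip (un n t) (smode k a b) @[n --> U] --> vip (w t) (smode k a b).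
    by move=> tt; apply: w_lim => //; exact: VL2_smode.
  split; first exact: (equicontinuous_uniform tau0 (mode_equicontinuous k a b) lim).
  exact: (equicontinuous_limit_continuous (mode_equicontinuous k a b) lim).
have [W1 [lW1 H1 A1]] : exists W : mR * (mR * mR) -> R, [/\ L2 leb3 cyl W,
    forall g, L2 leb3 cyl g ->
      \int[leb3]_(p in cyl) ((un n p.1 p.2).1 * g p) @[n --> U] --> \int[leb3]_(p in cyl) (W p * g p)
    & {ae leb, forall t, 0 <= t <= tau -> {ae leb2, forall x, cell x -> W (t, x) = (w t x).1}}].
  apply: (@cylinder_weak_limit R tau tau0 U UU (fun n p => (un n p.1 p.2).1) (fun t x => (w t x).1) C E).
  - by move=> n; case: (galerkin_measurable n).
  - by move=> n t tt; split; [case: (Vun n t)|case: (B n t tt)].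
  - exact: energy_bound.
  - by move=> t _; case: (Vw t).
  - move=> k; have [_] := UC k (1, 0) 0; rewrite (_ : (fun t => vip _ _) = fun t => \int[leb2]_(x in cell) ((w t x).1 * cos (phase k x)))//.
    by apply/funext => t; have [] := vip_modes_coord k (Vw t).
  - move=> k; have [_] := UC k 0 (1, 0); rewrite (_ : (fun t => vip _ _) = fun t => \int[leb2]_(x in cell) ((w t x).1 * sin (phase k x)))//.
    by apply/funext => t; have [] := vip_modes_coord k (Vw t).
  - move=> k e e0; have [h _] := UC k (1, 0) 0; apply: filterS (h e e0) => n hn t tt.
    by have := hn t tt; have [-> _ _ _] := vip_modes_coord k (Vun n t); have [-> _ _ _] := vip_modes_coord k (Vw t).
  - move=> k e e0; have [h _] := UC k 0 (1, 0); apply: filterS (h e e0) => n hn t tt.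
    by have := hn t tt; have [_ _ -> _] := vip_modes_coord k (Vun n t); have [_ _ -> _] := vip_modes_coord k (Vw t).
have [W2 [lW2 H2 A2]] : exists W : mR * (mR * mR) -> R, [/\ L2 leb3 cyl W,
    forall g, L2 leb3 cyl g ->
      \int[leb3]_(p in cyl) ((un n p.1 p.2).2 * g p) @[n --> U] --> \int[leb3]_(p in cyl) (W p * g p)
    & {ae leb, forall t, 0 <= t <= tau -> {ae leb2, forall x, cell x -> W (t, x) = (w t x).2}}].
  apply: (@cylinder_weak_limit R tau tau0 U UU (fun n p => (un n p.1 p.2).2) (fun t x => (w t x).2) C E).
  - by move=> n; case: (galerkin_measurable n).
  - by move=> n t tt; split; [case: (Vun n t)|case: (B n t tt)].
  - exact: energy_bound.
  - by move=> t _; case: (Vw t).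
  - move=> k; have [_] := UC k (0, 1) 0; rewrite (_ : (fun t => vip _ _) = fun t => \int[leb2]_(x in cell) ((w t x).2 * cos (phase k x)))//.
    by apply/funext => t; have [] := vip_modes_coord k (Vw t).
  - move=> k; have [_] := UC k 0 (0, 1); rewrite (_ : (fun t => vip _ _) = fun t => \int[leb2]_(x in cell) ((w t x).2 * sin (phase k x)))//.
    by apply/funext => t; have [] := vip_modes_coord k (Vw t).
  - move=> k e e0; have [h _] := UC k (0, 1) 0; apply: filterS (h e e0) => n hn t tt.
    by have := hn t tt; have [_ -> _ _] := vip_modes_coord k (Vun n t); have [_ -> _ _] := vip_modes_coord k (Vw t).
  - move=> k e e0; have [h _] := UC k 0 (0, 1); apply: filterS (h e e0) => n hn t tt.
    by have := hn t tt; have [_ _ _ ->] := vip_modes_coord k (Vun n t); have [_ _ _ ->] := vip_modes_coord k (Vw t).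
exists (fun p => (W1 p, W2 p)); split=> //.
  by move=> g lg; split; [exact: H1|exact: H2].
have := ae_and A1 A2; apply: filterS => t [h1 h2] tt; rewrite /ae_cell.
have := ae_and (h1 tt) (h2 tt); apply: filterS => x [k1 k2] cx.
by rewrite /= k1// k2// -surjective_pairing.
Qed.

End galerkin_limit.

Section bounded_coefficients.
Context d (T : measurableType d) (R : realType).
Variables (mu : {measure set T -> \bar R}) (D : set T).
Hypothesis mD : measurable D.

Lemma rint_bmul (f g : T -> R) (B : R) : measurable_fun D f -> (forall x, D x -> `|f x| <= B) ->
  rint mu D g -> rint mu D (fun x => f x * g x).
Proof.
move=> mf fB rg; apply: rint_le (rintZ mD B (integrable_norm rg)) _ => //.
  by apply: measurable_funM => //; exact: rint_measurable rg.
by move=> x Dx /=; rewrite normrM ler_wpM2r ?fB.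
Qed.

Definition bounded_matrix (A : T -> (R * R) * (R * R)) (B : R) :=
  [/\ measurable_fun D (fun x => (A x).1.1), measurable_fun D (fun x => (A x).1.2),
      measurable_fun D (fun x => (A x).2.1), measurable_fun D (fun x => (A x).2.2)
    & forall x, D x -> [/\ `|(A x).1.1| <= B, `|(A x).1.2| <= B, `|(A x).2.1| <= B & `|(A x).2.2| <= B]].

Definition L2pair (u : T -> R * R) := L2 mu D (fun x => (u x).1) /\ L2 mu D (fun x => (u x).2).

Lemma rint_dot (u v : T -> R * R) : L2pair u -> L2pair v -> rint mu D (fun x => dot (u x) (v x)).
Proof. by move=> [u1 u2] [v1 v2]; apply: rintD => //; exact: L2_prod. Qed.

Lemma L2pairB (u v : T -> R * R) : L2pair u -> L2pair v -> L2pair (fun x => u x - v x).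
Proof. by move=> [u1 u2] [v1 v2]; split; exact: L2B. Qed.

Lemma rint_ddot_tens (A : T -> (R * R) * (R * R)) (u v : T -> R * R) (B : R) :
  bounded_matrix A B -> L2pair u -> L2pair v ->
  rint mu D (fun x => ddot (A x) (tens (u x) (v x))).
Proof.
move=> [m1 m2 m3 m4 b] [u1 u2] [v1 v2].
have h (f : T -> R) (g k : T -> R) : measurable_fun D f -> (forall x, D x -> `|f x| <= B) ->
    L2 mu D g -> L2 mu D k -> rint mu D (fun x => f x * (g x * k x)).
  by move=> mf fB lg lk; apply: (rint_bmul mf fB); exact: L2_prod.
apply: rintD => //; apply: rintD => //; apply: h => // x Dx; by case: (b x Dx).
Qed.

Lemma Rint_diff_bound (f g h : T -> R) : rint mu D f -> rint mu D g -> rint mu D h ->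
  (forall x, D x -> `|f x - g x| <= h x) ->
  `| (\int[mu]_(x in D) f x) - \int[mu]_(x in D) g x| <= \int[mu]_(x in D) h x.
Proof.
move=> rf rg rh H; have rd := rintB mD rf rg.
rewrite -RintegralB//; apply: le_trans (le_normr_Rintegral mD rd) _.
by apply: le_Rintegral => //; exact: (integrable_norm rd).
Qed.

End bounded_coefficients.

Section test_field_coefficients.
Context {R : realType}.
Local Notation mR := (measurableTypeR R).
Local Notation cell := (@cell R).

Definition field_continuous (F : R * (R * R) -> R * R) :=
  continuous (fun p => (F p).1) /\ continuous (fun p => (F p).2).

Definition matrix_continuous (A : R * (R * R) -> (R * R) * (R * R)) :=
  [/\ continuous (fun p => (A p).1.1), continuous (fun p => (A p).1.2),
      continuous (fun p => (A p).2.1) & continuous (fun p => (A p).2.2)].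

Lemma test_field_continuous tau (phi : R -> R * R -> R * R) : test_field tau phi ->
  [/\ field_continuous (fun p => phi p.1 p.2), field_continuous (fun p => dt phi p.1 p.2)
    & matrix_continuous (fun p => nabla (phi p.1) p.2)].
Proof.
move=> [_ sphi _ _]; set F := (fun p => phi p.1 p.2) in sphi.
have cF : continuous F by have [] := sphi 0%N.
have [dF cDF] := smooth_derive sphi.
pose g1 p := (F p).1; pose g2 p := (F p).2.
pose et : R * (R * R) := (1, (0, 0)); pose ex (e : R * R) : R * (R * R) := (0, e).
pose D1 v p := ('D_v F p).1; pose D2 v p := ('D_v F p).2.
have cD1 v : continuous (D1 v) := continuous_fst_comp (cDF v).
have cD2 v : continuous (D2 v) := continuous_snd_comp (cDF v).
have t1 (s : R) x : is_derive s 1 (fun r => g1 (r, x)) (D1 et (s, x)) := is_derive_slice_time (is_derive_fst (dF (s, x) et)).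
have t2 (s : R) x : is_derive s 1 (fun r => g2 (r, x)) (D2 et (s, x)) := is_derive_slice_time (is_derive_snd (dF (s, x) et)).
have x1 (s : R) (x e : R * R) : is_derive x e (fun y => g1 (s, y)) (D1 (ex e) (s, x)) := is_derive_slice_space (is_derive_fst (dF (s, x) (ex e))).
have x2 (s : R) (x e : R * R) : is_derive x e (fun y => g2 (s, y)) (D2 (ex e) (s, x)) := is_derive_slice_space (is_derive_snd (dF (s, x) (ex e))).
have dtE : (fun p => dt phi p.1 p.2) = (fun p => (D1 et p, D2 et p)).
  apply/funext => -[t x]; rewrite /dt derive1E; have [_ ] := is_derive_pair (t1 t x) (t2 t x).
  by rewrite (_ : (fun y => (g1 (y, x), g2 (y, x))) = phi ^~ x)//; apply/funext => s; rewrite /g1 /g2/F/= -surjective_pairing.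
have dxE (e : R * R) : (fun p => 'D_e (phi p.1) p.2) = (fun p => (D1 (ex e) p, D2 (ex e) p)).
  apply/funext => -[t x]; have [_ ] := is_derive_pair (x1 t x e) (x2 t x e).
  by rewrite (_ : (fun y => (g1 (t, y), g2 (t, y))) = phi t)//; apply/funext => y; rewrite /g1 /g2/F/= -surjective_pairing.
split.
- by split; [exact: continuous_fst_comp|exact: continuous_snd_comp].
- rewrite dtE; split; [exact: (cD1 et)|exact: (cD2 et)].
- have E e : (fun p : R * (R * R) => 'D_e (phi p.1) p.2) = (fun p => (D1 (ex e) p, D2 (ex e) p)) := dxE e.
  have F1 e : (fun p : R * (R * R) => ('D_e (phi p.1) p.2).1) = D1 (ex e).
    by apply/funext => p; have /(congr1 (fun f => (f p).1)) := E e.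
  have F2 e : (fun p : R * (R * R) => ('D_e (phi p.1) p.2).2) = D2 (ex e).
    by apply/funext => p; have /(congr1 (fun f => (f p).2)) := E e.
  split; rewrite /nabla/=.
  + by rewrite (F1 e1).
  + by rewrite (F1 e2).
  + by rewrite (F2 e1).
  + by rewrite (F2 e2).
Qed.

Variable tau : R.
Hypothesis tau0 : 0 < tau.
Local Notation cyl := (cylinder tau).
Local Notation leb2 := (@leb2 R).
Local Notation leb3 := (@leb3 R).

Lemma continuous_L2_cylinder (g : R * (R * R) -> R) : continuous g -> L2 leb3 cyl g.
Proof.
move=> cg; have [B B0 HB] := slab_bounded 0 tau cg.
apply: (@L2_bounded _ _ _ _ _ (measurable_cylinder tau) (fin_cylinder tau0) _ B).
  exact: measurable_funTS (measurable_continuous3 cg).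
by move=> [t x] [/= tt cx]; apply: HB => //; rewrite in_itv in tt.
Qed.

Lemma field_L2_cylinder F : field_continuous F -> L2pair leb3 cyl F.
Proof. by move=> [c1 c2]; split; exact: continuous_L2_cylinder. Qed.

Lemma matrix_bounded_cylinder A : matrix_continuous A -> exists2 B, 0 <= B & bounded_matrix cyl A B.
Proof.
move=> [c1 c2 c3 c4].
have [B1 B10 H1] := slab_bounded 0 tau c1; have [B2 B20 H2] := slab_bounded 0 tau c2.
have [B3 B30 H3] := slab_bounded 0 tau c3; have [B4 B40 H4] := slab_bounded 0 tau c4.
exists (B1 + B2 + B3 + B4); first by rewrite !addr_ge0 ?ltW.
split; try by apply: measurable_funTS; exact: measurable_continuous3.
move=> [t x] [/= tt cx]; rewrite in_itv in tt; split.
- by apply: le_trans (H1 t x tt cx) _; lra.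
- by apply: le_trans (H2 t x tt cx) _; lra.
- by apply: le_trans (H3 t x tt cx) _; lra.
- by apply: le_trans (H4 t x tt cx) _; lra.
Qed.

Lemma field_section F (t : R) : field_continuous F -> VL2 (fun x => F (t, x)).
Proof.
move=> [c1 c2]; have s1 := continuous_section (t := t) c1; have s2 := continuous_section (t := t) c2.
by split; exact: continuous_L2.
Qed.

Lemma matrix_section A (t : R) : 0 <= t <= tau -> matrix_continuous A ->
  exists B, bounded_matrix cell (fun x => A (t, x)) B.
Proof.
move=> tt cA; have [B _ [_ _ _ _ H]] := matrix_bounded_cylinder cA; exists B.
have [c1 c2 c3 c4] := cA.
have s1 := continuous_section (t := t) c1; have s2 := continuous_section (t := t) c2.
have s3 := continuous_section (t := t) c3; have s4 := continuous_section (t := t) c4.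
split.
- exact: measurable_funTS (measurable_continuous2 s1).
- exact: measurable_funTS (measurable_continuous2 s2).
- exact: measurable_funTS (measurable_continuous2 s3).
- exact: measurable_funTS (measurable_continuous2 s4).
- by move=> x cx; apply: (H (t, x)); split; rewrite //= in_itv.
Qed.

End test_field_coefficients.

Lemma weak_integrandB (R : realType) (p q v : R * R) (A B : (R * R) * (R * R)) :
  dot p v + ddot A (tens v v) - (dot v q + ddot B (tens v v)) =
  dot (p - q) v + ddot (A.1 - B.1, A.2 - B.2) (tens v v).
Proof.
case: p q v A B => [p1 p2] [q1 q2] [v1 v2] [[a1 a2] [a3 a4]] [[b1 b2] [b3 b4]].
by rewrite /ddot /dot/=; ring.
Qed.

(** The linear term contributes [1 + normsq v], since |s| <= 1/2 + s^2 in each component, and the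
    quadratic term contributes [2 * normsq v]. *)
Lemma weak_integrand_close (R : realType) (p q v : R * R) (A B : (R * R) * (R * R)) (e : R) : 0 <= e ->
  `|q.1 - p.1| <= e -> `|q.2 - p.2| <= e -> `|B.1.1 - A.1.1| <= e -> `|B.1.2 - A.1.2| <= e ->
  `|B.2.1 - A.2.1| <= e -> `|B.2.2 - A.2.2| <= e ->
  `|dot p v + ddot A (tens v v) - (dot v q + ddot B (tens v v))| <= e * (1 + 3 * normsq v).
Proof.
move=> e0 k1 k2 a1 a2 a3 a4; rewrite weak_integrandB.
apply: le_trans (ler_normD _ _) _.
have d1 : `|dot (p - q) v| <= e * (1 + normsq v) by apply: dot_close; rewrite //= distrC.
have d2 : `|ddot (A.1 - B.1, A.2 - B.2) (tens v v)| <= 2 * e * normsq v.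
  by apply: ddot_tens_bound; rewrite //= distrC.
by apply: le_trans (lerD d1 d2) _; rewrite le_eqVlt; apply/orP; left; apply/eqP; ring.
Qed.

(** * The Galerkin equation tested against an arbitrary test field *)

Section galerkin_test.
Context {R : realType}.
Local Notation mR := (measurableTypeR R).
Local Notation leb := (@lebesgue_measure R).
Local Notation cell := (@cell R).
Local Notation leb2 := (@leb2 R).
Local Notation leb3 := (@leb3 R).
Context (U : set_system nat) {UU : UltraFilter U}.
Hypothesis UF : \oo `<=` U.
Variables (u0 : L2sigma R) (un0 : nat -> L2sigma R) (un : nat -> R -> L2sigma R).
Hypothesis gal : forall n, galerkin_solution n (un0 n) (un n).
Hypothesis un0_cvg : vip (fun x => un0 n x - u0 x) (fun x => un0 n x - u0 x) @[n --> U] --> (0 : R).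
Variable tau : R.
Hypothesis tau0 : 0 < tau.
Local Notation cyl := (cylinder tau).

Let mc := @measurable_cell R.
Let mC := @measurable_cylinder R tau.
Let Vun n t : VL2 (un n t) := in_L2sigma_VL2 (L2funP (un n t)).
Let Vun0 n : VL2 (un0 n) := in_L2sigma_VL2 (L2funP (un0 n)).

Lemma galerkin_L2pair n : L2pair leb3 cyl (fun p => un n p.1 p.2).
Proof.
have [m1 m2] := galerkin_measurable gal tau n.
have B (t : R) (tt : 0 <= t <= tau) : \int[leb2]_(x in cell) ((un n t x).1 * (un n t x).1) <= vip (un0 n) (un0 n) /\
           \int[leb2]_(x in cell) ((un n t x).2 * (un n t x).2) <= vip (un0 n) (un0 n).
  have t0 : 0 <= t by case/andP: tt.
  rewrite -(galerkin_energyE gal n t0) vipE//.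
  have := ip_ge0 leb2 cell (fun x => (un n t x).1).
  have := ip_ge0 leb2 cell (fun x => (un n t x).2).
  move: (\int[_]_(_ in _) _) (\int[_]_(_ in _) _) => P Q; split; lra.
split.
  apply: (cylinder_L2 tau0 m1 (C := vip (un0 n) (un0 n)) _).1 => t tt.
  by split; [case: (Vun n t)|case: (B t tt)].
apply: (cylinder_L2 tau0 m2 (C := vip (un0 n) (un0 n)) _).1 => t tt.
by split; [case: (Vun n t)|case: (B t tt)].
Qed.

Definition weak_density (phi : R -> R * R -> R * R) (v : R * (R * R) -> R * R) p : R :=
  dot (dt phi p.1 p.2) (v p) + ddot (nabla (phi p.1) p.2) (tens (v p) (v p)).

Lemma weak_density_rint phi v : test_field tau phi -> L2pair leb3 cyl v ->
  rint leb3 cyl (weak_density phi v).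
Proof.
move=> /test_field_continuous[_ cdt cnab] lv; apply: rintD => //.
  by apply: rint_dot => //; exact: (field_L2_cylinder tau0 cdt).
have [B _ bB] := matrix_bounded_cylinder tau cnab.
exact: (rint_ddot_tens mC bB lv lv).
Qed.

Lemma weak_density_section phi (t : R) (v : R * R -> R * R) : test_field tau phi -> 0 <= t <= tau -> VL2 v ->
  rint leb2 cell (fun x => dot (dt phi t x) (v x) + ddot (nabla (phi t) x) (tens (v x) (v x))).
Proof.
move=> /test_field_continuous[_ cdt cnab] tt Vv; apply: rintD => //.
  by apply: rint_dot => //; exact: (field_section t cdt).
have [B bB] := matrix_section tt cnab.
exact: (rint_ddot_tens mc bB Vv Vv).
Qed.

(** For the approximating polynomial [G] the weak equation is exact once [n] is at least twice its
    degree. Replacing it by [phi] costs at most [e * (1 + 3 * En)] at each time, hence the factor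
    [tau], and at most [e * (1 + En)] in the initial term. *)
Lemma galerkin_test_bound (phi : R -> R * R -> R * R) (e : R) : test_field tau phi -> 0 < e ->
  \forall n \near U,
    `| \int[leb3]_(p in cyl) weak_density phi (fun p => un n p.1 p.2) p + vip (phi 0) (un0 n)| <=
    e * (tau + 1) * (1 + 3 * vip (un0 n) (un0 n)).
Proof.
move=> tphi e0; have [p [G [G' [[tG tG'] dG [cG' cDG] [PG Gtau] close]]]] := test_field_approx tau0 tphi e0.
have near2p : \forall n \near U, (2 * p <= n)%N by apply: UF; exact: nbhs_infty_ge.
apply: filterS near2p => n np.
have PiG (t : R) : 0 <= t -> exists c, forall x, G t x = Pi_ n (G t) x + c by move=> t0; exact: PG.
have [rr wk] := @galerkin_weak R n (un0 n) (un n) (gal n) p G G' tau tau0 tG tG' dG PiG cG' cDG.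
(* There is no contribution at the final time: the approximation vanishes there exactly, like the
   test field. *)
have gtau : vip (un n tau) (G tau) = 0.
  rewrite /vip -[RHS](mul0r (fine (leb2 cell))) -Rintegral_cst//; apply: eq_Rint => x _.
  by rewrite Gtau /dot/= !mulr0 addr0.
rewrite gtau sub0r in wk.
have mI : measurable ([set` `[0 : R, tau]] : set mR) by exact: measurable_itv.
have [_ rq ->] := rint_Fubini mI mc (weak_density_rint tphi (galerkin_L2pair n)).
set En := vip (un0 n) (un0 n).
have one : \int[leb2]_(x in cell) (1 : R) = 1 by rewrite Rintegral_cst// mul1r; exact: (congr1 fine (@leb2_cell R)).
have Ep : 0 <= En by exact: vip_ge0.
have tt0 : (0 : R) <= 0 <= tau by rewrite lexx ltW.
have [cphi _ _] := test_field_continuous tphi.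
have Vphi0 : VL2 (phi 0) := field_section 0 cphi.
have h0 : `|vip (phi 0) (un0 n) - vip (G 0) (un0 n)| <= e * (1 + En).
  have rb : rint leb2 cell (fun x => e * (1 + normsq (un0 n x))).
    apply: rintZ => //; apply: rintD => //; last exact: (VL2_rint (Vun0 n) (Vun0 n)).
    by apply: (@rint_bounded _ _ _ _ _ mc (@fin_cell R) _ 1) => // x _; rewrite normr1.
  have -> : e * (1 + En) = \int[leb2]_(x in cell) (e * (1 + normsq (un0 n x))).
    rewrite RintegralZl//; last first.
      by apply: eq_rint (rintZ mc e^-1 rb) => // x _; rewrite mulrA mulVf ?mul1r// gt_eqF.
    rewrite RintegralD//; last 2 first.
    - by apply: (@rint_bounded _ _ _ _ _ mc (@fin_cell R) _ 1) => // x _; rewrite normr1.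
    - exact: (VL2_rint (Vun0 n) (Vun0 n)).
    by rewrite one.
  apply: Rint_diff_bound => //.
  - exact: VL2_rint.
  - exact: VL2_rint (VTP_VL2 (tG 0)) (Vun0 n).
  - move=> x cx; have [[k1 k2] _ _ _] := close 0 x tt0 cx.
    have -> : dot (phi 0 x) (un0 n x) - dot (G 0 x) (un0 n x) = dot (phi 0 x - G 0 x) (un0 n x).
      by rewrite /dot/=; ring.
    by apply: dot_close (ltW e0) _ _; rewrite /= distrC.
have h1 (t : R) : [set` `[0, tau]] t ->
    `|\int[leb2]_(x in cell) weak_density phi (fun p => un n p.1 p.2) (t, x) - galerkin_rate (un n) G G' t| <= e * (1 + 3 * En).
  rewrite /= in_itv/= => tt; have t0 : 0 <= t by case/andP: tt.
  have r1 := weak_density_section tphi tt (Vun n t).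
  have rG1 := VL2_rint (Vun n t) (VTP_VL2 (tG' t)).
  have bG : exists B, bounded_matrix cell (nabla (G t)) B.
    have [g1 g2] := tG t.
    have bd (f : R * R -> R) v : TP p f -> exists2 b, 0 < b & forall x, cell x -> `|'D_v f x| <= b.
      move=> tf; have [tf' _ _] := TP_derive v tf.
      have [B B0 HB] := continuous_bounded_cell (TP_continuous tf').
      by exists B => // x /cell_norm [k1 k2]; exact: HB.
    have md (f : R * R -> R) (v : R * R) : TP p f -> measurable_fun cell (fun x => 'D_v f x).
      by move=> tf; have [tf' _ _] := TP_derive v tf; exact: rint_measurable (TP_rint tf').
    have [b1 b10 H1] := bd _ e1 g1; have [b2 b20 H2] := bd _ e2 g1.
    have [b3 b30 H3] := bd _ e1 g2; have [b4 b40 H4] := bd _ e2 g2.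
    have -> : nabla (G t) = fun x => (('D_e1 (fun y => (G t y).1) x, 'D_e2 (fun y => (G t y).1) x),
      ('D_e1 (fun y => (G t y).2) x, 'D_e2 (fun y => (G t y).2) x)).
      by apply/funext => x; exact: nablaE (tG t).
    exists (b1 + b2 + b3 + b4); split; rewrite /=; [exact: md|exact: md|exact: md|exact: md|].
    move=> x cx; split.
    + by apply: le_trans (H1 x cx) _; lra.
    + by apply: le_trans (H2 x cx) _; lra.
    + by apply: le_trans (H3 x cx) _; lra.
    + by apply: le_trans (H4 x cx) _; lra.
  have [B bB] := bG.
  have rG2 := rint_ddot_tens mc bB (Vun n t) (Vun n t).
  have rn := VL2_rint (Vun n t) (Vun n t).
  have r1c : rint leb2 cell (fun=> 1 : R).
    by apply: (@rint_bounded _ _ _ _ _ mc (@fin_cell R) _ 1) => // x _; rewrite normr1.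
  have rb : rint leb2 cell (fun x => 1 + 3 * normsq (un n t x)).
    by apply: rintD => //; exact: rintZ.
  have -> : e * (1 + 3 * En) = \int[leb2]_(x in cell) (e * (1 + 3 * normsq (un n t x))).
    rewrite RintegralZl// RintegralD//; last exact: rintZ.
    by rewrite RintegralZl// one /En -(galerkin_energyE gal n t0).
  have -> : galerkin_rate (un n) G G' t = \int[leb2]_(x in cell)
      (dot (un n t x) (G' t x) + ddot (nabla (G t) x) (tens (un n t x) (un n t x))).
    by rewrite /galerkin_rate /vip RintegralD.
  apply: (Rint_diff_bound mc r1 (rintD mc rG1 rG2) (rintZ mc e rb)).
  move=> x cx; have [_ [k1 k2] [a1 a2] [a3 a4]] := close t x tt cx.
  rewrite /weak_density/=.
  exact: (@weak_integrand_close R (dt phi t x) (G' t x) (un n t x) (nabla (phi t) x) (nabla (G t) x) e (ltW e0) k1 k2 a1 a3 a2 a4).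
have h2 : `|(\int[leb]_(t in [set` `[0, tau]]) \int[leb2]_(x in cell) weak_density phi (fun p => un n p.1 p.2) (t, x)) -
    \int[leb]_(t in [set` `[0, tau]]) galerkin_rate (un n) G G' t| <= e * (1 + 3 * En) * tau.
  rewrite -(Rint_cst_itv tau0); apply: Rint_diff_bound => //.
  by apply: (@rint_bounded _ _ _ _ _ mI (fin_itv tau0) _ (e * (1 + 3 * En))) => // x _; rewrite ger0_norm// mulr_ge0 ?ltW//; lra.
rewrite -wk [vip (un0 n) (G 0)]vipC in h2.
move: h2 h0; move: (Rintegral _ _ _) (vip (phi 0) _) (vip (G 0) _) => P Q S h2 h0.
have -> : P + Q = P - - S + (Q - S) by ring.
apply: le_trans (ler_normD _ _) _; apply: le_trans (lerD h2 h0) _.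
have := mulr_ge0 (ltW e0) Ep; have := mulr_ge0 (ltW tau0) (mulr_ge0 (ltW e0) Ep); nra.
Qed.

Lemma galerkin_test_limit (phi : R -> R * R -> R * R) : test_field tau phi ->
  \int[leb3]_(p in cyl) weak_density phi (fun p => un n p.1 p.2) p @[n --> U] --> - vip (phi 0) u0.
Proof.
move=> tphi; have [cphi _ _] := test_field_continuous tphi.
have Vphi0 : VL2 (phi 0) := field_section 0 cphi.
have c0 : vip (phi 0) (un0 n) @[n --> U] --> vip (phi 0) u0.
  by rewrite vipC; under eq_fun do rewrite vipC; exact: un0_weak.
suff c1 : (\int[leb3]_(p in cyl) weak_density phi (fun p => un n p.1 p.2) p + vip (phi 0) (un0 n)) @[n --> U] --> (0 : R).
  have E : (fun n => \int[leb3]_(p in cyl) weak_density phi (fun p => un n p.1 p.2) p) =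
      (fun n => (\int[leb3]_(p in cyl) weak_density phi (fun p => un n p.1 p.2) p + vip (phi 0) (un0 n)) -
                vip (phi 0) (un0 n)) by apply/funext => n; rewrite addrK.
  rewrite E -[X in _ --> X]sub0r; exact: cvgB.
(* The factor by which [galerkin_test_bound] multiplies the accuracy, with the energy replaced by
   its eventual bound. *)
apply/cvgrPdist_le => e e0; pose K := (tau + 1) * (1 + 3 * (vip u0 u0 + 1)).
have K0 : 0 < K by rewrite mulr_gt0// ?addr_gt0// mulr_gt0// ltr_wpDl// vip_ge0.
have := galerkin_test_bound tphi (divr_gt0 e0 K0).
apply: filterS2 (energy_bound un0_cvg) => n EC h; rewrite sub0r normrN.
apply: le_trans h _; rewrite -mulrA -[leRHS](divfK (lt0r_neq0 K0)) ler_wpM2l ?divr_ge0 ?(ltW e0) ?(ltW K0)//.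
by rewrite /K ler_wpM2l ?addr_ge0 ?(ltW tau0)// lerD2l ler_wpM2l.
Qed.

End galerkin_test.

Lemma Rint_le0_ae0 d (T : measurableType d) (R : realType) (mu : {measure set T -> \bar R}) (D : set T) (f : T -> R) :
  measurable D -> rint mu D f -> (forall x, D x -> 0 <= f x) -> \int[mu]_(x in D) f x <= 0 ->
  {ae mu, forall x, D x -> f x = 0}.
Proof.
move=> mD rf f0 h; apply: rint_ae0 => // A mA; apply/eqP; rewrite eq_le; apply/andP; split.
  by apply: le_trans h; apply: Rint_subset => //; exact: measurableI.
by apply: Rintegral_ge0 => y [Dy _]; exact: f0.
Qed.

(** * The defect measure *)

Section restricted_image.
Context d1 d2 (T1 : measurableType d1) (T2 : measurableType d2) (R : realType).
Variables (m : {measure set T1 -> \bar R}) (Y : T1 -> T2) (E : set T2).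
Hypotheses (mE : measurable E) (mY : measurable_fun setT Y) (mYE : (m (Y @^-1` E) < +oo)%E).

Let push : {measure set T2 -> \bar R}.
Proof. by refine (pushforward m Y : {measure set T2 -> \bar R}). Defined.

(** The image measure restricted to [E]. It is finite as soon as the preimage of [E] has finite
    measure, even where [m] itself is infinite, as for the Lebesgue measure on the line. *)
Definition restricted_image : set T2 -> \bar R := mrestr push mE.

Let image0 : restricted_image set0 = 0%E.
Proof. exact: (measure0 (mrestr push mE)). Qed.

Let image_ge0 A : (0 <= restricted_image A)%E.
Proof. exact: (measure_ge0 (mrestr push mE)). Qed.

Let image_sigma_additive : semi_sigma_additive restricted_image.
Proof. exact: (@measure_semi_sigma_additive _ _ _ (mrestr push mE)). Qed.

HB.instance Definition _ := isMeasure.Build _ _ _ restricted_image image0 image_ge0 image_sigma_additive.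

Let fin_image : fin_num_fun restricted_image.
Proof.
move=> A mA; rewrite ge0_fin_numE//; apply: le_lt_trans mYE.
rewrite /restricted_image /mrestr/= /pushforward; apply: le_measure; rewrite ?inE.
- by rewrite -[X in measurable X]setTI; apply: mY => //; exact: measurableI.
- by rewrite -[X in measurable X]setTI; apply: mY.
- by move=> x [].
Qed.

HB.instance Definition _ := @Measure_isFinite.Build _ T2 _ restricted_image fin_image.

Lemma restricted_imageE (f : T2 -> \bar R) : measurable_fun E f ->
  (\int[restricted_image]_(y in E) f y = \int[m]_(x in Y @^-1` E) f (Y x))%E.
Proof.
move=> mf; rewrite (@eq_measure_integral _ _ _ E push); last first.
  by move=> A mA AE; rewrite -[LHS]/(push (A `&` E)) (setIidl AE).
rewrite integralE [RHS]integralE; congr (_ - _)%E.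
- by rewrite (@ge0_integral_pushforward _ _ _ _ _ Y mY m E _ mE (measurable_funepos mf))// -funepos_comp.
- by rewrite (@ge0_integral_pushforward _ _ _ _ _ Y mY m E _ mE (measurable_funeneg mf))// -funeneg_comp.
Qed.

Lemma restricted_imageC : restricted_image (~` E) = 0%E.
Proof. by rewrite /restricted_image /mrestr setICl measure0. Qed.

Lemma restricted_image_exists : exists kappa : {finite_measure set T2 -> \bar R},
  kappa (~` E) = 0%E /\ forall f : T2 -> \bar R, measurable_fun E f ->
    (\int[kappa]_(y in E) f y = \int[m]_(x in Y @^-1` E) f (Y x))%E.
Proof.
unshelve eexists; first by refine (restricted_image : {finite_measure set T2 -> \bar R}).
by split; [exact: restricted_imageC|exact: restricted_imageE].
Qed.

End restricted_image.

Section conditional_expectation.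
Context d1 d2 (T1 : measurableType d1) (T2 : measurableType d2) (R : realType).
Variables (m : {measure set T1 -> \bar R}) (Y : T1 -> T2) (E : set T2).
Variable kappa : {finite_measure set T2 -> \bar R}.
Hypotheses (mE : measurable E) (mY : measurable_fun setT Y).
Hypothesis kappaE : forall f : T2 -> \bar R, measurable_fun E f ->
  (\int[kappa]_(y in E) f y = \int[m]_(x in Y @^-1` E) f (Y x))%E.
Local Notation D := (Y @^-1` E).

Let mD : measurable D.
Proof. by rewrite -[X in measurable X]setTI; exact: mY. Qed.

Let mcomp (f : T2 -> R) : measurable_fun E f -> measurable_fun D (fun x => f (Y x)).
Proof.
move=> mf; apply: (measurable_comp mE _ mf); first by move=> _ [x h <-].
exact: measurable_funTS.
Qed.

Let fin_kappa : (kappa E < +oo)%E.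
Proof. by rewrite ltey_eq fin_num_measure. Qed.

Lemma rint_image (f : T2 -> R) : rint kappa E f -> rint m D (fun x => f (Y x)).
Proof.
move=> rf; have mf := rint_measurable rf; apply/integrableP; split.
  by apply/measurable_EFinP; exact: mcomp.
have /integrableP[_] := rf; rewrite kappaE//.
by apply: measurableT_comp => //; exact/measurable_EFinP.
Qed.

Lemma Rint_image (f : T2 -> R) : measurable_fun E f ->
  \int[kappa]_(y in E) f y = \int[m]_(x in D) f (Y x).
Proof. by move=> mf; rewrite /Rintegral kappaE//; exact/measurable_EFinP. Qed.

Lemma L2_image (f : T2 -> R) : L2 kappa E f -> L2 m D (fun x => f (Y x)).
Proof. by move=> [mf rf]; split; [exact: mcomp|exact: rint_image rf]. Qed.

(** The conditional expectation of [h] given [Y] as a function on the target: it represents the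
    functional sending [g] to the integral of [g (Y x) * h x], which is bounded on the L^2 space of
    [kappa]. *)
Lemma conditional_expectation (h : T1 -> R) : L2 m D h ->
  exists2 a : T2 -> R, L2 kappa E a & forall g, L2 kappa E g ->
    \int[m]_(x in D) (g (Y x) * h x) = \int[kappa]_(y in E) (a y * g y).
Proof.
move=> lh; pose L (g : T2 -> R) := \int[m]_(x in D) (g (Y x) * h x).
have rg g : L2 kappa E g -> rint m D (fun x => g (Y x) * h x).
  by move=> lg; apply: L2_prod => //; exact: L2_image.
have [||||a [la _] H] := @riesz_L2 _ _ _ kappa E mE fin_kappa L (\int[m]_(x in D) (h x * h x)); last by exists a.
- exact: ip_ge0.
- move=> f g lf lg; rewrite /L -RintegralD//; [|exact: rg|exact: rg].
  by apply: eq_Rint => x _; rewrite mulrDl.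
- move=> c f lf; rewrite /L -RintegralZl//; last exact: rg.
  by apply: eq_Rint => x _; rewrite mulrA.
- move=> f lf; apply: le_trans (cauchy_schwarz mD (L2_image lf) lh) _.
  by rewrite mulrC Rint_image//; apply: measurable_funM; case: lf.
Qed.

(* Conditional expectations of a vector in the unit disc lie in the unit disc: on the set where
   [a^2 + b^2 > 1], [a c + b s <= (a^2 + b^2 + 1) / 2] forces [a^2 + b^2 <= 1] on average. *)
Lemma disc_conditional_expectation (c s : T1 -> R) : L2 m D c -> L2 m D s ->
  (forall x, D x -> c x ^+ 2 + s x ^+ 2 <= 1) ->
  exists a b : T2 -> R, [/\ measurable_fun setT a, measurable_fun setT b,
    forall y, a y ^+ 2 + b y ^+ 2 <= 1
  & forall g, L2 kappa E g ->
      \int[m]_(x in D) (g (Y x) * c x) = \int[kappa]_(y in E) (g y * a y) /\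
      \int[m]_(x in D) (g (Y x) * s x) = \int[kappa]_(y in E) (g y * b y)].
Proof.
move=> lc ls cs; have [a la Ha] := conditional_expectation lc.
have [b lb Hb] := conditional_expectation ls.
have [ma ra] := la; have [mb rb] := lb.
have mr : measurable_fun E (fun y => a y * a y + b y * b y).
  by apply: measurable_funD; apply: measurable_funM.
pose F := E `&` [set y | 1 < a y * a y + b y * b y].
have mF : measurable F.
  have := measurable_fun_ltr (measurable_cst (1 : R)) mr mE (Y := [set true]) Logic.I.
  by rewrite (_ : _ @^-1` _ = [set y | 1 < a y * a y + b y * b y]).
have mG : measurable (E `\` F) by exact: measurableD.
have GE : (E `\` F) `<=` E by move=> y [].
have m1 : measurable_fun E (\1_F : T2 -> R) by exact: measurable_indic.
have b1 y : E y -> `|\1_F y : R| <= 1 by move=> _; rewrite indicE; case: (_ \in _); rewrite ?normr1 ?normr0.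
have l1a := L2_bmul mE m1 b1 la; have l1b := L2_bmul mE m1 b1 lb.
have r1 : rint kappa E (fun=> 1 : R).
  by apply: (@rint_bounded _ _ _ _ _ mE fin_kappa _ 1) => // y _; rewrite normr1.
have rr : rint kappa E (fun y => a y * a y + b y * b y) by exact: rintD.
have rm (f : T2 -> R) : rint kappa E f -> rint kappa E (fun y => \1_F y * f y) by exact: rint_bmul m1 b1.
have h1 : \int[kappa]_(y in E) (\1_F y * (a y * a y + b y * b y)) <=
    \int[kappa]_(y in E) (\1_F y * (2^-1 * (a y * a y + b y * b y + 1))).
  rewrite (@eq_Rint _ _ _ _ _ _ (fun y => a y * (\1_F y * a y) + b y * (\1_F y * b y))); last by move=> y _; ring.
  rewrite RintegralD//; [|exact: L2_prod|exact: L2_prod].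
  rewrite -Ha// -Hb// -RintegralD//; [|exact: L2_prod (L2_image l1a) lc|exact: L2_prod (L2_image l1b) ls].
  rewrite Rint_image; last by apply: measurable_funM => //; apply: measurable_funM => //; apply: measurable_funD.
  apply: le_Rintegral => //.
  - by apply: rintD => //; [exact: L2_prod (L2_image l1a) lc|exact: L2_prod (L2_image l1b) ls].
  - apply: (@rint_image (fun y => \1_F y * (2^-1 * (a y * a y + b y * b y + 1)))); apply: rm; apply: rintZ => //; exact: rintD.
  - move=> x Dx; have := cs x Dx; rewrite indicE; case: (_ \in _); rewrite ?mul0r ?addr0 ?mul1r//.
    by move: (a _) (b _) (c x) (s x) => p q r t h; have := sqr_ge0 (p - r); have := sqr_ge0 (q - t); lra.
have h2 : \int[kappa]_(y in E) (\1_F y * (a y * a y + b y * b y - 1)) <= 0.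
  have e (y : T2) : \1_F y * (a y * a y + b y * b y - 1) = 2 * (\1_F y * (a y * a y + b y * b y) -
     \1_F y * (2^-1 * (a y * a y + b y * b y + 1))) :> R by field.
  rewrite (@eq_Rint _ _ _ _ _ _ _ (fun y _ => e y)).
  have ra1 := rm _ rr; have ra2 := rm _ (rintZ mE 2^-1 (rintD mE rr r1)).
  rewrite RintegralZl//; last exact: rintB.
  by rewrite RintegralB// pmulr_rle0// subr_le0.
have ae1 : {ae kappa, forall y, E y -> ~ F y}.
  have := Rint_le0_ae0 mE (rm _ (rintB mE rr r1)) _ h2; rewrite /=.
  move=> H; apply: filterS (H _).
    move=> y h Ey Fy; have := h Ey; rewrite indicE mem_set// mul1r => /eqP; rewrite subr_eq0 => /eqP e.
    by case: Fy => _; rewrite /= e ltxx.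
  move=> y Ey; rewrite indicE; case: (boolP (y \in F)) => [/set_mem[_ /= /ltW]|_]; last by rewrite mul0r.
  by rewrite mul1r subr_ge0.
have key (f g : T2 -> R) : measurable_fun E f -> measurable_fun E g ->
    \int[kappa]_(y in E) (f y * g y) = \int[kappa]_(y in E) (g y * (f \_ (E `\` F)) y).
  move=> mf mg; rewrite /Rintegral; congr fine; apply: ae_eq_integral => //.
  - by apply/measurable_EFinP; exact: measurable_funM.
  - apply/measurable_EFinP; apply: measurable_funM => //.
    apply: measurable_funTS; apply/(measurable_restrictT _ mG).
    exact: measurable_funS mf.
  - apply: filterS ae1 => y h Ey; rewrite /patch mem_set; last by split=> //; exact: h.
    by rewrite mulrC.
(* Setting the functions to 0 on the null set [F] and outside [E] makes measurability and the disc
   bound hold everywhere. *)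
exists (a \_ (E `\` F)), (b \_ (E `\` F)); split.
- by apply/(measurable_restrictT _ mG); exact: measurable_funS ma.
- by apply/(measurable_restrictT _ mG); exact: measurable_funS mb.
- move=> y; rewrite /patch; case: ifP => [/set_mem[Ey nF]|_]; last by rewrite expr0n/= addr0.
  by rewrite leNgt; apply/negP => h; apply: nF; split=> //=; rewrite -!expr2.
- by move=> g lg; have mg := lg.1; rewrite Ha// Hb//; split; exact: key.
Qed.

End conditional_expectation.

(** * The double angle of a vector *)

Section directions.
Context {R : realType}.
Implicit Types z : R * R.

(** Cosine of twice the angle of [z], and below the sine. The double angle is what z (x) z
    determines besides the length, z and -z having the same tensor. At the origin both are 0 by the
    convention on division, which is compatible with [cosdirE] and [sindirE]. *)
Definition cosdir z : R := (z.1 * z.1 - z.2 * z.2) / normsq z.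
Definition sindir z : R := 2 * (z.1 * z.2) / normsq z.

Lemma normsq_eq0 z : normsq z = 0 -> z.1 = 0 /\ z.2 = 0.
Proof.
move=> h; have := sqr_ge0 z.1; have := sqr_ge0 z.2; rewrite !expr2 /normsq /dot in h * => h1 h2.
have e1 : z.1 * z.1 = 0 by lra.
have e2 : z.2 * z.2 = 0 by lra.
by split; apply/eqP; rewrite -[_ == 0]orbb -mulf_eq0 ?e1 ?e2.
Qed.

Lemma cosdirE z : cosdir z * normsq z = z.1 * z.1 - z.2 * z.2.
Proof.
have [h|h] := eqVneq (normsq z) 0; last by rewrite divfK.
by have [-> ->] := normsq_eq0 h; rewrite h mulr0 mul0r subrr.
Qed.

Lemma sindirE z : sindir z * normsq z = 2 * (z.1 * z.2).
Proof.
have [h|h] := eqVneq (normsq z) 0; last by rewrite divfK.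
by have [-> ->] := normsq_eq0 h; rewrite h !mulr0.
Qed.

Lemma direction_le1 z : cosdir z ^+ 2 + sindir z ^+ 2 <= 1.
Proof.
have [h|h] := eqVneq (normsq z) 0.
  by rewrite /cosdir /sindir h invr0 !mulr0 expr0n/= addr0.
suff -> : cosdir z ^+ 2 + sindir z ^+ 2 = 1 by [].
have h2 : normsq z ^+ 2 != 0 by rewrite expf_neq0.
apply: (mulIf h2); rewrite mulrDl -!exprMn cosdirE sindirE mul1r /normsq /dot; ring.
Qed.

Lemma direction_bound (c s : R) : c ^+ 2 + s ^+ 2 <= 1 -> -1 <= c <= 1 /\ -1 <= s <= 1.
Proof. by move=> h; split; apply/andP; split; nra. Qed.

(** With |x - y| <= 3e, |y| <= 1 and e <= 1 one has x^2 <= y^2 + 6e + 9e^2 <= y^2 + 15e, and there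
    are two coordinates. *)
Lemma direction_close (c0 s0 c s e : R) : c0 ^+ 2 + s0 ^+ 2 <= 1 -> 0 <= e <= 1 ->
  `|c - c0| <= 3 * e -> `|s - s0| <= 3 * e -> c ^+ 2 + s ^+ 2 <= 1 + 30 * e.
Proof.
move=> h /andP[e0 e1] hc hs; have [h1 h2] := direction_bound h.
have sq (x y : R) : -1 <= y <= 1 -> `|x - y| <= 3 * e -> x ^+ 2 <= y ^+ 2 + 15 * e.
  by move=> /andP[b1 b2]; rewrite ler_norml => /andP[a1 a2]; nra.
have := sq _ _ h1 hc; have := sq _ _ h2 hs; lra.
Qed.

Lemma measurable_inv_ge0 d (T : measurableType d) (D : set T) (f : T -> R) : measurable D ->
  measurable_fun D f -> (forall x, D x -> 0 <= f x) -> measurable_fun D (fun x => (f x)^-1).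
Proof.
move=> mD mf f0; have : measurable_fun D (fun x => powR (f x) (-1)).
  by apply: (measurableT_comp (f := fun x : R => x `^ (-1))) => //; exact: measurable_powR.
by apply: eq_measurable_fun => x /set_mem Dx; rewrite powR_inv1// f0.
Qed.

Lemma measurable_direction d (T : measurableType d) (D : set T) (v : T -> R * R) : measurable D ->
  measurable_fun D (fun x => (v x).1) -> measurable_fun D (fun x => (v x).2) ->
  measurable_fun D (fun x => cosdir (v x)) /\ measurable_fun D (fun x => sindir (v x)).
Proof.
move=> mD m1 m2.
have mi : measurable_fun D (fun x => (normsq (v x))^-1).
  apply: measurable_inv_ge0 => //.
    by apply: measurable_funD; apply: measurable_funM.
  by move=> x _; rewrite /normsq /dot addr_ge0// -expr2 sqr_ge0.
split; apply: measurable_funM => //.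
  by apply: measurable_funB; apply: measurable_funM.
by apply: measurable_funM => //; apply: measurable_funM.
Qed.

End directions.

Section box_continuity.
Context {R : realType} (I : finType).
Local Notation K := (I -> R).
Local Notation box := (fun k : K => forall i, 0 <= k i <= 1).

Lemma ucont_boxM (f g : K -> R) (B : R) : 0 < B -> ucont_box f -> ucont_box g ->
  (forall k, box k -> `|f k| <= B) -> (forall k, box k -> `|g k| <= B) -> ucont_box (fun k => f k * g k).
Proof.
move=> B0 uf ug bf bg e e0; have e2 : 0 < e / (2 * B) by rewrite divr_gt0// mulr_gt0.
have [d1 d10 H1] := uf _ e2; have [d2 d20 H2] := ug _ e2.
exists (Num.min d1 d2) => [|a b ba bb ab]; first by rewrite lt_min d10.
have h1 : `|f a - f b| <= e / (2 * B) by apply: H1 => // i; apply: le_trans (ab i) _; rewrite ge_min lexx.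
have h2 : `|g a - g b| <= e / (2 * B) by apply: H2 => // i; apply: le_trans (ab i) _; rewrite ge_min lexx orbT.
have -> : f a * g a - f b * g b = (f a - f b) * g a + f b * (g a - g b) by ring.
apply: le_trans (ler_normD _ _) _; rewrite !normrM.
apply: le_trans (lerD (ler_pM _ _ h1 (bg a ba)) (ler_pM _ _ (bf b bb) h2)) _ => //.
by rewrite le_eqVlt; apply/orP; left; apply/eqP; field; rewrite gt_eqF.
Qed.

Lemma ucont_box_affine (i : I) (a b : R) : ucont_box (fun k : K => a * k i + b).
Proof.
move=> e e0; exists (e / (`|a| + 1)) => [|k l _ _ kl]; first by rewrite divr_gt0// ltr_wpDl.
have -> : a * k i + b - (a * l i + b) = a * (k i - l i) by ring.
rewrite normrM; apply: le_trans (ler_wpM2l (normr_ge0 a) (kl i)) _.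
rewrite mulrA ler_pdivrMr ?ltr_wpDl// mulrC ler_wpM2l ?ltW//; lra.
Qed.

Lemma ucont_box_cst (c : R) : ucont_box (fun _ : K => c).
Proof. by move=> e e0; exists 1 => // a b _ _ _; rewrite subrr normr0 ltW. Qed.

Lemma ucont_box_field (g : R * (R * R) -> R) (T : R) (i0 i1 i2 : I) : 0 < T -> continuous g ->
  ucont_box (fun k : K => g (T * k i0, (k i1, k i2))).
Proof.
move=> T0 cg e e0.
have [d d0 Hd] := compact_ucont (@compact_slab R 0 T) (fun x _ => cg x) e0.
have T1 : 0 < T + 1 by rewrite addr_gt0.
exists (d / 2 / (T + 1)) => [|a b ba bb ab]; first by rewrite !divr_gt0.
have dd : d / 2 / (T + 1) <= d / 2 by rewrite ler_pdivrMr// ler_peMr ?divr_ge0 ?ltW//; lra.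
have dlt : d / 2 < d by lra.
apply: Hd.
  have /andP[p q] := ba i0; have h1 := ba i1; have h2 := ba i2.
  split; last by split; rewrite /= in_itv.
  by rewrite /= in_itv/= mulr_ge0 ?(ltW T0)//= ger_pMr.
split=> /=; last by split; rewrite /ball/=; apply: le_lt_trans dlt; apply: le_trans dd.
rewrite /ball/= -mulrBr normrM gtr0_norm//; apply: le_lt_trans dlt.
apply: le_trans (ler_wpM2l (ltW T0) (ab i0)) _.
rewrite mulrA ler_pdivrMr// mulrC ler_wpM2l ?divr_ge0 ?ltW//; lra.
Qed.

End box_continuity.

Section wrapping.
Context {R : realType}.

(** Limits of points of the half-open cell may have a coordinate equal to 1; it is brought back to
    0, which periodic functions do not notice. *)
Definition wrap (z : R) : R := if z < 1 then z else 0.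

Lemma wrap_itv z : 0 <= z <= 1 -> 0 <= wrap z < 1.
Proof. by rewrite /wrap => /andP[z0 z1]; case: ifP => [->|_]; rewrite ?z0 ?lexx ?ltr01. Qed.

Lemma wrap_int z : 0 <= z <= 1 -> exists k : int, wrap z = z + k%:~R.
Proof.
rewrite /wrap => /andP[z0 z1]; case: ltP => h; first by exists 0; rewrite addr0.
by exists (- 1%Z); have -> : z = 1 by [apply/eqP; rewrite eq_le z1]; rewrite rmorphN1 subrr.
Qed.

Lemma Z2periodic_wrap (W : Type) (f : R * R -> W) (a b : R) : Z2periodic f ->
  0 <= a <= 1 -> 0 <= b <= 1 -> f (wrap a, wrap b) = f (a, b).
Proof.
by move=> pf /wrap_int[k ->] /wrap_int[l ->]; have := pf (k, l) (a, b).
Qed.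

Lemma measurable_wrap : measurable_fun setT (wrap : measurableTypeR R -> R).
Proof. by apply: measurable_fun_ifT => //; exact: measurable_fun_ltr. Qed.

End wrapping.

(** * The limit distribution of the defects *)

Section defect_parametrization.
Context {R : realType}.
Local Notation mR := (measurableTypeR R).
Local Notation leb := (@lebesgue_measure R).
Local Notation leb3 := (@leb3 R).
Context (U : set_system nat) {UU : UltraFilter U}.
Variable tau : R.
Hypothesis tau0 : 0 < tau.
Local Notation cyl := (cylinder tau).
Variables (v : nat -> R * (R * R) -> R * R) (C : R).
Hypothesis Lv : forall n, L2pair leb3 cyl (v n).
Hypothesis vC : \forall n \near U, \int[leb3]_(p in cyl) normsq (v n p) <= C.

Let mC := @measurable_cylinder R tau.

(* The affine rescalings keep all the coordinates in [0, 1[. *)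
Let coord n (p : R * (R * R)) (i : 'I_5) : R :=
  nth 0 [:: p.1 / (2 * tau); p.2.1; p.2.2; (cosdir (v n p) + 1) / 3; (sindir (v n p) + 1) / 3] i.

Let coord01 n p : cyl p -> forall i, 0 <= coord n p i < 1.
Proof.
move=> [/= tt [/= x1 x2]]; rewrite !in_itv/= in tt x1 x2.
have [/andP[c1 c2] /andP[s1 s2]] := direction_bound (direction_le1 (v n p)).
have t2 : 0 < 2 * tau by rewrite mulr_gt0.
case=> [[|[|[|[|[|//]]]]] hi] //; rewrite /coord/=.
- have /andP[t0 t1] := tt; rewrite divr_ge0 ?(ltW t2)//= ltr_pdivrMr// mul1r; lra.
- lra.
- lra.
Qed.

Let mcoord n i : measurable_fun cyl (fun p => coord n p i).
Proof.
have [[m1 _] [m2 _]] := Lv n; have [mc ms] := measurable_direction mC m1 m2.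
have p1 : measurable_fun cyl (fun p : mR * (mR * mR) => p.1 : R) by exact: (measurable_funTS measurable_fst).
have p2 : measurable_fun cyl (fun p : mR * (mR * mR) => p.2) by exact: (measurable_funTS measurable_snd).
case: i => [[|[|[|[|[|//]]]]] hi] //; rewrite /coord/=.
- exact: measurable_funM.
- exact: (measurableT_comp measurable_fst p2).
- exact: (measurableT_comp measurable_snd p2).
- by apply: measurable_funM => //; apply: measurable_funD.
- by apply: measurable_funM => //; apply: measurable_funD.
Qed.

Let measurable_extend (Mt : R) (f : R -> R) (k : R) :
  measurable_fun ([set` `[0, Mt[] : set mR) f ->
  measurable_fun setT (fun r : mR => if 0 <= r < Mt then f r else k).
Proof.
move=> mf; have mI : measurable ([set` `[0, Mt[] : set mR) by exact: measurable_itv.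
have E : (fun r : mR => if 0 <= r < Mt then f r else k) =
    (fun r => ((fun r => f r - k) \_ ([set` `[0, Mt[] : set mR)) r + k).
  apply/funext => r; rewrite /patch mem_setE/= in_itv/=; case: ifP => _; first by rewrite subrK.
  by rewrite add0r.
rewrite E; apply: measurable_funD => //.
by apply/(measurable_restrictT _ mI); apply: measurable_funB.
Qed.

(** The Skorokhod representation is applied to the five numbers [coord] with weight
    [normsq (v n p)]. Undoing the rescalings turns [X] into a point [P] of the cylinder and the
    double-angle coordinates [c], [s]; the three limits are those of the weight times 1, the cosine
    and the sine. *)
Lemma defect_parametrization : exists (Mt : R) (P : R -> R * (R * R)) (c s : R -> R),
  [/\ 0 <= Mt, measurable_fun setT (P : mR -> mR * (mR * mR)) /\ P @^-1` cyl = [set` `[0, Mt[],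
      measurable_fun ([set` `[0, Mt[] : set mR) c /\ measurable_fun ([set` `[0, Mt[] : set mR) s,
      forall r, 0 <= r < Mt -> c r ^+ 2 + s r ^+ 2 <= 1
    & forall g : R * (R * R) -> R, continuous g -> (forall t, Z2periodic (fun x => g (t, x))) ->
      [/\ \int[leb3]_(p in cyl) (g p * normsq (v n p)) @[n --> U] -->
            \int[leb]_(r in ([set` `[0, Mt[] : set mR)) g (P r),
          \int[leb3]_(p in cyl) (g p * ((v n p).1 * (v n p).1 - (v n p).2 * (v n p).2)) @[n --> U] -->
            \int[leb]_(r in ([set` `[0, Mt[] : set mR)) (g (P r) * c r)
        & \int[leb3]_(p in cyl) (g p * (2 * ((v n p).1 * (v n p).2))) @[n --> U] -->
            \int[leb]_(r in ([set` `[0, Mt[] : set mR)) (g (P r) * s r)]].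
Proof.
have t2 : 0 < 2 * tau by rewrite mulr_gt0.
have rho_int n : rint leb3 cyl (fun p => normsq (v n p)) by apply: rint_dot.
have rho0 n p : cyl p -> 0 <= normsq (v n p).
  by move=> _; rewrite /normsq /dot addr_ge0// -expr2 sqr_ge0.
have mZ n k s : measurable (cyl `&` [set x | digits k (coord n x) = s]).
  by apply: (measurable_digits mC) => [i|x Dx i]; [exact: mcoord|exact: coord01].
have [Mt /andP[Mt0 _] [X [mX X01 Xclose Xlim]]] :=
  skorokhod mC (fun k (z z' : 'I_5 -> R) => @digits_close R _ k z z') coord01 mZ rho_int rho0 vC.
pose i0 : 'I_5 := @Ordinal 5 0 isT; pose i1 : 'I_5 := @Ordinal 5 1 isT.
pose i2 : 'I_5 := @Ordinal 5 2 isT; pose i3 : 'I_5 := @Ordinal 5 3 isT.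
pose i4 : 'I_5 := @Ordinal 5 4 isT.
pose c r := 3 * X r i3 + -1; pose s r := 3 * X r i4 + -1.
(* Outside the parameter interval [P] takes the time -1, so the preimage of the cylinder is exactly
   the interval. *)
pose P r : R * (R * R) := (if 0 <= r < Mt then 2 * tau * X r i0 else -1,
  (if 0 <= r < Mt then wrap (X r i1) else 0, if 0 <= r < Mt then wrap (X r i2) else 0)).
have mI : measurable ([set` `[0, Mt[] : set mR) by exact: measurable_itv.
(* Times at most [tau] have first coordinate at most 1/2. The bound passes to [X], which is
   approximated by actual coordinates, and keeps [P] inside the cylinder. *)
have X0 r : 0 <= r < Mt -> X r i0 <= 2^-1.
  move=> rM; apply/ler_addgt0Pr => e e0; have [n [p [cp H]]] := Xclose r e rM e0.
  have := H i0; rewrite /coord/= => h; have := ler_norm (X r i0 - p.1 / (2 * tau)).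
  have : p.1 / (2 * tau) <= 2^-1.
    case: cp => /= tt _; rewrite in_itv/= in tt; case/andP: tt => _ t1.
    by rewrite ler_pdivrMr// mulrA mulVf// mul1r.
  move=> h1 h2; apply: le_trans (_ : p.1 / (2 * tau) + e <= _); last by rewrite lerD2r.
  by rewrite -lerBlDl; exact: le_trans h2 h.
exists Mt, P, c, s; split=> //.
- split.
    apply/measurable_fun_pairP; split.
      by apply: measurable_extend; apply: measurable_funM => //; exact: mX.
    apply/measurable_fun_pairP; split; apply: measurable_extend.
      exact: (measurableT_comp (@measurable_wrap R) (mX i1)).
    exact: (measurableT_comp (@measurable_wrap R) (mX i2)).
  apply/seteqP; split=> r /=; rewrite in_itv/=.
    rewrite /P; case: ifP => // _ [/=]; rewrite in_itv/=; lra.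
  move=> rM; rewrite /P rM; have x0 := X01 r rM i0; have x1 := X01 r rM i1; have x2 := X01 r rM i2.
  split; last by split; rewrite /= in_itv/=; exact: wrap_itv.
  rewrite /= in_itv/=; have := X0 r rM; case/andP: x0 => x0 _ h.
  rewrite mulr_ge0 ?(ltW t2)//=; have := ler_wpM2l (ltW t2) h.
  by rewrite [X in _ <= X](_ : _ = tau)//; field.
- by split; apply: measurable_funD => //; apply: measurable_funM => //; exact: mX.
(* The disc constraint is closed and holds for actual directions; the number 30 is the constant of
   [direction_close]. *)
- move=> r rM; apply/ler_addgt0Pr => e e0; pose d := Num.min 1 (e / 30).
  have d0 : 0 < d by rewrite lt_min ltr01 divr_gt0.
  have d1 : d <= 1 by rewrite ge_min lexx.
  have de : 30 * d <= e by rewrite mulrC -ler_pdivlMr// ge_min lexx orbT.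
  have [n [p [cp H]]] := Xclose r d rM d0.
  have := H i3; have := H i4; rewrite /coord/= -/(c r) -/(s r).
  have := direction_le1 (v n p); move: (cosdir _) (sindir _) => c0 s0 cs.
  rewrite /c /s; move: (X r i3) (X r i4) => x y h4 h3.
  have aff (x' y' : R) : `|x' - (y' + 1) / 3| <= d -> `|3 * x' + -1 - y'| <= 3 * d.
    have -> : 3 * x' + -1 - y' = 3 * (x' - (y' + 1) / 3) by field.
    by rewrite normrM gtr0_norm// ler_pM2l.
  apply: le_trans (direction_close cs _ (aff _ _ h3) (aff _ _ h4)) _; first by rewrite ltW.
  by rewrite lerD2l.
(* The test function read in the rescaled coordinates. Unlike its composition with [P], which
   involves [wrap], it is continuous on the closed box; periodicity makes the two agree. *)
- move=> g cg pg; pose gk (k : 'I_5 -> R) := g (2 * tau * k i0, (k i1, k i2)).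
  have [B B0 HB] : exists2 B, 0 < B & forall k, (forall i, 0 <= k i <= 1) -> `|gk k| <= B.
    have [B B0 HB] := compact_cont_bounded (@compact_slab R 0 (2 * tau)) (fun x _ => cg x).
    exists B => // k k01; apply: HB; have h0 := k01 i0; have h1 := k01 i1; have h2 := k01 i2.
    split; last by split; rewrite /= in_itv.
    by case/andP: h0 => p q; rewrite /= in_itv/= mulr_ge0 ?(ltW t2)//= ger_pMr.
  have lim (h : ('I_5 -> R) -> R) (H : nat -> R * (R * R) -> R) : ucont_box h ->
      (forall k, (forall i, 0 <= k i <= 1) -> `|h k| <= 2) ->
      (forall n p, cyl p -> h (coord n p) * normsq (v n p) = H n p) ->
      \int[leb3]_(p in cyl) (g p * H n p) @[n --> U] -->
        \int[leb]_(r in ([set` `[0, Mt[] : set mR)) (g (P r) * h (X r)).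
    move=> uh hB hH.
    have uf : ucont_box (fun k => gk k * h k).
      apply: (@ucont_boxM _ _ _ _ (B + 2)) => //; first by rewrite addr_gt0.
      - exact: ucont_box_field.
      - by move=> k kk; apply: le_trans (HB k kk) _; lra.
      - by move=> k kk; apply: le_trans (hB k kk) _; lra.
    have [_ _ L] := Xlim _ uf.
    have E1 : (fun n => \int[leb3]_(p in cyl) (g p * H n p)) =
        (fun n => \int[leb3]_(p in cyl) (gk (coord n p) * h (coord n p) * normsq (v n p))).
      apply/funext => n; apply: eq_Rint => p cp; rewrite -(hH n p cp) mulrA; congr (_ * _ * _).
      rewrite /gk /coord/=; congr g; case: p {cp} => [t [x y]] /=; congr (_, _).
      by rewrite mulrC divfK// gt_eqF.
    have E2 : \int[leb]_(r in ([set` `[0, Mt[] : set mR)) (g (P r) * h (X r)) =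
        \int[leb]_(r in ([set` `[0, Mt[] : set mR)) (gk (X r) * h (X r)); last by rewrite E1 E2.
    apply: eq_Rint => r; rewrite /= in_itv/= => rM; congr (_ * _).
    rewrite /P rM /gk; exact: (Z2periodic_wrap (pg _) (X01 r rM i1) (X01 r rM i2)).
  split.
  + have := lim (fun=> 1) (fun n p => normsq (v n p)) (@ucont_box_cst _ _ 1).
    have -> : \int[leb]_(r in ([set` `[0, Mt[] : set mR)) (g (P r) * 1) =
        \int[leb]_(r in ([set` `[0, Mt[] : set mR)) g (P r) by apply: eq_Rint => r _; rewrite mulr1.
    by apply=> [k _|n p _]; rewrite ?mul1r// normr1; lra.
  + apply: (lim (fun k => 3 * k i3 + -1) (fun n p => ((v n p).1 * (v n p).1 - (v n p).2 * (v n p).2))); first exact: ucont_box_affine.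
      by move=> k /(_ i3) /andP[k0 k1]; rewrite ler_norml; apply/andP; split; lra.
    by move=> n p _; rewrite /coord/= -cosdirE; congr (_ * _); field.
  + apply: (lim (fun k => 3 * k i4 + -1) (fun n p => (2 * ((v n p).1 * (v n p).2)))); first exact: ucont_box_affine.
      by move=> k /(_ i4) /andP[k0 k1]; rewrite ler_norml; apply/andP; split; lra.
    by move=> n p _; rewrite /coord/= -sindirE; congr (_ * _); field.
Qed.

(** The measure [kappa] is the image of the Lebesgue measure of the interval under [P], and [a], [b]
    are the conditional expectations of [c] and [s] given [P]; thus every limit becomes an integral
    over the cylinder. *)
Lemma defect_measure : exists (kappa : {finite_measure set (mR * (mR * mR))%type -> \bar R}) (a b : R * (R * R) -> R),
  [/\ kappa (~` cyl) = 0%E,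
      measurable_fun setT (a : mR * (mR * mR) -> R) /\ measurable_fun setT (b : mR * (mR * mR) -> R),
      forall p, a p ^+ 2 + b p ^+ 2 <= 1
    & forall g : R * (R * R) -> R, continuous g -> (forall t, Z2periodic (fun x => g (t, x))) ->
      [/\ \int[leb3]_(p in cyl) (g p * normsq (v n p)) @[n --> U] --> \int[kappa]_(p in cyl) g p,
          \int[leb3]_(p in cyl) (g p * ((v n p).1 * (v n p).1 - (v n p).2 * (v n p).2)) @[n --> U] -->
            \int[kappa]_(p in cyl) (g p * a p)
        & \int[leb3]_(p in cyl) (g p * (2 * ((v n p).1 * (v n p).2))) @[n --> U] -->
            \int[kappa]_(p in cyl) (g p * b p)]].
Proof.
have [Mt [P [c [s [Mt0 [mP PC] [mc ms] cs lim]]]]] := defect_parametrization.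
have mI : measurable ([set` `[0, Mt[] : set mR) by exact: measurable_itv.
have fI : (leb ([set` `[0%R, Mt[] : set mR) < +oo)%E.
  by rewrite lebesgue_measure_itv/=; case: ifP => _; rewrite ?oppr0 ?addr0 ?ltry.
have [|kappa [kC kE]] := @restricted_image_exists _ _ mR (mR * (mR * mR))%type R leb P cyl mC mP; first by rewrite PC.
have bnd r : ([set` `[0, Mt[] : set mR) r -> `|c r| <= 1 /\ `|s r| <= 1.
  rewrite /= in_itv/= => rM; have [h1 h2] := direction_bound (cs r rM).
  by rewrite !ler_norml.
have lc : L2 leb ([set` `[0, Mt[] : set mR) c.
  by apply: (L2_bounded mI fI mc (B := 1)) => r /bnd[].
have ls : L2 leb ([set` `[0, Mt[] : set mR) s.
  by apply: (L2_bounded mI fI ms (B := 1)) => r /bnd[].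
rewrite -PC in lc ls.
have [|a [b [ma mb ab H]]] := disc_conditional_expectation mC mP kE lc ls.
  by move=> r; rewrite PC /= in_itv; exact: cs.
exists kappa, a, b; split=> // g cg pg; have [l1 l2 l3] := lim g cg pg.
have mg : measurable_fun setT (g : mR * (mR * mR) -> R) by exact: measurable_continuous3.
have fk : (kappa cyl < +oo)%E by rewrite ltey_eq fin_num_measure.
have lg : L2 kappa cyl g.
  have [B B0 HB] := slab_bounded 0 tau cg.
  apply: (L2_bounded mC fk (measurable_funTS mg) (B := B)).
  by move=> [t x] [/= tt cx]; apply: HB => //; rewrite in_itv in tt.
have [<- <-] := H g lg; rewrite PC; split=> //.
by rewrite (Rint_image kE) ?PC//; exact: measurable_funTS.
Qed.

End defect_parametrization.

Lemma ae_imply d (T : measurableType d) (R : realType) (mu : {measure set T -> \bar R}) (P Q : T -> Prop) :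
  (forall x, P x -> Q x) -> {ae mu, forall x, P x} -> {ae mu, forall x, Q x}.
Proof. by move=> PQ aP; apply: filterS aP. Qed.

(** * Young measures with a prescribed matrix of second moments *)

Section mixture.
Context d (T : measurableType d) (R : realType).
Variables (w : R) (z1 z2 : T).

(** The weight is clamped to [0, 1] so that the mixture is a probability measure for every real
    parameter; when [w] lies in [0, 1] nothing changes. *)
Let w1 : R := Num.max 0 (Num.min w 1).
Let w2 : R := 1 - w1.

Let w1_ge0 : 0 <= w1. Proof. by rewrite le_max lexx. Qed.
Let w2_ge0 : 0 <= w2.
Proof. by rewrite subr_ge0 ge_max ler01 ge_min lexx orbT. Qed.

Let m1 : {measure set T -> \bar R} := mscale (NngNum w1_ge0) (\d_z1 : {measure set T -> \bar R}).
Let m2 : {measure set T -> \bar R} := mscale (NngNum w2_ge0) (\d_z2 : {measure set T -> \bar R}).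
Let m12 : {measure set T -> \bar R} := measure_add m1 m2.

Definition mixture : set T -> \bar R := m12.

Let mixture0 : mixture set0 = 0%E. Proof. exact: (measure0 m12). Qed.
Let mixture_ge0 A : (0 <= mixture A)%E. Proof. exact: (measure_ge0 m12). Qed.
Let mixture_sigma_additive : semi_sigma_additive mixture.
Proof. exact: (@measure_semi_sigma_additive _ _ _ m12). Qed.

HB.instance Definition _ := isMeasure.Build _ _ _ mixture mixture0 mixture_ge0 mixture_sigma_additive.

Let mixtureE0 A : mixture A = (w1%:E * \d_z1 A + w2%:E * \d_z2 A)%E.
Proof. exact: (measure_addE m1 m2 A). Qed.

Let mixture_setT : mixture setT = 1%E.
Proof. by rewrite mixtureE0 !diracT !mule1 -EFinD /w2 addrC subrK. Qed.

HB.instance Definition _ := Measure_isProbability.Build _ _ _ mixture mixture_setT.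

Lemma mixture_mass A : A z1 -> A z2 -> mixture A = 1%E.
Proof.
by move=> A1 A2; rewrite mixtureE0 !diracE !mem_set// !mule1 -EFinD /w2 addrC subrK.
Qed.

Hypothesis w01 : 0 <= w <= 1.

Let w1E : w1 = w.
Proof. by case/andP: w01 => w0 wl; rewrite /w1 min_l// max_r. Qed.

Lemma ge0_integral_mixture (g : T -> \bar R) : measurable_fun setT g -> (forall x, 0 <= g x)%E ->
  (\int[mixture]_x g x = w%:E * g z1 + (1 - w)%:E * g z2)%E.
Proof.
move=> mg g0; rewrite (_ : (\int[mixture]_x g x = \int[m12]_x g x)%E)//.
rewrite ge0_integral_measure_add// !ge0_integral_mscale// !integral_dirac//.
by rewrite !diracT !mul1e /= /w2 w1E.
Qed.

Lemma Rint_mixture (f : T -> R) : measurable_fun setT f ->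
  \int[mixture]_x f x = w * f z1 + (1 - w) * f z2.
Proof.
move=> mf; have mF : measurable_fun setT (EFin \o f) by exact/measurable_EFinP.
rewrite /Rintegral integralE !ge0_integral_mixture//; [|exact/measurable_funeneg|exact/measurable_funepos].
have pos z : ((EFin \o f)^\+ z)%E = (Num.max (f z) 0)%:E by rewrite funeposE EFin_max.
have neg z : ((EFin \o f)^\- z)%E = (Num.max (- f z) 0)%:E by rewrite funenegE EFin_max.
rewrite !pos !neg -!EFinM -!EFinD/=.
have e (x : R) : Num.max x 0 - Num.max (- x) 0 = x.
  by case: (leP x 0) => h; case: (leP (- x) 0) => h'; lra.
rewrite -{3}(e (f z1)) -{3}(e (f z2)); ring.
Qed.

End mixture.

Section angle.
Context {R : realType}.

(** Half-angle formulas: [cos_angle a] and [sin_angle a] are the cosine and sine of the angle in the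
    first quadrant whose double has cosine [a]. That angle and its opposite have double-angle sines
    plus and minus the root of 1 - a^2, and [angle_weight] is the weight that gives them the mean
    [b]. *)
Definition cos_angle (a : R) : R := Num.sqrt ((1 + a) / 2).
Definition sin_angle (a : R) : R := Num.sqrt ((1 - a) / 2).
Definition angle_weight (a b : R) : R := (1 + b / Num.sqrt (1 - a ^+ 2)) / 2.

Variables a b : R.
Hypothesis ab : a ^+ 2 + b ^+ 2 <= 1.

Let bnd := direction_bound ab.

Let cc : cos_angle a * cos_angle a = (1 + a) / 2.
Proof. by rewrite -expr2 sqr_sqrtr// divr_ge0//; have [/andP[]] := bnd; lra. Qed.

Let ss : sin_angle a * sin_angle a = (1 - a) / 2.
Proof. by rewrite -expr2 sqr_sqrtr// divr_ge0//; have [/andP[]] := bnd; lra. Qed.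

Let cs : cos_angle a * sin_angle a = Num.sqrt (1 - a ^+ 2) / 2.
Proof.
have h : 0 <= (1 + a) / 2 by rewrite divr_ge0//; have [/andP[]] := bnd; lra.
rewrite -sqrtrM//; have -> : (1 + a) / 2 * ((1 - a) / 2) = (1 - a ^+ 2) * (2^-1 ^+ 2) by field.
have h1 : 0 <= 1 - a ^+ 2 by rewrite subr_ge0; apply: le_trans ab; rewrite lerDl sqr_ge0.
by rewrite sqrtrM// sqrtr_sqr gtr0_norm.
Qed.

Let b_le : `|b| <= Num.sqrt (1 - a ^+ 2).
Proof. by rewrite -sqrtr_sqr ler_wsqrtr// lerBrDl. Qed.

Lemma angle_weight01 : 0 <= angle_weight a b <= 1.
Proof.
have s0 := sqrtr_ge0 (1 - a ^+ 2).
have : `|b / Num.sqrt (1 - a ^+ 2)| <= 1.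
  have [->|s1] := eqVneq (Num.sqrt (1 - a ^+ 2)) 0; first by rewrite invr0 mulr0 normr0 ler01.
  by rewrite normrM normfV (ger0_norm s0) ler_pdivrMr ?mul1r// lt_neqAle eq_sym s1.
by rewrite /angle_weight ler_norml => /andP[h1 h2]; apply/andP; split; lra.
Qed.

Lemma angle_cross : (2 * angle_weight a b - 1) * (cos_angle a * sin_angle a) = b / 2.
Proof.
(* When the root vanishes the weight is 1/2 by the convention on division, and [b] is 0 because it
   is bounded by the root. *)
rewrite cs /angle_weight; have [e|s1] := eqVneq (Num.sqrt (1 - a ^+ 2)) 0.
  have := b_le; rewrite e normr_le0 => /eqP ->; ring.
by field.
Qed.

Lemma angle_circle : circle (cos_angle a, sin_angle a) /\ circle (cos_angle a, - sin_angle a).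
Proof.
by rewrite /circle/= /normsq /dot/= mulrNN cc ss; split; field.
Qed.

Local Notation angle := (mixture (angle_weight a b) (cos_angle a, sin_angle a) (cos_angle a, - sin_angle a)).

Lemma angle_second_moment : second_moment angle = (((1 + a) / 2, b / 2), (b / 2, (1 - a) / 2)).
Proof.
have w01 := angle_weight01.
have m1 : measurable_fun setT (fun z : R * R => z.1) by exact: measurable_fst.
have m2 : measurable_fun setT (fun z : R * R => z.2) by exact: measurable_snd.
rewrite /second_moment !Rint_mixture//; do ?exact: measurable_funM.
rewrite /= -angle_cross -cc -ss; congr ((_, _), (_, _)); ring.
Qed.

End angle.

Section young_measure_of_vectors.
Context {R : realType}.
Local Notation mR := (measurableTypeR R).
Local Notation leb := (@lebesgue_measure R).
Local Notation leb3 := (@leb3 R).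
Variable tau : R.
Local Notation cyl := (cylinder tau).

Let mC := @measurable_cylinder R tau.

Lemma mixture_weakstar (w f1 f2 g1 g2 : mR * (mR * mR) -> R) :
  (forall p, cyl p -> 0 <= w p <= 1) -> measurable_fun cyl w ->
  measurable_fun cyl f1 -> measurable_fun cyl f2 -> measurable_fun cyl g1 -> measurable_fun cyl g2 ->
  weakstar_measurable tau (fun p => mixture (w p) (f1 p, f2 p) (g1 p, g2 p)).
Proof.
move=> w01 mw mf1 mf2 mg1 mg2 f [cf _].
have mf : measurable_fun setT f by exact: measurable_continuous2.
have E : {in cyl, (fun p => w p * f (f1 p, f2 p) + (1 - w p) * f (g1 p, g2 p)) =1
    (fun p => \int[mixture (w p) (f1 p, f2 p) (g1 p, g2 p)]_z f z)}.
  by move=> p /set_mem cp; rewrite Rint_mixture// w01.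
apply: eq_measurable_fun E _.
apply: measurable_funD; apply: measurable_funM => //.
- exact: (measurableT_comp (measurable_continuous2 cf) (measurable_fun_pair_in mC mf1 mf2)).
- exact: measurable_funB.
- exact: (measurableT_comp (measurable_continuous2 cf) (measurable_fun_pair_in mC mg1 mg2)).
Qed.

(** The Dirac mass at [z] is written as a degenerate mixture, so that the oscillation part and the
    angle part are covered by the same integration formulas. *)
Lemma point_barycenter (z : R * R) : barycenter (mixture 1 z z) = z.
Proof.
have w01 : 0 <= (1 : R) <= 1 by rewrite ler01 /=.
have m1 : measurable_fun setT (fun z : R * R => z.1) by exact: measurable_fst.
have m2 : measurable_fun setT (fun z : R * R => z.2) by exact: measurable_snd.
by rewrite /barycenter !Rint_mixture// subrr !mul0r !addr0 !mul1r -surjective_pairing.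
Qed.

Lemma point_second_moment (z : R * R) : second_moment (mixture 1 z z) = tens z z.
Proof.
have w01 : 0 <= (1 : R) <= 1 by rewrite ler01 /=.
have m1 : measurable_fun setT (fun z : R * R => z.1) by exact: measurable_fst.
have m2 : measurable_fun setT (fun z : R * R => z.2) by exact: measurable_snd.
rewrite /second_moment !Rint_mixture//; do ?exact: measurable_funM.
by rewrite subrr !mul0r !addr0 !mul1r.
Qed.

Let measurable_normsq : measurable_fun setT (@normsq R).
Proof.
have m1 : measurable_fun setT (fun z : R * R => z.1) by exact: measurable_fst.
have m2 : measurable_fun setT (fun z : R * R => z.2) by exact: measurable_snd.
by apply: measurable_funD; apply: measurable_funM.
Qed.

Lemma point_normsq (z : R * R) : \int[mixture 1 z z]_y normsq y = normsq z.
Proof. by rewrite Rint_mixture ?ler01 ?lexx// subrr mul0r addr0 mul1r. Qed.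

(** The matrix is the second moment, on the unit circle, of a law whose double angle has mean cosine
    [a p] and mean sine [b p]. *)
Definition defect_density (phi : R -> R * R -> R * R) (a b : R * (R * R) -> R) p : R :=
  ddot (nabla (phi p.1) p.2) (((1 + a p) / 2, b p / 2), (b p / 2, (1 - a p) / 2)).

Variables (W : R * (R * R) -> R * R) (kappa : {finite_measure set (mR * (mR * mR))%type -> \bar R}).
Variables (a b : R * (R * R) -> R).
Hypothesis LW : L2pair leb3 cyl W.
Hypothesis kappaC : kappa (~` cyl) = 0%E.
Hypotheses (ma : measurable_fun setT (a : mR * (mR * mR) -> R)) (mb : measurable_fun setT (b : mR * (mR * mR) -> R)).
Hypothesis ab : forall p, a p ^+ 2 + b p ^+ 2 <= 1.

Let osc_ (p : mR * (mR * mR)) : probability (R * R)%type R := mixture 1 (W p) (W p).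
Let angle_ (p : mR * (mR * mR)) : probability (R * R)%type R :=
  mixture (angle_weight (a p) (b p)) (cos_angle (a p), sin_angle (a p)) (cos_angle (a p), - sin_angle (a p)).

Let osc_weakstar : weakstar_measurable tau osc_.
Proof.
have [[m1 _] [m2 _]] := LW.
have -> : osc_ = (fun p => mixture 1 ((W p).1, (W p).2) ((W p).1, (W p).2) : probability (R * R)%type R).
  by apply/funext => p; rewrite -surjective_pairing.
by apply: mixture_weakstar => // p _; apply/andP; split; [exact: ler01|exact: lexx].
Qed.

Let osc_finite : (\int[leb3]_(p in cyl) \int[osc_ p]_z (normsq z)%:E < +oo)%E.
Proof.
have rn : rint leb3 cyl (fun p => normsq (W p)) by apply: rint_dot.
have n0 z : 0 <= normsq z :> R by rewrite /normsq /dot addr_ge0// -expr2 sqr_ge0.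
have /integrableP[_] := rn; apply: le_lt_trans; rewrite le_eqVlt; apply/orP; left; apply/eqP.
apply: eq_integral => p _; rewrite ge0_integral_mixture ?ler01 ?lexx//.
- by rewrite subrr mul0e adde0 mul1e /= ger0_norm.
- exact/measurable_EFinP.
Qed.

Let angle_weakstar : weakstar_measurable tau angle_.
Proof.
have msq : measurable_fun setT (@Num.sqrt R) by apply: continuous_measurable_fun; exact: sqrt_continuous.
have mA : measurable_fun cyl (a : mR * (mR * mR) -> R) := measurable_funTS ma.
have mB : measurable_fun cyl (b : mR * (mR * mR) -> R) := measurable_funTS mb.
have mc : measurable_fun cyl (fun p : mR * (mR * mR) => cos_angle (a p)).
  by apply: (measurableT_comp msq); apply: measurable_funM => //; exact: measurable_funD.
have ms : measurable_fun cyl (fun p : mR * (mR * mR) => sin_angle (a p)).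
  by apply: (measurableT_comp msq); apply: measurable_funM => //; exact: measurable_funB.
apply: mixture_weakstar => //.
- by move=> p _; exact: angle_weight01.
- apply: measurable_funM => //; apply: measurable_funD => //; apply: measurable_funM => //.
  apply: (measurable_inv_ge0 mC) => [|p _]; last exact: sqrtr_ge0.
  by apply: (measurableT_comp msq); apply: measurable_funB => //; exact: measurable_funX.
- exact: measurableT_comp.
Qed.

Let angle_circle_ p : cyl p -> angle_ p circle = 1%E.
Proof. by move=> _; have [h1 h2] := angle_circle (ab p); exact: mixture_mass. Qed.

(** Reduces admissibility to statements about [W], [kappa], [a] and [b], all the moments of the two
    families of probabilities having been computed. It serves both for the Galerkin limit and for
    the Euler solution. *)
Lemma admissible_builder (u0 : L2sigma R) (w : R -> L2sigma R) : weakly_continuous tau w ->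
  {ae leb, forall t, t \in `[0, tau] -> ae_cell (fun x => W (t, x) = w t x)} ->
  (forall phi, test_field tau phi ->
    \int[leb3]_(p in cyl) weak_density phi W p + \int[kappa]_(p in cyl) defect_density phi a b p =
    - vip (phi 0) u0) ->
  (forall (phi : R * R -> R) (chi : R -> R), Z2periodic phi -> continuous phi ->
    {within `[0, tau], continuous chi} ->
    \int[leb3]_(p in cyl) (phi p.2 * chi p.1 * normsq (W p)) + \int[kappa]_(p in cyl) (phi p.2 * chi p.1) <=
    Linfty_norm phi * (\int[leb]_(t in `[0, tau]) `|chi t|) * L2norm u0 ^+ 2) ->
  exists N : young_measure tau, admissible u0 N /\ forall p, barycenter (osc N p) = W p.
Proof.
move=> cw Ww wk en.
exists (YoungMeasure osc_weakstar osc_finite kappaC angle_weakstar angle_circle_); split; last first.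
  by move=> p; rewrite /= point_barycenter.
split=> /=.
- exists w => //; apply: ae_imply Ww => t H tt; have := H tt.
  by apply: ae_imply => x h cx; rewrite point_barycenter; exact: h.
- move=> phi tphi; rewrite -/(vip _ _) -(wk phi tphi); congr (_ + _).
    by apply: eq_Rint => p _; rewrite point_barycenter point_second_moment.
  by apply: eq_Rint => p _; rewrite angle_second_moment.
- move=> phi chi pphi cphi cchi; apply: le_trans (en phi chi pphi cphi cchi).
  rewrite lerD2r le_eqVlt; apply/orP; left; apply/eqP.
  by apply: eq_Rint => p _; rewrite point_normsq.
Qed.

End young_measure_of_vectors.

(* No measurability is needed: the integral of a nonnegative function is a supremum over the simple
   functions below it, and these can be cut off on a null set. *)
Section almost_everywhere_equality.
Context d (T : measurableType d) (R : realType) (mu : {measure set T -> \bar R}).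

Import HBNNSimple.

Let le_integral_off_null (f g : T -> \bar R) (N : set T) : measurable N -> mu N = 0%E ->
  (forall x, 0 <= f x)%E -> (forall x, 0 <= g x)%E -> (forall x, ~ N x -> f x = g x) ->
  (\int[mu]_x f x <= \int[mu]_x g x)%E.
Proof.
move=> mN N0 f0 g0 fg; have mNC := measurableC mN.
rewrite !ge0_integralTE//; apply: ge_ereal_sup => _ [h hf <-].
pose h' := proj_nnsfun h mNC.
have h'E x : h' x = h x * \1_(~` N) x by [].
have -> : sintegral mu h = sintegral mu h'.
  have S (k : {nnsfun T >-> R}) : sintegral mu k = (\int[mu]_x (k x)%:E)%E.
    by rewrite integral_nnsfun// patch_setT.
  rewrite !S; apply: ae_eq_integral => //.
  - exact/measurable_EFinP.
  - exact/measurable_EFinP.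
  - exists N; split=> // x /= /not_implyP[_ H]; apply: contrapT => Nx; apply: H.
    by rewrite -[RHS]/((h' x)%:E) h'E indicE mem_set// mulr1.
apply: ereal_sup_ubound; exists h' => // x; rewrite h'E indicE.
have [Nx|Nx] := pselect (N x); first by rewrite memNset ?mulr0//; exact.
by rewrite mem_set// mulr1 -fg//; exact: hf.
Qed.

Lemma Rint_ae_eq (D : set T) (f g : T -> R) : {ae mu, forall x, D x -> f x = g x} ->
  \int[mu]_(x in D) f x = \int[mu]_(x in D) g x.
Proof.
move=> [N [mN N0 H]]; rewrite /Rintegral; congr fine.
have E x : D x -> ~ N x -> f x = g x by move=> Dx nN; apply: contrapT => h; apply: nN; apply: H => /= k; exact: h (k Dx).
have pos (F G : T -> \bar R) : (forall x, 0 <= F x)%E -> (forall x, 0 <= G x)%E ->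
    (forall x, D x -> ~ N x -> F x = G x) -> (\int[mu]_(x in D) F x = \int[mu]_(x in D) G x)%E.
  move=> F0 G0 FG; rewrite integral_mkcond [RHS]integral_mkcond.
  have P0 (F' : T -> \bar R) : (forall x, 0 <= F' x)%E -> forall x, (0 <= (F' \_ D) x)%E.
    by move=> F'0 x; rewrite /patch; case: ifP.
  have PE x : ~ N x -> (F \_ D) x = (G \_ D) x.
    by move=> nN; rewrite /patch; case: ifP => // /set_mem Dx; exact: FG.
  apply/eqP; rewrite eq_le; apply/andP; split; apply: (le_integral_off_null mN N0); do ?exact: P0.
    by [].
  by move=> x /PE.
rewrite integralE [RHS]integralE; congr (_ - _)%E; apply: pos => // x Dx nN.
- by rewrite !funeposE /= E.
- by rewrite !funenegE /= E.
Qed.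

End almost_everywhere_equality.

Section almost_everywhere.
Context d (T : measurableType d) (R : realType).
Variables (mu : {measure set T -> \bar R}) (D : set T).
Hypothesis mD : measurable D.

Lemma le_Rint_ae (f g : T -> R) : rint mu D f -> rint mu D g ->
  {ae mu, forall x, D x -> f x <= g x} -> \int[mu]_(x in D) f x <= \int[mu]_(x in D) g x.
Proof.
move=> rf rg H; have mf := rint_measurable rf; have mg := rint_measurable rg.
have mm : measurable_fun D (fun x => Num.min (f x) (g x)) by exact: measurable_minr.
rewrite (@Rint_ae_eq _ _ _ mu _ f (fun x => Num.min (f x) (g x))); last by apply: ae_imply H => x h Dx; rewrite min_l// h.
apply: le_Rintegral => //; last by move=> x _; rewrite ge_min lexx orbT.
apply: (rint_le mD mm (rintD mD (integrable_norm rf) (integrable_norm rg))) => x _ /=.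
by rewrite /Num.min; case: ifP => _; rewrite ?lerDl ?lerDr normr_ge0.
Qed.

End almost_everywhere.

(** * The energy inequality with continuous weights *)

Section energy_inequality.
Context {R : realType}.
Local Notation mR := (measurableTypeR R).
Local Notation leb := (@lebesgue_measure R).
Local Notation cell := (@cell R).
Local Notation leb2 := (@leb2 R).
Local Notation leb3 := (@leb3 R).

Let mc := @measurable_cell R.

(** A continuous function is bounded on the cell, so its essential supremum there is finite and
    taking its real value loses nothing. *)
Lemma Linfty_norm_ae (phi : R * R -> R) : continuous phi ->
  0 <= Linfty_norm phi /\ {ae leb2, forall x, cell x -> `|phi x| <= Linfty_norm phi}.
Proof.
move=> cphi; have [B B0 HB] := continuous_bounded_cell cphi.
rewrite /Linfty_norm; set mu := mrestr leb2 mc; set L := ('N[mu]_+oo [_])%E.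
have muT : (0 < mu setT)%E by rewrite /mu /mrestr setTI leb2_cell lte01.
have LE : L = ess_sup_inf.ess_sup mu (abse \o (EFin \o phi)) by rewrite /L unlock muT.
have L0 : (0 <= L)%E by exact: Lnorm_ge0.
have LB : (L <= B%:E)%E.
  rewrite LE; apply/ess_sup_inf.ess_supP; exists (~` cell); split.
  - exact: measurableC.
  - by rewrite -[LHS]/(leb2 (~` cell `&` cell)) setICl measure0.
  - move=> x /= h cx; apply: h; rewrite lee_fin; have [k1 k2] := cell_norm cx; exact: HB.
have Lf : L \is a fin_num by rewrite ge0_fin_numE//; apply: le_lt_trans LB _; rewrite ltry.
split; first exact: fine_ge0.
have [N [mN N0 HN]] := ess_sup_inf.ess_sup_ge mu (abse \o (EFin \o phi)).
exists (N `&` cell); split=> //; first exact: measurableI.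
move=> x /= /not_implyP[cx h]; split=> //; apply: HN => /= h2; apply: h.
by rewrite -lee_fin fineK// LE.
Qed.

Variable tau : R.
Hypothesis tau0 : 0 < tau.
Local Notation cyl := (cylinder tau).

Let mC := @measurable_cylinder R tau.
Let mI : measurable ([set` `[0, tau]] : set mR) := measurable_itv _.

Let half_dist (x y d : R) : `|d| <= `|x - y| -> `|(x - y + d) / 2| <= `|x - y|.
Proof.
move=> h; rewrite normrM [`|2^-1|]gtr0_norm// ler_pdivrMr//.
by apply: le_trans (ler_normD _ _) _; rewrite mulr_natr mulr2n lerD2l.
Qed.

Let dist_dist (a x y : R) : `| `|a - x| - `|a - y| | <= `|x - y|.
Proof. by apply: le_trans (ler_dist_dist _ _) _; rewrite opprB addrC addrA subrK -normrN opprB. Qed.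

Lemma max_dist (a x y : R) : `|Num.max a x - Num.max a y| <= `|x - y|.
Proof.
rewrite !maxr_absE -mulrBl (_ : a + x + _ - _ = x - y + (`|a - x| - `|a - y|)); last by ring.
by apply: half_dist => //; exact: dist_dist.
Qed.

Lemma min_dist (a x y : R) : `|Num.min a x - Num.min a y| <= `|x - y|.
Proof.
rewrite !minr_absE -mulrBl (_ : a + x - _ - _ = x - y + - (`|a - x| - `|a - y|)); last by ring.
by apply: half_dist => //; rewrite normrN; exact: dist_dist.
Qed.

(** The weight is continuous only relatively to the interval, whereas the limit theorems take
    functions continuous in all of space-time; composing with the retraction of the line onto the
    interval bridges the gap. *)
Lemma continuous_extension (chi : R -> R) : {within `[0, tau], continuous chi} ->
  exists2 chi' : R -> R, continuous chi' & forall t, 0 <= t <= tau -> chi' t = chi t.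
Proof.
move=> cchi; pose c (t : R) := Num.max 0 (Num.min tau t).
have cI (t : R) : 0 <= c t <= tau.
  by rewrite /c le_max lexx/= ge_max (ltW tau0)/= ge_min lexx.
have cid (t : R) : 0 <= t <= tau -> c t = t.
  by move=> /andP[t0 t1]; rewrite /c min_r// max_r.
have cL (s t : R) : `|c s - c t| <= `|s - t|.
  by apply: le_trans (max_dist _ _ _) _; exact: min_dist.
exists (chi \o c) => [t|t tt]; last by rewrite /= cid.
have ct : [set` `[0, tau]] (c t) by rewrite /= in_itv/=.
apply/cvgrPdist_lt => e e0.
have /subspace_continuousP/(_ _ ct)/cvgrPdist_lt/(_ _ e0)[r /= r0 H] := cchi.
exists r => //= s ts; apply: H; first by apply: le_lt_trans ts; exact: cL.
by rewrite /= in_itv/=.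
Qed.

Lemma continuous_weight (phi : R * R -> R) (chi : R -> R) : continuous phi -> continuous chi ->
  continuous (fun p : R * (R * R) => phi p.2 * chi p.1).
Proof.
move=> cphi cchi p; apply: cvgM.
  by apply: (continuous_comp (f := snd)); [exact: cvg_snd|exact: cphi].
by apply: (continuous_comp (f := fst)); [exact: cvg_fst|exact: cchi].
Qed.

(** The weight is bounded by [Linfty_norm phi] times the absolute value of [chi] for almost every
    [x], and then the energy bound applies on almost every time slice. *)
Lemma energy_inequality (V : R * (R * R) -> R * R) (E : R) (phi : R * R -> R) (chi : R -> R) :
  L2pair leb3 cyl V ->
  {ae leb, forall t, 0 <= t <= tau -> \int[leb2]_(x in cell) normsq (V (t, x)) <= E} ->
  continuous phi -> continuous chi ->
  \int[leb3]_(p in cyl) (phi p.2 * chi p.1 * normsq (V p)) <=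
  Linfty_norm phi * (\int[leb]_(t in [set` `[0, tau]]) `|chi t|) * E.
Proof.
move=> LV VE cphi cchi; have [L0 Lae] := Linfty_norm_ae cphi.
have cw := continuous_weight cphi cchi; have [B B0 HB] := slab_bounded 0 tau cw.
have rn : rint leb3 cyl (fun p => normsq (V p)) by exact: rint_dot.
have rw : rint leb3 cyl (fun p => phi p.2 * chi p.1 * normsq (V p)).
  apply: (rint_bmul mC (measurable_funTS (measurable_continuous3 cw)) (B := B)) => //.
  by move=> [t x] [/= tt cx]; apply: (HB t x) => //; rewrite in_itv in tt.
have [sn _ _] := rint_Fubini mI mc rn.
have [sw rI ->] := rint_Fubini mI mc rw.
have rchi : rint leb [set` `[0, tau]] (fun t => `|chi t|).
  have ci : {within `[0, tau], continuous (fun t => `|chi t|)}.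
    by apply: continuous_subspaceT => t; apply: cvg_norm; exact: cchi.
  exact: within_rint ci.
have rE : rint leb [set` `[0, tau]] (fun t => Linfty_norm phi * E * `|chi t|) by exact: rintZ.
rewrite [leRHS](_ : _ = \int[leb]_(t in [set` `[0, tau]]) (Linfty_norm phi * E * `|chi t|)); last first.
  by rewrite RintegralZl//; ring.
apply: le_Rint_ae => //.
have H := ae_and (ae_and sn sw) VE; apply: ae_imply H => t [[h1 h2] h3] It.
have rs := h1 It; have rws := h2 It; have hE : \int[leb2]_(x in cell) normsq (V (t, x)) <= E.
  by apply: h3; move: It; rewrite /= in_itv.
apply: le_trans (_ : \int[leb2]_(x in cell) (Linfty_norm phi * `|chi t| * normsq (V (t, x))) <= _).
  apply: le_Rint_ae => //; first exact: rintZ.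
  apply: ae_imply Lae => x h cx; rewrite ler_wpM2r//; first exact: normsq_ge0.
  apply: le_trans (ler_norm _) _; rewrite normrM ler_wpM2r//; exact: h.
by rewrite RintegralZl// [leRHS]mulrAC ler_wpM2l// mulr_ge0.
Qed.

End energy_inequality.

Lemma derive_periodic (R : realType) (f : R * R -> R * R) (v : R * R) : Z2periodic f ->
  Z2periodic (fun x => 'D_v f x).
Proof.
move=> pf k x; rewrite /derive pf.
rewrite (_ : f \o shift (x.1 + k.1%:~R, x.2 + k.2%:~R) = f \o shift x)//; apply/funext => y /=.
by rewrite -(pf k (y + x)); congr f; rewrite [LHS]surjective_pairing/= !addrA.
Qed.

(** The expansion at [w + v]: the density at [w], a part linear in [v], and a part quadratic in [v]
    written through the three quantities whose limits define [kappa], [a] and [b]. *)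
Lemma weak_density_split (R : realType) (q w v : R * R) (A : (R * R) * (R * R)) :
  dot q (w + v) + ddot A (tens (w + v) (w + v)) =
  dot q w + ddot A (tens w w) +
  (v.1 * (q.1 + (2 * (A.1.1 * w.1) + (A.1.2 * w.2 + A.2.1 * w.2))) +
   v.2 * (q.2 + (2 * (A.2.2 * w.2) + (A.1.2 * w.1 + A.2.1 * w.1)))) +
  ((A.1.1 + A.2.2) / 2 * normsq v + (A.1.1 - A.2.2) / 2 * (v.1 * v.1 - v.2 * v.2) +
   (A.1.2 + A.2.1) / 2 * (2 * (v.1 * v.2))).
Proof.
case: q w v A => [q1 q2] [w1 w2] [v1 v2] [[a1 a2] [a3 a4]].
by rewrite /normsq /ddot /dot/=; field.
Qed.

Lemma normsqD (R : realType) (w v : R * R) :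
  normsq (w + v) = normsq w + (v.1 * (2 * w.1) + v.2 * (2 * w.2)) + normsq v.
Proof. by rewrite /normsq /dot/=; ring. Qed.

(** * The two measure-valued solutions *)

Section galerkin_young_measure.
Context {R : realType}.
Local Notation mR := (measurableTypeR R).
Local Notation leb := (@lebesgue_measure R).
Local Notation cell := (@cell R).
Local Notation leb2 := (@leb2 R).
Local Notation leb3 := (@leb3 R).
Context (U : set_system nat) {UU : UltraFilter U}.
Hypothesis UF : \oo `<=` U.
Variables (u0 : L2sigma R) (un0 : nat -> L2sigma R) (un : nat -> R -> L2sigma R).
Hypothesis gal : forall n, galerkin_solution n (un0 n) (un n).
Hypothesis un0_cvg : vip (fun x => un0 n x - u0 x) (fun x => un0 n x - u0 x) @[n --> U] --> (0 : R).
Variable tau : R.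
Hypothesis tau0 : 0 < tau.
Local Notation cyl := (cylinder tau).
Variable w : R -> L2sigma R.
Hypothesis w_lim : forall t, 0 <= t <= tau -> forall g, VL2 g -> vip (un n t) g @[n --> U] --> vip (w t) g.
Variable W : R * (R * R) -> R * R.
Hypothesis LW : L2pair leb3 cyl W.
Hypothesis W_lim : forall g, L2 leb3 cyl g ->
  (\int[leb3]_(p in cyl) ((un n p.1 p.2).1 * g p) @[n --> U] --> \int[leb3]_(p in cyl) ((W p).1 * g p)) /\
  (\int[leb3]_(p in cyl) ((un n p.1 p.2).2 * g p) @[n --> U] --> \int[leb3]_(p in cyl) ((W p).2 * g p)).
Hypothesis W_ae : {ae leb, forall t, 0 <= t <= tau -> ae_cell (fun x => W (t, x) = w t x)}.

Let mc := @measurable_cell R.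
Let mC := @measurable_cylinder R tau.
Let mI : measurable ([set` `[0, tau]] : set mR) := measurable_itv _.
Let Lun n : L2pair leb3 cyl (fun p => un n p.1 p.2) := galerkin_L2pair gal tau0 n.
Let v n p := un n p.1 p.2 - W p.
Let Lv n : L2pair leb3 cyl (v n). Proof. exact: L2pairB. Qed.

Let energy_section n (t : R) : 0 <= t <= tau -> \int[leb2]_(x in cell) normsq (un n t x) = vip (un0 n) (un0 n).
Proof. by move=> /andP[t0 _]; rewrite -(galerkin_energyE gal n t0). Qed.

Let un_energy n : \int[leb3]_(p in cyl) normsq (un n p.1 p.2) = vip (un0 n) (un0 n) * tau.
Proof.
have rn : rint leb3 cyl (fun p => normsq (un n p.1 p.2)) by exact: rint_dot (Lun n) (Lun n).
have [_ _ ->] := rint_Fubini mI mc rn.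
rewrite -(Rint_cst_itv tau0); apply: eq_Rint => t It.
by apply: energy_section; move: It; rewrite /= in_itv.
Qed.

(** From |u - W|^2 <= 2 |u|^2 + 2 |W|^2, with the conserved energies bounded along [U]. *)
Lemma defect_energy_bound : exists C, \forall n \near U, \int[leb3]_(p in cyl) normsq (v n p) <= C.
Proof.
exists (2 * ((vip u0 u0 + 1) * tau) + 2 * \int[leb3]_(p in cyl) normsq (W p)).
apply: filterS (energy_bound un0_cvg) => n En.
have rn : rint leb3 cyl (fun p => normsq (un n p.1 p.2)) by exact: rint_dot (Lun n) (Lun n).
have rW : rint leb3 cyl (fun p => normsq (W p)) by exact: rint_dot LW LW.
have rv : rint leb3 cyl (fun p => normsq (v n p)) by exact: rint_dot (Lv n) (Lv n).
apply: le_trans (_ : \int[leb3]_(p in cyl) (2 * normsq (un n p.1 p.2) + 2 * normsq (W p)) <= _).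
  apply: le_Rintegral => //; first by apply: rintD => //; exact: rintZ.
  move=> p _; rewrite /v /normsq /dot/=.
  move: (un n p.1 p.2) (W p) => [a b] [c e] /=.
  have := sqr_ge0 (a + c); have := sqr_ge0 (b + e); lra.
rewrite RintegralD//; [|exact: rintZ|exact: rintZ].
rewrite !RintegralZl// un_energy lerD2r ler_pM2l// ler_wpM2r//; exact: ltW.
Qed.

Let v_weak (g : R * (R * R) -> R) : L2 leb3 cyl g ->
  (\int[leb3]_(p in cyl) ((v n p).1 * g p) @[n --> U] --> (0 : R)) /\
  (\int[leb3]_(p in cyl) ((v n p).2 * g p) @[n --> U] --> (0 : R)).
Proof.
move=> lg; have [c1 c2] := W_lim lg.
have E1 : (fun n => \int[leb3]_(p in cyl) ((v n p).1 * g p)) =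
    (fun n => (\int[leb3]_(p in cyl) ((un n p.1 p.2).1 * g p)) - \int[leb3]_(p in cyl) ((W p).1 * g p)).
  apply/funext => n; rewrite -RintegralB//; [|exact: L2_prod (Lun n).1 lg|exact: L2_prod LW.1 lg].
  by apply: eq_Rint => p _; rewrite /v/= mulrBl.
have E2 : (fun n => \int[leb3]_(p in cyl) ((v n p).2 * g p)) =
    (fun n => (\int[leb3]_(p in cyl) ((un n p.1 p.2).2 * g p)) - \int[leb3]_(p in cyl) ((W p).2 * g p)).
  apply/funext => n; rewrite -RintegralB//; [|exact: L2_prod (Lun n).2 lg|exact: L2_prod LW.2 lg].
  by apply: eq_Rint => p _; rewrite /v/= mulrBl.
split.
  by rewrite E1 -(subrr (\int[leb3]_(p in cyl) ((W p).1 * g p))); apply: cvgB => //; exact: cvg_cst.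
by rewrite E2 -(subrr (\int[leb3]_(p in cyl) ((W p).2 * g p))); apply: cvgB => //; exact: cvg_cst.
Qed.

Let unE n p : un n p.1 p.2 = W p + v n p. Proof. by rewrite /v addrC subrK. Qed.

Let linear_limit (g1 g2 : R * (R * R) -> R) : L2 leb3 cyl g1 -> L2 leb3 cyl g2 ->
  \int[leb3]_(p in cyl) ((v n p).1 * g1 p + (v n p).2 * g2 p) @[n --> U] --> (0 : R).
Proof.
move=> l1 l2; have [c1 _] := v_weak l1; have [_ c2] := v_weak l2.
have E : (fun n => \int[leb3]_(p in cyl) ((v n p).1 * g1 p + (v n p).2 * g2 p)) =
    (fun n => (\int[leb3]_(p in cyl) ((v n p).1 * g1 p)) + \int[leb3]_(p in cyl) ((v n p).2 * g2 p)).
  by apply/funext => n; rewrite RintegralD//; [exact: L2_prod (Lv n).1 l1|exact: L2_prod (Lv n).2 l2].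
by rewrite E -[X in _ --> X](addr0 0); apply: cvgD.
Qed.

Let rint_quad n (g : R * (R * R) -> R) : continuous g ->
  [/\ rint leb3 cyl (fun p => g p * normsq (v n p)),
      rint leb3 cyl (fun p => g p * ((v n p).1 * (v n p).1 - (v n p).2 * (v n p).2))
    & rint leb3 cyl (fun p => g p * (2 * ((v n p).1 * (v n p).2)))].
Proof.
move=> cg; have [B B0 HB] := slab_bounded 0 tau cg.
have mg : measurable_fun cyl g by exact: measurable_funTS (measurable_continuous3 cg).
have bg p : cyl p -> `|g p| <= B.
  by case: p => t x [/= tt cx]; apply: HB => //; rewrite in_itv in tt.
have [l1 l2] := Lv n.
split; apply: (rint_bmul mC mg bg).
- exact: rint_dot (Lv n) (Lv n).
- by apply: rintB => //; exact: L2_prod.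
- by apply: rintZ => //; exact: L2_prod.
Qed.

Let linear_coefficient (q : R * (R * R) -> R * R) (A : R * (R * R) -> (R * R) * (R * R)) (B : R) :
  L2pair leb3 cyl q -> bounded_matrix cyl A B ->
  L2 leb3 cyl (fun p => (q p).1 + (2 * ((A p).1.1 * (W p).1) + ((A p).1.2 * (W p).2 + (A p).2.1 * (W p).2))) /\
  L2 leb3 cyl (fun p => (q p).2 + (2 * ((A p).2.2 * (W p).2) + ((A p).1.2 * (W p).1 + (A p).2.1 * (W p).1))).
Proof.
move=> [lq1 lq2] [mA1 mA2 mA3 mA4 HB]; have [W1 W2] := LW.
have lA (h : R * (R * R) -> R) (f : R * (R * R) -> R) : measurable_fun cyl h -> (forall p, cyl p -> `|h p| <= B) ->
  L2 leb3 cyl f -> L2 leb3 cyl (fun p => h p * f p) by move=> mh hB lf; exact: L2_bmul mh hB lf.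
have b1 p : cyl p -> `|(A p).1.1| <= B by move=> /HB[].
have b2 p : cyl p -> `|(A p).1.2| <= B by move=> /HB[].
have b3 p : cyl p -> `|(A p).2.1| <= B by move=> /HB[].
have b4 p : cyl p -> `|(A p).2.2| <= B by move=> /HB[].
split.
  exact: (L2D mC lq1 (L2D mC (L2Z mC 2 (lA _ _ mA1 b1 W1)) (L2D mC (lA _ _ mA2 b2 W2) (lA _ _ mA3 b3 W2)))).
exact: (L2D mC lq2 (L2D mC (L2Z mC 2 (lA _ _ mA4 b4 W2)) (L2D mC (lA _ _ mA2 b2 W1) (lA _ _ mA3 b3 W1)))).
Qed.

Variables (kappa : {finite_measure set (mR * (mR * mR))%type -> \bar R}) (a b : R * (R * R) -> R).
Hypotheses (ma : measurable_fun setT (a : mR * (mR * mR) -> R)) (mb : measurable_fun setT (b : mR * (mR * mR) -> R)).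
Hypothesis ab : forall p, a p ^+ 2 + b p ^+ 2 <= 1.
Hypothesis klim : forall g : R * (R * R) -> R, continuous g -> (forall t, Z2periodic (fun x => g (t, x))) ->
  [/\ \int[leb3]_(p in cyl) (g p * normsq (v n p)) @[n --> U] --> \int[kappa]_(p in cyl) g p,
      \int[leb3]_(p in cyl) (g p * ((v n p).1 * (v n p).1 - (v n p).2 * (v n p).2)) @[n --> U] -->
        \int[kappa]_(p in cyl) (g p * a p)
    & \int[leb3]_(p in cyl) (g p * (2 * ((v n p).1 * (v n p).2))) @[n --> U] -->
        \int[kappa]_(p in cyl) (g p * b p)].

Let weight_rint (g h : R * (R * R) -> R) : continuous g -> measurable_fun setT (h : mR * (mR * mR) -> R) ->
  (forall p, `|h p| <= 1) -> rint kappa cyl (fun p => g p * h p).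
Proof.
move=> cg mh h1; have [B B0 HB] := slab_bounded 0 tau cg.
have fk : (kappa cyl < +oo)%E by rewrite ltey_eq fin_num_measure.
apply: (@rint_bounded _ _ _ _ _ mC fk _ B).
  by apply: measurable_funM; [exact: measurable_funTS (measurable_continuous3 cg)|exact: measurable_funTS].
move=> [t x] [/= tt cx]; rewrite normrM -[leRHS]mulr1 ler_pM//.
by apply: HB => //; rewrite in_itv in tt.
Qed.

(** The linear part tends to 0 because its coefficients are square integrable and the defects tend
    weakly to 0. In the quadratic part the coefficients are half the trace, half the difference of
    the diagonal entries and half the sum of the off-diagonal ones; together they rebuild the
    contraction with the second-moment matrix. *)
Let quadratic_limit (q : R * (R * R) -> R * R) (A : R * (R * R) -> (R * R) * (R * R)) :
  field_continuous q -> matrix_continuous A -> (forall t, Z2periodic (fun x => A (t, x))) ->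
  \int[leb3]_(p in cyl) (dot (q p) (un n p.1 p.2) + ddot (A p) (tens (un n p.1 p.2) (un n p.1 p.2))) @[n --> U] -->
  \int[leb3]_(p in cyl) (dot (q p) (W p) + ddot (A p) (tens (W p) (W p))) +
  \int[kappa]_(p in cyl) ddot (A p) (((1 + a p) / 2, b p / 2), (b p / 2, (1 - a p) / 2)).
Proof.
move=> cq cA pA; have [A1 A2 A3 A4] := cA.
pose g0 p : R := ((A p).1.1 + (A p).2.2) / 2; pose g1 p : R := ((A p).1.1 - (A p).2.2) / 2.
pose g2 p : R := ((A p).1.2 + (A p).2.1) / 2.
have cg0 : continuous g0 by move=> p; apply: cvgM; [apply: cvgD; [exact: A1|exact: A4]|exact: cvg_cst].
have cg1 : continuous g1 by move=> p; apply: cvgM; [apply: cvgB; [exact: A1|exact: A4]|exact: cvg_cst].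
have cg2 : continuous g2 by move=> p; apply: cvgM; [apply: cvgD; [exact: A2|exact: A3]|exact: cvg_cst].
have pg0 t : Z2periodic (fun x => g0 (t, x)) by move=> k x; rewrite /g0 pA.
have pg1 t : Z2periodic (fun x => g1 (t, x)) by move=> k x; rewrite /g1 pA.
have pg2 t : Z2periodic (fun x => g2 (t, x)) by move=> k x; rewrite /g2 pA.
have [B _ bA] := matrix_bounded_cylinder tau cA.
have lq := field_L2_cylinder tau0 cq.
have [lG1 lG2] := linear_coefficient lq bA.
have rW := rintD mC (rint_dot mC lq LW) (rint_ddot_tens mC bA LW LW).
have E n : \int[leb3]_(p in cyl) (dot (q p) (un n p.1 p.2) + ddot (A p) (tens (un n p.1 p.2) (un n p.1 p.2))) =
    (\int[leb3]_(p in cyl) (dot (q p) (W p) + ddot (A p) (tens (W p) (W p)))) +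
    (\int[leb3]_(p in cyl) ((v n p).1 * ((q p).1 + (2 * ((A p).1.1 * (W p).1) + ((A p).1.2 * (W p).2 + (A p).2.1 * (W p).2))) +
       (v n p).2 * ((q p).2 + (2 * ((A p).2.2 * (W p).2) + ((A p).1.2 * (W p).1 + (A p).2.1 * (W p).1))))) +
    ((\int[leb3]_(p in cyl) (g0 p * normsq (v n p))) +
     (\int[leb3]_(p in cyl) (g1 p * ((v n p).1 * (v n p).1 - (v n p).2 * (v n p).2))) +
     (\int[leb3]_(p in cyl) (g2 p * (2 * ((v n p).1 * (v n p).2))))).
  have [r0 _ _] := rint_quad n cg0; have [_ r1 _] := rint_quad n cg1; have [_ _ r2] := rint_quad n cg2.
  have rl := rintD mC (L2_prod mC (Lv n).1 lG1) (L2_prod mC (Lv n).2 lG2).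
  rewrite -(RintegralD mC rW rl) -(RintegralD mC r0 r1) -(RintegralD mC (rintD mC r0 r1) r2).
  rewrite -(RintegralD mC (rintD mC rW rl) (rintD mC (rintD mC r0 r1) r2)).
  by apply: eq_Rint => p _; rewrite unE weak_density_split.
have [k0 _ _] := klim cg0 pg0; have [_ k1 _] := klim cg1 pg1; have [_ _ k2] := klim cg2 pg2.
have lim := cvgD (cvgD (cvg_cst (\int[leb3]_(p in cyl) (dot (q p) (W p) + ddot (A p) (tens (W p) (W p)))))
  (linear_limit lG1 lG2)) (cvgD (cvgD k0 k1) k2).
rewrite (funext E).
have bnd p : `|a p| <= 1 /\ `|b p| <= 1.
  by have [h1 h2] := direction_bound (ab p); rewrite !ler_norml.
have r0 : rint kappa cyl g0.
  apply: eq_rint (weight_rint cg0 (h := fun=> 1) _ _) => //; first by move=> p _; rewrite mulr1.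
  by move=> p; rewrite normr1.
have r1 : rint kappa cyl (fun p => g1 p * a p) by apply: weight_rint => // p; case: (bnd p).
have r2 : rint kappa cyl (fun p => g2 p * b p) by apply: weight_rint => // p; case: (bnd p).
rewrite addr0 -(RintegralD mC r0 r1) -(RintegralD mC (rintD mC r0 r1) r2) in lim.
rewrite [X in _ --> _ + X](_ : _ = \int[kappa]_(p in cyl) (g0 p + g1 p * a p + g2 p * b p)); first exact: lim.
by apply: eq_Rint => p _; rewrite /ddot /dot/= /g0 /g1 /g2/=; field.
Qed.

Let momentum_equation (phi : R -> R * R -> R * R) : test_field tau phi ->
  \int[leb3]_(p in cyl) weak_density phi W p + \int[kappa]_(p in cyl) defect_density phi a b p = - vip (phi 0) u0.
Proof.
move=> tphi; have tl := @galerkin_test_limit R U UU UF u0 un0 un gal un0_cvg tau tau0 phi tphi.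
have [_ cdt cA] := test_field_continuous tphi; have [pphi _ _ _] := tphi.
have pA (t : R) : Z2periodic (fun x => nabla (phi t) x).
  by move=> k x; rewrite /nabla !(derive_periodic _ (pphi t)).
exact: (cvg_unique (@Rhausdorff R) (quadratic_limit cdt cA pA) tl).
Qed.

(** The weighted energies of the Galerkin solutions tend to the sum of the two integrals on the
    left, so the inequality is the limit of the one satisfied by each Galerkin solution with its own
    energy. *)
Let energy_equation (phi : R * R -> R) (chi : R -> R) : Z2periodic phi -> continuous phi ->
  {within `[0, tau], continuous chi} ->
  \int[leb3]_(p in cyl) (phi p.2 * chi p.1 * normsq (W p)) + \int[kappa]_(p in cyl) (phi p.2 * chi p.1) <=
  Linfty_norm phi * (\int[leb]_(t in `[0, tau]) `|chi t|) * L2norm u0 ^+ 2.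
Proof.
move=> pphi cphi cchi; have [chi' cchi' chiE] := continuous_extension tau0 cchi.
have cw := continuous_weight cphi cchi'.
pose g p : R := phi p.2 * chi' p.1.
have pg t : Z2periodic (fun x => g (t, x)) by move=> k x; rewrite /g/= pphi.
have gE p : cyl p -> phi p.2 * chi p.1 = g p.
  by move=> [/= tt _]; rewrite /g chiE//; move: tt; rewrite in_itv.
have -> : \int[leb3]_(p in cyl) (phi p.2 * chi p.1 * normsq (W p)) = \int[leb3]_(p in cyl) (g p * normsq (W p)).
  by apply: eq_Rint => p cp; rewrite gE.
have -> : \int[kappa]_(p in cyl) (phi p.2 * chi p.1) = \int[kappa]_(p in cyl) g p by exact: eq_Rint.
have -> : \int[leb]_(t in [set` `[0, tau]]) `|chi t| = \int[leb]_(t in [set` `[0, tau]]) `|chi' t|.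
  by apply: eq_Rint => t; rewrite /= in_itv/= => tt; rewrite chiE.
have [k0 _ _] := klim cw pg.
have [B B0 HB] := slab_bounded 0 tau cw.
have mg : measurable_fun cyl g by exact: measurable_funTS (measurable_continuous3 cw).
have bg p : cyl p -> `|g p| <= B.
  by case: p => t x [/= tt cx]; apply: (HB t x) => //; rewrite in_itv in tt.
have l1 : L2 leb3 cyl (fun p => g p * (2 * (W p).1)) by apply: (L2_bmul mC mg bg); apply: L2Z => //; exact: LW.1.
have l2 : L2 leb3 cyl (fun p => g p * (2 * (W p).2)) by apply: (L2_bmul mC mg bg); apply: L2Z => //; exact: LW.2.
have E n : \int[leb3]_(p in cyl) (g p * normsq (un n p.1 p.2)) =
    (\int[leb3]_(p in cyl) (g p * normsq (W p))) +
    (\int[leb3]_(p in cyl) ((v n p).1 * (g p * (2 * (W p).1)) + (v n p).2 * (g p * (2 * (W p).2)))) +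
    (\int[leb3]_(p in cyl) (g p * normsq (v n p))).
  have [r0 _ _] := rint_quad n cw.
  have rl : rint leb3 cyl (fun p => (v n p).1 * (g p * (2 * (W p).1)) + (v n p).2 * (g p * (2 * (W p).2))).
    exact: (rintD mC (L2_prod mC (Lv n).1 l1) (L2_prod mC (Lv n).2 l2)).
  have rW : rint leb3 cyl (fun p => g p * normsq (W p)) by exact: (rint_bmul mC mg bg (rint_dot mC LW LW)).
  rewrite -(RintegralD mC rW rl) -(RintegralD mC (rintD mC rW rl) r0).
  by apply: eq_Rint => p _; rewrite unE normsqD /g; ring.
have lim : \int[leb3]_(p in cyl) (g p * normsq (un n p.1 p.2)) @[n --> U] -->
    \int[leb3]_(p in cyl) (g p * normsq (W p)) + 0 + \int[kappa]_(p in cyl) g p.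
  rewrite (funext E).
  exact: (cvgD (cvgD (cvg_cst (\int[leb3]_(p in cyl) (g p * normsq (W p)))) (linear_limit l1 l2)) k0).
have Lu : L2norm u0 ^+ 2 = vip u0 u0 by rewrite L2norm_vip sqr_sqrtr// vip_ge0.
set K := Linfty_norm phi * _.
have limK : K * vip (un0 n) (un0 n) @[n --> U] --> K * vip u0 u0.
  by apply: cvgM; [exact: cvg_cst|exact: (energy_cvg un0_cvg)].
rewrite Lu; have := ultra_cvg_le lim limK; rewrite addr0; apply.
apply: nearW => n; apply: energy_inequality => //.
by exists set0; split=> // t /= h; case: h => tt; rewrite (energy_section n tt).
Qed.

Hypothesis kappaC : kappa (~` cyl) = 0%E.

Lemma galerkin_defect_young_measure : exists N : young_measure tau,
  admissible u0 N /\ forall p, barycenter (osc N p) = W p.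
Proof.
apply: (admissible_builder LW kappaC ma mb ab (limit_weakly_continuous UF gal un0_cvg tau0 w_lim) _ momentum_equation energy_equation).
by apply: ae_imply W_ae => t H tt; apply: H; move: tt; rewrite in_itv.
Qed.

End galerkin_young_measure.

Lemma galerkin_young_measure (R : realType) (U : set_system nat) {UU : UltraFilter U} (u0 : L2sigma R)
    (un0 : nat -> L2sigma R) (un : nat -> R -> L2sigma R) (tau : R) : \oo `<=` U ->
  (forall n, galerkin_solution n (un0 n) (un n)) ->
  vip (fun x => un0 n x - u0 x) (fun x => un0 n x - u0 x) @[n --> U] --> (0 : R) -> 0 < tau ->
  forall w : R -> L2sigma R,
  (forall t, 0 <= t <= tau -> forall g, VL2 g -> vip (un n t) g @[n --> U] --> vip (w t) g) ->
  exists (N : young_measure tau) (W : R * (R * R) -> R * R),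
  [/\ L2pair (@leb3 R) (cylinder tau) W, admissible u0 N, forall p, barycenter (osc N p) = W p
    & {ae @lebesgue_measure R, forall t, 0 <= t <= tau -> ae_cell (fun x => W (t, x) = w t x)}].
Proof.
move=> UF gal un0_cvg tau0 w w_lim.
have [W [LW W_lim W_ae]] := galerkin_cylinder_limit UF gal un0_cvg tau0 w_lim.
have [C vC] := defect_energy_bound gal un0_cvg tau0 LW.
have Lv n : L2pair (@leb3 R) (cylinder tau) (fun p => un n p.1 p.2 - W p).
  exact: (L2pairB (@measurable_cylinder R tau) (galerkin_L2pair gal tau0 n) LW).
have [kappa [a [b [kC [ma mb] ab klim]]]] := defect_measure tau0 Lv vC.
have [N [aN NW]] := galerkin_defect_young_measure UF gal un0_cvg tau0 w_lim LW W_lim W_ae ma mb ab klim kC.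
by exists N, W.
Qed.

(** * The Euler solution as a measure-valued solution *)

Section euler_young_measure.
Context {R : realType}.
Local Notation mR := (measurableTypeR R).
Local Notation leb := (@lebesgue_measure R).
Local Notation cell := (@cell R).
Local Notation leb2 := (@leb2 R).
Local Notation leb3 := (@leb3 R).

Lemma L2dist_vip (f g : R * R -> R * R) : L2dist f g = Num.sqrt (vip (fun x => f x - g x) (fun x => f x - g x)).
Proof. by []. Qed.

Lemma vip_L2dist (f g h : R * R -> R * R) : VL2 f -> VL2 g -> VL2 h ->
  `|vip f h - vip g h| <= L2dist f g * L2norm h.
Proof.
move=> Vf Vg Vh; have Vd := VL2B Vf Vg.
rewrite -vipBl// -sqrtr_sqr L2dist_vip L2norm_vip -sqrtrM ?vip_ge0// ler_wsqrtr//.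
exact: vip_cauchy_schwarz.
Qed.

Context (U : set_system nat) {UU : UltraFilter U}.
Hypothesis UF : \oo `<=` U.
Variables (u0 : L2sigma R) (u : R -> L2sigma R) (tau : R).
Hypothesis tau0 : 0 < tau.
Hypothesis eul : conservative_euler_solution u0 u.
Local Notation cyl := (cylinder tau).

Let mc := @measurable_cell R.
Let mC := @measurable_cylinder R tau.
Let mI : measurable ([set` `[0, tau]] : set mR) := measurable_itv _.
Let Vu t : VL2 (u t) := in_L2sigma_VL2 (L2funP (u t)).

Lemma euler_energy (t : R) : 0 <= t -> vip (u t) (u t) = vip u0 u0.
Proof.
move=> t0; have [_ _ H] := eul; have := H t t0; rewrite !L2norm_vip => e.
by rewrite -[LHS]sqr_sqrtr ?vip_ge0// e sqr_sqrtr ?vip_ge0.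
Qed.

Lemma euler_ucont (e : R) : 0 < e -> exists2 de, 0 < de & forall s t, 0 <= s <= tau -> 0 <= t <= tau ->
  `|s - t| < de -> L2dist (u s) (u t) < e.
Proof.
move=> e0; have [cu _ _] := eul.
have cu' : {within `[0, tau], continuous u}.
  by apply: continuous_subspaceW cu => t /=; rewrite !in_itv/= andbT => /andP[].
exact: within_ucont cu' e e0.
Qed.

Let pairing_ucont g (e : R) : VL2 g -> 0 < e -> exists2 de, 0 < de & forall s t, 0 <= s <= tau -> 0 <= t <= tau ->
  `|s - t| < de -> `|vip (u s) g - vip (u t) g| <= e.
Proof.
move=> Vg e0; have K0 : 0 < L2norm g + 1 by rewrite ltr_wpDl// sqrtr_ge0.
have [de de0 H] := euler_ucont (divr_gt0 e0 K0); exists de => // s t ss tt st.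
apply: le_trans (vip_L2dist (Vu s) (Vu t) Vg) _.
apply: le_trans (_ : e / (L2norm g + 1) * (L2norm g + 1) <= _); last by rewrite divfK ?gt_eqF.
by apply: ler_pM; rewrite ?sqrtr_ge0//; [exact: ltW (H s t ss tt st)|lra].
Qed.

Let pairing_continuous g : VL2 g -> {within `[0, tau], continuous (fun t => vip (u t) g)}.
Proof. by move=> Vg; apply: ucont_within => e e0; exact: pairing_ucont. Qed.

Let dyadic_close m (t : R) : `|dyadic_floor m t - t| <= 2 ^- m.
Proof.
have pm : 0 < 2 ^+ m :> R by rewrite exprn_gt0.
have /andP[h1 h2] := floor_itv (2 ^+ m * t); rewrite intrD in h2.
rewrite -(ler_pM2l pm) mulfV ?gt_eqF// -[X in X * `|_|](ger0_norm (ltW pm)) -normrM mulrBr.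
rewrite /dyadic_floor mulrCA mulfV ?gt_eqF// mulr1 distrC ger0_norm ?subr_ge0//; lra.
Qed.

Let pairing_uniform g : VL2 g ->
  uniform_along U tau (fun m t => vip (u (dyadic_floor m t)) g) (fun t => vip (u t) g).
Proof.
move=> Vg e e0; have [de de0 H] := pairing_ucont Vg e0; have [k kd] := exp2_small de0.
have kU : \forall m \near U, (k <= m)%N by apply: UF; exact: nbhs_infty_ge.
apply: filterS kU => m km t tt; apply: H => //.
  have [t0 t1] := andP tt; have /andP[-> h] := dyadic_floor_itv m t0; exact: le_trans h t1.
apply: le_lt_trans kd; apply: le_trans (dyadic_close m t) _.
by rewrite lef_pV2 ?posrE ?exprn_gt0// ler_weXn2l// ler1n.
Qed.

(** Freezing [u] at dyadic times gives jointly measurable fields. By the continuity of [u] they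
    converge to it uniformly in time in every mode, so their weak limit on the cylinder has the
    slices of [u]. *)
Lemma euler_cylinder : exists W : R * (R * R) -> R * R,
  L2pair leb3 cyl W /\ {ae leb, forall t, 0 <= t <= tau -> ae_cell (fun x => W (t, x) = u t x)}.
Proof.
have B t (tt : 0 <= t <= tau) : \int[leb2]_(x in cell) ((u t x).1 * (u t x).1) <= vip u0 u0 /\
           \int[leb2]_(x in cell) ((u t x).2 * (u t x).2) <= vip u0 u0.
  have t0 : 0 <= t by case/andP: tt.
  have := euler_energy t0; rewrite vipE//.
  have := ip_ge0 leb2 cell (fun x => (u t x).1).
  have := ip_ge0 leb2 cell (fun x => (u t x).2).
  move: (\int[_]_(_ in _) _) (\int[_]_(_ in _) _) => P Q; split; lra.
have fl m t : 0 <= t <= tau -> 0 <= dyadic_floor m t <= tau.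
  by move=> /andP[t0 t1]; have /andP[-> h] := dyadic_floor_itv m t0; exact: le_trans h t1.
have near1 : \forall n \near U, vip u0 u0 <= vip u0 u0 by apply: nearW.
have EQ k : [/\ (fun t => vip (u t) (smode k (1, 0) 0)) = (fun t => \int[leb2]_(x in cell) ((u t x).1 * cos (phase k x))),
    (fun t => vip (u t) (smode k (0, 1) 0)) = (fun t => \int[leb2]_(x in cell) ((u t x).2 * cos (phase k x))),
    (fun t => vip (u t) (smode k 0 (1, 0))) = (fun t => \int[leb2]_(x in cell) ((u t x).1 * sin (phase k x)))
  & (fun t => vip (u t) (smode k 0 (0, 1))) = (fun t => \int[leb2]_(x in cell) ((u t x).2 * sin (phase k x)))].
  by split; apply/funext => t; case: (vip_modes_coord k (Vu t)).
have [||||||||W1 [L1 _ E1]] := @cylinder_weak_limit R tau tau0 U UU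
  (fun m p => (u (dyadic_floor m p.1) p.2).1) (fun t x => (u t x).1) (vip u0 u0) (fun=> vip u0 u0).
- by move=> m; apply: (@measurable_step R tau m (fun t x => (u t x).1)) => t _; case: (Vu t) => -[].
- move=> m t tt; split; first by case: (Vu (dyadic_floor m t)).
  by case: (B _ (fl m t tt)).
- exact: near1.
- by move=> t _; case: (Vu t).
- move=> k; have := pairing_continuous (VL2_smode k (1, 0) 0).
  by have [e _ _ _] := EQ k; rewrite e.
- move=> k; have := pairing_continuous (VL2_smode k 0 (1, 0)).
  by have [_ _ e _] := EQ k; rewrite e.
- move=> k e e0; apply: filterS (pairing_uniform (VL2_smode k (1, 0) 0) e0) => m H t tt.
  have [e1 _ _ _] := vip_modes_coord k (Vu t); have [e2 _ _ _] := vip_modes_coord k (Vu (dyadic_floor m t)).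
  by have := H t tt; rewrite e1 e2.
- move=> k e e0; apply: filterS (pairing_uniform (VL2_smode k 0 (1, 0)) e0) => m H t tt.
  have [_ _ e1 _] := vip_modes_coord k (Vu t); have [_ _ e2 _] := vip_modes_coord k (Vu (dyadic_floor m t)).
  by have := H t tt; rewrite e1 e2.
have [||||||||W2 [L2' _ E2]] := @cylinder_weak_limit R tau tau0 U UU
  (fun m p => (u (dyadic_floor m p.1) p.2).2) (fun t x => (u t x).2) (vip u0 u0) (fun=> vip u0 u0).
- by move=> m; apply: (@measurable_step R tau m (fun t x => (u t x).2)) => t _; case: (Vu t) => _ [].
- move=> m t tt; split; first by case: (Vu (dyadic_floor m t)).
  by case: (B _ (fl m t tt)).
- exact: near1.
- by move=> t _; case: (Vu t).
- move=> k; have := pairing_continuous (VL2_smode k (0, 1) 0).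
  by have [_ e _ _] := EQ k; rewrite e.
- move=> k; have := pairing_continuous (VL2_smode k 0 (0, 1)).
  by have [_ _ _ e] := EQ k; rewrite e.
- move=> k e e0; apply: filterS (pairing_uniform (VL2_smode k (0, 1) 0) e0) => m H t tt.
  have [_ e1 _ _] := vip_modes_coord k (Vu t); have [_ e2 _ _] := vip_modes_coord k (Vu (dyadic_floor m t)).
  by have := H t tt; rewrite e1 e2.
- move=> k e e0; apply: filterS (pairing_uniform (VL2_smode k 0 (0, 1)) e0) => m H t tt.
  have [_ _ _ e1] := vip_modes_coord k (Vu t); have [_ _ _ e2] := vip_modes_coord k (Vu (dyadic_floor m t)).
  by have := H t tt; rewrite e1 e2.
exists (fun p => (W1 p, W2 p)); split=> //.
apply: ae_imply (ae_and E1 E2) => t [h1 h2] tt.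
apply: ae_imply (ae_and (h1 tt) (h2 tt)) => x [k1 k2] cx.
by rewrite k1// k2// -surjective_pairing.
Qed.

Lemma euler_young_measure : exists (N : young_measure tau) (W : R * (R * R) -> R * R),
  [/\ L2pair leb3 cyl W, admissible u0 N, forall p, barycenter (osc N p) = W p
    & {ae leb, forall t, 0 <= t <= tau -> ae_cell (fun x => W (t, x) = u t x)}].
Proof.
have [W [LW W_ae]] := euler_cylinder; have [_ ew _] := eul; have [cu eu] := ew tau tau0.
(* An exact solution has no defect: the concentration measure is 0, and the angle data below are the
   arbitrary choice a = b = 0. *)
pose kappa : {finite_measure set (mR * (mR * mR))%type -> \bar R} := mzero.
have k0 (f : R * (R * R) -> R) : \int[kappa]_(p in cyl) f p = 0.
  by rewrite /Rintegral (_ : (\int[kappa]_(p in cyl) (f p)%:E = 0)%E)// integral_measure_zero.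
have [|||||||N [aN NW]] := @admissible_builder R tau W kappa (fun=> 0) (fun=> 0) LW _ _ _ _ u0 u cu.
- by [].
- exact: measurable_cst.
- exact: measurable_cst.
- by move=> p; rewrite expr0n/= addr0 ler01.
- by apply: ae_imply W_ae => t H; rewrite in_itv/=; exact: H.
- move=> phi tphi; rewrite k0 addr0 -(eu phi tphi).
  have [_ _ ->] := rint_Fubini mI mc (weak_density_rint tau0 tphi LW).
  apply: Rint_ae_eq; apply: ae_imply W_ae => t H; rewrite /= in_itv/= => tt.
  apply: Rint_ae_eq; apply: ae_imply (H tt) => x h cx.
  by rewrite /weak_density/= h.
- move=> phi chi pphi cphi cchi; rewrite k0 addr0.
  have [chi' cchi' chiE] := continuous_extension tau0 cchi.
  have -> : \int[leb3]_(p in cyl) (phi p.2 * chi p.1 * normsq (W p)) =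
      \int[leb3]_(p in cyl) (phi p.2 * chi' p.1 * normsq (W p)).
    by apply: eq_Rint => -[t x] [/= tt _]; rewrite chiE//; move: tt; rewrite in_itv.
  have -> : \int[leb]_(t in [set` `[0, tau]]) `|chi t| = \int[leb]_(t in [set` `[0, tau]]) `|chi' t|.
    by apply: eq_Rint => t; rewrite /= in_itv/= => tt; rewrite chiE.
  have -> : L2norm u0 ^+ 2 = vip u0 u0 by rewrite L2norm_vip sqr_sqrtr// vip_ge0.
  apply: energy_inequality => //; apply: ae_imply W_ae => t H tt.
  have t0 : 0 <= t by case/andP: tt.
  rewrite -(euler_energy t0) le_eqVlt; apply/orP; left; apply/eqP.
  by apply: Rint_ae_eq; apply: ae_imply (H tt) => x h cx; rewrite h.
- by exists N, W.
Qed.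

End euler_young_measure.

(** * Strong convergence *)

Section identification.
Context {R : realType}.
Local Notation mR := (measurableTypeR R).
Local Notation leb := (@lebesgue_measure R).
Local Notation cell := (@cell R).
Local Notation leb2 := (@leb2 R).
Local Notation leb3 := (@leb3 R).
Variable tau : R.
Hypothesis tau0 : 0 < tau.
Local Notation cyl := (cylinder tau).

Let mc := @measurable_cell R.
Let mC := @measurable_cylinder R tau.
Let mI : measurable ([set` `[0, tau]] : set mR) := measurable_itv _.

Lemma same_barycenter (m m' : probability (R * R)%type R) : same_probability m m' -> barycenter m = barycenter m'.
Proof.
move=> H; have e (f : R * R -> R) : \int[m]_z f z = \int[m']_z f z.
  by rewrite /Rintegral; congr fine; apply: eq_measure_integral => A mA _; exact: H.
by rewrite /barycenter !e.
Qed.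

(** A nonzero value would persist on an interval of positive length around [t], cut off at the ends
    of [0, tau], which a null set cannot contain. *)
Lemma continuous_ae0 (h : R -> R) : {within `[0, tau], continuous h} ->
  {ae leb, forall t, [set` `[0, tau]] t -> h t = 0} -> forall t, 0 <= t <= tau -> h t = 0.
Proof.
move=> ch [N [mN N0 HN]] t tt; apply/eqP; apply: contrapT => /negP ht.
have h0 : 0 < `|h t| by rewrite normr_gt0.
have [d d0 H] := within_ucont ch h0.
pose a := Num.max 0 (t - d / 2); pose b := Num.min tau (t + d / 2).
have [t0 t1] := andP tt.
have ab : a < b by rewrite /a /b lt_min !gt_max tau0/=; apply/andP; split; [|apply/andP; split]; lra.
have sub : [set` `[a, b]] `<=` N.
  move=> s; rewrite /= in_itv/= /a /b le_min ge_max => /andP[/andP[s0 s1] /andP[s2 s3]].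
  have ss : 0 <= s <= tau by rewrite s0.
  apply: HN => /= k; have e : h s = 0 by apply: k; rewrite in_itv/=.
  have st : `|t - s| < d by rewrite ltr_norml; apply/andP; split; lra.
  by have := H t s tt ss st; rewrite /ball/= e subr0 ltxx.
have L : @lebesgue_measure R ([set` `[a, b]] : set mR) = (b - a)%:E.
  by rewrite lebesgue_measure_itv/= lte_fin ab EFinB.
have : ((b - a)%:E <= 0 :> \bar R)%E by rewrite -L -N0; apply: le_measure => //; rewrite inE.
by rewrite lee_fin subr_le0 leNgt ab.
Qed.

Let L2pair_time (g : L2sigma R) : L2pair leb3 cyl (fun p => g p.2).
Proof.
have [[m1 r1] [m2 r2]] := in_L2sigma_VL2 (L2funP g).
have p2 : measurable_fun cyl (fun p : mR * (mR * mR) => p.2) by exact: (measurable_funTS measurable_snd).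
have im : (fun p : mR * (mR * mR) => p.2) @` cyl `<=` cell by move=> _ [[t x] [_ cx] <-].
split.
  apply: (cylinder_L2 tau0 (measurable_comp mc im m1 p2) (C := \int[leb2]_(x in cell) ((g x).1 * (g x).1)) _).1.
  by move=> t _; split.
apply: (cylinder_L2 tau0 (measurable_comp mc im m2 p2) (C := \int[leb2]_(x in cell) ((g x).2 * (g x).2)) _).1.
by move=> t _; split.
Qed.

(** Uniqueness equates the barycenters only almost everywhere in space-time. Fubini passes to almost
    every time slice, and weak continuity to every time. *)
Lemma cylinder_identification (w u : R -> L2sigma R) (W V : R * (R * R) -> R * R) :
  L2pair leb3 cyl W -> L2pair leb3 cyl V ->
  {ae leb3, forall p, cyl p -> W p = V p} ->
  {ae leb, forall t, 0 <= t <= tau -> ae_cell (fun x => W (t, x) = w t x)} ->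
  {ae leb, forall t, 0 <= t <= tau -> ae_cell (fun x => V (t, x) = u t x)} ->
  weakly_continuous tau w -> weakly_continuous tau u ->
  forall (g : L2sigma R) t, 0 <= t <= tau -> vip (w t) g = vip (u t) g.
Proof.
move=> LW LV WV Ww Vu cw cu g; have lg := L2pair_time g.
pose f p := dot (W p) (g p.2) - dot (V p) (g p.2).
have rf : rint leb3 cyl f by exact: (rintB mC (rint_dot mC LW lg) (rint_dot mC LV lg)).
have rn : rint leb3 cyl (fun p => `|f p|) := integrable_norm rf.
have n0 : \int[leb3]_(p in cyl) `|f p| = 0.
  rewrite (@Rint_ae_eq _ _ _ leb3 cyl _ (fun=> 0)); first by rewrite Rintegral_cst// mul0r.
  by apply: ae_imply WV => p h cp; rewrite /f h// subrr normr0.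
have [sf _ _] := rint_Fubini mI mc rf; have [sn rI E] := rint_Fubini mI mc rn; rewrite E in n0.
have G0 : {ae leb, forall t, [set` `[0, tau]] t -> \int[leb2]_(x in cell) `|f (t, x)| = 0}.
  by apply: Rint_le0_ae0 => //; [move=> t _; exact: Rintegral_ge0|rewrite n0].
have Vw t : VL2 (w t) := in_L2sigma_VL2 (L2funP (w t)).
have Vuu t : VL2 (u t) := in_L2sigma_VL2 (L2funP (u t)).
have Vg : VL2 g := in_L2sigma_VL2 (L2funP g).
(* The difference of the pairings is continuous in time, so its vanishing for almost every time is
   enough. *)
suff H : forall t, 0 <= t <= tau -> vip (w t) g - vip (u t) g = 0.
  by move=> t tt; apply/eqP; rewrite -subr_eq0; apply/eqP; exact: H.
apply: continuous_ae0.
  move=> t; apply: cvgB; [exact: cw|exact: cu].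
apply: ae_imply (ae_and (ae_and G0 sf) (ae_and Ww Vu)) => t [[h1 h2] [h3 h4]] It.
have tt : 0 <= t <= tau by move: It; rewrite /= in_itv.
rewrite -vipBl// /vip.
have -> : \int[leb2]_(x in cell) dot (w t x - u t x) (g x) = \int[leb2]_(x in cell) f (t, x).
  apply: Rint_ae_eq; apply: ae_imply (ae_and (h3 tt) (h4 tt)) => x [k1 k2] cx.
  by rewrite /f/= k1// k2// /dot/=; ring.
apply/eqP; rewrite -normr_le0; apply: le_trans (le_normr_Rintegral mc (h2 It)) _.
by rewrite h1.
Qed.

End identification.

Section strong_convergence.
Context {R : realType}.
Context (U : set_system nat) {UU : UltraFilter U}.
Hypothesis UF : \oo `<=` U.
Variables (u0 : L2sigma R) (un0 : nat -> L2sigma R) (un : nat -> R -> L2sigma R).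
Hypothesis gal : forall n, galerkin_solution n (un0 n) (un n).
Hypothesis un0_cvg : vip (fun x => un0 n x - u0 x) (fun x => un0 n x - u0 x) @[n --> U] --> (0 : R).
Variables (tau : R) (u : R -> L2sigma R).
Hypothesis tau0 : 0 < tau.
Hypothesis eul : conservative_euler_solution u0 u.
Hypothesis u_lim : forall g : L2sigma R,
  uniform_along U tau (fun n t => vip (un n t) g) (fun t => vip (u t) g).

Let Vu t : VL2 (u t) := in_L2sigma_VL2 (L2funP (u t)).
Let Vun n t : VL2 (un n t) := in_L2sigma_VL2 (L2funP (un n t)).

(* Weak convergence, uniform in time, and convergence of the energies give strong convergence. *)
Lemma strong_convergence (e : R) : 0 < e ->
  \forall n \near U, forall t, 0 <= t <= tau -> L2dist (un n t) (u t) <= e.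
Proof.
move=> e0; set E := vip u0 u0; have E0 : 0 <= E by exact: vip_ge0.
pose K := Num.sqrt (E + 1) + Num.sqrt E + 1.
have K0 : 0 < K by rewrite ltr_wpDl// addr_ge0// sqrtr_ge0.
(* The squared distance is bounded by the error [eta] of the energy plus twice the error [eta * K]
   of the pairing of the two solutions. *)
pose eta := e ^+ 2 / (2 * K + 1).
have eta0 : 0 < eta by rewrite divr_gt0 ?exprn_gt0// addr_gt0// mulr_gt0.
(* Uniform convergence is available for a fixed test field only, while [u t] moves with time; the
   strong continuity of [u] replaces it by finitely many values on a grid. *)
have [d d0 Hd] := euler_ucont tau eul eta0.
have [M [p [p01 pc]]] := grid_cover tau0 d0.
have grid : \forall n \near U, forall i, forall t, 0 <= t <= tau -> `|vip (un n t) (u (p i)) - vip (u t) (u (p i))| <= eta.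
  by apply: filter_forall => i; exact: u_lim.
have en : \forall n \near U, `|vip (un0 n) (un0 n) - E| <= eta.
  have c : vip (un0 n) (un0 n) @[n --> U] --> E by exact: energy_cvg un0_cvg.
  have /cvgrPdist_le/(_ _ eta0) := c; apply: filterS => n; by rewrite distrC.
have en1 : \forall n \near U, vip (un0 n) (un0 n) <= E + 1 by exact: energy_bound un0_cvg.
apply: filterS2 grid (filterI en en1) => n gr [h1 h2] t tt.
have t0 : 0 <= t by case/andP: tt.
have [i ti] := pc t tt.
have un2 : vip (un n t) (un n t) = vip (un0 n) (un0 n) := galerkin_energyE gal n t0.
have uu : vip (u t) (u t) = E := euler_energy eul t0.
have dti : L2dist (u t) (u (p i)) <= eta by apply: ltW; exact: Hd.
have a1 : `|vip (un n t) (u t) - vip (un n t) (u (p i))| <= eta * Num.sqrt (E + 1).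
  rewrite ![vip (un n t) _]vipC; apply: le_trans (vip_L2dist (Vu t) (Vu (p i)) (Vun n t)) _.
  by apply: ler_pM; rewrite ?sqrtr_ge0// L2norm_vip un2 ler_wsqrtr.
have a2 : `|vip (u t) (u (p i)) - vip (u t) (u t)| <= eta * Num.sqrt E.
  rewrite distrC [vip (u t) (u (p i))]vipC; apply: le_trans (vip_L2dist (Vu t) (Vu (p i)) (Vu t)) _.
  by apply: ler_pM; rewrite ?sqrtr_ge0// L2norm_vip uu.
have a3 := gr i t tt.
have a4 : `|vip (un n t) (u t) - E| <= eta * K.
  have -> : vip (un n t) (u t) - E = (vip (un n t) (u t) - vip (un n t) (u (p i))) +
    (vip (un n t) (u (p i)) - vip (u t) (u (p i))) + (vip (u t) (u (p i)) - vip (u t) (u t)).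
    by rewrite uu; ring.
  apply: le_trans (ler_normD _ _) _; apply: le_trans (lerD (ler_normD _ _) (lexx _)) _.
  apply: le_trans (lerD (lerD a1 a3) a2) _.
  by rewrite le_eqVlt; apply/orP; left; apply/eqP; rewrite /K; ring.
rewrite L2dist_vip vip_normB// un2 uu -[leRHS](ger0_norm (ltW e0)) -sqrtr_sqr ler_wsqrtr//.
have -> : e ^+ 2 = eta * (2 * K + 1) by rewrite divfK// gt_eqF// addr_gt0// mulr_gt0.
move: h1 a4; rewrite !ler_norml => /andP[_ h1] /andP[a4 _].
rewrite mulrDr mulr1; lra.
Qed.

End strong_convergence.

Section initial_data.
Context {R : realType}.

Lemma L2sigma_cvg_vip (un0 : nat -> L2sigma R) (u0 : L2sigma R) : un0 @ \oo --> u0 ->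
  vip (fun x => un0 n x - u0 x) (fun x => un0 n x - u0 x) @[n --> \oo] --> (0 : R).
Proof.
move=> c; apply/cvgrPdist_le => e e0; rewrite /=.
(* A distance below both 1 and [e] has its square below [e]. *)
have d0 : 0 < Num.min 1 e by rewrite lt_min ltr01.
have H : \forall n \near \oo, ball u0 (Num.min 1 e) (un0 n) by exact: (c _ (nbhsx_ballx u0 _ d0)).
apply: filterS H => n.
rewrite /= L2sigma_ballE /= lt_min => /andP[h1 h2].
have E : vip (fun x => un0 n x - u0 x) (fun x => un0 n x - u0 x) = L2dist u0 (un0 n) ^+ 2.
  rewrite L2dist_vip sqr_sqrtr ?vip_ge0//; apply: eq_Rint => x _; rewrite /dot/=; ring.
rewrite sub0r normrN E ger0_norm ?sqr_ge0// expr2.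
have l0 : 0 <= L2dist u0 (un0 n) by exact: sqrtr_ge0.
by apply: le_trans (_ : L2dist u0 (un0 n) * 1 <= _); [rewrite ler_wpM2l// ltW|rewrite mulr1 ltW].
Qed.

(** If [B] is not in [F], the trace of [F] on the complement of [B] is a proper filter, and an
    ultrafilter refining it contains the complement of [B]. *)
Lemma ultrafilter_near (F : set_system nat) (B : set nat) : ProperFilter F ->
  (forall U : set_system nat, UltraFilter U -> F `<=` U -> U B) -> F B.
Proof.
move=> PF H; apply: contrapT => nB.
have PW : ProperFilter (within (~` B) F).
  have WF : Filter (within (~` B) F) by exact: within_filter.
  apply: Build_ProperFilter_ex => P FP; apply: contrapT => nP; apply: nB.
  have {}FP : F [set n | (~` B) n -> P n] := FP; apply: filterS FP => n nPn.
  by apply: contrapT => nBn; apply: nP; exists n; exact: nPn.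
have [U [UU WU]] := ultraFilterLemma PW.
have FU : F `<=` U by move=> P FP; apply: WU; apply: filterS FP.
have UB := H U UU FU; have UC : U (~` B).
  apply: WU; suff : F [set n | (~` B) n -> (~` B) n] by []; apply: filterE => n h; exact: h.
have [n [Bn nBn]] : exists n, (B `&` ~` B) n by apply: (@filter_ex _ U); exact: filterI.
exact: nBn.
Qed.

End initial_data.

Theorem corollary1p4 (R : realType) (G : set (L2sigma R))
  (G_residual : Gdelta_dense G)
  (G_existence : forall u0 : L2sigma R, G u0 ->
    exists u : R -> L2sigma R, conservative_euler_solution u0 u)
  (G_uniqueness : forall (tau : R) (u0 : L2sigma R), 0 < tau -> G u0 ->
    forall N N' : young_measure tau,
      admissible u0 N -> admissible u0 N' -> young_eq N N')
  (G_inviscid_limit : forall (u0 : L2sigma R) (u : R -> L2sigma R),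
    G u0 -> conservative_euler_solution u0 u ->
    forall (un0 : nat -> L2sigma R) (nu : nat -> R) (v : nat -> R -> L2sigma R),
      un0 @ \oo --> u0 ->
      (forall n, 0 < nu n) -> nu @ \oo --> (0 : R) ->
      (forall n, navier_stokes_solution (nu n) (un0 n) (v n)) ->
      forall tau : R, 0 < tau ->
        sup_dist tau (v n) u @[n --> \oo] --> 0%E /\
        (\int[lebesgue_measure]_(t in `[0%R, tau])
           ((nu n)%:E * gradnormsq (v n t)))%E @[n --> \oo] --> 0%E) :
  forall (u0 : L2sigma R) (u : R -> L2sigma R),
    G u0 -> conservative_euler_solution u0 u ->
    forall (un0 : nat -> L2sigma R) (un : nat -> R -> L2sigma R),
      (forall n, ae_cell (fun x => un0 n x = Pi_ n (un0 n) x)) ->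
      un0 @ \oo --> u0 ->
      (forall n, galerkin_solution n (un0 n) (un n)) ->
      forall tau : R, 0 < tau -> sup_dist tau (un n) u @[n --> \oo] --> 0%E.
Proof.
move=> u0 u Gu0 eul un0 un _ un0c gal tau tau0.
have v0 := L2sigma_cvg_vip un0c.
have close (e : R) : 0 < e -> \forall n \near \oo, (sup_dist tau (un n) u <= e%:E)%E.
  move=> e0; apply: ultrafilter_near => U UU UF.
  have un0_cvg : vip (fun x => un0 n x - u0 x) (fun x => un0 n x - u0 x) @[n --> U] --> (0 : R).
    by move=> P /v0; exact: UF.
  have [w [w_lim _]] := galerkin_weak_limit gal un0_cvg tau.
  have [N [W [LW aN NW Ww]]] := galerkin_young_measure UF gal un0_cvg tau0 w_lim.
  have [N' [V [LV aN' NV Vu]]] := euler_young_measure UF tau0 eul.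
  have [same _ _] := G_uniqueness tau u0 tau0 Gu0 N N' aN aN'.
  have WV : {ae @leb3 R, forall p, cylinder tau p -> W p = V p}.
    by apply: ae_imply same => p h cp; rewrite -NW -NV; apply: same_barycenter; exact: h.
  have cw : weakly_continuous tau w by exact: (limit_weakly_continuous UF gal un0_cvg tau0 w_lim).
  have cu : weakly_continuous tau u by have [_ h _] := eul; have [] := h tau tau0.
  have wu := cylinder_identification tau0 LW LV WV Ww Vu cw cu.
  have u_lim (g : L2sigma R) : uniform_along U tau (fun n t => vip (un n t) g) (fun t => vip (u t) g).
    have H : uniform_along U tau (fun n t => vip (un n t) g) (fun t => vip (w t) g).
      by exact: (field_uniform UF gal un0_cvg tau0 w_lim (L2funP g)).
    by move=> d d0; apply: filterS (H d d0) => n {}H t tt; rewrite -(wu g t tt); exact: H.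
  have sc : \forall n \near U, forall t, 0 <= t <= tau -> L2dist (un n t) (u t) <= e.
    by exact: (strong_convergence gal un0_cvg tau0 eul u_lim e0).
  apply: filterS sc => n H; apply: ge_ereal_sup => _ [t tt <-]; rewrite lee_fin; apply: H.
  by move: tt; rewrite /= in_itv.
(* The supremum is at least the distance at time 0, hence nonnegative; with the upper bound it is
   finite from some rank on, and the limit can be taken among real numbers. *)
have pos n : (0 <= sup_dist tau (un n) u)%E.
  apply: le_trans (_ : ((L2dist (un n 0) (u 0))%:E <= _)%E); first by rewrite lee_fin sqrtr_ge0.
  by apply: ereal_sup_ubound; exists 0 => //; rewrite /= in_itv/= lexx ltW.
apply/fine_cvgP; split.
  apply: filterS (close 1 ltr01) => n h; rewrite ge0_fin_numE//; apply: le_lt_trans h _; exact: ltry.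
apply/cvgrPdist_le => e e0; apply: filterS (close e e0) => n h /=.
have f : sup_dist tau (un n) u \is a fin_num by rewrite ge0_fin_numE//; apply: le_lt_trans h _; exact: ltry.
by rewrite sub0r normrN ger0_norm ?fine_ge0// -lee_fin fineK.
Qed.
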